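(* Let $A=(17,t)\otimes(13,(t-1)(t-11))$, a biquaternion algebra over $\mathbf Q(t)$, with Brauer class $\alpha\in\operatorname{Br}(\mathbf Q(t))[2]$. Let $\mathscr P\to\mathbf P^1_{\mathbf Q}$ be the stack of square roots along the points of $\mathbf P^1_{\mathbf Q}$ at which $\alpha$ is ramified, and let $\mathscr C\to\mathscr P$ be a $\boldsymbol{\mu}_2$-gerbe with Brauer class $\alpha$. Then for every invertible sheaf $L$ on $\mathscr P$, the set $M^*_{\mathscr C/\mathbf Q}(2,L)(\mathbf Q_{17})$ is empty.
   Context: $(a,b)$ denotes the quaternion algebra with generators $x,y$ and relations $x^2=a$, $y^2=b$, $xy=-yx$. $\mathscr P$ is the root stack of order $2$ (in the sense of Cadman) along the reduced ramification divisor $p_1+\dots+p_r$ of $\alpha$ on $\mathbf P^1_{\mathbf Q}$, with residual gerbes $\cong\mathsf B\boldsymbol{\mu}_2$ over the residue fields $\kappa_i$ of the $p_i$; $\alpha$ extends to $\operatorname{Br}(\mathscr P)[2]$. A $\mathscr C$-twisted sheaf is a sheaf of $\mathscr O_{\mathscr C}$-modules on which the banding $\boldsymbol{\mu}_2$ acts by scalar multiplication. A regular $\mathscr C$-twisted sheaf is a locally free $\mathscr C$-twisted sheaf $V$ such that for each $i$ the restriction $V_{\mathscr C\times_{\mathbf P^1}\operatorname{Spec}\overline\kappa_i}$ has the form $\mathscr L\otimes\rho^{\oplus m}$ for some $m>0$, with $\mathscr L$ an invertible twisted sheaf and $\rho$ the sheaf on $\mathsf B\boldsymbol{\mu}_2$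 associated to the regular representation of $\boldsymbol{\mu}_2$. The degree of an invertible sheaf $N$ on $\mathscr C$ is $\frac1m\deg N'$ whenever $N^{\otimes m}$ $(m>0)$ is the pullback of an invertible sheaf $N'$ on $\mathbf P^1$; $\deg V=\deg\det V$, $\mu(V)=\deg V/\operatorname{rk}V$, and $V$ is stable if $\mu(W)<\mu(V)$ for all proper locally split subsheaves $W\subset V$. $M^*_{\mathscr C/\mathbf Q}(2,L)$ is the coarse moduli space (sheafification) of the stack of families of regular $\mathscr C$-twisted sheaves with stable geometric fibers, rank $2$ and determinant identified with $L$. *)

(* Defs.v *)
(* Stacks are treated through their functors of points: a stack is a category
   over the category of (nonzero, commutative) rings, opposite to nonempty
   affine schemes, and a sheaf of modules on it assigns to each object over R an
   R-module.  The nonempty affine schemes form a dense subsite of the big etale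
   site, so nothing is lost by ignoring the zero ring. *)

From HB Require Import structures.
From mathcomp Require Import all_boot all_order all_algebra.
From mathcomp Require Import mpoly.
From Stdlib Require Import ProofIrrelevance.

Set Implicit Arguments.
Unset Strict Implicit.
Unset Printing Implicit Defensive.

Import Order.TTheory GRing.Theory Num.Theory.
Local Open Scope ring_scope.

(* Ring maps are plain functions, so that composition is strictly associative
   and unital up to conversion; see [hom] below. *)
Definition is_rmorph (R S : pzRingType) (f : R -> S) : Prop :=
  [/\ f 1 = 1, {morph f : a b / a + b} & {morph f : a b / a * b}].

Definition semilin (R S : pzRingType) (f : R -> S) (M : lmodType R)
    (N : lmodType S) (u : M -> N) : Prop :=
  forall a x y, u (a *: x + y) = f a *: u x + u y.

Definition is_lin (R : pzRingType) (M N : lmodType R) (u : M -> N) : Prop :=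
  semilin (fun a : R => a) u.

Definition is_bilin (R : comNzRingType) (M N E : lmodType R)
    (b : M -> N -> E) : Prop :=
  (forall m, is_lin (b m)) /\ (forall n, is_lin (fun m => b m n)).

Definition is_basechange (R S : comNzRingType) (f : R -> S) (M : lmodType R)
    (N : lmodType S) (u : M -> N) : Prop :=
  semilin f u /\
  forall (E : lmodType S) (w : M -> E), semilin f w ->
    exists l : N -> E, [/\ is_lin l, forall x, l (u x) = w x &
      forall l' : N -> E, is_lin l' -> (forall x, l' (u x) = w x) -> l' =1 l].

Definition is_tensor (R : comNzRingType) (M N E : lmodType R)
    (b : M -> N -> E) : Prop :=
  is_bilin b /\
  forall (F : lmodType R) (w : M -> N -> F), is_bilin w ->
    exists l : E -> F, [/\ is_lin l, forall x y, l (b x y) = w x y &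
      forall l' : E -> F, is_lin l' -> (forall x y, l' (b x y) = w x y) ->
        l' =1 l].

Definition is_basis (R : comNzRingType) (M : lmodType R) (r : nat)
    (b : 'I_r -> M) : Prop :=
  forall v : M, exists! c : {ffun 'I_r -> R}, v = \sum_i c i *: b i.

Definition is_gen (R : comNzRingType) (M : lmodType R) (v : M) : Prop :=
  forall w : M, exists! c : R, w = c *: v.

(* Locally free of rank [r] in the Zariski topology: the elements [a i] generate
   the unit ideal, and the two conditions on [b] say that the image of [b] in
   the localization M[1/a i] is a basis over R[1/a i]. *)
Definition locfree (R : comNzRingType) (M : lmodType R) (r : nat) : Prop :=
  exists (n : nat) (a : 'I_n -> R),
    (exists c : 'I_n -> R, \sum_i c i * a i = 1) /\
    forall i, exists b : 'I_r -> M,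
      (forall v, exists k (c : 'I_r -> R), a i ^+ k *: v = \sum_j c j *: b j) /\
      (forall c : 'I_r -> R, \sum_j c j *: b j = 0 ->
         exists k, forall j, a i ^+ k * c j = 0).

Definition upd (T : Type) (m : nat) (t : {ffun 'I_m -> T}) (i : 'I_m) (v : T)
    : {ffun 'I_m -> T} := [ffun j => if j == i then v else t j].

Definition is_multilin (R : comNzRingType) (M N : lmodType R) (m : nat)
    (mu : {ffun 'I_m -> M} -> N) : Prop :=
  forall t i, is_lin (fun v => mu (upd t i v)).

Definition is_alternating (T : Type) (V : zmodType) (m : nat)
    (mu : {ffun 'I_m -> T} -> V) : Prop :=
  forall (t : {ffun 'I_m -> T}) (i j : 'I_m), i != j -> t i = t j -> mu t = 0.

Definition is_alghom (K : fieldType) (A B : algType K) (f : A -> B) : Prop :=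
  is_rmorph f /\ forall (c : K) a, f (c *: a) = c *: f a.

Definition quat_rel (K : fieldType) (a b : K) (B : algType K) (x y : B) : Prop :=
  [/\ x * x = a%:A, y * y = b%:A & x * y = - (y * x)].

Definition is_quaternion (K : fieldType) (a b : K) (H : algType K) : Prop :=
  exists x y : H, quat_rel a b x y /\
    forall (B : algType K) (x' y' : B), quat_rel a b x' y' ->
      exists f : H -> B, [/\ is_alghom f, f x = x' /\ f y = y' &
        forall g : H -> B, is_alghom g -> g x = x' -> g y = y' -> g =1 f].

Definition is_algtensor (K : fieldType) (H1 H2 A : algType K) : Prop :=
  exists (i : H1 -> A) (j : H2 -> A),
    [/\ is_alghom i, is_alghom j, forall x y, i x * j y = j y * i x &
      forall (B : algType K) (i' : H1 -> B) (j' : H2 -> B),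
        is_alghom i' -> is_alghom j' -> (forall x y, i' x * j' y = j' y * i' x) ->
        exists f : A -> B,
          [/\ is_alghom f, (forall x, f (i x) = i' x) /\ (forall y, f (j y) = j' y) &
            forall g : A -> B, is_alghom g -> (forall x, g (i x) = i' x) ->
              (forall y, g (j y) = j' y) -> g =1 f]].

Definition finpres (R S : comNzRingType) (f : R -> S) : Prop :=
  exists (n : nat) (x : 'I_n -> S),
    (forall s, exists p : {mpoly R[n]}, mmap f x p = s) /\
    exists (m : nat) (r : 'I_m -> {mpoly R[n]}), forall p : {mpoly R[n]},
      mmap f x p = 0 <-> exists c : 'I_m -> {mpoly R[n]}, p = \sum_i c i * r i.

(* Unique lifting through surjections T -> T0 with square-zero kernel. *)
Definition formally_etale (R S : comNzRingType) (f : R -> S) : Prop :=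
  forall (T T0 : comNzRingType) (p : T -> T0) (a : R -> T) (b : S -> T0),
    is_rmorph p -> (forall y, exists x, p x = y) ->
    (forall x y, p x = 0 -> p y = 0 -> x * y = 0) ->
    is_rmorph a -> is_rmorph b -> (forall r, p (a r) = b (f r)) ->
    exists c : S -> T, [/\ is_rmorph c,
      (forall r, c (f r) = a r) /\ (forall s, p (c s) = b s) &
      forall c' : S -> T, is_rmorph c' -> (forall r, c' (f r) = a r) ->
        (forall s, p (c' s) = b s) -> c' =1 c].

Definition is_etale (R S : comNzRingType) (f : R -> S) : Prop :=
  [/\ is_rmorph f, finpres f & formally_etale f].

(* Etale coverings by finitely many affines; [ec_surj] is joint surjectivity on
   field-valued points, up to field extension. *)
Record etcover (R : comNzRingType) := EtCover {
  ec_n : nat;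
  ec_S : 'I_ec_n -> comNzRingType;
  ec_f : forall i, R -> ec_S i;
  ec_etale : forall i, is_etale (@ec_f i);
  ec_surj : forall (K : fieldType) (g : R -> K), is_rmorph g ->
    exists (i : 'I_ec_n) (K' : fieldType) (e : K -> K') (h : ec_S i -> K'),
      [/\ is_rmorph e, is_rmorph h & forall a, h (ec_f i a) = e (g a)] }.

Definition in_sieve (R : comNzRingType) (U : etcover R) (S : comNzRingType)
    (g : R -> S) : Prop :=
  exists (i : 'I_(ec_n U)) (h : ec_S i -> S),
    is_rmorph h /\ forall a, g a = h (ec_f i a).

(* [hom f x y] is the type of arrows from [x] over R to [y] over S lying over
   f : R -> S.  Geometrically it consists of the arrows from y to x over
   Spec S -> Spec R, so an arrow presents [y] as the pullback of [x]. *)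
Record rcat := RCat {
  ob :> comNzRingType -> Type;
  hom : forall R S : comNzRingType, (R -> S) -> ob R -> ob S -> Type;
  hid : forall (R : comNzRingType) (x : ob R), hom (fun a : R => a) x x;
  hcomp : forall (R S T : comNzRingType) (f : R -> S) (g : S -> T)
    (x : ob R) (y : ob S) (z : ob T),
    hom f x y -> hom g y z -> hom (fun a => g (f a)) x z;
  hom_rm : forall (R S : comNzRingType) (f : R -> S) (x : ob R) (y : ob S),
    hom f x y -> is_rmorph f;
  hcomp1h : forall (R S : comNzRingType) (f : R -> S) (x : ob R) (y : ob S)
    (h : hom f x y), hcomp (hid x) h = h;
  hcomph1 : forall (R S : comNzRingType) (f : R -> S) (x : ob R) (y : ob S)
    (h : hom f x y), hcomp h (hid y) = h;
  hcompA : forall (R S T W : comNzRingType) (f : R -> S) (g : S -> T) (k : T -> W)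
    (x : ob R) (y : ob S) (z : ob T) (w : ob W)
    (a : hom f x y) (b : hom g y z) (c : hom k z w),
    hcomp a (hcomp b c) = hcomp (hcomp a b) c }.

Arguments ob X R : rename.
Arguments hom {r R S} f x y.
Arguments hid {r R} x.
Arguments hcomp {r R S T f g x y z} _ _.

Record rfun (X Y : rcat) := RFun {
  fob :> forall R : comNzRingType, X R -> Y R;
  fmap : forall (R S : comNzRingType) (f : R -> S) (x : X R) (y : X S),
    hom f x y -> hom f (fob x) (fob y);
  fmap_id : forall (R : comNzRingType) (x : X R), fmap (hid x) = hid (fob x);
  fmap_comp : forall (R S T : comNzRingType) (f : R -> S) (g : S -> T)
    (x : X R) (y : X S) (z : X T) (a : hom f x y) (b : hom g y z),
    fmap (hcomp a b) = hcomp (fmap a) (fmap b) }.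

Arguments fob {X Y} r {R} x.
Arguments fmap {X Y} r {R S f x y} _.

Definition rfun_comp (X Y Z : rcat) (F : rfun X Y) (G : rfun Y Z) : rfun X Z.
Proof.
refine (@RFun X Z (fun R x => G R (F R x))
  (fun R S f x y h => fmap G (fmap F h)) _ _).
- by move=> R x; rewrite !fmap_id.
- by move=> R S T f g x y z a b; rewrite !fmap_comp.
Defined.

(* Fibered in groupoids: pullbacks exist and every arrow is cartesian. *)
Definition fibered_in_groupoids (X : rcat) : Prop :=
  (forall (R S : comNzRingType) (f : R -> S) (x : X R), is_rmorph f ->
     exists y : X S, inhabited (hom f x y)) /\
  (forall (R S T : comNzRingType) (f : R -> S) (g : S -> T)
     (x : X R) (y : X S) (z : X T)
     (h : hom f x y) (k : hom (fun a => g (f a)) x z), is_rmorph g ->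
     exists! l : hom g y z, hcomp h l = k).

(* Arrows x -> x' over the identity form a sheaf: a local section is recorded by
   its composites with all pullbacks of x' along the covering sieve. *)
Definition homs_glue (X : rcat) : Prop :=
  forall (R : comNzRingType) (U : etcover R) (x x' : X R)
    (tau : forall (S : comNzRingType) (g : R -> S) (z : X S),
       in_sieve U g -> hom g x' z -> hom g x z),
    (forall (S T : comNzRingType) (g : R -> S) (h : S -> T) (z : X S) (w : X T)
       (p : in_sieve U g) (p' : in_sieve U (fun a => h (g a)))
       (b : hom g x' z) (k : hom h z w),
       tau T _ w p' (hcomp b k) = hcomp (tau S g z p b) k) ->
    exists! phi : hom (fun a : R => a) x x',
      forall (S : comNzRingType) (g : R -> S) (z : X S) (p : in_sieve U g)
        (b : hom g x' z), tau S g z p b = hcomp phi b.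

Definition descent_effective (X : rcat) : Prop :=
  forall (R : comNzRingType) (U : etcover R)
    (y : forall (S : comNzRingType) (g : R -> S), in_sieve U g -> X S)
    (t : forall (S T : comNzRingType) (g : R -> S) (h : S -> T)
       (p : in_sieve U g) (p' : in_sieve U (fun a => h (g a))),
       is_rmorph h -> hom h (y S g p) (y T _ p')),
    (forall (S : comNzRingType) (g : R -> S) (p : in_sieve U g)
       (i : is_rmorph (fun a : S => a)),
       t S S g (fun a => a) p p i = hid (y S g p)) ->
    (forall (S T W : comNzRingType) (g : R -> S) (h : S -> T) (k : T -> W)
       (p : in_sieve U g) (p' : in_sieve U (fun a => h (g a)))
       (p'' : in_sieve U (fun a => k (h (g a))))
       (hh : is_rmorph h) (hk : is_rmorph k)
       (hkh : is_rmorph (fun a => k (h a))),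
       t S W g (fun a => k (h a)) p p'' hkh =
       hcomp (t S T g h p p' hh) (t T W (fun a => h (g a)) k p' p'' hk)) ->
    exists (x : X R)
      (e : forall (S : comNzRingType) (g : R -> S) (p : in_sieve U g),
         hom g x (y S g p)),
      forall (S T : comNzRingType) (g : R -> S) (h : S -> T)
        (p : in_sieve U g) (p' : in_sieve U (fun a => h (g a)))
        (hh : is_rmorph h),
        hcomp (e S g p) (t S T g h p p' hh) = e T _ p'.

Definition is_stack (X : rcat) : Prop :=
  [/\ fibered_in_groupoids X, homs_glue X & descent_effective X].

Record omod (X : rcat) := OMod {
  vsort :> forall R : comNzRingType, X R -> lmodType R;
  vmap : forall (R S : comNzRingType) (f : R -> S) (x : X R) (y : X S),
    hom f x y -> vsort x -> vsort y;
  vmap_semilin : forall (R S : comNzRingType) (f : R -> S) (x : X R) (y : X S)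
    (h : hom f x y), semilin f (vmap h);
  vmap_id : forall (R : comNzRingType) (x : X R) (v : vsort x),
    vmap (hid x) v = v;
  vmap_comp : forall (R S T : comNzRingType) (f : R -> S) (g : S -> T)
    (x : X R) (y : X S) (z : X T) (a : hom f x y) (b : hom g y z) (v : vsort x),
    vmap (hcomp a b) v = vmap b (vmap a v) }.

Arguments vsort {X} o {R} x.
Arguments vmap {X} o {R S f x y} _ _.

Definition is_bundle (X : rcat) (r : nat) (V : omod X) : Prop :=
  (forall (R S : comNzRingType) (f : R -> S) (x : X R) (y : X S)
     (h : hom f x y), is_basechange f (vmap V h)) /\
  (forall (R : comNzRingType) (x : X R), locfree (V R x) r).

Definition pull (X Y : rcat) (F : rfun X Y) (V : omod Y) : omod X.
Proof.
refine (@OMod X (fun R x => V R (F R x)) (fun R S f x y h => vmap V (fmap F h))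
  _ _ _).
- by move=> *; apply: vmap_semilin.
- by move=> *; rewrite fmap_id vmap_id.
- by move=> *; rewrite fmap_comp vmap_comp.
Defined.

Definition is_iso (X : rcat) (V W : omod X)
    (phi : forall (R : comNzRingType) (x : X R), V R x -> W R x) : Prop :=
  [/\ forall (R : comNzRingType) (x : X R), is_lin (phi R x),
      forall (R : comNzRingType) (x : X R), bijective (phi R x) &
      forall (R S : comNzRingType) (f : R -> S) (x : X R) (y : X S)
        (h : hom f x y) v, phi S y (vmap V h v) = vmap W h (phi R x v)].

Record osec (X : rcat) (V : omod X) := OSec {
  sv :> forall (R : comNzRingType) (x : X R), V R x;
  sv_nat : forall (R S : comNzRingType) (f : R -> S) (x : X R) (y : X S)
    (h : hom f x y), vmap V h (sv x) = sv y }.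

(* [mu] induces an isomorphism from the m-th tensor power of the invertible
   sheaf [N] to [M]: locally, the tensor power has the generator v (x) ... (x) v. *)
Definition is_tensor_power (X : rcat) (m : nat) (N M : omod X) : Prop :=
  exists mu : forall (R : comNzRingType) (x : X R),
      {ffun 'I_m -> N R x} -> M R x,
    [/\ forall (R : comNzRingType) (x : X R), is_multilin (mu R x),
        forall (R S : comNzRingType) (f : R -> S) (x : X R) (y : X S)
          (h : hom f x y) (t : {ffun 'I_m -> N R x}),
          mu S y [ffun i => vmap N h (t i)] = vmap M h (mu R x t) &
        forall (R : comNzRingType) (x : X R) (t : {ffun 'I_m -> N R x}),
          (forall i, is_gen (t i)) -> is_gen (mu R x t)].

Definition is_dual (X : rcat) (N M : omod X) : Prop :=
  exists b : forall (R : comNzRingType) (x : X R), N R x -> M R x -> R^o,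
    [/\ forall (R : comNzRingType) (x : X R), is_bilin (b R x),
        forall (R S : comNzRingType) (f : R -> S) (x : X R) (y : X S)
          (h : hom f x y) v w,
          b S y (vmap N h v) (vmap M h w) = f (b R x v w) &
        forall (R : comNzRingType) (x : X R) v w, is_gen v -> is_gen w ->
          exists u : R, u * (b R x v w : R) = 1].

(* An isomorphism from det V, for V of rank [r], to the invertible sheaf [D]:
   an alternating form carrying bases to generators. *)
Definition is_det (X : rcat) (r : nat) (V D : omod X)
    (delta : forall (R : comNzRingType) (x : X R),
       {ffun 'I_r -> V R x} -> D R x) : Prop :=
  [/\ forall (R : comNzRingType) (x : X R),
        is_multilin (delta R x) /\ is_alternating (delta R x),
      forall (R S : comNzRingType) (f : R -> S) (x : X R) (y : X S)
        (h : hom f x y) (t : {ffun 'I_r -> V R x}),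
        delta S y [ffun i => vmap V h (t i)] = vmap D h (delta R x t) &
      forall (R : comNzRingType) (x : X R) (t : {ffun 'I_r -> V R x}),
        is_basis (fun i => t i) -> is_gen (delta R x t)].

Section BaseChange.
Variables (X : rcat) (R : comNzRingType)
  (P : forall S : comNzRingType, (R -> S) -> X S -> Prop).

Record bob (S : comNzRingType) := BOb {
  bmap : R -> S;
  bpt : X S;
  bmap_rm : is_rmorph bmap;
  bobP : P bmap bpt }.

Definition bhom (S T : comNzRingType) (g : S -> T) (x : bob S) (y : bob T) :=
  {h : hom g (bpt x) (bpt y) | forall a, g (bmap x a) = bmap y a}.

Definition bhid (S : comNzRingType) (x : bob S) : bhom (fun a : S => a) x x :=
  exist _ (hid (bpt x)) (fun a => erefl).

Definition bhcomp (S T W : comNzRingType) (f : S -> T) (g : T -> W)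
    (x : bob S) (y : bob T) (z : bob W) (a : bhom f x y) (b : bhom g y z)
    : bhom (fun r => g (f r)) x z :=
  exist _ (hcomp (sval a) (sval b))
    (fun r => etrans (congr1 g (svalP a r)) (svalP b r)).

(* The full subcategory, cut out by [P], of the base change X x Spec R. *)
Definition bcsub : rcat.
Proof.
refine (@RCat bob bhom bhid bhcomp _ _ _ _).
- by move=> S T f x y [h _]; apply: hom_rm h.
- by move=> S T f x y [h p]; apply: subset_eq_compat; apply: hcomp1h.
- by move=> S T f x y [h p]; apply: subset_eq_compat; apply: hcomph1.
- move=> S T W Z f g k x y z w [a pa] [b pb] [c pc].
  by apply: subset_eq_compat; apply: hcompA.
Defined.

End BaseChange.

Definition bc (X : rcat) (R : comNzRingType) : rcat :=
  @bcsub X R (fun _ _ _ => True).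

Definition bcproj (X : rcat) (R : comNzRingType)
    (P : forall S : comNzRingType, (R -> S) -> X S -> Prop)
    : rfun (bcsub P) X.
Proof.
by refine (@RFun (bcsub P) X (fun S x => bpt x) (fun S T g x y h => sval h) _ _).
Defined.

Definition bcincl (X : rcat) (R : comNzRingType)
    (P : forall S : comNzRingType, (R -> S) -> X S -> Prop)
    : rfun (bcsub P) (bc X R).
Proof.
refine (@RFun (bcsub P) (bc X R)
  (fun S x => @BOb X R (fun _ _ _ => True) S _ (bpt x) (bmap_rm x) I)
  (fun S T g x y h => exist _ (sval h) (svalP h)) _ _).
- by move=> S x; apply: subset_eq_compat.
- by move=> S T W f g x y z a b; apply: subset_eq_compat.
Defined.

Definition bcfun (X Y : rcat) (F : rfun X Y) (R : comNzRingType)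
    : rfun (bc X R) (bc Y R).
Proof.
refine (@RFun (bc X R) (bc Y R)
  (fun S x => @BOb Y R (fun _ _ _ => True) S _ (F S (bpt x)) (bmap_rm x) I)
  (fun S T g x y h => exist _ (fmap F (sval h)) (svalP h)) _ _).
- by move=> S x; apply: subset_eq_compat; apply: fmap_id.
- by move=> S T W f g x y z a b; apply: subset_eq_compat; apply: fmap_comp.
Defined.

Lemma rmorph_comp (R S T : comNzRingType) (f : R -> S) (g : S -> T) :
  is_rmorph f -> is_rmorph g -> is_rmorph (fun a => g (f a)).
Proof.
move=> [f1 fD fM] [g1 gD gM].
by split=> [|a b|a b]; rewrite ?f1 ?fD ?fM ?gD ?gM ?g1.
Qed.

Definition bcrestr (X : rcat) (R S : comNzRingType) (g : R -> S)
    (hg : is_rmorph g) : rfun (bc X S) (bc X R).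
Proof.
refine (@RFun (bc X S) (bc X R)
  (fun T x => @BOb X R (fun _ _ _ => True) T (fun a => bmap x (g a)) (bpt x)
     (rmorph_comp hg (bmap_rm x)) I)
  (fun T W f x y h => exist _ (sval h) (fun a => svalP h (g a))) _ _).
- by move=> T x; apply: subset_eq_compat.
- by move=> T T' W f f' x y z a b; apply: subset_eq_compat.
Defined.

(* An R-point: an invertible module with two generating sections.  The module
   [pL] is the fibre of O(1), and (p0 : p1) are homogeneous coordinates. *)
Record p1ob (R : comNzRingType) := P1Ob {
  pL : lmodType R;
  p0 : pL;
  p1 : pL;
  p_rat : exists q : rat -> R, is_rmorph q;
  p_inv : locfree pL 1;
  p_gen : forall v : pL, exists a b : R, v = a *: p0 + b *: p1 }.

(* There is at most one arrow over a given [f]; it identifies the target with the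
   base change, because a surjection of invertible modules is an isomorphism. *)
Definition p1hom (R S : comNzRingType) (f : R -> S) (x : p1ob R) (y : p1ob S) :=
  {u : pL x -> pL y |
    [/\ is_rmorph f, semilin f u, u (p0 x) = p0 y & u (p1 x) = p1 y]}.

Definition p1id (R : comNzRingType) (x : p1ob R) : p1hom (fun a : R => a) x x.
Proof. by exists (fun v => v). Defined.

Definition p1comp (R S T : comNzRingType) (f : R -> S) (g : S -> T)
    (x : p1ob R) (y : p1ob S) (z : p1ob T) (a : p1hom f x y) (b : p1hom g y z)
    : p1hom (fun r => g (f r)) x z.
Proof.
exists (fun v => sval b (sval a v)).
case: a b => [u [fm su u0 u1]] [w [gm sw w0 w1]] /=.
split; [exact: rmorph_comp | | by rewrite u0 | by rewrite u1].
by move=> c v v'; rewrite su sw.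
Defined.

Definition P1 : rcat.
Proof.
refine (@RCat p1ob p1hom p1id p1comp _ _ _ _).
- by move=> R S f x y [u []].
- by move=> R S f x y [u p]; apply: subset_eq_compat.
- by move=> R S f x y [u p]; apply: subset_eq_compat.
- by move=> R S T W f g k x y z w [a pa] [b pb] [c pc]; apply: subset_eq_compat.
Defined.

Definition O1 : omod P1.
Proof.
refine (@OMod P1 (fun R x => pL x) (fun R S f x y h => sval h) _ _ _) => //.
by move=> R S f x y [u []].
Defined.

Lemma locfree_regular (R : comNzRingType) : locfree R^o 1.
Proof.
exists 1%N, (fun=> 1); split.
  by exists (fun=> 1); rewrite big_ord1 mulr1.
move=> _; exists (fun=> 1 : R^o); split=> [v | c].
  by exists 0%N, (fun=> v); rewrite big_ord1 /= expr0 scale1r /GRing.scale /= mulr1.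
rewrite big_ord1 /GRing.scale /= mulr1 => c0.
by exists 0%N => j; rewrite expr0 mul1r ord1.
Qed.

Definition p1pt (R : comNzRingType) (a b : R)
    (hQ : exists q : rat -> R, is_rmorph q)
    (hab : exists c d : R, c * a + d * b = 1) : P1 R.
Proof.
refine (@P1Ob R R^o a b hQ (locfree_regular R) _).
by case: hab => c [d e] v; exists (v * c), (v * d); rewrite /GRing.scale /= -!mulrA -mulrDr e mulr1.
Defined.

Lemma rmorphP (R S : pzRingType) (f : {rmorphism R -> S}) : is_rmorph f.
Proof. by split; [exact: rmorph1 | exact: rmorphD | exact: rmorphM]. Qed.

Lemma rat_to_poly : exists q : rat -> {poly rat}, is_rmorph q.
Proof. by exists (polyC : rat -> {poly rat}); apply: rmorphP. Qed.

Lemma unimod1l (R : comNzRingType) (b : R) : exists c d : R, c * 1 + d * b = 1.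
Proof. by exists 1, 0; rewrite mulr1 mul0r addr0. Qed.

Lemma unimod1r (R : comNzRingType) (a : R) : exists c d : R, c * a + d * 1 = 1.
Proof. by exists 0, 1; rewrite mulr1 mul0r add0r. Qed.

(* The two standard charts, with coordinates t = p1/p0 ([false]) and
   1/t = p0/p1 ([true]). *)
Definition chart (j : bool) : P1 {poly rat} :=
  if j then p1pt rat_to_poly (unimod1r ('X : {poly rat}))
  else p1pt rat_to_poly (unimod1l ('X : {poly rat})).

Definition Qt : fieldType := {fraction {poly rat}}.

Definition tvar : Qt := tofrac ('X : {poly rat}).

Lemma rat_to_Qt : exists q : rat -> Qt, is_rmorph q.
Proof.
by exists (fun c : rat => tofrac (c%:P : {poly rat})); split;
  [rewrite rmorph1 | move=> a b; rewrite !rmorphD | move=> a b; rewrite !rmorphM].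
Qed.

Definition generic_pt : P1 Qt := p1pt rat_to_Qt (unimod1l tvar).

(* [N] is isomorphic to O(d). *)
Definition p1_degree (K : fieldType) (N : omod (bc P1 K)) (d : int) : Prop :=
  match d with
  | Posz n => is_tensor_power n (pull (bcproj _) O1) N
  | Negz n => exists M : omod (bc P1 K),
      [/\ is_bundle 1 M, is_dual N M &
          is_tensor_power n.+1 (pull (bcproj _) O1) M]
  end.

Definition chart_fun (j : bool) (p : {poly rat}) : Qt :=
  if j then (map_poly (fun c : rat => tofrac (c%:P : {poly rat}) : Qt) p).[tvar^-1]
  else tofrac p.

(* The local ring, inside Q(t), of the closed point of the chart [j] defined by
   the irreducible polynomial [p]. *)
Definition local_ring (j : bool) (p : {poly rat}) (k : Qt) : Prop :=
  exists f g : {poly rat}, ~~ (p %| g) /\ k = chart_fun j f / chart_fun j g.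

(* The K-algebra [B] is the generic fibre of an Azumaya algebra over the local
   subring [O] of K: the lattice spanned over [O] by some basis [b] is an
   O-algebra whose O-linear endomorphisms are freely generated by the maps
   x |-> b i * x * b j. *)
Definition has_azumaya_order (K : fieldType) (O : K -> Prop) (B : algType K)
    : Prop :=
  exists (n : nat) (b : 'I_n -> B),
    let in_lattice (x : B) :=
      exists c : 'I_n -> K, (forall i, O (c i)) /\ x = \sum_i c i *: b i in
    [/\ is_basis b, in_lattice 1, forall i j, in_lattice (b i * b j) &
      forall phi : B -> B, is_lin phi -> (forall i, in_lattice (phi (b i))) ->
        exists! c : 'M[K]_n, (forall i j, O (c i j)) /\
          forall x, phi x = \sum_i \sum_j c i j *: (b i * x * b j)].

Definition brauer_equiv (K : fieldType) (A B : algType K) : Prop :=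
  exists (m n : nat) (phi : 'M[A]_m.+1 -> 'M[B]_n.+1),
    [/\ is_rmorph phi, bijective phi &
        forall c : K, phi ((c%:A)%:M) = (c%:A)%:M].

Definition ramified (A : algType Qt) (j : bool) (p : {poly rat}) : Prop :=
  ~ exists B : algType Qt,
      has_azumaya_order (local_ring j p) B /\ brauer_equiv A B.

(* [D] with its section [s] is O(p_1 + ... + p_r) with its canonical section,
   where p_1, ..., p_r are the closed points at which the class of [A] ramifies:
   in each chart, [s] is given by a squarefree polynomial whose irreducible
   factors are the ramified points. *)
Definition is_ramification_divisor (A : algType Qt) (D : omod P1) (s : osec D)
    : Prop :=
  is_bundle 1 D /\
  forall j : bool, exists (e : D _ (chart j)) (F : {poly rat}),
    [/\ is_gen e, s _ (chart j) = F *: e, F != 0,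
        (forall p : {poly rat}, irreducible_poly p -> ~~ (p ^+ 2 %| F)) &
        forall p : {poly rat}, irreducible_poly p ->
          (p %| F <-> ramified A j p)].

Section RootStack.
Variables (D : omod P1) (s : osec D).

Record rootob (R : comNzRingType) := RootOb {
  rpt : P1 R;
  rN : lmodType R;
  rn : rN;
  rsq : rN -> rN -> D R rpt;
  rN_inv : locfree rN 1;
  rsq_iso : is_tensor rsq;
  rsq_n : rsq rn rn = s R rpt }.

(* As for [p1hom], the second component automatically is a base change map. *)
Definition roothom (R S : comNzRingType) (f : R -> S)
    (x : rootob R) (y : rootob S) :=
  {h : hom f (rpt x) (rpt y) * (rN x -> rN y) |
    [/\ semilin f h.2, h.2 (rn x) = rn y &
        forall a b, rsq (h.2 a) (h.2 b) = vmap D h.1 (rsq a b)]}.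

Definition rootid (R : comNzRingType) (x : rootob R)
    : roothom (fun a : R => a) x x.
Proof.
by exists (hid (rpt x), fun v => v); split=> // a b; rewrite vmap_id.
Defined.

Definition rootcomp (R S T : comNzRingType) (f : R -> S) (g : S -> T)
    (x : rootob R) (y : rootob S) (z : rootob T)
    (a : roothom f x y) (b : roothom g y z) : roothom (fun r => g (f r)) x z.
Proof.
exists (hcomp (sval a).1 (sval b).1, fun v => (sval b).2 ((sval a).2 v)).
case: a b => [[u1 u2] /= [su un uq]] [[w1 w2] /= [sw wn wq]] /=.
split=> [c v v' | | v v']; first by rewrite su sw.
- by rewrite un.
- by rewrite wq uq vmap_comp.
Defined.

Definition rootstack : rcat.
Proof.
refine (@RCat rootob roothom rootid rootcomp _ _ _ _).
- by move=> R S f x y [[u w] p]; apply: hom_rm u.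
- move=> R S f x y [[u w] p]; apply: subset_eq_compat.
  by congr pair; apply: hcomp1h.
- move=> R S f x y [[u w] p]; apply: subset_eq_compat.
  by congr pair; apply: hcomph1.
- move=> R S T W f g k x y z w [[a a'] pa] [[b b'] pb] [[c c'] pc].
  by apply: subset_eq_compat; congr pair; apply: hcompA.
Defined.

Definition root_to_P1 : rfun rootstack P1.
Proof.
by refine (@RFun rootstack P1 (fun R x => rpt x)
  (fun R S f x y h => (sval h).1) _ _).
Defined.

Definition root_N : omod rootstack.
Proof.
refine (@OMod rootstack (fun R x => rN x) (fun R S f x y h => (sval h).2)
  _ _ _) => //.
by move=> R S f x y [[u w] []].
Defined.

End RootStack.

Definition mu2 (R : comNzRingType) := {z : R | z ^+ 2 = 1}.

Record mu2_gerbe (P : rcat) := Mu2Gerbe {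
  gC :> rcat;
  gpi : rfun gC P;
  gband : forall (R : comNzRingType) (c : gC R),
    mu2 R -> hom (fun a : R => a) c c;
  g_stack : is_stack gC;
  g_locally_nonempty : forall (R : comNzRingType) (x : P R),
    exists U : etcover R, forall i, exists c : gC (ec_S i),
      inhabited (hom (@ec_f R U i) x (gpi _ c));
  g_locally_connected : forall (R : comNzRingType) (c c' : gC R)
      (phi : hom (fun a : R => a) (gpi _ c) (gpi _ c')),
    exists U : etcover R, forall i, exists (d : gC (ec_S i))
      (a : hom (@ec_f R U i) c d) (b : hom (@ec_f R U i) c' d),
      hcomp phi (fmap gpi b) = fmap gpi a;
  g_band_mul : forall (R : comNzRingType) (c : gC R) (z z' w : mu2 R),
    sval w = sval z * sval z' -> gband c w = hcomp (gband c z) (gband c z');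
  g_band_inj : forall (R : comNzRingType) (c : gC R), injective (gband c);
  g_band_im : forall (R : comNzRingType) (c : gC R)
      (h : hom (fun a : R => a) c c),
    (exists z, gband c z = h) <-> fmap gpi h = hid (gpi _ c);
  g_band_nat : forall (R S : comNzRingType) (f : R -> S) (c : gC R) (d : gC S)
      (h : hom f c d) (z : mu2 R) (w : mu2 S),
    sval w = f (sval z) -> hcomp (gband c z) h = hcomp h (gband d w) }.

Arguments gpi {P} m.
Arguments gband {P} m {R} c _.

Definition is_twisted (P : rcat) (C : mu2_gerbe P) (R : comNzRingType)
    (Q : forall S : comNzRingType, (R -> S) -> C S -> Prop)
    (V : omod (bcsub Q)) : Prop :=
  forall (S : comNzRingType) (x : bcsub Q S) (z : mu2 S) (v : V S x),
    @vmap _ V _ _ _ x x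
      (exist _ (gband C (bpt x) z) (fun a => erefl) : bhom (fun a : S => a) x x) v
    = sval z *: v.

Section Twisted.
Variables (D : omod P1) (s : osec D) (C : mu2_gerbe (rootstack s)).

Definition gerbe_to_P1 : rfun C P1 := rfun_comp (gpi C) (root_to_P1 s).

(* The fibre product over P^1 of C and the R-point [x]; an arrow of P^1 over a
   given ring map being unique, only its existence is recorded. *)
Definition over_point (R : comNzRingType) (x : P1 R) (S : comNzRingType)
    (f : R -> S) (c : C S) : Prop := inhabited (hom f x (gerbe_to_P1 S c)).

Definition gfibre (R : comNzRingType) (x : P1 R) : rcat :=
  bcsub (over_point x).

(* The Brauer class of C is that of [A]: over the generic point of P^1, the
   algebra [A] is isomorphic to the endomorphism algebra of a locally free
   twisted sheaf. *)
Definition has_brauer_class (A : algType Qt) : Prop :=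
  exists (r : nat) (V : omod (gfibre generic_pt))
    (act : forall (S : comNzRingType) (x : gfibre generic_pt S), A -> V S x -> V S x),
    [/\ (0 < r)%N, is_bundle r V, is_twisted V,
        forall (S : comNzRingType) (x : gfibre generic_pt S),
        [/\ forall a, is_lin (act S x a),
            forall v, act S x 1 v = v,
            forall a b v, act S x (a * b) v = act S x a (act S x b v) &
            forall (k : Qt) a b v, act S x (k *: a + b) v
              = bmap x k *: act S x a v + act S x b v] &
        (forall (S T : comNzRingType) (f : S -> T) (x : gfibre generic_pt S)
           (y : gfibre generic_pt T) (h : hom f x y) a v,
           vmap V h (act S x a v) = act T y a (vmap V h v)) /\
        (exists (n : nat) (b : 'I_n -> A), is_basis b /\
           forall (S : comNzRingType) (x : gfibre generic_pt S) (phi : V S x -> V S x),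
             is_lin phi -> exists! c : {ffun 'I_n -> S},
               forall v, phi v = \sum_i c i *: act S x (b i) v)].

(* Here [x] is a geometric point of P^1 on the divisor.  The universal square
   root N restricts to the fibre over [x] as the sheaf attached to the
   nontrivial character of mu_2 (a trivialization of D at [x], unique up to
   isomorphism, makes it so), hence the regular representation gives
   rho = O + N.  The maps [alpha i] and [beta i] assemble into an isomorphism
   E (x) (O + N)^m -> V. *)
Definition regular_at (K : fieldType) (V : omod (bc C K)) (x : P1 K) : Prop :=
  let W := pull (bcincl (over_point x)) V in
  let N := pull (rfun_comp (bcproj (over_point x)) (gpi C)) (root_N s) in
  exists (m : nat) (E : omod (gfibre x))
    (alpha : 'I_m -> forall (S : comNzRingType) (y : gfibre x S),
       E S y -> W S y)
    (beta : 'I_m -> forall (S : comNzRingType) (y : gfibre x S),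
       E S y -> N S y -> W S y),
    [/\ (0 < m)%N, is_bundle 1 E /\ is_twisted E,
        (forall i (S : comNzRingType) (y : gfibre x S), is_lin (alpha i S y)) /\
        (forall i (S : comNzRingType) (y : gfibre x S), is_bilin (beta i S y)),
        (forall i (S T : comNzRingType) (f : S -> T) (y : gfibre x S)
           (z : gfibre x T) (h : hom f y z) e,
           alpha i T z (vmap E h e) = vmap W h (alpha i S y e)) /\
        (forall i (S T : comNzRingType) (f : S -> T) (y : gfibre x S)
           (z : gfibre x T) (h : hom f y z) e n,
           beta i T z (vmap E h e) (vmap N h n) = vmap W h (beta i S y e n)) &
        forall (S : comNzRingType) (y : gfibre x S) e n,
          is_gen e -> is_gen n ->
          is_basis (fun k : 'I_(m + m) =>
            match split k with
            | inl i => alpha i S y e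
            | inr i => beta i S y e n
            end)].

Definition is_regular (K : fieldType) (V : omod (bc C K)) : Prop :=
  forall x : P1 K, s K x = 0 -> regular_at V x.

Definition has_degree (K : fieldType) (N : omod (bc C K)) (q : rat) : Prop :=
  exists (m : nat) (N' : omod (bc P1 K)) (d : int),
    [/\ (0 < m)%N, is_bundle 1 N',
        is_tensor_power m N (pull (bcfun gerbe_to_P1 K) N'),
        p1_degree N' d & q = d%:~R / m%:R].

Definition bundle_degree (K : fieldType) (r : nat) (V : omod (bc C K)) (q : rat)
    : Prop :=
  exists (Dt : omod (bc C K))
    (delta : forall (S : comNzRingType) (x : bc C K S),
       {ffun 'I_r -> V S x} -> Dt S x),
    [/\ is_bundle 1 Dt, is_det delta & has_degree Dt q].

(* Inclusions of subsheaves that are locally split; on an affine scheme locally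
   split and split coincide for maps of locally free sheaves of finite rank. *)
Definition locally_split_mono (K : fieldType) (W V : omod (bc C K))
    (i : forall (S : comNzRingType) (x : bc C K S), W S x -> V S x) : Prop :=
  [/\ forall (S : comNzRingType) (x : bc C K S), is_lin (i S x),
      forall (S T : comNzRingType) (f : S -> T) (x : bc C K S) (y : bc C K T)
        (h : hom f x y) w, i T y (vmap W h w) = vmap V h (i S x w) &
      forall (S : comNzRingType) (x : bc C K S), exists p : V S x -> W S x,
        is_lin p /\ cancel (i S x) p].

(* A locally split subsheaf of V is proper and nonzero exactly when its rank lies
   strictly between 0 and that of V. *)
Definition is_stable (K : fieldType) (r : nat) (V : omod (bc C K)) : Prop :=
  forall (k : nat) (W : omod (bc C K))
    (i : forall (S : comNzRingType) (x : bc C K S), W S x -> V S x) (dW dV : rat),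
    (0 < k < r)%N -> is_bundle k W -> locally_split_mono i ->
    bundle_degree k W dW -> bundle_degree r V dV ->
    dW / k%:R < dV / r%:R.

Variables (L : omod (rootstack s)) (r : nat).

Definition detL (R : comNzRingType) : omod (bc C R) :=
  pull (rfun_comp (bcproj _) (gpi C)) L.

Definition alg_closed (K : fieldType) : Prop :=
  forall p : {poly K}, (1 < size p)%N -> exists x, root p x.

Record mobj (R : comNzRingType) := MObj {
  mV : omod (bc C R);
  mdet : forall (S : comNzRingType) (x : bc C R S),
    {ffun 'I_r -> mV S x} -> detL R S x;
  mV_bundle : is_bundle r mV;
  mV_twisted : is_twisted mV;
  mdetP : is_det mdet;
  mV_geom : forall (K : fieldType) (g : R -> K) (hg : is_rmorph g),
    alg_closed K ->
    is_regular (pull (bcrestr C hg) mV) /\ is_stable r (pull (bcrestr C hg) mV) }.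

Definition is_mpull (R S : comNzRingType) (g : R -> S) (m : mobj R) (m' : mobj S)
    : Prop :=
  exists (hg : is_rmorph g)
    (phi : forall (T : comNzRingType) (x : bc C S T),
       mV m' T x -> pull (bcrestr C hg) (mV m) T x),
    is_iso phi /\
    forall (T : comNzRingType) (x : bc C S T) (t : {ffun 'I_r -> mV m' T x}),
      mdet [ffun i => phi T x (t i)] = mdet t.

(* Sections over R of the sheafification of the presheaf of isomorphism classes.
   A section is recorded as the class of all pairs (g : R -> S, m over S) such
   that the section defined by [m] is the restriction along [g] of the given
   one; the fields say that this class is a section. *)
Record coarse_moduli (R : comNzRingType) := CoarseSection {
  cs : forall S : comNzRingType, (R -> S) -> mobj S -> Prop;
  cs_rm : forall (S : comNzRingType) (g : R -> S) (m : mobj S),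
    cs g m -> is_rmorph g;
  cs_pull : forall (S T : comNzRingType) (g : R -> S) (h : S -> T)
      (m : mobj S) (m' : mobj T),
    cs g m -> is_mpull h m m' -> cs (fun a => h (g a)) m';
  cs_exists : exists U : etcover R, forall i, exists m : mobj (ec_S i),
    cs (@ec_f R U i) m;
  cs_unique : forall (S : comNzRingType) (g : R -> S) (m m' : mobj S),
    cs g m -> cs g m' ->
    exists U : etcover S, forall i, exists n : mobj (ec_S i),
      is_mpull (@ec_f S U i) m n /\ is_mpull (@ec_f S U i) m' n;
  cs_local : forall (S : comNzRingType) (g : R -> S) (m : mobj S)
      (U : etcover S), is_rmorph g ->
    (forall i, exists n : mobj (ec_S i),
       is_mpull (@ec_f S U i) m n /\ cs (fun a => ec_f i (g a)) n) ->
    cs g m }.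

End Twisted.

Definition padic_norm (p : nat) (q : rat) : rat :=
  if q == 0 then 0
  else (p%:R : rat) ^ ((logn p `|denq q|)%:Z - (logn p `|numq q|)%:Z).

Definition is_padic_field (p : nat) (K : fieldType) : Prop :=
  exists nrm : K -> rat,
    [/\ (forall x, (0 <= nrm x) /\ (nrm x = 0 <-> x = 0)),
        (forall x y, nrm (x * y) = nrm x * nrm y) /\
        (forall x y, nrm (x + y) <= Num.max (nrm x) (nrm y)),
        (forall q : rat, nrm (ratr q) = padic_norm p q),
        (forall (x : K) (e : rat), 0 < e -> exists q : rat, nrm (x - ratr q) < e) &
        forall u : nat -> K,
          (forall e : rat, 0 < e -> exists n0, forall i j,
             (n0 <= i)%N -> (n0 <= j)%N -> nrm (u i - u j) < e) ->
          exists x : K, forall e : rat, 0 < e -> exists n0, forall i,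
            (n0 <= i)%N -> nrm (u i - x) < e].

(* Main.v *)
(* Let t0 be 1 or 11. The divisor passes through t0: otherwise the class of A would be
   unramified there, while its residue is the nonsquare 13. Over a finite Galois
   extension E of Q_17, the gerbe has a point c over E[[u]] with t = t0 + u^2,
   carrying semilinear automorphisms a_x for all x in the Galois group and j over
   u |-> - u. A twisted sheaf with endomorphism algebra A has a canonical line in
   its fibre over the generic point of c, the joint eigenline of the square roots of
   17 and 13 in A; the leading coefficients of the action of the a_x on it form a
   cochain xi whose coboundary is t0 ^ (d(x) d(y)), up to the band, where d is the
   character of Q_17(sqrt 17).

   A Q_17-point of the moduli space gives a sheaf V over C_E with natural isomorphisms
   to its Galois twists. By regularity, j acts on V at u = 0 as a nonscalar, and its
   two eigenlines are stable under the Galois action on V; this gives a cochain mu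
   with the same band signs as xi, up to eigenvalues of natural automorphisms of V of
   determinant 1. The trace of such an automorphism is a regular function on the
   projective line, hence constant, so these eigenvalues are the same at t0 = 1 and
   t0 = 11. Dividing xi / mu at t0 = 11 by xi / mu at t0 = 1 thus gives a cochain with
   coboundary 11 ^ (d(x) d(y)). Then 11 is a norm from Q_17(sqrt 17), which is false as 11
   is not a square mod 17. *)

Require Import Defs.
From HB Require Import structures.
From mathcomp Require Import mpoly.
From mathcomp Require Import all_boot all_order all_algebra all_fingroup all_field.
From mathcomp Require Import generic_quotient ring zify boolp classical_sets filter.
(* Imported again because the libraries shadow [hom]. *)
Require Import Defs.

Set Implicit Arguments.
Unset Strict Implicit.
Unset Printing Implicit Defensive.

Import Order.TTheory GRing.Theory Num.Theory.
Local Open Scope ring_scope.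

(** A point of the coarse space is only locally a sheaf: over E it yields isomorphisms from V to its
    Galois twists, but no cocycle condition on them. The defect is a family of natural automorphisms
    of V, whose eigenvalues l and 1/l enter the coboundary of mu and cannot be controlled at a
    single t0. This is why two points are compared. The points 1 and 11 are zeros of (t-1)(t-11),
    and 13 is a square in Q_17 although not in Q: the latter puts them on the divisor, the former
    makes the Galois action fix the root of 13, so that of the two quaternion algebras only (17, t)
    leaves a trace t0 in the coboundary. As a trace determines l only up to inversion, one of the
    two eigenlines at t0 = 11 has to be selected, and the same one must serve for all automorphisms.

    Finite extensions are used because the valuations of the numbers by which the a_x act give
    homomorphisms from the Galois group to the integers, which vanish on a finite group. The
    equation t = t0 + u^2 makes u a section of the square root of the divisor, so that u -> - u
    lifts to the root stack and acts by -1 on the square root at u = 0. *)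

(** * Algebraic closures *)

Section Ultraproduct.
Variables (I : Type) (U : set_system I) (E : I -> fieldType).
Hypothesis ultraU : UltraFilter U.

(** The ultrafilter is a parameter of the type because the proof that 1 is not 0 in the product
    takes from it that the index type is inhabited. *)
Definition prodfield_of (_ : UltraFilter U) := forall i, E i.
HB.instance Definition _ (u : UltraFilter U) :=
  Choice.copy (prodfield_of u) (forall i, E i).
Local Notation prodfield := (prodfield_of ultraU).

Definition ueq (a b : prodfield) := `[< U (fun i => a i = b i) >].

Lemma ueq_refl : reflexive ueq.
Proof. by move=> a; apply/asboolP; apply: filterS filterT => i _. Qed.

Lemma ueq_sym : symmetric ueq.
Proof. by move=> a b; apply/asboolP/asboolP; apply: filterS => i /= ->. Qed.

Lemma ueq_trans : transitive ueq.
Proof.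
move=> b a c /asboolP ab /asboolP bc; apply/asboolP.
by apply: filterS (filterI ab bc) => i [/= -> ->].
Qed.

Canonical ueq_equiv := EquivRel ueq ueq_refl ueq_sym ueq_trans.
Definition uprod := {eq_quot ueq}%qT.
HB.instance Definition _ : EqQuotient _ ueq uprod := EqQuotient.on uprod.
HB.instance Definition _ := Choice.on uprod.

Definition upi (a : prodfield) : uprod := (\pi_uprod a)%qT.

Lemma upiP a b : upi a = upi b <-> U (fun i => a i = b i).
Proof.
split=> [/eqmodP|h]; first by move/asboolP.
by apply/eqmodP; apply/asboolP.
Qed.

Lemma upi_surj (x : uprod) : exists a, x = upi a.
Proof. by exists (repr x); rewrite /upi reprK. Qed.

Definition uop2 (o : forall i, E i -> E i -> E i) (x y : uprod) : uprod :=
  upi (fun i => o i (repr x i) (repr y i)).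
Definition uop1 (o : forall i, E i -> E i) (x : uprod) : uprod :=
  upi (fun i => o i (repr x i)).

Lemma urepr a : U (fun i => repr (upi a) i = a i).
Proof. by apply/upiP; rewrite /upi reprK. Qed.

Lemma uop2E o a b : uop2 o (upi a) (upi b) = upi (fun i => o i (a i) (b i)).
Proof.
by apply/upiP; apply: filterS (filterI (urepr a) (urepr b)) => i [/= -> ->].
Qed.

Lemma uop1E o a : uop1 o (upi a) = upi (fun i => o i (a i)).
Proof. by apply/upiP; apply: filterS (urepr a) => i /= ->. Qed.

Let uadd := uop2 (fun i x y => x + y).
Let umul := uop2 (fun i x y => x * y).
Let uopp := uop1 (fun i x => - x).
Let uinv := uop1 (fun i x => x^-1).
Let u0 := upi (fun i => 0).
Let u1 := upi (fun i => 1).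


Lemma upi_ext a b : (forall i, a i = b i) -> upi a = upi b.
Proof. by move=> ab; apply/upiP; apply: filterS filterT => i _ /=. Qed.

Lemma uaddA : associative uadd.
Proof.
move=> x y z; have [[a ->] [b ->] [c ->]] := And3 (upi_surj x) (upi_surj y) (upi_surj z).
by rewrite /uadd !uop2E; apply: upi_ext => i; rewrite addrA.
Qed.
Lemma uaddC : commutative uadd.
Proof.
move=> x y; have [[a ->] [b ->]] := conj (upi_surj x) (upi_surj y).
by rewrite /uadd !uop2E; apply: upi_ext => i; rewrite addrC.
Qed.
Lemma uadd0 : left_id u0 uadd.
Proof.
by move=> x; have [a ->] := upi_surj x; rewrite /uadd !uop2E; apply: upi_ext => i; rewrite add0r.
Qed.
Lemma uaddN : left_inverse u0 uopp uadd.
Proof.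
move=> x; have [a ->] := upi_surj x.
by rewrite /uadd /uopp uop1E !uop2E; apply: upi_ext => i; rewrite addNr.
Qed.
HB.instance Definition _ := GRing.isZmodule.Build uprod uaddA uaddC uadd0 uaddN.

Lemma umulA : associative umul.
Proof.
move=> x y z; have [[a ->] [b ->] [c ->]] := And3 (upi_surj x) (upi_surj y) (upi_surj z).
by rewrite /umul !uop2E; apply: upi_ext => i; rewrite mulrA.
Qed.
Lemma umulC : commutative umul.
Proof.
move=> x y; have [[a ->] [b ->]] := conj (upi_surj x) (upi_surj y).
by rewrite /umul !uop2E; apply: upi_ext => i; rewrite mulrC.
Qed.
Lemma umul1 : left_id u1 umul.
Proof.
by move=> x; have [a ->] := upi_surj x; rewrite /umul !uop2E; apply: upi_ext => i; rewrite mul1r.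
Qed.
Lemma umulD : left_distributive umul uadd.
Proof.
move=> x y z; have [[a ->] [b ->] [c ->]] := And3 (upi_surj x) (upi_surj y) (upi_surj z).
by rewrite /umul /uadd !uop2E; apply: upi_ext => i; rewrite mulrDl.
Qed.
Lemma u1_neq0 : u1 != 0.
Proof.
apply/eqP=> /upiP h; apply: (@filter_not_empty _ U).
by apply: filterS h => i /= /eqP; rewrite oner_eq0.
Qed.
HB.instance Definition _ :=
  GRing.Zmodule_isComNzRing.Build uprod umulA umulC umul1 umulD u1_neq0.

Lemma umulV (x : uprod) : x != 0 -> umul (uinv x) x = 1.
Proof.
have [a ->] := upi_surj x => nz; rewrite /umul /uinv uop1E uop2E; apply/upiP.
(* An ultrafilter contains the zero set of [a] or its complement; in the first case the class of [a]
   is zero. *)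
have [z|nz'] := in_ultra_setVsetC (fun i => a i = 0) ultraU.
  by case/eqP: nz; apply/upiP.
by apply: filterS nz' => i /= /eqP nzi; rewrite mulVf.
Qed.
Lemma uinv0 : uinv 0 = 0.
Proof. by rewrite /uinv uop1E; apply: upi_ext => i; rewrite invr0. Qed.
HB.instance Definition _ := GRing.ComNzRing_isField.Build uprod umulV uinv0.

Lemma upi0 : upi (fun=> 0) = 0 :> uprod. Proof. by []. Qed.
Lemma upi1 : upi (fun=> 1) = 1 :> uprod. Proof. by []. Qed.
Lemma upiD a b : upi a + upi b = upi (fun i => a i + b i).
Proof. exact: uop2E. Qed.
Lemma upiM a b : upi a * upi b = upi (fun i => a i * b i).
Proof. exact: uop2E. Qed.
Lemma upiN a : - upi a = upi (fun i => - a i).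
Proof. exact: uop1E. Qed.

Lemma prodfield_ext (a b : prodfield) : (forall i, a i = b i) -> a = b.
Proof. exact: functional_extensionality_dep. Qed.

Let prod_add (a b : prodfield) : prodfield := fun i => a i + b i.
Let prod_mul (a b : prodfield) : prodfield := fun i => a i * b i.
Let prod_opp (a : prodfield) : prodfield := fun i => - a i.
Let p0 : prodfield := fun=> 0.
Let p1 : prodfield := fun=> 1.
Lemma prodfield_addA : associative prod_add.
Proof. by move=> a b c; apply: prodfield_ext => i; apply: addrA. Qed.
Lemma prodfield_addC : commutative prod_add.
Proof. by move=> a b; apply: prodfield_ext => i; apply: addrC. Qed.
Lemma prodfield_add0 : left_id p0 prod_add.
Proof. by move=> a; apply: prodfield_ext => i; apply: add0r. Qed.
Lemma prodfield_addN : left_inverse p0 prod_opp prod_add.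
Proof. by move=> a; apply: prodfield_ext => i; apply: addNr. Qed.
HB.instance Definition _ := GRing.isZmodule.Build prodfield prodfield_addA prodfield_addC prodfield_add0 prodfield_addN.
Lemma prodfield_mulA : associative prod_mul.
Proof. by move=> a b c; apply: prodfield_ext => i; apply: mulrA. Qed.
Lemma prodfield_mulC : commutative prod_mul.
Proof. by move=> a b; apply: prodfield_ext => i; apply: mulrC. Qed.
Lemma prodfield_mul1 : left_id p1 prod_mul.
Proof. by move=> a; apply: prodfield_ext => i; apply: mul1r. Qed.
Lemma prodfield_mulD : left_distributive prod_mul prod_add.
Proof. by move=> a b c; apply: prodfield_ext => i; apply: mulrDl. Qed.
Lemma prodfield_neq0 : p1 != 0.
Proof. by apply/eqP=> h; case/eqP: u1_neq0; rewrite -[RHS]upi0 -[LHS]/(upi p1) h. Qed.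
HB.instance Definition _ :=
  GRing.Zmodule_isComNzRing.Build prodfield prodfield_mulA prodfield_mulC prodfield_mul1 prodfield_mulD prodfield_neq0.

Lemma upi_zmod : zmod_morphism (upi : prodfield -> uprod).
Proof. by move=> a b; rewrite upiN upiD. Qed.
HB.instance Definition _ := GRing.isZmodMorphism.Build prodfield uprod upi upi_zmod.
Lemma upi_monoid : monoid_morphism (upi : prodfield -> uprod).
Proof. by split=> [|a b]; rewrite ?upiM. Qed.
HB.instance Definition _ := GRing.isMonoidMorphism.Build prodfield uprod upi upi_monoid.

Definition pproj (i : I) (a : prodfield) : E i := a i.
Lemma pproj_zmod i : zmod_morphism (pproj i). Proof. by []. Qed.
HB.instance Definition _ i := GRing.isZmodMorphism.Build prodfield (E i) (pproj i) (pproj_zmod i).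
Lemma pproj_monoid i : monoid_morphism (pproj i). Proof. by []. Qed.
HB.instance Definition _ i := GRing.isMonoidMorphism.Build prodfield (E i) (pproj i) (pproj_monoid i).

End Ultraproduct.

(** A nonconstant divisor of least degree is irreducible. *)
Lemma irreducible_factor (k : fieldType) (p : {poly k}) : (1 < size p)%N ->
  exists2 q, irreducible_poly q & q %| p.
Proof.
move=> sp.
have ex : exists n, `[< exists q : {poly k}, [/\ (1 < size q)%N, q %| p & size q = n] >].
  by exists (size p); apply/asboolP; exists p.
case: (ex_minnP ex) => n /asboolP [q [sq qp sqn]] nmin; exists q => //.
split=> // r sr rq; rewrite -dvdp_size_eqp // eqn_leq dvdp_leq ?size_poly_gt0 //=; last first.
  by rewrite -size_poly_gt0 (ltn_trans _ sq).
rewrite sqn; apply: nmin; apply/asboolP; exists r; split=> //; last exact: dvdp_trans rq qp.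
case: (ltngtP (size r) 1) => // [|/eqP]; last by rewrite (negPf sr).
rewrite ltnS leqn0 size_poly_eq0 => /eqP r0; move: rq; rewrite r0 dvd0p.
by move=> /eqP q0; rewrite q0 size_poly0 in sq.
Qed.

Lemma root_extension (k : fieldType) (p : {poly k}) : (1 < size p)%N ->
  exists (E : fieldType) (f : {rmorphism k -> E}) x, root (map_poly f p) x.
Proof.
case/irreducible_factor=> q irq qp.
have [L _ [z rz _]] := irredp_FAdjoin irq.
exists L, (in_alg L), z; move: rz; rewrite -!dvdp_XsubCl => /dvdp_trans; apply.
by rewrite dvdp_map.
Qed.

Definition splits (k : fieldType) (p : {poly k}) :=
  exists rs : seq k, p = lead_coef p *: \prod_(r <- rs) ('X - r%:P).

Lemma split_extension (k : fieldType) (p : {poly k}) :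
  exists (E : fieldType) (f : {rmorphism k -> E}), splits (map_poly f p).
Proof.
have [n] := ubnP (size p); elim: n => // n IH in k p *; rewrite ltnS => spn.
case: (ltnP 1 (size p)) => sp; last first.
  exists k, idfun; exists [::]; rewrite big_nil map_poly_id // alg_polyC.
  by rewrite {1}(size1_polyC sp) lead_coefE; case: (size p) sp => [|[]].
have [E [f [x]]] := root_extension sp; case/factor_theorem=> q eq.
have nzp : map_poly f p != 0 by rewrite map_poly_eq0 -size_poly_gt0 (ltn_trans _ sp).
have nzq : q != 0 by apply: contraNneq nzp => q0; rewrite eq q0 mul0r.
have sq : (size q < n)%N.
  move: spn; rewrite -(size_map_poly f) eq size_Mmonic ?monicXsubC //.
  by rewrite size_XsubC addn2.
have [E' [f' [rs ers]]] := IH _ _ sq.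
exists E', (f' \o f); exists (f' x :: rs); rewrite big_cons map_poly_comp eq.
rewrite rmorphM /= [in LHS]ers rmorphB /= map_polyX map_polyC /=.
rewrite lead_coef_Mmonic ?monicXsubC // -scalerAl; congr (_ *: _); exact: mulrC.
Qed.

Lemma splits_factor (k : fieldType) (p q : {poly k}) :
  q != 0 -> p %| q -> splits q -> splits p.
Proof.
move=> nzq pq [rs e].
have /dvdp_prod_XsubC[m em] : p %| \prod_(r <- rs) ('X - r%:P).
  by move: pq; rewrite {1}e dvdpZr ?lead_coef_eq0.
exists (mask m rs); have [c cn ec] := eqpf_eq _ _ em.
rewrite {1}ec; congr (_ *: _).
by rewrite ec lead_coefZ (monicP _) ?mulr1 // monic_prod_XsubC.
Qed.

Lemma splits_all (k : fieldType) (ps : seq {poly k}) :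
  exists (E : fieldType) (f : {rmorphism k -> E}),
    forall p, p \in ps -> p != 0 -> splits (map_poly f p).
Proof.
pose q := \prod_(p <- ps | p != 0) p.
have nzq : q != 0 by rewrite prodf_seq_neq0; apply/allP => p _; apply/implyP.
have [E [f s]] := split_extension q; exists E, f => p pps nzp.
apply: splits_factor s; first by rewrite map_poly_eq0.
rewrite dvdp_map; rewrite /q (big_rem p) //= nzp; exact: dvdp_mulIl.
Qed.

(* The ultraproduct of the splitting fields of all finite sets of polynomials. *)
Lemma all_split (k : fieldType) :
  exists (E : fieldType) (f : {rmorphism k -> E}),
    forall p, p != 0 -> splits (map_poly f p).
Proof.
pose I := seq {poly k}.
have ch (ps : I) : {E : fieldType & {f : {rmorphism k -> E} |
    forall p, p \in ps -> p != 0 -> splits (map_poly f p)}}.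
  by have /cid[E /cid h] := splits_all ps; exists E.
pose E ps := projT1 (ch ps).
pose f ps : {rmorphism k -> E ps} := sval (projT2 (ch ps)).
have fP ps := svalP (projT2 (ch ps)).
(* Two cones contain a third, so they generate a filter. In an ultrafilter containing it, any given
   polynomial belongs to almost all [ps]. *)
pose cone (ps : I) : set I := fun qs => {subset ps <= qs}.
have FF : Filter (filter_from setT cone).
  apply: filter_fromT_filter; first by exists [::].
  move=> ps qs; exists (ps ++ qs) => r h.
  by split=> p pin; apply: h; rewrite mem_cat pin ?orbT.
have PF : ProperFilter (filter_from setT cone).
  by apply: filter_from_proper => ps _; exists ps => p.
have [U [UU FU]] := ultraFilterLemma PF.
pose g (x : k) : uprod E UU := @upi _ _ E UU (fun ps => f ps x).
have gz : zmod_morphism g.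
  by move=> x y; rewrite /g upiN upiD; apply: upi_ext => ps; rewrite rmorphB.
have gm : monoid_morphism g.
  split=> [|x y]; first by rewrite -upi1; apply: upi_ext => ps; rewrite rmorph1.
  by rewrite /g upiM; apply: upi_ext => ps; rewrite rmorphM.
pose gr : {rmorphism k -> uprod E UU} :=
  HB.pack g (GRing.isZmodMorphism.Build _ _ _ gz) (GRing.isMonoidMorphism.Build _ _ _ gm).
exists (uprod E UU : fieldType), gr => p nzp.
have sp ps : {rs : seq (E ps) | p \in ps -> [/\ size rs = (size p).-1 &
    map_poly (f ps) p = f ps (lead_coef p) *: \prod_(r <- rs) ('X - r%:P)]}.
  apply: cid; case: (boolP (p \in ps)) => [pps|_]; last by exists [::].
  have [rs e] := fP ps p pps nzp; exists rs => _; split.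
    rewrite -(size_map_poly (f ps)) e size_scale ?size_prod_XsubC //.
    by rewrite lead_coef_eq0 map_poly_eq0.
  by rewrite e lead_coef_map.
pose n := (size p).-1.
pose r (j : nat) : prodfield_of E UU := fun ps => nth 0 (sval (sp ps)) j.
(* The candidate factorization has coefficients in the product, which maps both to the ultraproduct
   and to each splitting field. The identity is checked in the splitting fields of the sets that
   contain p. *)
pose P : {poly prodfield_of E UU} :=
  ((fun ps => f ps (lead_coef p)) : prodfield_of E UU) *: \prod_(j < n) ('X - (r j)%:P).
exists [seq @upi _ _ E UU (r j) | j <- index_iota 0 n].
have -> : \prod_(x <- [seq @upi _ _ E UU (r j) | j <- index_iota 0 n]) ('X - x%:P)
   = map_poly (@upi _ _ E UU : prodfield_of E UU -> _) (\prod_(j < n) ('X - (r j)%:P)).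
  rewrite rmorph_prod big_map big_mkord.
  by apply: eq_bigr => j _; rewrite rmorphB /= map_polyX map_polyC.
rewrite lead_coef_map -[gr _]/(@upi _ _ E UU (fun ps => f ps (lead_coef p))) -linearZ /= -/P.
apply/polyP=> i; have -> : (map_poly gr p)`_i = @upi _ _ E UU (fun ps => f ps p`_i).
  by rewrite coef_map.
rewrite coef_map.
apply/upiP; apply: FU; exists [:: p] => // ps /(_ p (mem_head _ _)) pps.
have [sz e] := svalP (sp ps) pps.
rewrite -(coef_map (f ps)) e.
transitivity (map_poly (pproj ps : prodfield_of E UU -> E ps) P)`_i; last by rewrite coef_map.
rewrite [map_poly _ P]map_polyZ rmorph_prod; apply: (congr1 (fun q : {poly E ps} => q`_i)); congr (_ *: _).
rewrite (big_nth 0) sz big_mkord; apply: eq_bigr => j _.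
by rewrite rmorphB /= map_polyX map_polyC.
Qed.

Section AlgebraicElements.
Variables (k E : fieldType) (f : {rmorphism k -> E}).

Definition algebraic_pred : {pred E} := fun x => `[< algebraicOver f x >].

Fact algebraic_divring : divring_closed algebraic_pred.
Proof.
split; first exact/asboolP/algebraic1.
- by move=> x y /asboolP hx /asboolP hy; apply/asboolP/algebraic_sub.
- by move=> x y /asboolP hx /asboolP hy; apply/asboolP/algebraic_div.
Qed.
HB.instance Definition _ := GRing.isDivringClosed.Build E algebraic_pred algebraic_divring.

Record algebraic_elt := AlgebraicElt { alg_val : E; _ : alg_val \in algebraic_pred }.
HB.instance Definition _ := [isSub for alg_val].
HB.instance Definition _ := [Choice of algebraic_elt by <:].
HB.instance Definition _ := [SubChoice_isSubComUnitRing of algebraic_elt by <:].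
HB.instance Definition _ := [SubComUnitRing_isSubIntegralDomain of algebraic_elt by <:].
HB.instance Definition _ := [SubIntegralDomain_isSubField of algebraic_elt by <:].

Lemma algebraic_id_pred a : f a \in algebraic_pred.
Proof. exact/asboolP/algebraic_id. Qed.

Definition alg_inj (a : k) : algebraic_elt := AlgebraicElt (algebraic_id_pred a).
Fact alg_inj_zmod : zmod_morphism alg_inj.
Proof. by move=> a b; apply: val_inj; rewrite rmorphB /= rmorphB. Qed.
Fact alg_inj_monoid : monoid_morphism alg_inj.
Proof. by split=> [|a b]; apply: val_inj; rewrite ?rmorph1 ?rmorphM /= ?rmorph1 ?rmorphM. Qed.
HB.instance Definition _ := GRing.isZmodMorphism.Build k algebraic_elt alg_inj alg_inj_zmod.
HB.instance Definition _ := GRing.isMonoidMorphism.Build k algebraic_elt alg_inj alg_inj_monoid.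

Lemma alg_inj_algebraic x : algebraicOver alg_inj x.
Proof.
case: x => x xP; have /asboolP[p nzp rp] := xP; exists p => //.
move: rp; rewrite /root => /eqP rp; apply/eqP/val_inj.
by rewrite -horner_map -map_poly_comp.
Qed.
End AlgebraicElements.

(** Although only polynomials over k are known to split in E, the elements of E algebraic over k
    form a closed field: a root of a polynomial over them is integral over k, so it is a root of a
    monic polynomial over k, all of whose roots are in E. *)
Theorem algebraic_closure (k : fieldType) :
  exists (O : fieldType) (f : {rmorphism k -> O}),
    alg_closed O /\ forall x, algebraicOver f x.
Proof.
have [E [f sp]] := all_split k.
exists (algebraic_elt f), (alg_inj f); split; last exact: alg_inj_algebraic.
move=> p; rewrite -(size_map_poly (val : algebraic_elt f -> E)) => szp.
have [E' [g [z rz]]] := root_extension szp.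
have : integralOver (g \o f) z.
  apply: (@integral_root _ _ (g \o f) _ z _ rz).
    by rewrite map_poly_eq0 -size_poly_gt0 (ltn_trans _ szp).
  apply/(integral_poly (g \o f)) => i; rewrite !coef_map /=.
  apply/(@integral_rmorph _ _ _ f g)/integral_algebraic; apply/asboolP.
  by case: (p`_i).
case=> q mq; have [rs] := sp q (monic_neq0 mq).
rewrite lead_coef_map (monicP mq) rmorph1 scale1r map_poly_comp => e.
rewrite e rmorph_prod /= (eq_bigr (fun r => 'X - (g r)%:P)); last first.
  by move=> r _; rewrite map_polyXsubC.
rewrite -(big_map g predT (fun r => 'X - r%:P)) root_prod_XsubC => /mapP[r rin zr].
have ra : r \in algebraic_pred f.
  apply/asboolP; exists q; first exact: monic_neq0.
  by rewrite e root_prod_XsubC.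
move: rz; rewrite zr fmorph_root => /eqP rz.
by exists (AlgebraicElt ra); apply/eqP/val_inj; rewrite -horner_map /=.
Qed.

(** * The Nullstellensatz *)

Section MkRmorph.
Variables (R S : pzRingType) (f : R -> S).
Hypothesis hf : is_rmorph f.
Fact is_rmorph_zmod : zmod_morphism f.
Proof.
case: hf => [f1 fD fM] a b.
have f0 : f 0 = 0 by apply: (addrI (f 0)); rewrite -fD !addr0.
have fN : f (- b) = - f b by apply: (addrI (f b)); rewrite -fD !subrr f0.
by rewrite fD fN.
Qed.
Fact is_rmorph_monoid : monoid_morphism f.
Proof. by case: hf. Qed.
Definition rmor : {rmorphism R -> S} :=
  HB.pack f (GRing.isZmodMorphism.Build _ _ _ is_rmorph_zmod)
            (GRing.isMonoidMorphism.Build _ _ _ is_rmorph_monoid).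
End MkRmorph.

Section PlaceStep.
Variables (A : comNzRingType) (K O : fieldType) (kappa : {rmorphism A -> K}).
Hypothesis clO : alg_closed O.
Variable x : K.
Local Notation "p ^k" := (map_poly kappa p) (at level 2, format "p ^k").

(** A lift whose degree does not drop under [kappa], so that pseudo-division by it in A[X] is also a
    division in K[X]. *)
Lemma trunc_lift (q : {poly A}) : exists2 q', q'^k = q^k & size q' = size q^k.
Proof.
pose q' := \poly_(i < size q^k) q`_i.
have e : q'^k = q^k.
  apply/polyP=> i; rewrite coef_map coef_poly.
  case: ltnP => [_|h]; first by rewrite coef_map.
  by rewrite [RHS]nth_default //= rmorph0.
exists q' => //; apply/eqP; rewrite eqn_leq; apply/andP; split; first exact: size_poly.
rewrite -e; exact: size_poly.
Qed.

(** One step in the extension of maps to an algebraically closed field. If no polynomial over A with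
    nonzero image vanishes at x, then [a] is the coefficient of [b] that becomes leading over K, and
    y is any point off the roots of phi b. Otherwise y is a root of phi p, for p of least degree
    vanishing at x, and [a] is the leading coefficient of p times a constant c such that u b - c
    vanishes at x, hence at y; this keeps b nonzero at y. *)
Lemma place_step (b : {poly A}) : b^k.[x] != 0 ->
  exists2 a, kappa a != 0 & forall phi : {rmorphism A -> O},
    (forall c, kappa c = 0 -> phi c = 0) -> phi a != 0 ->
    exists2 y, (forall q, q^k.[x] = 0 -> (map_poly phi q).[y] = 0) &
      (map_poly phi b).[y] != 0.
Proof.
move=> bx.
pose good (p : {poly A}) := p^k.[x] = 0 /\ p^k != 0.
case: (EM (exists p, good p)) => [[p0 gp0]|ngood]; last first.
  have nzb : b^k != 0 by apply: contraNneq bx => ->; rewrite horner0.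
  exists b`_(size b^k).-1; first by rewrite -coef_map -lead_coefE lead_coef_eq0.
  move=> phi kerphi nza.
  have nzphi : map_poly phi b != 0.
    by apply: contraNneq nza => e; rewrite -coef_map e coef0.
  have [y ny] : exists y, (map_poly phi b).[y] != 0.
    case: (ltnP 1 (size (map_poly phi b))) => sz.
      (* At a root of phi b - 1 the value of phi b is 1. *)
      have [|y] := clO (p := map_poly phi b - 1).
        by rewrite size_polyDl // size_polyN size_poly1.
      rewrite /root hornerD hornerN hornerC subr_eq0 => /eqP e.
      by exists y; rewrite e oner_eq0.
    exists 0; rewrite (size1_polyC sz) hornerC.
    by apply: contraNneq nzphi => e; rewrite (size1_polyC sz) e.
  exists y => // q qx; have q0 : q^k = 0.
    by apply/eqP/negPn/negP => nzq; case: ngood; exists q.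
  suff -> : map_poly phi q = 0 by rewrite horner0.
  apply/polyP=> i; rewrite coef_map coef0; apply: kerphi.
  by rewrite -coef_map q0 coef0.
have ex : exists n, `[< exists p, good p /\ size p^k = n >].
  by exists (size p0^k); apply/asboolP; exists p0.
case: (ex_minnP ex) => n /asboolP[p1 [gp1 sp1]] nmin {ex p0 gp0}.
have pmin q : q^k.[x] = 0 -> (size q^k < n)%N -> q^k = 0.
  move=> qx; apply: contraTeq => nzq; rewrite -leqNgt; apply: nmin.
  by apply/asboolP; exists q.
have [p ep sp] := trunc_lift p1; rewrite sp1 in sp.
have [px nzp] : good p by rewrite /good ep.
have spk : size p^k = n by rewrite ep.
have nzl : kappa (lead_coef p) != 0.
  rewrite lead_coefE -coef_map sp -spk -lead_coefE lead_coef_eq0 //.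
have n1 : (1 < n)%N.
  rewrite ltnNge; apply/negP => n1; move: px nzp.
  by rewrite (size1_polyC (p := p^k)) ?spk // hornerC => ->; rewrite eqxx.
have nzp' : p != 0 by rewrite -size_poly_gt0 sp (ltn_trans _ n1).
have smap q : (size q^k <= size q)%N by apply: size_poly.
(* Pseudo-division by an element of least degree in the ideal of [b] and [p]. *)
have [u [c [nzc euc]]] : exists u c, kappa c != 0 /\ u^k.[x] * b^k.[x] = kappa c.
  pose inI (r : {poly A}) := r^k != 0 /\ exists u : {poly A}, r^k.[x] = u^k.[x] * b^k.[x].
  pose P m := `[< exists r, inI r /\ size r^k = m >].
  have small (r : {poly A}) : r^k.[x] != 0 -> r^k != 0.
    by apply: contraNneq => ->; rewrite horner0.
  pose r0 := Pdiv.Ring.rmodp b p.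
  have er0 : r0^k.[x] = kappa (lead_coef p) ^+ (Pdiv.Ring.rscalp b p) * b^k.[x].
    have := congr1 (fun q => q^k.[x]) (Pdiv.ComRing.rdivp_eq p b).
    rewrite map_polyZ hornerZ rmorphXn /= => ->.
    by rewrite rmorphD rmorphM /= hornerD hornerM px mulr0 add0r.
  have sr0 : (size r0 < n)%N by rewrite -sp Pdiv.CommonRing.ltn_rmodp.
  have ir0 : inI r0.
    split; first by apply: small; rewrite er0 mulf_neq0 ?expf_neq0.
    exists (lead_coef p ^+ (Pdiv.Ring.rscalp b p))%:P.
    by rewrite er0 map_polyC hornerC /= rmorphXn.
  have exP : exists m, P m by exists (size r0^k); apply/asboolP; exists r0.
  case: (ex_minnP exP) => m /asboolP[r1 [[nzr1 [u eu]] sr1]] mmin.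
  have mn : (m < n)%N.
    apply: leq_ltn_trans (leq_ltn_trans (smap r0) sr0); apply: mmin.
    by apply/asboolP; exists r0.
  have [r er sr] := trunc_lift r1; rewrite sr1 in sr.
  have srk : size r^k = m by rewrite er.
  have nzr : r^k != 0 by rewrite er.
  have rx : r^k.[x] != 0.
    by apply: contraNneq nzr => /pmin -> //; rewrite srk.
  have nzlr : kappa (lead_coef r) != 0.
    by rewrite lead_coefE -coef_map sr -srk -lead_coefE lead_coef_eq0.
  have nzr' : r != 0 by apply: contraNneq nzr => ->; rewrite rmorph0.
  case: (leqP m 1) => m1.
    exists u, r`_0; rewrite -eu -er.
    have := nzr; rewrite {1}[r^k]size1_polyC ?srk // polyC_eq0 coef_map => h.
    by split=> //; rewrite [r^k]size1_polyC ?srk // hornerC coef_map.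
  pose s := Pdiv.Ring.rdivp p r; pose r' := Pdiv.Ring.rmodp p r.
  pose lr := kappa (lead_coef r) ^+ (Pdiv.Ring.rscalp p r).
  have ediv : lr *: p^k = s^k * r^k + r'^k.
    have := congr1 (map_poly kappa) (Pdiv.ComRing.rdivp_eq r p).
    by rewrite map_polyZ rmorphD rmorphM /= rmorphXn.
  have er' : r'^k.[x] = (- (s * u))^k.[x] * b^k.[x].
    have := congr1 (fun q => q.[x]) ediv; rewrite hornerZ px mulr0 hornerD hornerM.
    move/esym/eqP; rewrite addrC addr_eq0 => /eqP ->.
    by rewrite rmorphN rmorphM hornerN hornerM er eu mulNr mulrA.
  case: (eqVneq r'^k 0) => [r'0|nzr'k]; last first.
    have : (m <= size r'^k)%N.
      by apply: mmin; apply/asboolP; exists r'; split=> //; split=> //; exists (- (s * u)).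
    rewrite leqNgt (leq_ltn_trans (smap _)) // -sr.
    by rewrite Pdiv.CommonRing.ltn_rmodp.
  rewrite r'0 addr0 in ediv.
  have sx : s^k.[x] = 0.
    have := congr1 (fun q => q.[x]) ediv; rewrite hornerZ px mulr0 hornerM.
    by move/esym/eqP; rewrite mulf_eq0 (negPf rx) orbF => /eqP.
  have nzlrp : lr *: p^k != 0 by rewrite scaler_eq0 negb_or nzp expf_neq0.
  have nzs : s^k != 0 by apply: contraNneq nzlrp => s0; rewrite ediv s0 mul0r.
  have : s^k = 0.
    apply: pmin => //; have := congr1 (fun q : {poly K} => size q) ediv.
    rewrite size_scale ?expf_neq0 // spk size_mul // srk => ->.
    by case: (m) m1 => [|[|m']] // _; rewrite !addnS /= ltnS leq_addr.
  by move/eqP: nzs.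
exists (lead_coef p * c); first by rewrite rmorphM mulf_neq0.
move=> phi kerphi; rewrite rmorphM mulf_eq0 negb_or => /andP[nzpl nzpc].
have sphi : size (map_poly phi p) = n by rewrite size_map_poly_id0.
have [|y /eqP ry] := clO (p := map_poly phi p); first by rewrite sphi.
have kill q : q^k.[x] = 0 -> (map_poly phi q).[y] = 0.
  move=> qx; pose r := Pdiv.Ring.rmodp q p.
  have ediv := Pdiv.ComRing.rdivp_eq p q.
  have r0 : r^k = 0.
    apply: pmin; last first.
      by apply: leq_ltn_trans (smap _) _; rewrite -sp Pdiv.CommonRing.ltn_rmodp.
    have := congr1 (fun q => q^k.[x]) ediv.
    rewrite map_polyZ hornerZ qx mulr0 rmorphD rmorphM /= hornerD hornerM px mulr0.
    by rewrite add0r.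
  have rphi0 : map_poly phi r = 0.
    apply/polyP=> i; rewrite coef_map coef0; apply: kerphi.
    by rewrite -coef_map r0 coef0.
  have := congr1 (fun q => (map_poly phi q).[y]) ediv.
  rewrite map_polyZ hornerZ rmorphD rmorphM /= rphi0 addr0 hornerM ry mulr0.
  by move/eqP; rewrite mulf_eq0 rmorphXn expf_eq0 (negPf nzpl) andbF => /eqP.
exists y => //.
have /kill : (u * b - c%:P)^k.[x] = 0.
  by rewrite rmorphB rmorphM /= map_polyC hornerD hornerN hornerM hornerC euc subrr.
rewrite rmorphB rmorphM /= map_polyC hornerD hornerN hornerM hornerC.
move/eqP; rewrite subr_eq0 => /eqP e.
by apply: contraNneq nzpc => b0; rewrite -e b0 mulr0.
Qed.
End PlaceStep.

Section Tower.

(** Each variable is adjoined to the base ring, so that the induction in [tower_extend] runs over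
    all base rings and ends with a single condition on A. *)
Fixpoint tower (A : comNzRingType) (n : nat) : comNzRingType :=
  if n is m.+1 then tower {poly A} m else A.

Fixpoint tower_eval (A K : comNzRingType) (f : {rmorphism A -> K}) (n : nat)
    (xs : nat -> K) : {rmorphism tower A n -> K} :=
  match n return {rmorphism tower A n -> K} with
  | 0 => f
  | m.+1 => tower_eval (horner_eval (xs 0%N) \o map_poly f) m (fun i => xs i.+1)
  end.

Fixpoint tower_const (A : comNzRingType) (n : nat) : {rmorphism A -> tower A n} :=
  match n return {rmorphism A -> tower A n} with
  | 0 => idfun
  | m.+1 => tower_const {poly A} m \o polyC
  end.

Fixpoint tower_var (A : comNzRingType) (n i : nat) : tower A n :=
  match n return tower A n with
  | 0 => 0
  | m.+1 => if i is j.+1 then tower_var {poly A} m j else tower_const {poly A} m 'X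
  end.

Lemma tower_eval_const (A K : comNzRingType) (f : {rmorphism A -> K}) n xs a :
  tower_eval f n xs (tower_const A n a) = f a.
Proof.
elim: n => [|n IH] //= in A f xs a *; rewrite IH /= /horner_eval map_polyC.
exact: hornerC.
Qed.

Lemma tower_eval_var (A K : comNzRingType) (f : {rmorphism A -> K}) n xs i :
  (i < n)%N -> tower_eval f n xs (tower_var A n i) = xs i.
Proof.
elim: n => [|n IH] //= in A f xs i *.
case: i => [_|i]; last by rewrite ltnS => /IH ->.
by rewrite tower_eval_const /= /horner_eval map_polyX hornerX.
Qed.

Lemma tower_extend (K O : fieldType) (clO : alg_closed O) n (A : comNzRingType)
    (kappa : {rmorphism A -> K}) (xs : nat -> K) (b : tower A n) :
  tower_eval kappa n xs b != 0 ->
  exists2 a, kappa a != 0 & forall phi : {rmorphism A -> O},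
    (forall c, kappa c = 0 -> phi c = 0) -> phi a != 0 ->
    exists2 ys, (forall q, tower_eval kappa n xs q = 0 -> tower_eval phi n ys q = 0) &
      tower_eval phi n ys b != 0.
Proof.
elim: n => [|n IH] /= in A kappa xs b * => nzb.
  by exists b => // phi kerphi nz; exists (fun=> 0).
have [a' nza' ext] := IH _ _ _ _ nzb.
have [a nza ext'] := place_step clO nza'; exists a => // phi kerphi nzphi.
have [y kery nzy] := ext' phi kerphi nzphi.
have [//|//|ys keryys nzys] := ext (horner_eval y \o map_poly phi).
by exists (fun i => if i is j.+1 then ys j else y).
Qed.
End Tower.

Lemma rmorph_mmap (n : nat) (R S T : comNzRingType) (h : {rmorphism S -> T})
    (f : {rmorphism R -> S}) (x : 'I_n -> S) (p : {mpoly R[n]}) :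
  h (mmap f x p) = mmap (h \o f) (h \o x) p.
Proof.
rewrite /mmap rmorph_sum; apply: eq_bigr => m _; rewrite rmorphM /mmap1 rmorph_prod.
by congr (_ * _); apply: eq_bigr => i _; rewrite rmorphXn.
Qed.

Lemma eq_mmap (n : nat) (R S : nzRingType) (f g : R -> S) (x y : 'I_n -> S) p :
  f =1 g -> x =1 y -> mmap f x p = mmap g y p.
Proof.
move=> fg xy; rewrite /mmap; apply: eq_bigr => m _; rewrite fg /mmap1.
by congr (_ * _); apply: eq_bigr => i _; rewrite xy.
Qed.

(** This is [tower_extend] for the polynomial 1. As M is a field, [g] and [phi] are injective, so
    the condition that the extension imposes on [phi] holds. *)
Theorem nullstellensatz (M K O : fieldType) (g : {rmorphism M -> K})
    (phi : {rmorphism M -> O}) n (xs : 'I_n -> K) : alg_closed O ->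
  exists ys : 'I_n -> O,
    forall p : {mpoly M[n]}, mmap g xs p = 0 -> mmap phi ys p = 0.
Proof.
move=> clO; pose xs' i := if insub i is Some j then xs j else 0.
have [|a nza /(_ phi) ext] := @tower_extend K O clO n M g xs' 1.
  by rewrite rmorph1 oner_eq0.
have kerg c : g c = 0 -> phi c = 0.
  by move/eqP; rewrite fmorph_eq0 => /eqP ->; rewrite rmorph0.
have [|ys kerys _] := ext kerg; first by move: nza; rewrite !fmorph_eq0.
pose G : {mpoly M[n]} -> tower M n :=
  mmap (tower_const M n) (fun i : 'I_n => tower_var M n i).
have GE (L : fieldType) (f : {rmorphism M -> L}) zs p :
    tower_eval f n zs (G p) = mmap f (fun i : 'I_n => zs i) p.
  rewrite rmorph_mmap; apply: eq_mmap => [a'|i] /=.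
    by rewrite tower_eval_const.
  by rewrite tower_eval_var.
exists (fun i => ys i) => p e; rewrite -(GE O phi ys p); apply: kerys; rewrite GE -{}e.
by apply: eq_mmap => // i; rewrite /xs' valK.
Qed.

Lemma is_rmorph_comp (R S T : pzRingType) (f : R -> S) (g : S -> T) :
  is_rmorph f -> is_rmorph g -> is_rmorph (g \o f).
Proof.
by case=> [f1 fD fM] [g1 gD gM]; split=> [|a b|a b] /=; rewrite ?f1 ?fD ?fM ?gD ?gM ?g1.
Qed.

(** K and O are unrelated extensions of M. The images in K of the generators of S satisfy certain
    relations over M, and the Nullstellensatz solves the same relations in O. *)
Lemma fingen_point (R S : comNzRingType) (M K O : fieldType) (f : R -> S)
    (g : R -> M) (h : S -> K) (e : M -> K) (phi : M -> O) n (x : 'I_n -> S) :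
  (forall s, exists p : {mpoly R[n]}, mmap f x p = s) -> is_rmorph f -> is_rmorph g -> is_rmorph h -> is_rmorph e ->
  is_rmorph phi -> alg_closed O -> (forall a, h (f a) = e (g a)) ->
  exists h' : S -> O, is_rmorph h' /\ forall a, h' (f a) = phi (g a).
Proof.
move=> gen hf hg hh he hphi clO hfeg.
have [ys kerys] := nullstellensatz (rmor he) (rmor hphi) (h \o x) clO.
pose gphi := rmor (is_rmorph_comp hg hphi).
have ker p : mmap f x p = 0 -> mmap gphi ys p = 0.
  move=> p0; pose q : {mpoly M[n]} := mmap ((@mpolyC n M) \o rmor hg) (fun i => 'X_i) p.
  have qE (L : fieldType) (k : {rmorphism M -> L}) zs :
      mmap k zs q = mmap (k \o rmor hg) zs p.
    rewrite /q rmorph_mmap; apply: eq_mmap => [a|i] /=.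
      by rewrite mmapC.
    by rewrite mmapX mmap1U.
  have : mmap (rmor he) (h \o x) q = 0.
    rewrite qE; transitivity (rmor hh (mmap (rmor hf) x p)); last first.
      by rewrite -[mmap _ _ p]/(mmap f x p) p0 rmorph0.
    rewrite rmorph_mmap; apply: eq_mmap => // a /=.
    by rewrite -[RHS]/(h (f a)) hfeg.
  by move/kerys; rewrite qE.
pose P s := sval (cid (gen s)).
have PE s : mmap f x (P s) = s := svalP (cid (gen s)).
have wd p s : mmap f x p = s -> mmap gphi ys (P s) = mmap gphi ys p.
  move=> e'; apply/eqP; rewrite -subr_eq0 -rmorphB; apply/eqP/ker.
  by rewrite -[f]/(rmor hf : _ -> _) rmorphB /= PE e' subrr.
exists (fun s => mmap gphi ys (P s)); split; last first.
  move=> a; rewrite (wd (a%:MP)); first by rewrite mmapC.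
  by rewrite -[f]/(rmor hf : _ -> _) mmapC.
split=> [|s t|s t].
- by rewrite (wd 1) ?rmorph1 // -[f]/(rmor hf : _ -> _) rmorph1.
- by rewrite (wd (P s + P t)) ?rmorphD // -[f]/(rmor hf : _ -> _) rmorphD /= !PE.
- by rewrite (wd (P s * P t)) ?rmorphM // -[f]/(rmor hf : _ -> _) rmorphM /= !PE.
Qed.

Lemma etcover_point (R : comNzRingType) (U : etcover R) (M O : fieldType)
    (g : R -> M) (phi : M -> O) :
  is_rmorph g -> is_rmorph phi -> alg_closed O ->
  exists i (h : ec_S i -> O), is_rmorph h /\ forall a, h (@ec_f R U i a) = phi (g a).
Proof.
move=> hg hphi clO; have [i [K [e [h [he hh hfe]]]]] := ec_surj U hg.
have [hf fp _] := ec_etale i.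
by case: fp => n [x [gen _]]; exists i; apply: fingen_point gen hf hg hh he hphi clO hfe.
Qed.

(** * Finite Galois subextensions of an algebraic closure *)

(** A finite Galois extension of k inside O, reduced to the properties used below; [ge_indep] is the
    independence of characters. By [ge_actM] the group acts on the right. *)
Record galext (k O : fieldType) (iota : {rmorphism k -> O}) := GalExt {
  ge_L :> fieldType;
  ge_in : {rmorphism k -> ge_L};
  ge_out : {rmorphism ge_L -> O};
  ge_G : finGroupType;
  ge_act : ge_G -> {rmorphism ge_L -> ge_L};
  ge_outin : forall a, ge_out (ge_in a) = iota a;
  ge_actM : forall x y a, ge_act (x * y)%g a = ge_act y (ge_act x a);
  ge_act_in : forall x a, ge_act x (ge_in a) = ge_in a;
  ge_fixed : forall a, (forall x, ge_act x a = a) -> exists b, a = ge_in b;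
  ge_all : forall f : ge_L -> ge_L, is_rmorph f ->
    (forall a, f (ge_in a) = ge_in a) -> exists x, f =1 ge_act x;
  ge_indep : forall (c : ge_G -> ge_L) x, c x != 0 ->
    exists a, \sum_y c y * ge_act y a != 0;
  ge_fin : exists n (b : 'I_n -> ge_L), forall x, exists c : 'I_n -> k,
    x = \sum_i ge_in (c i) * b i }.

Arguments ge_in {k O iota} g.
Arguments ge_out {k O iota} g.
Arguments ge_act {k O iota} g x.

Section GaloisCover.
Variables (k O : fieldType) (iota : {rmorphism k -> O}).
Hypothesis clO : alg_closed O.
Hypothesis algO : forall x, algebraicOver iota x.
Hypothesis pchark : [pchar k] =i pred0.

(** The first clause says that z lies in every additive group containing [rs]. It shows later that z
    belongs to the field generated by the roots, which makes that field the whole of k(z). *)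
Lemma primitive_element (rs : seq O) : exists z,
  (forall P : O -> Prop, P 0 -> (forall x y, P x -> P y -> P (x - y)) ->
     (forall r, r \in rs -> P r) -> P z) /\
  forall r, r \in rs -> exists q, (map_poly iota q).[z] = r.
Proof.
elim: rs => [|r rs [z [zP zgen]]]; first by exists 0; split.
have [p nzp pz] := algO z; have [q nzq qr] := algO r.
have [n /= [[q1 e1] [q2 e2]]] := pchar0_PET nzp pz nzq qr pchark.
exists (r *+ n - z); split=> [P P0 PB Prs|x].
  apply: (PB); last by apply: zP => // x xin; apply: Prs; rewrite inE xin orbT.
  have PD x y : P x -> P y -> P (x + y).
    by move=> Px Py; rewrite -[y]opprK; apply: (PB) => //; rewrite -sub0r; apply: (PB).
  elim: n {q1 e1 q2 e2} => [|n IH]; first by rewrite mulr0n.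
  by rewrite mulrS; apply: PD => //; apply: Prs; rewrite mem_head.
rewrite inE => /predU1P[->|/zgen[q3 <-]]; first by exists q2.
by exists (q3 \Po q1); rewrite map_comp_poly horner_comp e1.
Qed.

Lemma closed_splits (p : {poly O}) : splits p.
Proof.
have [n] := ubnP (size p); elim: n => // n IH in p *; rewrite ltnS => spn.
case: (ltnP 1 (size p)) => sp; last first.
  exists [::]; rewrite big_nil alg_polyC.
  by rewrite {1}(size1_polyC sp) lead_coefE; case: (size p) sp => [|[]].
have [x /factor_theorem[q eq]] := clO sp.
have nzq : q != 0.
  by apply: contraTneq sp => q0; rewrite eq q0 mul0r size_poly0.
have sq : (size q < n)%N.
  by move: spn; rewrite eq size_Mmonic ?monicXsubC // size_XsubC addn2.
have [rs ers] := IH _ sq; exists (x :: rs); rewrite big_cons {1}eq [in LHS]ers.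
by rewrite eq lead_coef_Mmonic ?monicXsubC // -scalerAl mulrC.
Qed.

Lemma splitting_subfield (Z : seq O) :
  exists (L : splittingFieldType k) (out : {rmorphism L -> O}),
    (forall a, out a%:A = iota a) /\ forall z, z \in Z -> exists y, out y = z.
Proof.
have [p nzp pZ] : exists2 p : {poly k}, p != 0 & forall z, z \in Z -> root (map_poly iota p) z.
  elim: Z => [|z Z [p nzp pZ]]; first by exists 1; rewrite ?oner_eq0.
  have [q nzq qz] := algO z; exists (q * p); first by rewrite mulf_neq0.
  move=> x; rewrite rmorphM rootM inE => /predU1P[->|/pZ ->]; last by rewrite orbT.
  by rewrite qz.
have [rs ers] := closed_splits (map_poly iota p).
have [z [zP zgen]] := primitive_element rs.
have exr : exists n, `[< exists r : {poly k}, [/\ r != 0, root (map_poly iota r) z & size r = n] >].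
  by have [r nzr rz] := algO z; exists (size r); apply/asboolP; exists r.
case: (ex_minnP exr) => n /asboolP[r [nzr rz szr]] rmin.
have irr : irreducible_poly r.
  apply/(subfx_irreducibleP rz nzr) => q qz nzq; rewrite szr; apply: rmin.
  by apply/asboolP; exists q.
pose L0 := SubFieldExtType rz irr.
pose out : {rmorphism L0 -> O} := @subfx_inj _ _ iota z r.
have outA (a : k) : out a%:A = iota a by apply: subfx_inj_base.
pose z0 : L0 := subfx_root iota z r.
have outz : out z0 = z by apply: subfx_inj_root.
have outH q : out (map_poly (in_alg L0) q).[z0] = (map_poly iota q).[z].
  rewrite -horner_map outz -map_poly_comp; congr _.[_]; exact: eq_map_poly.
have genz0 (x : L0) : exists q, x = (map_poly (in_alg L0) q).[z0].
  by have [q ->] := subfxEroot rz nzr x; exists q.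
have inrs x : x \in rs -> exists y : L0, out y = x.
  by move=> /zgen[q <-]; exists (map_poly (in_alg L0) q).[z0].
have [ss ess] : exists ss : seq L0, map out ss = rs.
  elim: (rs) inrs => [|x s IH] h; first by exists [::].
  have [y ey] := h x (mem_head _ _); have [|ss ess] := IH.
    by move=> x' x'in; apply: h; rewrite inE x'in orbT.
  by exists (y :: ss); rewrite /= ey ess.
have split0 : splitting_field_axiom L0.
  exists (map_poly (in_alg L0) p).
    by apply/polyOverP => i; rewrite coef_map memvZ ?mem1v.
  exists ss.
    apply/eqpf_eq; exists (lead_coef (map_poly (in_alg L0) p)).
      by rewrite lead_coef_eq0 map_poly_eq0.
    apply: (map_poly_inj out); rewrite -map_poly_comp (eq_map_poly outA) ers.
    rewrite map_polyZ rmorph_prod -ess big_map /= !lead_coef_map outA; congr (_ *: _).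
    by apply: eq_bigr => x _; rewrite map_polyXsubC.
  apply/vspaceP => x; rewrite memvf; have [q ->] := genz0 x.
  have z0in : z0 \in <<1 & ss>>%VS.
    suff [y yin ey] : exists2 y, y \in <<1 & ss>>%VS & out y = z.
      by rewrite -outz in ey; rewrite -(fmorph_inj out ey).
    apply: (zP (fun w => exists2 y, y \in <<1 & ss>>%VS & out y = w)); first by exists 0; rewrite ?mem0v ?rmorph0.
      move=> _ _ [y1 y1in <-] [y2 y2in <-]; exists (y1 - y2); first by rewrite rpredB.
      by rewrite rmorphB.
    move=> x' ; rewrite -ess => /mapP[y yin ->]; exists y => //.
    exact: seqv_sub_adjoin.
  elim/poly_ind: q => [|q c IH]; first by rewrite rmorph0 horner0 mem0v.
  rewrite rmorphD rmorphM /= map_polyX map_polyC hornerMXaddC.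
  apply: memvD; last by apply: memvZ; apply: mem1v.
  by apply: memvM.
pose L : splittingFieldType k :=
  HB.pack L0 (FieldExt_isSplittingField.Build k L0 split0).
exists L, out; split=> // x /pZ; rewrite ers rootE hornerZ mulf_eq0.
rewrite lead_coef_eq0 map_poly_eq0 (negPf nzp) /= -/(root _ x) root_prod_XsubC.
exact: inrs.
Qed.
End GaloisCover.

Section GaloisCover2.
Variables (k O : fieldType) (iota : {rmorphism k -> O}).
Hypothesis clO : alg_closed O.
Hypothesis algO : forall x, algebraicOver iota x.
Hypothesis pchark : [pchar k] =i pred0.

Section FromSplitting.
Variables (L : splittingFieldType k) (out : {rmorphism L -> O}).
Hypothesis outA : forall a, out a%:A = iota a.

Let act (x : gal_of {:L}) : {rmorphism L -> L} := GRing.RMorphism.clone _ _ (x : L -> L) _.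

Let galL : galois 1 {:L}.
Proof.
rewrite /galois sub1v normalFieldf andbT; apply/separableP => a _.
apply: pcharf0_separable => p; rewrite -pchark.
by rewrite !inE; case: (prime p) => //=; rewrite -(rmorph_nat (in_alg L)) fmorph_eq0.
Qed.

Lemma splitting_galext : exists E : galext iota,
  forall z, (exists y, out y = z) -> exists y, ge_out E y = z.
Proof.
have actM x y a : act (x * y)%g a = act y (act x a) by apply: galM; apply: memvf.
have act_in x a : act x (in_alg L a) = in_alg L a.
  by rewrite /= linearZ /= (rmorph1 (act x)).
have fixed (a : L) : (forall x, act x a = a) -> exists b, a = in_alg L b.
  move=> fa; have : a \in fixedField 'Gal({:L} / 1)%g.
    by apply/fixedFieldP; rewrite ?memvf // => x _; apply: fa.
  by rewrite (galois_fixedField galL) => /vlineP[b ->]; exists b.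
have all (f : L -> L) : is_rmorph f -> (forall a, f (in_alg L a) = in_alg L a) ->
    exists x, f =1 act x.
  move=> hf fid.
  have flin : linear f.
    move=> a u v; case: hf => [f1 fD fM]; rewrite fD; congr (_ + _).
    by rewrite -mulr_algl fM fid mulr_algl.
  pose fl : {linear L -> L} := HB.pack f (GRing.isLinear.Build _ _ _ _ f flin).
  have hom : kHom 1 {:L} (linfun fl).
    apply/kHomP; split=> [x y _ _|x /vlineP[a ->]]; rewrite !lfunE /=.
      by case: hf => _ _ ->.
    exact: fid.
  have [g eg] := kHom_to_AEnd hom; exists (gal {:L} g) => a.
  rewrite -[RHS]/(gal {:L} g a) galK ?subvf ?memvf //.
  by rewrite -eg ?memvf // lfunE.
have indep (c : gal_of {:L} -> L) x : c x != 0 ->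
    exists a, \sum_y c y * act y a != 0.
  by move=> nz; have [a _ na] := @gal_independent_contra _ _ _ predT c x isT nz; exists a.
have fin : exists n (b : 'I_n -> L), forall x, exists c : 'I_n -> k,
    x = \sum_i in_alg L (c i) * b i.
  exists (\dim {:L}), (fun i => (vbasis {:L})`_i) => x.
  exists (fun i => coord (vbasis {:L}) i x); rewrite {1}(coord_vbasis (memvf x)).
  by apply: eq_bigr => i _; rewrite mulr_algl.
by exists (@GalExt _ _ iota L (in_alg L) out (gal_of {:L}) act outA actM act_in fixed all indep fin).
Qed.
End FromSplitting.

Lemma galext_cover (Z : seq O) : exists E : galext iota,
  forall z, z \in Z -> exists y, ge_out E y = z.
Proof.
have [L [out [outA outZ]]] := splitting_subfield clO algO pchark Z.
by have [E EP] := splitting_galext outA; exists E => z /outZ /EP.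
Qed.
End GaloisCover2.

Section GaloisMor.
Variables (k O : fieldType) (iota : {rmorphism k -> O}).
Implicit Types E : galext iota.

Record galmor E E' := GalMor {
  gm_map :> {rmorphism E -> E'};
  gm_out : forall a, ge_out E' (gm_map a) = ge_out E a;
  gm_res : ge_G E' -> ge_G E;
  gm_act : forall x a, ge_act E' x (gm_map a) = gm_map (ge_act E (gm_res x) a) }.

Lemma gm_in E E' (j : galmor E E') a : j (ge_in E a) = ge_in E' a.
Proof. by apply: (fmorph_inj (ge_out E')); rewrite gm_out !ge_outin. Qed.

Lemma ge_orbit_poly E (a : E) :
  exists p : {poly k}, map_poly (ge_in E) p = \prod_(x : ge_G E) ('X - (ge_act E x a)%:P).
Proof.
set q := \prod_x _.
have fixq y : map_poly (ge_act E y) q = q.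
  rewrite rmorph_prod /q [RHS](reindex_inj (mulIg y)) /=; apply: eq_bigr => x _.
  by rewrite ge_actM map_polyXsubC.
have ch i : {b | q`_i = ge_in E b}.
  by apply: cid; apply: ge_fixed => y; rewrite -coef_map fixq.
exists (\poly_(i < size q) sval (ch i)); apply/polyP => i.
rewrite coef_map coef_poly; case: ltnP => [_|h]; first by rewrite [RHS](svalP (ch i)).
by rewrite /= rmorph0 nth_default.
Qed.

Lemma ge_act1 E a : ge_act E 1%g a = a.
Proof. by apply: (fmorph_inj (ge_act E 1%g)); rewrite -ge_actM mulg1. Qed.

(** The Galois group of E' preserves the image of E, because it permutes the roots of the orbit
    polynomials, and these all lie in E. The induced maps of E come from its own group by
    [ge_all]. *)
Lemma galmor_exists E E' : (forall x, exists y, ge_out E' y = ge_out E x) ->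
  inhabited (galmor E E').
Proof.
move=> sub; pose j x := sval (cid (sub x)).
have jE x : ge_out E' (j x) = ge_out E x := svalP (cid (sub x)).
have hj : is_rmorph j.
  split=> [|x y|x y]; apply: (fmorph_inj (ge_out E')).
  - by rewrite jE !rmorph1.
  - by rewrite rmorphD /= !jE rmorphD.
  - by rewrite rmorphM /= !jE rmorphM.
pose jr := rmor hj.
have jin a : jr (ge_in E a) = ge_in E' a.
  by apply: (fmorph_inj (ge_out E')); rewrite jE !ge_outin.
have stab x a : exists b, ge_act E' x (jr a) = jr b.
  have [p ep] := ge_orbit_poly a.
  have : root (map_poly (ge_in E') p) (ge_act E' x (jr a)).
    have -> : map_poly (ge_in E') p = map_poly (ge_act E' x) (map_poly (ge_in E') p).
      by rewrite -map_poly_comp; apply: eq_map_poly => c /=; rewrite ge_act_in.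
    rewrite fmorph_root.
    have -> : map_poly (ge_in E') p = map_poly jr (map_poly (ge_in E) p).
      by rewrite -map_poly_comp; apply: eq_map_poly => c; rewrite -jin.
    rewrite fmorph_root ep /root horner_prod (bigD1 1%g) //=.
    by rewrite hornerXsubC ge_act1 subrr mul0r.
  have -> : map_poly (ge_in E') p = map_poly jr (map_poly (ge_in E) p).
    by rewrite -map_poly_comp; apply: eq_map_poly => c; rewrite -jin.
  rewrite ep rmorph_prod rootE horner_prod prodf_seq_eq0 => /hasP[y _ /=].
  by rewrite -[map_poly j _]/(map_poly jr _) map_polyXsubC hornerXsubC subr_eq0 => /eqP ->; exists (ge_act E y a).
have res x : {y | forall a, ge_act E' x (jr a) = jr (ge_act E y a)}.
  apply: cid; pose f a := sval (cid (stab x a)).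
  have fE a : ge_act E' x (jr a) = jr (f a) := svalP (cid (stab x a)).
  have [||y ey] := @ge_all _ _ _ E f.
  - split=> [|a b|a b]; apply: (fmorph_inj jr); rewrite -fE.
    + by rewrite !rmorph1.
    + by rewrite !rmorphD -!fE.
    + by rewrite !rmorphM -!fE.
  - by move=> a; apply: (fmorph_inj jr); rewrite -fE jin ge_act_in.
  by exists y => a; rewrite -ey fE.
exact: inhabits (@GalMor E E' jr jE (fun x => sval (res x)) (fun x => svalP (res x))).
Qed.

Hypothesis clO : alg_closed O.
Hypothesis algO : forall x, algebraicOver iota x.
Hypothesis pchark : [pchar k] =i pred0.

(** It suffices to adjoin, besides Z, a finite set that spans E over k. *)
Lemma galext_enlarge E (Z : seq O) : exists (E' : galext iota) (j : galmor E E'),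
  forall z, z \in Z -> exists y, ge_out E' y = z.
Proof.
have [n [b bgen]] := ge_fin E.
have [E' EP] := galext_cover clO algO pchark (Z ++ codom (fun i => ge_out E (b i))).
have [|j] := @galmor_exists E E'; last first.
  by exists E', j => z zZ; apply: EP; rewrite mem_cat zZ.
have ch i : {y | ge_out E' y = ge_out E (b i)}.
  by apply: cid; apply: EP; rewrite mem_cat codom_f orbT.
move=> x; have [c ->] := bgen x; exists (\sum_i ge_in E' (c i) * sval (ch i)).
rewrite !rmorph_sum; apply: eq_bigr => i _.
by rewrite !rmorphM (svalP (ch i)) !ge_outin.
Qed.
End GaloisMor.

(** * Power series *)

Record pser (k : Type) := PSer { pc : nat -> k }.

Section PowerSeries.
Variable k : comNzRingType.
Local Notation S := (pser k).
HB.instance Definition _ := gen_eqMixin S.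
HB.instance Definition _ := gen_choiceMixin S.
Implicit Types f g h : S.

Lemma pserP f g : (forall n, pc f n = pc g n) -> f = g.
Proof. by case: f g => [f] [g] /= fg; congr PSer; apply: functional_extensionality_dep. Qed.

Definition padd f g := PSer (fun n => pc f n + pc g n).
Definition popp f := PSer (fun n => - pc f n).
Definition pzero : S := PSer (fun=> 0).
Definition pmul f g := PSer (fun n => \sum_(i < n.+1) pc f i * pc g (n - i)%N).
Definition pone : S := PSer (fun n => (n == 0%N)%:R).

Fact paddA : associative padd. Proof. by move=> f g h; apply: pserP => n /=; rewrite addrA. Qed.
Fact paddC : commutative padd. Proof. by move=> f g; apply: pserP => n /=; rewrite addrC. Qed.
Fact padd0 : left_id pzero padd. Proof. by move=> f; apply: pserP => n /=; rewrite add0r. Qed.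
Fact paddN : left_inverse pzero popp padd. Proof. by move=> f; apply: pserP => n /=; rewrite addNr. Qed.
HB.instance Definition _ := GRing.isZmodule.Build S paddA paddC padd0 paddN.

Definition ptrunc n f : {poly k} := \poly_(i < n) pc f i.

(** Truncation lets commutativity and associativity be inherited from polynomials. *)
Lemma pmul_trunc f g n m : (n < m)%N -> pc (pmul f g) n = (ptrunc m f * ptrunc m g)`_n.
Proof.
move=> nm; rewrite coefM; apply: eq_bigr => i _; rewrite !coef_poly.
have im : (i < m)%N := leq_ltn_trans (ltn_ord i : (i <= n)%N) nm.
by rewrite im (leq_ltn_trans (leq_subr _ _) nm).
Qed.

Fact pmulC : commutative pmul.
Proof. by move=> f g; apply: pserP => n; rewrite !(pmul_trunc _ _ (ltnSn n)) mulrC. Qed.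

Lemma ptruncM n f g i : (i < n)%N ->
  (ptrunc n (pmul f g))`_i = (ptrunc n f * ptrunc n g)`_i.
Proof. by move=> ni; rewrite coef_poly ni (pmul_trunc _ _ ni). Qed.

Fact pmulA : associative pmul.
Proof.
move=> f g h; apply: pserP => n; rewrite !(pmul_trunc _ _ (ltnSn n)).
transitivity (ptrunc n.+1 f * (ptrunc n.+1 g * ptrunc n.+1 h))`_n.
  rewrite !coefM; apply: eq_bigr => i _; congr (_ * _).
  by rewrite ptruncM // ltnS leq_subr.
rewrite mulrA !coefM; apply: eq_bigr => i _; congr (_ * _).
by rewrite ptruncM.
Qed.
Fact pmul1 : left_id pone pmul.
Proof.
move=> f; apply: pserP => n /=; rewrite big_ord_recl /= mul1r subn0.
by rewrite big1 ?addr0 // => i _; rewrite mul0r.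
Qed.
Fact pmulD : left_distributive pmul padd.
Proof.
move=> f g h; apply: pserP => n /=; rewrite -big_split; apply: eq_bigr => i _.
exact: mulrDl.
Qed.
Fact pone_neq0 : pone != 0.
Proof. by apply/eqP => /(congr1 (fun f => pc f 0%N)) /eqP; rewrite /= oner_eq0. Qed.
HB.instance Definition _ :=
  GRing.Zmodule_isComNzRing.Build S pmulA pmulC pmul1 pmulD pone_neq0.

Lemma pcD f g n : pc (f + g) n = pc f n + pc g n. Proof. by []. Qed.
Lemma pcB f g n : pc (f - g) n = pc f n - pc g n. Proof. by []. Qed.
Lemma pcM f g n : pc (f * g) n = \sum_(i < n.+1) pc f i * pc g (n - i)%N. Proof. by []. Qed.
Lemma pc1 n : pc (1 : S) n = (n == 0%N)%:R. Proof. by []. Qed.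
Lemma pc0 n : pc (0 : S) n = 0. Proof. by []. Qed.

Definition punit : {pred S} := fun f => `[< exists g, g * f = 1 >].
Definition pinv f : S :=
  match pselect (exists g, g * f = 1) with left p => sval (cid p) | right _ => f end.
Fact pmulV : {in punit, left_inverse 1 pinv *%R}.
Proof. by move=> f /asboolP h; rewrite /pinv; case: pselect => // p; apply: (svalP (cid p)). Qed.
Fact punitP f g : g * f = 1 -> punit f.
Proof. by move=> e; apply/asboolP; exists g. Qed.
Fact pinv_out : {in [predC punit], pinv =1 id}.
Proof.
move=> f nu; rewrite /pinv; case: pselect => // p; case/negP: nu.
exact/asboolP.
Qed.
HB.instance Definition _ :=
  GRing.ComNzRing_hasMulInverse.Build S pmulV punitP pinv_out.

Definition pX : S := PSer (fun n => (n == 1%N)%:R).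
Definition pshift f : S := PSer (fun n => pc f n.+1).

Lemma pcXM f n : pc (pX * f) n = if n is m.+1 then pc f m else 0.
Proof.
rewrite pcM; case: n => [|n]; first by rewrite big_ord1 /= mul0r.
by rewrite 2!big_ord_recl /= mul0r add0r mul1r subSS subn0 big1 ?addr0 // => i _; rewrite mul0r.
Qed.

Lemma pcXnM f m n : pc (pX ^+ m * f) n = if (n < m)%N then 0 else pc f (n - m)%N.
Proof.
elim: m => [|m IH] in n *; first by rewrite mul1r subn0.
by rewrite exprS -mulrA pcXM; case: n => [|n] //; rewrite IH ltnS subSS.
Qed.

Lemma pshiftK f : pc f 0 = 0 -> f = pX * pshift f.
Proof. by move=> f0; apply: pserP => -[|n]; rewrite pcXM. Qed.

Lemma pc0M f g : pc (f * g) 0 = pc f 0 * pc g 0.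
Proof. by rewrite pcM big_ord1. Qed.

Definition pconst (a : k) : S := PSer (fun n => if n is 0 then a else 0).
Fact pconst_zmod : zmod_morphism pconst.
Proof. by move=> a b; apply: pserP => -[|n] //=; rewrite subr0. Qed.
HB.instance Definition _ := GRing.isZmodMorphism.Build k S pconst pconst_zmod.
Fact pconst_monoid : monoid_morphism pconst.
Proof.
split=> [|a b]; apply: pserP => -[|n] //; rewrite pcM.
  by rewrite big_ord1.
by rewrite big_ord_recl /= mulr0 big1 ?addr0 // => i _; rewrite mul0r.
Qed.
HB.instance Definition _ := GRing.isMonoidMorphism.Build k S pconst pconst_monoid.

Definition pev (f : S) : k := pc f 0.
Fact pev_zmod : zmod_morphism pev. Proof. by []. Qed.
HB.instance Definition _ := GRing.isZmodMorphism.Build S k pev pev_zmod.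
Fact pev_monoid : monoid_morphism pev. Proof. by split=> // f g; apply: pc0M. Qed.
HB.instance Definition _ := GRing.isMonoidMorphism.Build S k pev pev_monoid.

Lemma pser_nonzero f : f <> 0 -> exists n g, f = pX ^+ n * g /\ pc g 0 <> 0.
Proof.
move=> nz; have ex : exists n, `[< pc f n <> 0 >].
  apply: contrapT => h; apply: nz; apply: pserP => n.
  by apply: contrapT => h'; apply: h; exists n; apply/asboolP.
case: (ex_minnP ex) => n /asboolP fn nmin.
exists n, (PSer (fun m => pc f (m + n)%N)); split=> //.
apply: pserP => m; rewrite pcXnM; case: ltnP => h /=; last by rewrite subnK.
by apply: contrapT => fm; move: h; rewrite ltnNge nmin //; apply/asboolP.
Qed.

(* the coefficients of the inverse of [1 - h], for [pc h 0 = 0], are those of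
   the partial sums of the geometric series *)
Lemma punit_geom h : pc h 0 = 0 -> (1 - h) \is a GRing.unit.
Proof.
move=> h0; pose s n : S := \sum_(i < n) h ^+ i.
have sE n : (1 - h) * s n = 1 - h ^+ n.
  elim: n => [|n IH]; first by rewrite /s big_ord0 mulr0 expr0 subrr.
  by rewrite /s big_ord_recr /= mulrDr -/(s n) IH mulrBl mul1r -exprS addrA subrK.
have low n m : (m < n)%N -> pc (h ^+ n) m = 0.
  by move=> mn; rewrite (pshiftK h0) exprMn pcXnM mn.
have smon n m : (m < n)%N -> pc (s n) m = pc (s m.+1) m.
  elim: n => // n IH; rewrite ltnS leq_eqVlt => /predU1P[->//|mn].
  by rewrite /s big_ord_recr pcD -/(s n) IH // low // addr0.
have : (1 - h) * PSer (fun m => pc (s m.+1) m) = 1.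
  apply: pserP => n; transitivity (pc ((1 - h) * s n.+1) n).
    rewrite !pcM; apply: eq_bigr => i _; congr (_ * _) => /=.
    by rewrite -(smon n.+1) // ltnS leq_subr.
  by rewrite sE pcB low ?subr0.
by move=> e; apply/unitrPr; exists (PSer (fun m => pc (s m.+1) m)).
Qed.

End PowerSeries.

Arguments pX {k}.

Section PowerSeriesField.
Variable k : fieldType.
Implicit Types f g : pser k.

Lemma punitE f : (f \is a GRing.unit) = (pc f 0 != 0).
Proof.
apply/idP/idP => [/unitrPr[g /(congr1 (fun h => pc h 0))]|nz].
  rewrite pc0M => e; apply/eqP => f0; move/eqP: e.
  by rewrite f0 mul0r eq_sym oner_eq0.
have -> : f = pconst (pc f 0) * (1 - (1 - pconst (pc f 0)^-1 * f)).
  by rewrite subKr mulrA -rmorphM /= divff // rmorph1 mul1r.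
rewrite unitrM; apply/andP; split; last first.
  by apply: punit_geom; rewrite pcB pc0M /= mulVf ?subrr.
by apply: rmorph_unit; rewrite unitfE.
Qed.

Fact pser_idomain f g : f * g = 0 -> (f == 0) || (g == 0).
Proof.
move=> e; apply: contrapT => /negP; rewrite negb_or => /andP[/eqP nf /eqP ng].
have [n [f' [ef f0]]] := pser_nonzero nf; have [m [g' [eg g0]]] := pser_nonzero ng.
have : pc (f * g) (n + m) = 0 by rewrite e.
rewrite ef eg mulrACA -exprD pcXnM ltnn subnn pc0M => /eqP.
by rewrite mulf_eq0 => /orP[] /eqP.
Qed.
HB.instance Definition _ := GRing.ComUnitRing_isIntegral.Build (pser k) pser_idomain.
End PowerSeriesField.

Section PMap.
Variables (k l : comNzRingType) (s : {rmorphism k -> l}).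
Definition pmap (f : pser k) : pser l := PSer (fun n => s (pc f n)).
Fact pmap_zmod : zmod_morphism pmap.
Proof. by move=> f g; apply: pserP => n /=; rewrite rmorphB. Qed.
HB.instance Definition _ := GRing.isZmodMorphism.Build (pser k) (pser l) pmap pmap_zmod.
Fact pmap_monoid : monoid_morphism pmap.
Proof.
split=> [|f g]; apply: pserP => n; rewrite /= ?rmorph_nat //.
by rewrite rmorph_sum; apply: eq_bigr => i _; rewrite rmorphM.
Qed.
HB.instance Definition _ := GRing.isMonoidMorphism.Build (pser k) (pser l) pmap pmap_monoid.
Lemma pmap_const a : pmap (pconst a) = pconst (s a).
Proof. by apply: pserP => -[|n] //=; rewrite rmorph0. Qed.
Lemma pmap_X : pmap pX = pX.
Proof. by apply: pserP => n /=; rewrite rmorph_nat. Qed.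
End PMap.

Section PNeg.
Variable k : comNzRingType.
Definition pneg (f : pser k) : pser k := PSer (fun n => (-1) ^+ n * pc f n).
Fact pneg_zmod : zmod_morphism pneg.
Proof. by move=> f g; apply: pserP => n /=; rewrite mulrBr. Qed.
HB.instance Definition _ := GRing.isZmodMorphism.Build (pser k) (pser k) pneg pneg_zmod.
Fact pneg_monoid : monoid_morphism pneg.
Proof.
split=> [|f g]; apply: pserP => n /=; first by case: n => [|n]; rewrite ?mulr0 ?mul1r.
rewrite mulr_sumr; apply: eq_bigr => i _.
by rewrite mulrACA -exprD subnKC // (ltn_ord i : (i <= n)%N).
Qed.
HB.instance Definition _ := GRing.isMonoidMorphism.Build (pser k) (pser k) pneg pneg_monoid.
Lemma pneg_const a : pneg (pconst a) = pconst a.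
Proof. by apply: pserP => -[|n] //=; rewrite ?mul1r ?mulr0. Qed.
Lemma pneg_X : pneg pX = - pX.
Proof. by apply: pserP => -[|[|n]]; rewrite /= ?mulr0 ?oppr0 ?mulr1 ?expr1. Qed.
Lemma pnegK f : pneg (pneg f) = f.
Proof. by apply: pserP => n /=; rewrite mulrA -exprMn mulrNN mulr1 expr1n mul1r. Qed.
End PNeg.

Section Truncation.
Variables (k : comNzRingType) (n : nat).
Definition eqmod (f g : pser k) := forall i, (i <= n)%N -> pc f i = pc g i.
Definition low_ideal : {pred pser k} := fun f => `[< eqmod f 0 >].
Fact low_idealr : idealr_closed low_ideal.
Proof.
split; first by apply/asboolP.
  apply/negP => /asboolP /(_ 0%N isT) /eqP; by rewrite /= oner_eq0.
move=> a f g /asboolP f0 /asboolP g0; apply/asboolP => i ni.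
rewrite pcD g0 // addr0 pcM big1 // => j _; rewrite f0 ?mulr0 //.
exact: leq_trans (leq_subr _ _) ni.
Qed.
HB.instance Definition _ := isIdealr.Build (pser k) low_ideal low_idealr.
Definition low_ideal_pack : idealr (pser k) := low_ideal.
(** This is k[u] / (u^(n+1)). *)
Definition tser : comNzRingType := {ideal_quot low_ideal_pack}.
Definition tpi (f : pser k) : tser := (\pi_({ideal_quot low_ideal_pack}) f)%qT.
Lemma tpiP f g : tpi f = tpi g <-> eqmod f g.
Proof.
split=> [/eqP|h]; last apply/eqP.
  rewrite -Quotient.idealrBE => /asboolP h i /h; rewrite pcB => /eqP.
  by rewrite subr_eq0 => /eqP.
by rewrite -Quotient.idealrBE; apply/asboolP => i /h; rewrite pcB => ->; rewrite subrr.
Qed.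
Lemma tpi_rm : is_rmorph tpi.
Proof. exact: (rmorphP (\pi_({ideal_quot low_ideal_pack})%qT : {rmorphism pser k -> {ideal_quot low_ideal_pack}})). Qed.
Lemma tpi_repr (x : tser) : tpi (repr x) = x.
Proof. by rewrite /tpi reprK. Qed.
End Truncation.

Lemma eqmodM (k : comNzRingType) n (f g f' g' : pser k) :
  eqmod n f f' -> eqmod n g g' -> eqmod n (f * g) (f' * g').
Proof.
move=> ff gg; have [_ _ tM] := tpi_rm k n.
by apply/tpiP; rewrite !tM (iffRL (tpiP n f f') ff) (iffRL (tpiP n g g') gg).
Qed.

Section EtaleLifting.
Variables (R S : comNzRingType) (k : fieldType) (f : R -> S).
Variables (G : R -> pser k) (h0 : S -> k).
Hypotheses (etf : is_etale f) (hG : is_rmorph G) (hh0 : is_rmorph h0).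
Hypothesis h0G : forall r, h0 (f r) = pc (G r) 0.

(** A ring map to k[u] / (u^(n+1)) that lifts [h0] and extends [G], represented by a function to
    k[[u]] so that the successive lifts all have the same type. *)
Record hommod n (h : S -> pser k) : Prop := HomMod {
  hm1 : eqmod n (h 1) 1;
  hmD : forall a b, eqmod n (h (a + b)) (h a + h b);
  hmM : forall a b, eqmod n (h (a * b)) (h a * h b);
  hmf : forall r, eqmod n (h (f r)) (G r);
  hm0 : forall a, pc (h a) 0 = h0 a }.

(** Formal etaleness is applied to k[u] / (u^(n+2)) -> k[u] / (u^(n+1)), whose kernel has square
    zero, being generated by u^(n+1). *)
Lemma hommod_step n h : hommod n h ->
  exists h', hommod n.+1 h' /\ forall a, eqmod n (h' a) (h a).
Proof.
move=> hh; pose T := tser k n.+1; pose T0 := tser k n.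
pose p (x : T) : T0 := tpi n (repr x).
have pE g : p (tpi n.+1 g) = tpi n g.
  apply/tpiP => i ni; have /tpiP := tpi_repr (tpi n.+1 g); apply.
  exact: leqW.
have [t1 tD tM] := tpi_rm k n.+1; have [u1 uD uM] := tpi_rm k n.
have hp : is_rmorph p.
  split=> [|x y|x y]; first by rewrite -t1 pE.
  - by rewrite -(tpi_repr x) -(tpi_repr y) -tD !pE.
  - by rewrite -(tpi_repr x) -(tpi_repr y) -tM !pE.
have psurj y : exists x, p x = y by exists (tpi n.+1 (repr y)); rewrite pE tpi_repr.
have psq x y : p x = 0 -> p y = 0 -> x * y = 0.
  rewrite -(tpi_repr x) -(tpi_repr y) !pE -tM.
  have e0 : (0 : T0) = tpi n 0 by rewrite -(rmorph0 (rmor (tpi_rm k n))).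
  have -> : (0 : T) = tpi n.+1 0 by rewrite -(rmorph0 (rmor (tpi_rm k n.+1))).
  rewrite e0 => /tpiP x0 /tpiP y0; apply/tpiP => i ni; rewrite pcM big1 // => j _.
  case: (leqP j n) => jn; first by rewrite x0 // mul0r.
  have -> : (i - j)%N = 0%N.
    by apply/eqP; rewrite subn_eq0; apply: leq_trans ni jn.
  by rewrite y0 // mulr0.
have tG : is_rmorph (fun r => tpi n.+1 (G r)).
  by case: hG => [g1 gD gM]; split=> [|a b|a b]; rewrite ?g1 ?gD ?gM ?t1 ?tD ?tM.
have th : is_rmorph (fun a => tpi n (h a)).
  split=> [|a b|a b]; first by rewrite -u1; apply/tpiP/(hm1 hh).
  - by rewrite -uD; apply/tpiP/(hmD hh).
  - by rewrite -uM; apply/tpiP/(hmM hh).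
have comm r : p (tpi n.+1 (G r)) = tpi n (h (f r)).
  by rewrite pE; apply/esym/tpiP/(hmf hh).
have [_ _ fe] := etf.
have [c [[c1 cD cM] [cf cp] cu]] := fe T T0 p _ _ hp psurj psq tG th comm.
  have cE a : eqmod n (repr (c a)) (h a).
    by apply/tpiP; rewrite -cp -{2}(tpi_repr (c a)) pE.
  exists (fun a => repr (c a)); split; last exact: cE.
  split=> [|a b|a b|r|a].
  - by apply/tpiP; rewrite tpi_repr c1 t1.
  - by apply/tpiP; rewrite tpi_repr cD tD !tpi_repr.
  - by apply/tpiP; rewrite tpi_repr cM tM !tpi_repr.
  - by apply/tpiP; rewrite tpi_repr cf.
  - by rewrite cE // (hm0 hh).
Qed.

Lemma etale_lift : exists h : S -> pser k,
  [/\ is_rmorph h, forall r, h (f r) = G r & forall a, pc (h a) 0 = h0 a].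
Proof.
have hm_0 : hommod 0 (fun a => pconst (h0 a)).
  case: hh0 => [e1 eD eM].
  split=> [|a b|a b|r|a] => [[|i]//= _|[|i]//= _|[|i]//= _|[|i]//= _|] //=.
  - by rewrite eM big_ord1.
pose H := fix H n : {h | hommod n h} := match n with
  | 0 => exist _ _ hm_0
  | m.+1 => let w := cid (hommod_step (svalP (H m))) in
            exist _ (sval w) (svalP w).1 end.
have HS n a : eqmod n (sval (H n.+1) a) (sval (H n) a).
  exact: ((svalP (cid (hommod_step (svalP (H n))))).2 a).
have Hm n m a i : (i <= n)%N -> (n <= m)%N -> pc (sval (H m) a) i = pc (sval (H n) a) i.
  move=> ni; elim: m => [|m IH]; first by rewrite leqn0 => /eqP ->.
  rewrite leq_eqVlt => /predU1P[->//|]; rewrite ltnS => nm.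
  by rewrite HS ?IH // (leq_trans ni).
pose h a := PSer (fun n => pc (sval (H n) a) n).
have hE n a : eqmod n (h a) (sval (H n) a) by move=> i ni; rewrite (Hm i n).
have hP n := svalP (H n).
exists h; split=> [|r|a]; last exact: (hm0 (hP 0%N)).
  split=> [|a b|a b]; apply: pserP => n.
  - by rewrite (hE n) // (hm1 (hP n)).
  - by rewrite (hE n) // (hmD (hP n)) // !pcD (hE n) // (hE n).
  - by rewrite (hE n) // (hmM (hP n)) //; apply: eqmodM (leqnn n) => i /hE.
by apply: pserP => n; rewrite (hE n) // (hmf (hP n)).
Qed.

End EtaleLifting.

(** * Fractions *)

Lemma fraction_div (R : idomainType) (x : {fraction R}) :
  exists a b, b != 0 /\ x = tofrac a / tofrac b.
Proof.
elim/quotW: x => r.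
have nd : (\d_r)%R != 0 := denom_ratioP r.
exists (\n_r), (\d_r); split=> //.
apply: (canRL (mulfK _)); first by rewrite tofrac_eq0.
rewrite -[LHS]/(FracField.mul _ _); unlock tofrac; rewrite -FracField.pi_mul.
apply/eqmodP; rewrite /= FracField.equivfE /FracField.mulf.
by rewrite !numden_Ratio ?mulf_neq0 ?oner_eq0 // !mulr1 mulrC.
Qed.

Lemma fraction_lift (R : idomainType) (F : fieldType) (f : {rmorphism R -> F}) :
  injective f -> exists g : {rmorphism {fraction R} -> F}, forall a, g (tofrac a) = f a.
Proof.
move=> finj.
have f0 a : a != 0 -> f a != 0.
  by move=> nz; rewrite -(rmorph0 f) (inj_eq finj).
have ch (x : {fraction R}) : {ab : R * R | ab.2 != 0 /\ x = tofrac ab.1 / tofrac ab.2}.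
  by apply: cid; have [a [b h]] := fraction_div x; exists (a, b).
pose g x := f (sval (ch x)).1 / f (sval (ch x)).2.
have gE a b : b != 0 -> g (tofrac a / tofrac b) = f a / f b.
  move=> nb; rewrite /g; case: (ch _) => [[c d]] /= [nd e].
  apply/eqP; rewrite eqr_div ?f0 // -!rmorphM (inj_eq finj) -tofrac_eq !rmorphM /=.
  by rewrite -eqr_div ?tofrac_eq0 // e.
have gz : zmod_morphism g.
  move=> x y; have [a [b [nb ->]]] := fraction_div x; have [c [d [nd ->]]] := fraction_div y.
  rewrite !gE // -!mulNr addf_div ?tofrac_eq0 // addf_div ?f0 //.
  by rewrite -!rmorphN -!rmorphM -!rmorphD gE // mulf_neq0.
have gm : monoid_morphism g.
  split; first by rewrite -(divr1 1) -(tofrac1 R) gE ?oner_neq0 // rmorph1 divr1.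
  move=> x y; have [a [b [nb ->]]] := fraction_div x; have [c [d [nd ->]]] := fraction_div y.
  by rewrite mulf_div -!rmorphM !gE ?mulf_neq0 // !rmorphM mulf_div.
pose gr : {rmorphism {fraction R} -> F} :=
  HB.pack g (GRing.isZmodMorphism.Build _ _ _ gz) (GRing.isMonoidMorphism.Build _ _ _ gm).
exists gr.
by move=> a /=; rewrite -[tofrac a]divr1 -(tofrac1 R) gE ?oner_neq0 // rmorph1 divr1.
Qed.

Section LeadingCoefficient.
Variable k : fieldType.
Local Notation F := ({fraction (pser k)}).
Local Notation U := (tofrac (@pX k)).
Implicit Types (x y : F) (n m : int) (c d : k).

Lemma pX_neq0 : (pX : pser k) != 0.
Proof. by apply/eqP => /(congr1 (fun f => pc f 1)) /eqP; rewrite /= oner_eq0. Qed.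

Lemma fracX_neq0 : U != 0. Proof. by rewrite tofrac_eq0 pX_neq0. Qed.

(** The Laurent series x has valuation n and leading coefficient c. *)
Definition lterm x n c := c != 0 /\ exists g, pc g 0 = c /\ x = U ^ n * tofrac g.

Lemma lterm_ps (g : pser k) : pc g 0 != 0 -> lterm (tofrac g) 0 (pc g 0).
Proof. by move=> nz; split=> //; exists g; rewrite expr0z mul1r. Qed.

Lemma ltermX (g : pser k) n : pc g 0 != 0 -> lterm (U ^ n * tofrac g) n (pc g 0).
Proof. by move=> nz; split=> //; exists g. Qed.

Lemma ltermM x y n m c d : lterm x n c -> lterm y m d -> lterm (x * y) (n + m) (c * d).
Proof.
move=> [nc [g [gc ->]]] [nd [h [hd ->]]]; split; first by rewrite mulf_neq0.
exists (g * h); split; first by rewrite pc0M gc hd.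
by rewrite rmorphM /= mulrACA expfzDr ?fracX_neq0.
Qed.

Lemma lterm_exists x : x != 0 -> exists n c, lterm x n c.
Proof.
have [a [b [nb ->]]] := fraction_div x => nz.
have na : a != 0 by apply: contraNneq nz => ->; rewrite rmorph0 mul0r.
have [n [g [ea /eqP g0]]] := pser_nonzero (elimN eqP na).
have [m [h [eb /eqP h0]]] := pser_nonzero (elimN eqP nb).
have uh : h \is a GRing.unit by rewrite punitE.
have h'0 : pc h^-1 0 != 0 by rewrite -punitE unitrV.
exists (n%:Z - m%:Z), (pc (g * h^-1) 0); rewrite ea eb.
have -> : tofrac (pX ^+ n * g) / tofrac (pX ^+ m * h) =
    U ^ (n%:Z - m%:Z) * tofrac (g * h^-1).
  rewrite !rmorphM /= !rmorphXn /= invfM mulrACA expfzDr ?fracX_neq0 //.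
  by rewrite exprnN [tofrac (h^-1)]rmorphV.
by apply: ltermX; rewrite pc0M mulf_neq0.
Qed.

Lemma lterm_uniq x n m c d : lterm x n c -> lterm x m d -> n = m /\ c = d.
Proof.
move=> [nc [g [gc ex]]] [nd [h [hd ex']]].
wlog le : n m c d g h nc gc ex nd hd ex' / (n <= m)%R.
  move=> W; case: (lerP n m) => [|/ltW] le; first exact: (W n m c d g h).
  by have [-> ->] := W _ _ _ _ _ _ nd hd ex' nc gc ex le.
have [j ej] : exists j : nat, m = n + j%:Z.
  exists `|(m - n)%R|%N; rewrite gez0_abs ?subr_ge0 //; ring.
have e : g = pX ^+ j * h.
  apply/eqP; rewrite -tofrac_eq; apply/eqP.
  apply: (mulfI (expfz_neq0 n fracX_neq0)); rewrite -ex ex' ej.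
  by rewrite expfzDr ?fracX_neq0 // -mulrA rmorphM /= rmorphXn.
case: j => [|j] in ej e; first by rewrite ej addr0 -gc -hd e mul1r.
by move/eqP: nc; rewrite -gc e pcXnM.
Qed.

End LeadingCoefficient.

(* [s] is a substitution u |-> e u composed with a map [r] of the coefficients. *)
Lemma lterm_map (k l : fieldType) (s : {rmorphism pser k -> pser l}) (r : k -> l) (e : l)
    (phi : {rmorphism {fraction (pser k)} -> {fraction (pser l)}}) x n c :
  e != 0 -> (forall a, r a = 0 -> a = 0) ->
  s pX = pconst e * pX -> (forall g, pc (s g) 0 = r (pc g 0)) ->
  (forall g, phi (tofrac g) = tofrac (s g)) ->
  lterm x n c -> lterm (phi x) n (e ^ n * r c).
Proof.
move=> ne r0 sX sg phis [nc [g [gc ->]]].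
have nrc : r c != 0 by apply: contraNneq nc => /r0 ->.
have e_l : lterm (tofrac (pconst e)) 0 e by apply: (@lterm_ps _ (pconst e)).
have en_l (m : int) : lterm (tofrac (pconst e) ^ m) 0 (e ^ m).
  split; first by rewrite expfz_neq0.
  exists (pconst (e ^ m)); split=> //; rewrite expr0z mul1r.
  exact: esym (fmorphXz (@tofrac (pser l) \o @pconst l) m e).
have nz : pc (s g) 0 != 0 by rewrite sg gc.
have := ltermM (en_l n) (ltermX n nz); rewrite add0r sg gc.
by rewrite [phi _]rmorphM /= phis fmorphXz /= phis sX rmorphM /= exprzMl ?unitfE ?fracX_neq0 ?tofrac_eq0 ?fmorph_eq0 // -mulrA.
Qed.

Section Evaluation.
Variable k : fieldType.

Definition pev_at (tau : pser k) : {rmorphism {poly k} -> pser k} :=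
  horner_eval tau \o map_poly (@pconst k).

Lemma pev_atE tau p : pev_at tau p = (map_poly (@pconst k) p).[tau].
Proof. by []. Qed.
Lemma pev_atC tau c : pev_at tau c%:P = pconst c.
Proof. by rewrite pev_atE map_polyC hornerC. Qed.
Lemma pev_at_X tau : pev_at tau 'X = tau.
Proof. by rewrite pev_atE map_polyX hornerX. Qed.

Lemma pc_pev_at tau p : pc (pev_at tau p) 0 = p.[pc tau 0].
Proof.
rewrite -[LHS]/(pev (pev_at tau p)) pev_atE -horner_map -map_poly_comp.
by rewrite (@map_poly_id _ (@pev k \o @pconst k)).
Qed.

(* The coordinate t = a + u^e in terms of the ramified parameter u. *)
Definition ramif (a : k) (e : nat) : pser k := pconst a + pX ^+ e.

Lemma pc_ramif a e : (0 < e)%N -> pc (ramif a e) 0 = a.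
Proof. by case: e => // e _; rewrite pcD exprS pc0M mul0r addr0. Qed.

Lemma pev_ramif (a : k) e (p : {poly k}) m q : (0 < e)%N ->
  p = q * ('X - a%:P) ^+ m -> q.[a] != 0 ->
  exists g, pev_at (ramif a e) p = pX ^+ (e * m) * g /\ pc g 0 = q.[a].
Proof.
move=> e0 -> nq; exists (pev_at (ramif a e) q); rewrite pc_pev_at pc_ramif //.
split=> //; rewrite rmorphM rmorphXn rmorphB pev_at_X pev_atC.
by rewrite /ramif [pconst a + _]addrC addrK -exprM mulrC.
Qed.

(** A nonzero polynomial vanishes at a to a finite order m, and then its value at a + u^e has order
    e m. *)
Lemma pev_ramif_inj a e : (0 < e)%N -> injective (pev_at (ramif a e)).
Proof.
move=> e0 p q /eqP; rewrite -subr_eq0 -rmorphB; case: (eqVneq (p - q) 0) => [/subr0_eq //|nz].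
have [m [r nr er]] := multiplicity_XsubC (p - q) a; rewrite nz /= in nr.
have [|g [-> g0]] := @pev_ramif a e (p - q) m r e0 er; first exact: nr.
rewrite mulf_eq0 expf_eq0 (negPf (pX_neq0 k)) andbF /= => /eqP g00.
by move: nr; rewrite /root -g0 g00 eqxx.
Qed.
End Evaluation.

(** * Locally free modules over local rings *)

(** Local rings, in the form that suits [locfree]: in a finite Zariski covering by basic open sets,
    one of the sets is everything. *)
Definition localring (S : comNzRingType) :=
  forall n (a c : 'I_n -> S), \sum_i c i * a i = 1 -> exists i u, u * a i = 1.

Lemma localring_field (k : fieldType) : localring k.
Proof.
move=> n a c e; apply: contrapT => h.
have : \sum_i c i * a i = 0.
  apply: big1 => i _; case: (eqVneq (a i) 0) => [->|nz]; first by rewrite mulr0.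
  by case: h; exists i, (a i)^-1; rewrite mulVf.
by rewrite e => /eqP; rewrite oner_eq0.
Qed.

Lemma localring_pser (k : fieldType) : localring (pser k).
Proof.
move=> n a c e; have : \sum_i pev (c i) * pev (a i) = 1.
  by rewrite -(rmorph1 (@pev k)) -e rmorph_sum; apply: eq_bigr => i _; rewrite rmorphM.
case/(@localring_field k) => i [u eu]; exists i.
have : a i \is a GRing.unit.
  rewrite punitE; apply/eqP => a0; move/eqP: eu.
  by rewrite /pev a0 mulr0 eq_sym oner_eq0.
by case/unitrPr => v ev; exists v; rewrite mulrC.
Qed.

Section Lin.
Variables (R S : pzRingType) (f : R -> S) (M : lmodType R) (N : lmodType S) (u : M -> N).
Hypotheses (hf : is_rmorph f) (hu : semilin f u).
Lemma semilinD x y : u (x + y) = u x + u y.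
Proof. by case: hf => f1 _ _; have := hu 1 x y; rewrite f1 !scale1r. Qed.
Lemma semilin0 : u 0 = 0.
Proof. by apply: (addrI (u 0)); rewrite -semilinD !addr0. Qed.
Lemma semilinZ a x : u (a *: x) = f a *: u x.
Proof. by have := hu a x 0; rewrite !addr0 semilin0 addr0. Qed.
Lemma semilin_sum (I : Type) (r : seq I) (P : pred I) (F : I -> M) :
  u (\sum_(i <- r | P i) F i) = \sum_(i <- r | P i) u (F i).
Proof. by apply: (big_morph u semilinD semilin0). Qed.
Lemma semilinN x : u (- x) = - u x.
Proof. by apply: (addrI (u x)); rewrite -semilinD !subrr semilin0. Qed.
End Lin.

Lemma is_rmorph_id (R : pzRingType) : is_rmorph (fun a : R => a).
Proof. by []. Qed.
Arguments is_rmorph_id {R}.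

Section Basis.
Variables (R : comNzRingType) (M : lmodType R).

Lemma is_basisP r (b : 'I_r -> M) :
  (forall v, exists c : 'I_r -> R, v = \sum_i c i *: b i) ->
  (forall c : 'I_r -> R, \sum_i c i *: b i = 0 -> forall i, c i = 0) -> is_basis b.
Proof.
move=> gen free v; have [c ec] := gen v; exists [ffun i => c i]; split.
  by rewrite ec; apply: eq_bigr => i _; rewrite ffunE.
move=> d ed; apply/ffunP => i; rewrite ffunE; apply/eqP; rewrite -subr_eq0; apply/eqP.
apply: (free (fun i => c i - d i)).
transitivity (\sum_j c j *: b j - \sum_j d j *: b j); last by rewrite -ec -ed subrr.
by rewrite -sumrB; apply: eq_bigr => j _; rewrite scalerBl.
Qed.

Lemma is_basis_gen r (b : 'I_r -> M) v : is_basis b -> exists c : 'I_r -> R, v = \sum_i c i *: b i.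
Proof. by move=> /(_ v)[c [e _]]; exists c. Qed.

Lemma is_basis_free r (b : 'I_r -> M) (c : 'I_r -> R) :
  is_basis b -> \sum_i c i *: b i = 0 -> forall i, c i = 0.
Proof.
move=> hb e i; have [d [_ u]] := hb 0.
have e1 : d = [ffun i => c i].
  apply: u; transitivity (\sum_i c i *: b i); first by rewrite e.
  by apply: eq_bigr => j _; rewrite ffunE.
have e0 : d = [ffun=> 0].
  by apply: u; rewrite big1 // => j _; rewrite ffunE scale0r.
by have := congr1 (fun g : {ffun 'I_r -> R} => g i) (etrans (esym e1) e0); rewrite !ffunE.
Qed.

Lemma locfree_basis r : localring R -> locfree M r -> exists b : 'I_r -> M, is_basis b.
Proof.
move=> lR [n [a [[c ec] hb]]]; have [i [u eu]] := lR _ _ _ ec.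
have eun k : u ^+ k * a i ^+ k = 1 by rewrite -exprMn eu expr1n.
have [b [gen free]] := hb i; exists b; apply: is_basisP => [v|d ed j].
  have [k [d ed]] := gen v; exists (fun j => u ^+ k * d j).
  rewrite -[LHS]scale1r -(eun k) -scalerA ed scaler_sumr.
  by apply: eq_bigr => j _; rewrite scalerA.
have [k /(_ j) e] := free d ed.
by rewrite -[LHS]mul1r -(eun k) -mulrA e mulr0.
Qed.

Lemma is_gen_basis (e : M) : is_gen e <-> is_basis (fun _ : 'I_1 => e).
Proof.
split=> [h|h w].
  apply: is_basisP => [v|c].
    by have [c [ev _]] := h v; exists (fun=> c); rewrite big_ord1.
  rewrite big_ord1 => e0 i; have [d [_ u]] := h 0.
  rewrite (ord1 i); transitivity d; first by apply/esym/u; rewrite e0.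
  by apply: u; rewrite scale0r.
have [c ec] := is_basis_gen w h; rewrite big_ord1 in ec; exists (c 0); split=> // d ed.
have : (c 0 - d) *: e = 0 by rewrite scalerBl -ec -ed subrr.
move=> e0; apply/eqP; rewrite -subr_eq0; apply/eqP.
by apply: (@is_basis_free 1 _ (fun=> c 0 - d) h _ 0); rewrite big_ord1.
Qed.

Lemma locfree_gen : localring R -> locfree M 1 -> exists e : M, is_gen e.
Proof.
move=> lR /(locfree_basis lR)[b hb]; exists (b 0); apply/is_gen_basis.
by move: hb; congr is_basis; apply: functional_extensionality_dep => i; rewrite (ord1 i).
Qed.

Lemma is_genZ_inj (e : M) a b : is_gen e -> a *: e = b *: e -> a = b.
Proof. by move=> h ab; have [c [_ u]] := h (a *: e); rewrite -(u a) // (u b). Qed.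

Lemma is_genP (e : M) : (forall w, exists c, w = c *: e) ->
  (forall c, c *: e = 0 -> c = 0) -> is_gen e.
Proof.
move=> gen free w; have [c ec] := gen w; exists c; split=> // d ed.
apply/eqP; rewrite -subr_eq0; apply/eqP/free.
by rewrite scalerBl -ec -ed subrr.
Qed.

Lemma is_gen_ex (e w : M) : is_gen e -> exists c, w = c *: e.
Proof. by move=> /(_ w)[c [ec _]]; exists c. Qed.

Lemma is_gen_unit (e : M) u v : v * u = 1 -> is_gen e -> is_gen (u *: e).
Proof.
move=> vu h; apply: is_genP => [w|c].
  by have [c ->] := is_gen_ex w h; exists (c * v); rewrite scalerA -mulrA vu mulr1.
rewrite scalerA -[RHS in _ = RHS](scale0r e) => /(is_genZ_inj h) e0.
by rewrite -[c]mulr1 -vu mulrCA mulrC [c * u]e0 mul0r.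
Qed.

Lemma is_gen_span (e e' : M) : is_gen e -> (exists c, e = c *: e') -> is_gen e'.
Proof.
move=> h [c ec]; have [d ed] := is_gen_ex e' h.
have dc : c * d = 1 by apply: (is_genZ_inj h); rewrite -scalerA -ed -ec scale1r.
by rewrite ed; apply: is_gen_unit h; apply: dc.
Qed.

End Basis.

Section Coordinates.
Variables (R : comNzRingType) (M : lmodType R) (r : nat) (b : 'I_r -> M).
Hypothesis hb : is_basis b.
Definition coords (v : M) : {ffun 'I_r -> R} := sval (cid (hb v)).
Lemma coordsE v : v = \sum_i coords v i *: b i.
Proof. by case: (svalP (cid (hb v))). Qed.
Lemma coords_uniq v (c : 'I_r -> R) : v = \sum_i c i *: b i -> forall i, coords v i = c i.
Proof.
move=> e i; have [_ u] := svalP (cid (hb v)); rewrite /coords (u [ffun i => c i]) ?ffunE //.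
by rewrite e; apply: eq_bigr => j _; rewrite ffunE.
Qed.
End Coordinates.

Section BaseChangeBasis.
Variables (R S : comNzRingType) (f : R -> S) (M : lmodType R) (N : lmodType S) (u : M -> N).
Hypotheses (hf : is_rmorph f) (hu : is_basechange f u).

(** The universal property turns the coordinates on M into a linear map from N to S^r. It takes u (b
    i) to the i-th unit vector, whence independence; composed with the map back to N it is the
    identity by uniqueness, whence generation. *)
Lemma basechange_basis r (b : 'I_r -> M) : is_basis b -> is_basis (fun i => u (b i)).
Proof.
move=> hb; have [su univ] := hu; have [f1 fD fM] := hf.
pose w (v : M) : {ffun 'I_r -> S^o} := [ffun i => f (coords hb v i) : S^o].
have sw : semilin f w.
  move=> a x y; apply/ffunP => i; rewrite !ffunE /GRing.scale /= -fM -fD; congr f.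
  apply: (coords_uniq hb (c := fun i => a * coords hb x i + coords hb y i)).
  transitivity (a *: (\sum_j coords hb x j *: b j) + \sum_j coords hb y j *: b j).
    by rewrite -!coordsE.
  rewrite scaler_sumr -big_split.
  by apply: eq_bigr => j _; rewrite scalerDl scalerA.
have [l [ll lw _]] := univ _ w sw.
have l0 := semilinZ is_rmorph_id ll; have lD := semilin_sum is_rmorph_id ll.
pose m (c : {ffun 'I_r -> S^o}) := \sum_i (c i : S) *: u (b i).
have mlin : is_lin (fun v => m (l v)).
  move=> a x y; rewrite ll /m scaler_sumr -big_split; apply: eq_bigr => i _.
  by rewrite !ffunE scalerDl scalerA.
have mw v : m (l (u v)) = u v.
  rewrite lw /m [RHS](congr1 u (coordsE hb v)) (semilin_sum hf su).
  by apply: eq_bigr => i _; rewrite (semilinZ hf su) ffunE.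
have mlid v : m (l v) = v.
  have [l1 [_ _ uni]] := univ N u su.
  transitivity (l1 v); first exact: (uni (fun x => m (l x)) mlin mw).
  by apply/esym; apply: (uni (fun x => x)).
apply: is_basisP => [v|c ec i]; first by exists (l v); rewrite -[LHS]mlid.
have := congr1 l ec; rewrite (semilin0 is_rmorph_id ll) lD => /ffunP /(_ i).
rewrite ffunE sum_ffunE (bigD1 i) //= big1 => [|j ji].
  rewrite l0 lw !ffunE addr0 (coords_uniq hb (c := fun j => (j == i)%:R)).
    by rewrite eqxx f1 /GRing.scale /= mulr1.
  by rewrite (bigD1 i) //= eqxx scale1r big1 ?addr0 // => j /negPf ->; rewrite scale0r.
rewrite l0 lw !ffunE (coords_uniq hb (c := fun i => (i == j)%:R)).
  by rewrite eq_sym (negPf ji) (semilin0 (M := R^o) (N := S^o) hf) ?/GRing.scale /= ?mulr0 // => a x y; rewrite fD fM.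
by rewrite (bigD1 j) //= eqxx scale1r big1 ?addr0 // => k /negPf ->; rewrite scale0r.
Qed.

Lemma basechange_gen e : is_gen e -> is_gen (u e).
Proof. by move/is_gen_basis/basechange_basis/is_gen_basis. Qed.
End BaseChangeBasis.

(** * Points of the projective line and of the root stack *)

Definition pgen (b : bool) (R : comNzRingType) (y : P1 R) : pL y := if b then p1 y else p0 y.
Definition poth (b : bool) (R : comNzRingType) (y : P1 R) : pL y := if b then p0 y else p1 y.

(** The coordinate is t = p1 / p0 when [b] is false and 1 / t when [b] is true. *)
Definition P1at (b : bool) (R : comNzRingType) (y : P1 R) (tau : R) :=
  is_gen (pgen b y) /\ poth b y = tau *: pgen b y.

Section P1Arrows.
Variables (R S : comNzRingType) (f : R -> S) (x : P1 R) (y : P1 S).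

Lemma p1hom_uniq (h h' : hom f x y) : h = h'.
Proof.
case: h h' => [u hu] [v hv] /=; apply: eq_exist; apply: functional_extensionality_dep => w.
have [a [b ->]] := p_gen w.
case: hu hv => hf su u0 u1 [_ sv v0 v1].
by rewrite !(semilinD hf su) !(semilinD hf sv) !(semilinZ hf su) !(semilinZ hf sv) u0 u1 v0 v1.
Qed.

Lemma p1hom_coord b (h : hom f x y) :
  sval h (pgen b x) = pgen b y /\ sval h (poth b x) = poth b y.
Proof. by case: h => [u [_ _ u0 u1]] /=; case: b. Qed.

Lemma P1at_push b tau : localring S -> hom f x y -> P1at b x tau -> P1at b y (f tau).
Proof.
move=> lS h [gx ex]; have [e0 e1] := p1hom_coord b h.
have hf := hom_rm h; have su : semilin f (sval h) by case: (svalP h).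
have ey : poth b y = f tau *: pgen b y.
  by rewrite -e1 ex (semilinZ hf su) e0.
split=> //; have [e ge] := locfree_gen lS (p_inv y); apply: is_gen_span ge _.
have [a [c ->]] := p_gen e; move: ey; rewrite /pgen /poth; case: (b) => ->.
  by exists (a * f tau + c); rewrite scalerDl scalerA.
by exists (a + c * f tau); rewrite scalerDl scalerA.
Qed.

Lemma p1hom_exists b tau : is_rmorph f -> P1at b x tau -> P1at b y (f tau) ->
  inhabited (hom f x y).
Proof.
move=> hf [gx ex] [gy ey]; have [f1 fD fM] := hf.
have ch v : {c | v = c *: pgen b x} by apply: cid; apply: is_gen_ex.
have chE v c : v = c *: pgen b x -> sval (ch v) = c.
  by move=> e; apply: (is_genZ_inj gx); rewrite -(svalP (ch v)).
pose u (v : pL x) : pL y := f (sval (ch v)) *: pgen b y.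
have uE c : u (c *: pgen b x) = f c *: pgen b y by rewrite /u (chE _ c).
have ug : u (pgen b x) = pgen b y by rewrite -[in LHS](scale1r (pgen b x)) uE f1 scale1r.
have uo : u (poth b x) = poth b y by rewrite ex uE ey.
apply: inhabits; exists u; split=> //.
- move=> a v w; rewrite (svalP (ch v)) (svalP (ch w)) scalerA -scalerDl !uE.
  by rewrite fD fM scalerDl scalerA.
- by move: ug uo; rewrite /pgen /poth; case: (b).
- by move: ug uo; rewrite /pgen /poth; case: (b).
Qed.
End P1Arrows.

Lemma is_gen1 (R : comNzRingType) : is_gen (1 : R^o).
Proof.
apply: is_genP => [w|c]; first by exists w; rewrite /GRing.scale /= mulr1.
by rewrite /GRing.scale /= mulr1.
Qed.

Lemma P1at_chart b : P1at b (chart b) 'X.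
Proof. by case: b; split; rewrite ?/pgen ?/poth /=; [exact: is_gen1|rewrite /GRing.scale /= mulr1|exact: is_gen1|rewrite /GRing.scale /= mulr1]. Qed.

Lemma P1at_generic : P1at false generic_pt tvar.
Proof. by split; rewrite ?/pgen ?/poth /=; [exact: is_gen1|rewrite /GRing.scale /= mulr1]. Qed.

Lemma P1at_exists (R : comNzRingType) b (tau : R) : (exists q : rat -> R, is_rmorph q) ->
  exists y : P1 R, P1at b y tau.
Proof.
move=> hq; have h1 : exists c d : R, c * tau + d * 1 = 1 by exists 0, 1; rewrite mul0r add0r mulr1.
have h2 : exists c d : R, c * 1 + d * tau = 1 by exists 1, 0; rewrite mul0r addr0 mulr1.
exists (if b then p1pt hq h1 else p1pt hq h2).
by case: b; split; rewrite ?/pgen ?/poth /=; [exact: is_gen1|rewrite /GRing.scale /= mulr1|exact: is_gen1|rewrite /GRing.scale /= mulr1].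
Qed.

Lemma P1at_flip (R : comNzRingType) (y : P1 R) b (tau tau' : R) :
  tau' * tau = 1 -> P1at b y tau -> P1at (~~ b) y tau'.
Proof.
have E c : pgen (~~ c) y = poth c y /\ poth (~~ c) y = pgen c y by case: c.
move=> tt [gy ey]; have [e1 e2] := E b; rewrite /P1at e1 e2 ey; split.
  exact: is_gen_unit tt gy.
by rewrite scalerA tt scale1r.
Qed.

Lemma eq_sig2_pair (A B : Type) (P : A * B -> Prop) (x y : {ab | P ab}) :
  (sval x).1 = (sval y).1 -> (sval x).2 = (sval y).2 -> x = y.
Proof.
case: x y => [[a b] p] [[a' b'] p'] /= ea eb; move: p p'; rewrite ea eb => p p'.
by congr exist; apply: Prop_irrelevance.
Qed.

Section Root.
Variables (D : omod P1) (s : osec D).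
Hypothesis hD : is_bundle 1 D.
Variables (eD : forall b, D _ (chart b)) (FD : bool -> {poly rat}).
Hypothesis geD : forall b, is_gen (eD b).
Hypothesis sD : forall b, s _ (chart b) = FD b *: eD b.

Local Notation P := (rootstack s).

(* A point of the root stack over the point of the chart [b] with coordinate
   [q 'X]: the square root is generated by some [n1] with section [nu n1] and
   [n1 ^ 2 = g e]. *)
Definition cdata (S : comNzRingType) (b : bool) (y : P S) (q : {poly rat} -> S) (nu g : S) :=
  exists (h : hom q (chart b) (rpt y)) (n1 : rN y),
    [/\ is_gen n1, rn y = nu *: n1 & rsq n1 n1 = g *: vmap D h (eD b)].

Lemma rsq_bilin (S : comNzRingType) (y : P S) : is_bilin (@rsq _ _ _ y).
Proof. by case: (rsq_iso y). Qed.

Lemma rsqZZ (S : comNzRingType) (y : P S) a c (m n : rN y) :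
  rsq (a *: m) (c *: n) = (a * c) *: rsq m n.
Proof.
have [l r] := rsq_bilin y.
rewrite (semilinZ is_rmorph_id (l _)) [rsq (a *: m) n](semilinZ is_rmorph_id (r n)).
by rewrite scalerA mulrC.
Qed.

Lemma eD_gen (S : comNzRingType) (y : P1 S) b (q : {poly rat} -> S) (h : hom q (chart b) y) :
  is_gen (vmap D h (eD b)).
Proof.
have hb := hD.1 _ _ _ _ _ h.
exact (basechange_gen (hom_rm h) hb (@geD b)).
Qed.

Lemma s_chart (S : comNzRingType) (y : P1 S) b (q : {poly rat} -> S) (h : hom q (chart b) y) :
  s S y = q (FD b) *: vmap D h (eD b).
Proof.
by rewrite -(sv_nat s h) sD (semilinZ (hom_rm h) (vmap_semilin h)).
Qed.

Lemma cdata_at (S : comNzRingType) b (y : P S) q nu g :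
  localring S -> cdata b y q nu g -> P1at b (rpt y) (q 'X).
Proof. by move=> lS [h _]; apply: P1at_push lS h (P1at_chart b). Qed.

(** Arrows of the root stack are not defined as base changes of the square root; the image of n1
    generates because its square does. *)
Lemma root_gen_push (S T : comNzRingType) (f : S -> T) (y : P S) (z : P T) (k : hom f y z)
    (n1 : rN y) e c c' : localring T -> c' * c = 1 -> rsq n1 n1 = c *: e -> is_gen e ->
  is_gen ((sval k).2 n1).
Proof.
move=> lT cc esq ge; have [sk nk qk] := svalP k.
have hf := hom_rm (sval k).1; have [f1 _ fM] := hf.
have [e' ge'] := locfree_gen lT (rN_inv z).
have [a ea] := is_gen_ex ((sval k).2 n1) ge'.
have ge2 : is_gen (vmap D (sval k).1 e) := basechange_gen hf (hD.1 _ _ _ _ _ _) ge.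
have [d ed] := is_gen_ex (rsq e' e') ge2.
have e3 : a * (a * d) = f c.
  apply: (is_genZ_inj ge2); rewrite mulrA -scalerA -ed -rsqZZ -ea qk esq.
  by rewrite (semilinZ hf (vmap_semilin _)).
rewrite ea; apply: is_gen_unit ge'; instantiate (1 := f c' * (a * d)).
by rewrite -mulrA [a * d * a]mulrC e3 -fM cc f1.
Qed.

Lemma cdata_push (S T : comNzRingType) (f : S -> T) (y : P S) (z : P T) b q nu g g' :
  localring T -> g' * g = 1 -> hom f y z -> cdata b y q nu g ->
  cdata b z (fun p => f (q p)) (f nu) (f g).
Proof.
move=> lT gg k [h [n1 [gn en esq]]]; exists (hcomp h (sval k).1), ((sval k).2 n1).
have [sk nk qk] := svalP k; have hf := hom_rm (sval k).1; split.
- exact: root_gen_push lT gg esq (eD_gen h).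
- exact: etrans (esym nk) (etrans (congr1 (sval k).2 en) (semilinZ hf sk _ _)).
- by rewrite qk esq (semilinZ hf (vmap_semilin _)) vmap_comp.
Qed.

Lemma cdata_iso (S : comNzRingType) (y y' : P S) b q nu g :
  localring S -> cdata b y q nu g -> cdata b y' q nu g ->
  inhabited (hom (fun a : S => a) y y').
Proof.
move=> lS cy cy'.
have [k] := @p1hom_exists _ _ _ _ _ b _ is_rmorph_id (cdata_at lS cy) (cdata_at lS cy').
have [h [n1 [gn en esq]]] := cy; have [h' [n1' [gn' en' esq']]] := cy'.
have ch v : {c | v = c *: n1} by apply: cid; apply: is_gen_ex.
have chE v c : v = c *: n1 -> sval (ch v) = c.
  by move=> e; apply: (is_genZ_inj gn); rewrite -(svalP (ch v)).
pose u (v : rN y) : rN y' := sval (ch v) *: n1'.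
have uE c : u (c *: n1) = c *: n1' by rewrite /u (chE _ c).
have hk : vmap D k (vmap D h (eD b)) = vmap D h' (eD b).
  by rewrite -vmap_comp; congr vmap; apply: p1hom_uniq.
apply: inhabits; exists (k, u); split=> /=.
- move=> a v w; rewrite (svalP (ch v)) (svalP (ch w)) scalerA -scalerDl !uE.
  by rewrite scalerDl scalerA.
- by rewrite en uE en'.
- move=> v w; rewrite (svalP (ch v)) (svalP (ch w)) !uE !rsqZZ esq esq'.
  by rewrite !(semilinZ is_rmorph_id (vmap_semilin k)) hk.
Qed.

(** The square root is the free module of rank one, with the product scaled by the unit g. *)
Lemma cdata_exists (S : comNzRingType) b q (nu g g' : S) :
  is_rmorph q -> g' * g = 1 -> nu ^+ 2 * g = q (FD b) ->
  exists y : P S, cdata b y q nu g.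
Proof.
move=> hq gg eF.
have hQ : exists r : rat -> S, is_rmorph r.
  by exists (fun c => q c%:P); apply: (rmorph_comp (rmorphP (@polyC rat)) hq).
have [y0 aty] := P1at_exists b (q 'X) hQ.
have [h] := p1hom_exists hq (P1at_chart b) aty.
pose eps := vmap D h (eD b); have ge : is_gen eps := eD_gen h.
pose sq (m n : S^o) : D S y0 := ((m * n : S) * g) *: eps.
have sc (a : S) (x : S^o) : a *: x = (a * x : S) by [].
have sqb : is_bilin sq.
  split=> m a x z; rewrite /sq sc scalerA -scalerDl; congr (_ *: _).
    by rewrite mulrDr mulrDl mulrCA !mulrA.
  by rewrite !mulrDl !mulrA.
have sqt : is_tensor sq.
  split=> // F w [wl wr].
  have [co [coE coK]] : exists co : D S y0 -> S,
      (forall v, v = co v *: eps) /\ forall c, co (c *: eps) = c.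
    have ch v : {c | v = c *: eps} by apply: cid; apply: is_gen_ex.
    exists (fun v => sval (ch v)); split=> [v|c]; first exact: (svalP (ch v)).
    by apply: (is_genZ_inj ge); rewrite -(svalP (ch _)).
  exists (fun v => (co v * g') *: w 1 1); split.
  - move=> a x z; rewrite scalerA -scalerDl; congr (_ *: _).
    rewrite {1}(coE x) {1}(coE z) scalerA -scalerDl coK.
    by rewrite mulrDl mulrA.
  - move=> x z; rewrite coK -[_ * g * g']mulrA [g * g']mulrC gg mulr1.
    have ex : x = (x : S) *: (1 : S^o) by rewrite sc mulr1.
    have ez : z = (z : S) *: (1 : S^o) by rewrite sc mulr1.
    rewrite [in RHS]ex [in RHS]ez (semilinZ is_rmorph_id (wl _)).
    by rewrite [w (_ *: _) _](semilinZ is_rmorph_id (wr _)) scalerA mulrC.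
  - move=> l' ll' el' v; rewrite {1}(coE v).
    have e1 : eps = g' *: sq 1 1 by rewrite /sq mulr1 mul1r scalerA gg scale1r.
    by rewrite (semilinZ is_rmorph_id ll') [in LHS]e1 (semilinZ is_rmorph_id ll') el' scalerA.
have sqn : sq nu nu = s S y0 by rewrite (s_chart h) /sq -expr2 eF.
exists (@RootOb D s S y0 S^o nu sq (locfree_regular S) sqt sqn).
exists h, (1 : S^o); split=> /=; first exact: is_gen1.
  by rewrite /GRing.scale /= mulr1.
by rewrite /sq mulr1 mul1r.
Qed.

(** The generator n1 is replaced by v n1. For v = -1 this turns the section - nu into nu and leaves
    g alone. *)
Lemma cdata_scale (S : comNzRingType) b (y : P S) q nu g (v w : S) :
  w * v = 1 -> cdata b y q (nu * v) g -> cdata b y q nu (g * v ^+ 2).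
Proof.
move=> wv [h [n1 [gn en esq]]]; exists h, (v *: n1); split.
- exact: is_gen_unit wv gn.
- by rewrite en scalerA.
- by rewrite rsqZZ esq scalerA mulrC expr2.
Qed.

End Root.

(** * Objects of the gerbe over fields and power series rings *)

Section HomCast.
Variables (X : rcat) (R S : comNzRingType).
Definition hom_ext (f g : R -> S) (x : X R) (y : X S) (e : f =1 g) (h : hom f x y) :
    hom g x y :=
  eq_rect f (fun g' => hom g' x y) h g (functional_extensionality_dep e).

End HomCast.

Section EtalePoints.

Lemma etcover_big (R : comNzRingType) (U : etcover R) (k : fieldType) (G : R -> pser k) :
  is_rmorph G -> exists (k' : fieldType) (e : {rmorphism k -> k'}) i (h : ec_S i -> pser k'),
    is_rmorph h /\ forall a, h (@ec_f R U i a) = pmap e (G a).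
Proof.
move=> hG; have hg : is_rmorph (@pev k \o G) := is_rmorph_comp hG (rmorphP (@pev k)).
have [i [K [e [h0 [he hh0 h0f]]]]] := ec_surj U hg.
have hGe : is_rmorph (pmap (rmor he) \o G) := is_rmorph_comp hG (rmorphP (pmap (rmor he))).
have [|h [hh hf _]] := etale_lift (ec_etale i) hGe hh0; first by move=> r; rewrite h0f.
by exists K, (rmor he), i, h.
Qed.

Variables (k O : fieldType) (iota : {rmorphism k -> O}).
Hypothesis clO : alg_closed O.
Hypothesis algO : forall x, algebraicOver iota x.
Hypothesis pchark : [pchar k] =i pred0.

(** A geometric point of the covering is determined by the finitely many elements of O to which the
    generators map, so it is defined over a larger Galois extension. *)
Lemma galext_point (R : comNzRingType) (U : etcover R) (E : galext iota) (g : R -> E) :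
  is_rmorph g -> exists (E' : galext iota) (j : galmor E E') i (h : ec_S i -> E'),
    is_rmorph h /\ forall a, h (@ec_f R U i a) = j (g a).
Proof.
move=> hg; have [i [h [hh hf]]] := etcover_point U hg (rmorphP (ge_out E)) clO.
have [hfi [n [x [gen _]]] _] := ec_etale i.
have [E' [j Ej]] := galext_enlarge clO algO pchark E (codom (h \o x)).
have chx l : {y | ge_out E' y = h (x l)}.
  by apply: cid; apply: Ej; apply/codomP; exists l.
have ch s : {y | ge_out E' y = h s}.
  apply: cid; have [p ep] := gen s.
  exists (mmap (j \o rmor hg) (fun l => sval (chx l)) p).
  rewrite rmorph_mmap -ep -[mmap (ec_f i) x p]/(mmap (rmor hfi) x p) -[h _]/(rmor hh _).
  rewrite rmorph_mmap; apply: eq_mmap => [a|l] /=; last exact: (svalP (chx l)).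
  by rewrite gm_out; apply/esym/hf.
exists E', j, i, (fun s => sval (ch s)); split; last first.
  by move=> a; apply: (fmorph_inj (ge_out E')); rewrite (svalP (ch _)) hf gm_out.
have [h1 hD hM] := hh.
split=> [|a b|a b]; apply: (fmorph_inj (ge_out E')); rewrite (svalP (ch _)).
- by rewrite h1 rmorph1.
- by rewrite rmorphD !(svalP (ch _)).
- by rewrite rmorphM !(svalP (ch _)).
Qed.

Lemma galext_lift (R : comNzRingType) (U : etcover R) (E : galext iota) (G : R -> pser E) :
  is_rmorph G -> exists (E' : galext iota) (j : galmor E E') i (h : ec_S i -> pser E'),
    is_rmorph h /\ forall a, h (@ec_f R U i a) = pmap j (G a).
Proof.
move=> hG; have hg : is_rmorph (@pev E \o G) := is_rmorph_comp hG (rmorphP (@pev E)).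
have [E' [j [i [h0 [hh0 h0f]]]]] := galext_point U hg.
have hGe : is_rmorph (pmap j \o G) := is_rmorph_comp hG (rmorphP (pmap j)).
have [|h [hh hf _]] := etale_lift (ec_etale i) hGe hh0; first by move=> r; rewrite h0f.
by exists E', j, i, h.
Qed.
End EtalePoints.

Lemma idomain_sqr1 (S : idomainType) (z : mu2 S) : sval z = 1 \/ sval z = -1.
Proof.
have /eqP := svalP z; rewrite -subr_eq0 -[X in _ - X](expr1n _ 2) subr_sqr mulf_eq0.
by rewrite subr_eq0 addr_eq0 => /orP[] /eqP; [left|right].
Qed.

Section GerbeObjects.
Variables (D : omod P1) (s : osec D) (C : mu2_gerbe (rootstack s)).

Lemma gerbe_fibered : fibered_in_groupoids C.
Proof. by case: (g_stack C). Qed.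

Lemma gerbe_pull (R S : comNzRingType) (f : R -> S) (c : C R) : is_rmorph f ->
  exists d : C S, inhabited (hom f c d).
Proof. by move=> hf; case: gerbe_fibered => h _; apply: h. Qed.

Lemma gerbe_lift (R S T : comNzRingType) (f : R -> S) (g : S -> T) (c : C R) (d : C S)
    (e : C T) (h : hom f c d) (k : hom (fun a => g (f a)) c e) : is_rmorph g ->
  exists l : hom g d e, hcomp h l = k.
Proof.
by move=> hg; case: gerbe_fibered => _ /(_ _ _ _ _ _ _ _ _ h k hg) [l [e' _]]; exists l.
Qed.

Lemma gerbe_lift_uniq (R S T : comNzRingType) (f : R -> S) (g : S -> T) (c : C R) (d : C S)
    (e : C T) (h : hom f c d) (l l' : hom g d e) : hcomp h l = hcomp h l' -> l = l'.
Proof.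
move=> e'; case: gerbe_fibered => _ /(_ _ _ _ _ _ _ _ _ h (hcomp h l) (hom_rm l)) [m [_ u]].
by rewrite -(u l) // (u l').
Qed.

(* Where the canonical section of the square root is nonzero, the root stack is
   a scheme, so that arrows of the gerbe over a given ring map differ by the band. *)
Lemma gerbe_arrows (R : comNzRingType) (S : idomainType) (f : R -> S) (c : C R) (d : C S)
    (h h' : hom f c d) (n1 : rN (gpi C S d)) (nu : S) :
  is_gen n1 -> rn (gpi C S d) = nu *: n1 -> nu != 0 ->
  exists2 z, (sval z = 1 \/ sval z = -1) & h' = hcomp h (gband C d z).
Proof.
move=> gn en nz; have [l el] := gerbe_lift (g := fun a => a) h h' is_rmorph_id.
suff : fmap (gpi C) l = hid (gpi C S d).
  by case/(g_band_im l) => z ez; exists z; [exact: idomain_sqr1|rewrite ez el].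
apply: eq_sig2_pair; first exact: p1hom_uniq.
apply: functional_extensionality_dep => v /=.
have [sl nl _] := svalP (fmap (gpi C) l); move: (sval _).2 sl nl => u sl nl.
have [a ea] := is_gen_ex (u n1) gn.
have ea1 : a = 1.
  have := nl; rewrite en (semilinZ is_rmorph_id sl) ea scalerA => /(is_genZ_inj gn).
  by move/eqP; rewrite -subr_eq0 -{2}[nu]mulr1 -mulrBr mulf_eq0 (negPf nz) /= subr_eq0 => /eqP.
by have [b ->] := is_gen_ex v gn; rewrite (semilinZ is_rmorph_id sl) ea ea1 scale1r.
Qed.

Lemma gerbe_object (R : comNzRingType) (y : rootstack s R) : exists U : etcover R,
  forall i (T : comNzRingType) (h : @ec_S R U i -> T), is_rmorph h ->
    exists c : C T, inhabited (hom (fun a => h (ec_f i a)) y (gpi C T c)).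
Proof.
have [U hU] := g_locally_nonempty C y; exists U => i T h hh.
have [c [k]] := hU i; have [d [l]] := gerbe_pull c hh.
by exists d; apply: inhabits; apply: hcomp k (fmap (gpi C) l).
Qed.

Lemma gerbe_iso (R : comNzRingType) (c c' : C R) :
  inhabited (hom (fun a : R => a) (gpi C R c) (gpi C R c')) -> exists U : etcover R,
  forall i (T : comNzRingType) (h : @ec_S R U i -> T), is_rmorph h ->
    exists d : C T, inhabited (hom (fun a => h (ec_f i a)) c d) /\
                    inhabited (hom (fun a => h (ec_f i a)) c' d).
Proof.
case=> phi; have [U hU] := g_locally_connected phi; exists U => i T h hh.
have [d [a [b _]]] := hU i; have [e [l]] := gerbe_pull d hh.
by exists e; split; apply: inhabits; [apply: hcomp a l|apply: hcomp b l].
Qed.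

Lemma gerbe_object_big (R : comNzRingType) (y : rootstack s R) (k : fieldType) (G : R -> pser k) :
  is_rmorph G -> exists (k' : fieldType) (e : {rmorphism k -> k'}) (c : C (pser k')),
    inhabited (hom (fun a => pmap e (G a)) y (gpi C _ c)).
Proof.
move=> hG; have [U hU] := gerbe_object y.
have [k' [e [i [h [hh hf]]]]] := etcover_big U hG.
by have [c [l]] := hU i _ h hh; exists k', e, c; apply: inhabits; apply: hom_ext l.
Qed.

Lemma gerbe_iso_field (k : fieldType) (c c' : C k) :
  inhabited (hom (fun a : k => a) (gpi C _ c) (gpi C _ c')) ->
  exists (k' : fieldType) (e : {rmorphism k -> k'}) (d : C k'),
    inhabited (hom e c d) /\ inhabited (hom e c' d).
Proof.
move=> /gerbe_iso[U hU].
have [i [k' [e [h [he hh hf]]]]] := ec_surj U (@is_rmorph_id k).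
have [d [[l] [l']]] := hU i _ h hh; exists k', (rmor he), d.
by split; apply: inhabits; [apply: hom_ext l|apply: hom_ext l'].
Qed.

Variables (k O : fieldType) (iota : {rmorphism k -> O}).
Hypothesis clO : alg_closed O.
Hypothesis algO : forall x, algebraicOver iota x.
Hypothesis pchark : [pchar k] =i pred0.

Lemma gerbe_object_galext (R : comNzRingType) (y : rootstack s R) (E : galext iota) (g : R -> E) :
  is_rmorph g -> exists (E' : galext iota) (j : galmor E E') (c : C E'),
    inhabited (hom (fun a => j (g a)) y (gpi C _ c)).
Proof.
move=> hg; have [U hU] := gerbe_object y.
have [E' [j [i [h [hh hf]]]]] := galext_point clO algO pchark U hg.
by have [c [l]] := hU i _ h hh; exists E', j, c; apply: inhabits; apply: hom_ext l.
Qed.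

Lemma gerbe_object_lift (R : comNzRingType) (y : rootstack s R) (E : galext iota) (G : R -> pser E) :
  is_rmorph G -> exists (E' : galext iota) (j : galmor E E') (c : C (pser E')),
    inhabited (hom (fun a => pmap j (G a)) y (gpi C _ c)).
Proof.
move=> hG; have [U hU] := gerbe_object y.
have [E' [j [i [h [hh hf]]]]] := galext_lift clO algO pchark U hG.
by have [c [l]] := hU i _ h hh; exists E', j, c; apply: inhabits; apply: hom_ext l.
Qed.

Lemma gerbe_iso_lift (R : comNzRingType) (c c' : C R) (E : galext iota) (G : R -> pser E) :
  inhabited (hom (fun a : R => a) (gpi C R c) (gpi C R c')) -> is_rmorph G ->
  exists (E' : galext iota) (j : galmor E E') (d : C (pser E')),
    inhabited (hom (fun a => pmap j (G a)) c d) /\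
    inhabited (hom (fun a => pmap j (G a)) c' d).
Proof.
move=> /gerbe_iso[U hU] hG.
have [E' [j [i [h [hh hf]]]]] := galext_lift clO algO pchark U hG.
have [d [[l] [l']]] := hU i _ h hh; exists E', j, d.
by split; apply: inhabits; [apply: hom_ext l|apply: hom_ext l'].
Qed.
End GerbeObjects.

(** * Biquaternion algebras acting on a space of linear maps *)

Section SubAlgebra.
Variables (K : fieldType) (H : algType K) (P : H -> Prop).
Definition subalg_prop := [/\ P 1, forall c a b, P a -> P b -> P (c *: a + b) &
  forall a b, P a -> P b -> P (a * b)].
Hypothesis hP : subalg_prop.
Definition subalg_pred (_ : subalg_prop) : {pred H} := fun h => `[< P h >].
Fact subalg_pred_closed : subalg_closed (subalg_pred hP).
Proof.
case: hP => P1 PZ PM; split; first exact/asboolP.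
  by move=> c a b /asboolP pa /asboolP pb; apply/asboolP/PZ.
by move=> a b /asboolP pa /asboolP pb; apply/asboolP/PM.
Qed.
HB.instance Definition _ := GRing.isSubalgClosed.Build K H (subalg_pred hP) subalg_pred_closed.
Record subalg_type := SubAlg { subalg_val : H; _ : subalg_val \in subalg_pred hP }.
HB.instance Definition _ := [isSub for subalg_val].
HB.instance Definition _ := [Choice of subalg_type by <:].
HB.instance Definition _ := [SubChoice_isSubAlgebra of subalg_type by <:].

Lemma subalg_val_hom : is_alghom (subalg_val : subalg_type -> H).
Proof. by split; first by split. Qed.
End SubAlgebra.

Lemma alghom_id (K : fieldType) (H : algType K) : is_alghom (fun a : H => a).
Proof. by split; first by split. Qed.

Lemma alghom_comp (K : fieldType) (A B C : algType K) (f : A -> B) (g : B -> C) :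
  is_alghom f -> is_alghom g -> is_alghom (fun a => g (f a)).
Proof.
move=> [hf fZ] [hg gZ]; split; first exact: is_rmorph_comp.
by move=> c a; rewrite fZ gZ.
Qed.

(** The universal property maps H to the subalgebra defined by P. Followed by the inclusion, this
    map fixes x and y, so it is the identity by uniqueness. *)
Lemma quaternion_generated (K : fieldType) (a b : K) (H : algType K) : is_quaternion a b H ->
  exists x y : H, quat_rel a b x y /\
    forall P, subalg_prop P -> P x -> P y -> forall h : H, P h.
Proof.
move=> [x [y [rel univ]]]; exists x, y; split=> // P hP Px Py h.
pose S := subalg_type hP.
pose x' : S := SubAlg (introT (asboolP _) Px : x \in subalg_pred hP).
pose y' : S := SubAlg (introT (asboolP _) Py : y \in subalg_pred hP).
have rel' : quat_rel a b x' y'.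
  by case: rel => e1 e2 e3; split; apply: val_inj.
have [f [hf [fx fy] _]] := univ S x' y' rel'.
have [g [_ _ u]] := univ H x y rel.
have e1 := u _ (alghom_comp hf (subalg_val_hom hP)).
have e2 := u _ (alghom_id H) erefl erefl.
have eh : subalg_val (f h) = h.
  by rewrite e1 ?fx ?fy // -e2.
by rewrite -eh; case: (f h) => z /= /asboolP.
Qed.

Lemma algtensor_generated (K : fieldType) (H1 H2 A : algType K) : is_algtensor H1 H2 A ->
  exists (i : H1 -> A) (j : H2 -> A),
    [/\ is_alghom i, is_alghom j, forall x y, i x * j y = j y * i x &
      forall P, subalg_prop P -> (forall x, P (i x)) -> (forall y, P (j y)) -> forall h : A, P h].
Proof.
move=> [i [j [hi hj cij univ]]]; exists i, j; split=> // P hP Pi Pj h.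
pose S := subalg_type hP.
pose i' x : S := SubAlg (introT (asboolP _) (Pi x) : i x \in subalg_pred hP).
pose j' x : S := SubAlg (introT (asboolP _) (Pj x) : j x \in subalg_pred hP).
have hi' : is_alghom i'.
  case: hi => [[e1 eD eM] eZ]; split; first by split=> [|u v|u v]; apply: val_inj; rewrite /= ?e1 ?eD ?eM.
  by move=> u v; apply: val_inj; rewrite /= eZ.
have hj' : is_alghom j'.
  case: hj => [[e1 eD eM] eZ]; split; first by split=> [|u v|u v]; apply: val_inj; rewrite /= ?e1 ?eD ?eM.
  by move=> u v; apply: val_inj; rewrite /= eZ.
have [|f [hf [fi fj] _]] := univ S i' j' hi' hj'.
  by move=> x y; apply: val_inj => /=.
have [g [_ _ u]] := univ A i j hi hj cij.
have e1 := u _ (alghom_comp hf (subalg_val_hom hP)).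
have e2 := u _ (alghom_id A) (fun _ => erefl) (fun _ => erefl).
have eh : subalg_val (f h) = h.
  by rewrite e1 => [|x|y]; rewrite ?fi ?fj // -e2.
by rewrite -eh; case: (f h) => z /= /asboolP.
Qed.

Record biquat_gens (K : fieldType) (a b c d : K) (A : algType K) (i1 j1 i2 j2 : A) : Prop := {
  bq_rel1 : quat_rel a b i1 j1;
  bq_rel2 : quat_rel c d i2 j2;
  bq_comm : [/\ i1 * i2 = i2 * i1, i1 * j2 = j2 * i1, j1 * i2 = i2 * j1 & j1 * j2 = j2 * j1];
  bq_gen : forall P, subalg_prop P -> P i1 -> P j1 -> P i2 -> P j2 -> forall h : A, P h }.

Lemma biquaternion_gens (K : fieldType) (a b c d : K) (H1 H2 A : algType K) :
  is_quaternion a b H1 -> is_quaternion c d H2 -> is_algtensor H1 H2 A ->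
  exists i1 j1 i2 j2 : A, biquat_gens a b c d i1 j1 i2 j2.
Proof.
move=> /quaternion_generated[x1 [y1 [rel1 gen1]]] /quaternion_generated[x2 [y2 [rel2 gen2]]].
move=> /algtensor_generated[i [j [hi hj cij gen]]].
have rel (H : algType K) (u v : K) (x y : H) (f : H -> A) : is_alghom f -> quat_rel u v x y ->
    quat_rel u v (f x) (f y).
  move=> [hm eZ] [r1 r2 r3]; have [e1 eD eM] := hm.
  split; rewrite -?eM ?r1 ?r2 ?eZ ?e1 // r3 -[LHS]/(rmor hm _) rmorphN.
  by [].
exists (i x1), (i y1), (j x2), (j y2); split=> //; [exact: rel hi rel1|exact: rel hj rel2|].
move=> P hP P1 P2 P3 P4; have [Pone PZ PM] := hP.
have pull (H : algType K) (f : H -> A) : is_alghom f -> subalg_prop (fun h => P (f h)).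
  move=> [[e1 eD eM] eZ]; split=> [|u v w pv pw|v w pv pw]; first by rewrite e1.
    by rewrite eD eZ; apply: PZ.
  by rewrite eM; apply: PM.
by apply: gen => // [x|y]; [apply: (gen1 _ (pull _ _ hi))|apply: (gen2 _ (pull _ _ hj))].
Qed.

Section JointEigenline.
Variables (K : fieldType) (A : algType K) (E : fieldType) (W : lmodType E) (q : K -> E).
Variable act : A -> W -> W.
Hypothesis hq : is_rmorph q.
Hypothesis act_lin : forall a, is_lin (act a).
Hypothesis act1 : forall v, act 1 v = v.
Hypothesis actM : forall a b v, act (a * b) v = act a (act b v).
Hypothesis actD : forall k a b v, act (k *: a + b) v = q k *: act a v + act b v.
Variables (r : nat) (bW : 'I_r -> W).
Hypotheses (r0 : (0 < r)%N) (hbW : is_basis bW).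
Variables (n : nat) (bA : 'I_n -> A).
Hypothesis act_end : forall phi : W -> W, is_lin phi -> exists c : 'I_n -> E,
  forall v, phi v = \sum_i c i *: act (bA i) v.
Variables (a b c d : K) (i1 j1 i2 j2 : A).
Hypothesis gens : biquat_gens a b c d i1 j1 i2 j2.
Variables (al be : E).
Hypotheses (eal : al ^+ 2 = q a) (ebe : be ^+ 2 = q c).
Hypotheses (nal : al != 0) (nbe : be != 0) (nb : q b != 0) (nd : q d != 0) (n2 : (2%:R : E) != 0).

Let actZ x k v : act x (k *: v) = k *: act x v.
Proof. exact: semilinZ is_rmorph_id (act_lin x) _ _. Qed.
Let actDr x v w : act x (v + w) = act x v + act x w.
Proof. exact: semilinD is_rmorph_id (act_lin x) _ _. Qed.
Let actN x v : act x (- v) = - act x v.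
Proof. exact: semilinN is_rmorph_id (act_lin x) _. Qed.
Let qN1 : q (-1) = -1. Proof. exact: rmorphN1 (rmor hq). Qed.
Let act0 v : act 0 v = 0.
Proof. by have := actD (-1) 1 1 v; rewrite scaleN1r addNr qN1 scaleN1r addNr. Qed.
Let actNl x v : act (- x) v = - act x v.
Proof.
by have := actD (-1) x 0 v; rewrite scaleN1r addr0 act0 addr0 qN1 scaleN1r.
Qed.
Let actA k v : act k%:A v = q k *: v.
Proof. by have := actD k 1 0 v; rewrite act1 act0 !addr0. Qed.

Definition joint_eigen (w : W) := act i1 w = al *: w /\ act i2 w = be *: w.

Let anti x y v : x * y = - (y * x) -> act x (act y v) = - act y (act x v).
Proof. by move=> e; rewrite -!actM e actNl. Qed.
Let com x y v : x * y = y * x -> act x (act y v) = act y (act x v).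
Proof. by move=> e; rewrite -!actM e. Qed.

Let j1sq v : act j1 (act j1 v) = q b *: v.
Proof. by case: gens => -[_ e _] _ _ _; rewrite -actM e actA. Qed.
Let j2sq v : act j2 (act j2 v) = q d *: v.
Proof. by case: gens => _ [_ e _] _ _; rewrite -actM e actA. Qed.

Let inj_sq x k v : (forall v, act x (act x v) = k *: v) -> k != 0 -> v != 0 -> act x v != 0.
Proof.
move=> e nk; apply: contraNneq => h; have := e v; rewrite h (semilin0 is_rmorph_id (act_lin x)).
by move/esym/eqP; rewrite scaler_eq0 (negPf nk).
Qed.

Lemma joint_eigen_exists : exists w0, w0 != 0 /\ joint_eigen w0.
Proof.
have [[e11 _ an1] [e22 _ an2] [c1 c2 c3 c4] _] := gens.
pose v := bW (Ordinal r0).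
have nv : v != 0.
  apply/eqP=> v0; have z : \sum_l (l == Ordinal r0)%:R *: bW l = 0.
    by rewrite (bigD1 (Ordinal r0)) //= -/v v0 scaler0 add0r big1 // => l /negPf ->; rewrite scale0r.
  have /eqP := is_basis_free hbW z (Ordinal r0).
  by rewrite eqxx oner_eq0.
(* Either e v' + x v' is an eigenvector of x for e, or v' is one for - e and y moves it to e. The
   explicit form of the result shows that the second application, to i2 and j2, does not leave the
   eigenspace of i1. *)
have step x y k e u v' : x * x = k%:A -> e ^+ 2 = q k -> e != 0 -> x * y = - (y * x) ->
    (forall v, act y (act y v) = u *: v) -> u != 0 -> v' != 0 ->
    exists w, [/\ w != 0, act x w = e *: w & exists z k1 k2, (z = v' \/ z = act y v') /\ w = k1 *: z + k2 *: act x z].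
  move=> xx ee ne an yy nu nv'.
  have xxv z : act x (act x z) = (e * e) *: z by rewrite -actM xx actA -ee expr2.
  case: (eqVneq (e *: v' + act x v') 0) => [z|nz].
    exists (act y v'); split; first exact: inj_sq yy nu nv'.
      rewrite anti //; have -> : act x v' = - (e *: v') by apply/eqP; rewrite -addr_eq0 addrC z.
      by rewrite actN opprK actZ.
    exists (act y v'), 1, 0; split; first by right.
    by rewrite scale1r scale0r addr0.
  exists (e *: v' + act x v'); split=> //; first by rewrite actDr actZ xxv scalerDr scalerA addrC.
  by exists v', e, 1; split; [left|rewrite scale1r].
have [v1 [nv1 ev1 _]] := step _ _ _ _ _ _ e11 eal nal an1 j1sq nb nv.
have [v2 [nv2 ev2 [z [k1 [k2 [ez ew]]]]]] := step _ _ _ _ _ _ e22 ebe nbe an2 j2sq nd nv1.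
exists v2; split=> //; split=> //.
have ez1 : act i1 z = al *: z by case: ez => ->; [|rewrite com // ev1 actZ].
by rewrite ew actDr !actZ com // ez1 actZ scalerDr !scalerA ![al * _]mulrC.
Qed.

Let flip_i1 v e : act i1 v = e *: v -> act i1 (act j1 v) = - (e *: act j1 v).
Proof. by move=> h; case: gens => -[_ _ an] _ _ _; rewrite anti // h actZ. Qed.
Let flip_i2 v e : act i2 v = e *: v -> act i2 (act j2 v) = - (e *: act j2 v).
Proof. by move=> h; case: gens => _ [_ _ an] _ _; rewrite anti // h actZ. Qed.

Lemma joint_eigen_line w0 w : w0 != 0 -> joint_eigen w0 -> joint_eigen w ->
  exists k, w = k *: w0.
Proof.
move=> nw0 [e1 e2] [f1 f2]; have [[e11 _ an1] [e22 _ an2] [c1 c2 c3 c4] gen] := gens.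
have e12 : act i1 (act j2 w0) = al *: act j2 w0 by rewrite com // e1 actZ.
(* The span of the images of w0 under 1, j1, j2 and j1 j2 is stable under A. *)
pose T v := exists k0 k1 k2 k3,
  v = k0 *: w0 + k1 *: act j1 w0 + k2 *: act j2 w0 + k3 *: act j1 (act j2 w0).
have TD u v : T u -> T v -> T (u + v).
  move=> [k0 [k1 [k2 [k3 ->]]]] [l0 [l1 [l2 [l3 ->]]]].
  exists (k0 + l0), (k1 + l1), (k2 + l2), (k3 + l3); rewrite !scalerDl.
  rewrite addrACA; congr (_ + _); rewrite addrACA; congr (_ + _).
  by rewrite addrACA.
have TZ k u : T u -> T (k *: u).
  move=> [k0 [k1 [k2 [k3 ->]]]]; exists (k * k0), (k * k1), (k * k2), (k * k3).
  by rewrite !scalerDr !scalerA.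
have T0 : T w0 by exists 1, 0, 0, 0; rewrite scale1r !scale0r !addr0.
have T1 : T (act j1 w0) by exists 0, 1, 0, 0; rewrite scale1r !scale0r !addr0 add0r.
have T2 : T (act j2 w0) by exists 0, 0, 1, 0; rewrite scale1r !scale0r !addr0 !add0r.
have T3 : T (act j1 (act j2 w0)) by exists 0, 0, 0, 1; rewrite scale1r !scale0r !add0r.
have TN u : T u -> T (- u) by rewrite -scaleN1r; apply: TZ.
have stab x : T (act x w0) -> T (act x (act j1 w0)) -> T (act x (act j2 w0)) ->
    T (act x (act j1 (act j2 w0))) -> forall v, T v -> T (act x v).
  move=> t0 t1 t2 t3 v [k0 [k1 [k2 [k3 ->]]]]; rewrite !actDr !actZ.
  by apply: (TD); last apply: (TZ) => //; apply: (TD); last apply: (TZ) => //;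
     apply: (TD); apply: (TZ).
have all x v : T v -> T (act x v).
  move: x v; apply: (gen (fun x => forall v, T v -> T (act x v))).
  - split=> [v|k x y hx hy v tv|x y hx hy v tv]; first by rewrite act1.
      by rewrite actD; apply: (TD); [apply/TZ/hx|apply: hy].
    by rewrite actM; apply/hx/hy.
  - apply: stab; rewrite ?e1; [exact: TZ|by rewrite (flip_i1 e1); apply/TN/TZ| |].
      by rewrite com // e1 actZ; apply: TZ.
    by rewrite (@flip_i1 _ al) ?e12 //; apply/TN/TZ.
  - apply: stab => //; rewrite ?j1sq; exact: TZ.
  - apply: stab; rewrite ?e2; [exact: TZ|by rewrite com // e2 actZ; apply: TZ| |].
      by rewrite (flip_i2 e2); apply/TN/TZ.
    by rewrite com // (flip_i2 e2) actN actZ; apply/TN/TZ.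
  - apply: stab => //; rewrite ?j2sq; [by rewrite com|exact: TZ|].
    by rewrite com // j2sq actZ; apply: TZ.
have Tw : T w.
  have [l nl] : exists l, coords hbW w0 l != 0.
    apply: contrapT => h; case/eqP: nw0; rewrite (coordsE hbW w0) big1 // => l _.
    by apply/eqP; rewrite scaler_eq0; apply/orP; left; apply/negPn/negP => nz; apply: h; exists l.
  (* An endomorphism of rank at most one that sends w0 to w. It is a combination of elements of A,
     so w lies in T. *)
  pose phi v := (coords hbW v l / coords hbW w0 l) *: w.
  have lphi : is_lin phi.
    move=> k u v; rewrite /phi scalerA -scalerDl mulrA -mulrDl; congr (_ / _ *: _).
    apply: (coords_uniq hbW (c := fun l => k * coords hbW u l + coords hbW v l)).
    transitivity (k *: (\sum_j coords hbW u j *: bW j) + \sum_j coords hbW v j *: bW j).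
      by rewrite -!coordsE.
    rewrite scaler_sumr -big_split; apply: eq_bigr => j _.
    by rewrite scalerDl scalerA.
  have [cc ecc] := act_end lphi.
  have -> : w = phi w0 by rewrite /phi divff // scale1r.
  rewrite ecc; elim/big_rec: _ => [|j y _ ty]; last by apply: (TD) => //; apply/TZ/all.
  by exists 0, 0, 0, 0; rewrite !scale0r !addr0.
have [k0 [k1 [k2 [k3 ew]]]] := Tw; exists k0.
have h2 (v : W) : v = - v -> v = 0.
  move/eqP; rewrite -subr_eq0 opprK -mulr2n -scaler_nat scaler_eq0 (negPf n2) /=.
  by move/eqP.
(* i1 acts by al on u0 and by - al on u1, which forces u1 = 0; then i2 separates the two terms of u0
   in the same way. *)
pose u0 := k0 *: w0 + k2 *: act j2 w0; pose u1 := k1 *: act j1 w0 + k3 *: act j1 (act j2 w0).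
have ewu : w = u0 + u1 by rewrite ew /u0 /u1 !addrA; congr (_ + _); rewrite -!addrA; congr (_ + _); rewrite addrC.
have a0 : act i1 u0 = al *: u0.
  by rewrite /u0 actDr !actZ com // e1 actZ scalerDr !scalerA ![al * _]mulrC.
have a1 : act i1 u1 = - (al *: u1).
  rewrite /u1 actDr !actZ (flip_i1 e1) (@flip_i1 _ al) ?e12 //.
  by rewrite !scalerN scalerDr !scalerA ![al * _]mulrC opprD.
have u10 : u1 = 0.
  apply/eqP; rewrite -(inj_eq (scalerI nal)) scaler0; apply/eqP/h2.
  apply: (addrI (al *: u0)); rewrite -[LHS]scalerDr -ewu -f1 ewu.
  by rewrite actDr a0 a1.
have w_u0 : w = u0 by rewrite ewu u10 addr0.
have b0 : act i2 (k0 *: w0) = be *: (k0 *: w0) by rewrite actZ e2 !scalerA mulrC.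
have b1 : act i2 (k2 *: act j2 w0) = - (be *: (k2 *: act j2 w0)).
  by rewrite actZ (flip_i2 e2) scalerN !scalerA mulrC.
have : k2 *: act j2 w0 = 0.
  apply/eqP; rewrite -(inj_eq (scalerI nbe)) scaler0; apply/eqP/h2.
  apply: (addrI (be *: (k0 *: w0))); rewrite -[LHS]scalerDr -/u0 -w_u0 -f2 w_u0.
  by rewrite actDr b0 b1.
by move=> z; rewrite w_u0 /u0 z addr0.
Qed.

Definition mono (d1 d2 : bool) (v : W) : W :=
  let v' := if d2 then act j2 v else v in if d1 then act j1 v' else v'.

Lemma monoZ d1 d2 k v : mono d1 d2 (k *: v) = k *: mono d1 d2 v.
Proof. by case: d1 d2 => -[]; rewrite /mono ?actZ. Qed.

Lemma mono_mono d1 d2 e1 e2 v : mono d1 d2 (mono e1 e2 v) =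
  (q b ^+ (d1 && e1) * q d ^+ (d2 && e2)) *: mono (d1 (+) e1) (d2 (+) e2) v.
Proof.
have [_ _ [_ _ _ c4] _] := gens.
have c' w : act j2 (act j1 w) = act j1 (act j2 w) by rewrite com.
by case: d1; case: d2; case: e1; case: e2;
  rewrite /mono /= ?expr0 ?expr1 ?mulr1 ?mul1r ?scale1r ?c' ?j1sq ?j2sq ?actZ ?scalerA.
Qed.

Lemma mono_neq0 d1 d2 v : v != 0 -> mono d1 d2 v != 0.
Proof.
move=> nv; have h2 : act j2 v != 0 by apply: inj_sq j2sq nd nv.
by case: d1; case: d2; rewrite /mono //=; apply: inj_sq j1sq nb _.
Qed.

Lemma mono_eigen (d1 d2 e1 e2 : bool) w :
  act i1 w = ((-1) ^+ e1 * al) *: w -> act i2 w = ((-1) ^+ e2 * be) *: w ->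
  act i1 (mono d1 d2 w) = ((-1) ^+ (d1 (+) e1) * al) *: mono d1 d2 w /\
  act i2 (mono d1 d2 w) = ((-1) ^+ (d2 (+) e2) * be) *: mono d1 d2 w.
Proof.
have [_ _ [c1 c2 c3 c4] _] := gens => h1 h2.
have g1 : act i1 (act j2 w) = ((-1) ^+ e1 * al) *: act j2 w by rewrite com // h1 actZ.
have g2 : act i2 (act j2 w) = ((-1) ^+ (~~ e2) * be) *: act j2 w.
  by rewrite (flip_i2 h2) -scaleNr -mulNr; congr (_ * _ *: _); case: (e2); rewrite ?opprK.
have f1 (e : bool) v : act i1 v = ((-1) ^+ e * al) *: v ->
    act i1 (act j1 v) = ((-1) ^+ (~~ e) * al) *: act j1 v.
  by move=> h; rewrite (flip_i1 h) -scaleNr -mulNr; congr (_ * _ *: _); case: (e); rewrite ?opprK.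
have f2 e v : act i2 v = e *: v -> act i2 (act j1 v) = e *: act j1 v.
  by move=> h; rewrite (com v (esym c3)) h actZ.
case: d1; case: d2; rewrite /mono ?addTb ?addFb; split; rewrite ?(f1 e1) //.
- exact: f2 g2.
- exact: f2 h2.
Qed.

Lemma joint_eigen_signed w0 w (d1 d2 : bool) : w0 != 0 -> joint_eigen w0 ->
  act i1 w = ((-1) ^+ d1 * al) *: w -> act i2 w = ((-1) ^+ d2 * be) *: w ->
  exists k, w = k *: mono d1 d2 w0.
Proof.
move=> nw0 hw0 h1 h2; have [f1 f2] := mono_eigen d1 d2 h1 h2.
have [k ek] : exists k, mono d1 d2 w = k *: w0.
  by apply: joint_eigen_line nw0 hw0 _; split; rewrite ?f1 ?f2 addbb expr0 mul1r.
have nu : q b ^+ d1 * q d ^+ d2 != 0 by rewrite mulf_neq0 ?expf_neq0.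
exists ((q b ^+ d1 * q d ^+ d2)^-1 * k); rewrite -scalerA -monoZ -ek mono_mono !andbb !addbb.
by rewrite scalerA mulVf // scale1r.
Qed.
End JointEigenline.

(** * Arrows over varying ring maps *)

Section Arr.
Variable X : rcat.

(** The ring map is part of the arrow, so that arrows can be compared by plain equality when their
    ring maps are equal but not convertible. *)
Record arr (R S : comNzRingType) (x : X R) (y : X S) := Arr { afun : R -> S; ahom : hom afun x y }.
Arguments Arr {R S x y afun} ahom.

Definition acomp (R S T : comNzRingType) (x : X R) (y : X S) (z : X T)
    (a : arr x y) (b : arr y z) : arr x z := Arr (hcomp (ahom a) (ahom b)).

Lemma acompA (R S T W : comNzRingType) (x : X R) (y : X S) (z : X T) (w : X W)
    (a : arr x y) (b : arr y z) (c : arr z w) :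
  acomp a (acomp b c) = acomp (acomp a b) c.
Proof. by rewrite /acomp /= hcompA. Qed.

Lemma arr_rm (R S : comNzRingType) (x : X R) (y : X S) (a : arr x y) : is_rmorph (afun a).
Proof. exact: hom_rm (ahom a). Qed.

Lemma Arr_hom_ext (R S : comNzRingType) (x : X R) (y : X S) (f g : R -> S) (e : f =1 g)
  (h : hom f x y) : Arr (hom_ext e h) = Arr h.
Proof. by rewrite /hom_ext; case: _ / (functional_extensionality_dep e). Qed.

Lemma arr_inj (R S : comNzRingType) (x : X R) (y : X S) (f : R -> S) (h h' : hom f x y) :
  Arr h = Arr h' -> h = h'.
Proof.
have aux (a : arr x y) : Arr h = a -> forall p : afun a = f,
    h = eq_rect _ (fun g => hom g x y) (ahom a) _ p.
  by move=> <- p; rewrite (Prop_irrelevance p erefl).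
by move=> /aux /(_ erefl).
Qed.

Lemma arr_over (R S : comNzRingType) (x : X R) (y : X S) (a : arr x y) (f : R -> S) :
  afun a =1 f -> exists h : hom f x y, Arr h = a.
Proof. by move=> e; exists (hom_ext e (ahom a)); rewrite Arr_hom_ext; case: a e. Qed.

Definition avmap (V : omod X) (R S : comNzRingType) (x : X R) (y : X S) (a : arr x y) :
  V R x -> V S y := vmap V (ahom a).
Arguments avmap V {R S x y} a v.

Lemma avmap_comp (V : omod X) (R S T : comNzRingType) (x : X R) (y : X S) (z : X T)
    (a : arr x y) (b : arr y z) v : avmap V (acomp a b) v = avmap V b (avmap V a v).
Proof. exact: vmap_comp. Qed.

Lemma avmap_semilin (V : omod X) (R S : comNzRingType) (x : X R) (y : X S) (a : arr x y) :
  semilin (afun a) (avmap V a).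
Proof. exact: vmap_semilin. Qed.

End Arr.

Arguments Arr {X R S x y afun} ahom.
Arguments avmap {X} V {R S x y} a v.

Section ArrSub.
Variables (X : rcat) (R : comNzRingType)
  (P : forall S : comNzRingType, (R -> S) -> X S -> Prop).

Lemma bcsub_arr (S T : comNzRingType) (x : bcsub P S) (y : bcsub P T) (a : arr (bpt x) (bpt y)) :
  (forall r, afun a (bmap x r) = bmap y r) ->
  exists b : arr x y, Arr (sval (ahom b)) = a.
Proof. by move=> e; exists (@Arr (bcsub P) _ _ x y (afun a) (exist _ (ahom a) e)); case: a e. Qed.

Lemma bcsub_arr_inj (S T : comNzRingType) (x : bcsub P S) (y : bcsub P T) (b b' : arr x y) :
  Arr (sval (ahom b)) = Arr (sval (ahom b')) -> b = b'.
Proof.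
case: b b' => [f h] [f' h'] /= e.
have ef : f = f' by have := congr1 (@afun _ _ _ _ _) e.
subst f'; congr Arr; move: (arr_inj e) => e'.
by case: h h' e e' => [h p] [h' p'] /= _ e'; subst h'; congr exist; apply: Prop_irrelevance.
Qed.
End ArrSub.

Section GerbeArr.
Variables (D : omod P1) (s : osec D) (C : mu2_gerbe (rootstack s)).

Lemma garr_pull (R S : comNzRingType) (f : R -> S) (c : C R) : is_rmorph f ->
  exists (d : C S) (a : arr c d), afun a = f.
Proof. by move=> hf; have [d [h]] := gerbe_pull c hf; exists d, (Arr h). Qed.

Lemma garr_lift (R S T : comNzRingType) (c : C R) (d : C S) (e : C T) (h : arr c d)
    (k : arr c e) (g : S -> T) : is_rmorph g -> (forall a, afun k a = g (afun h a)) ->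
  exists l : arr d e, acomp h l = k /\ afun l = g.
Proof.
move=> hg e'; have [k' ek] := arr_over e'.
have [l el] := gerbe_lift (ahom h) k' hg; exists (Arr l); split=> //.
by rewrite -ek /acomp /= el.
Qed.

Lemma garr_lift_uniq (R S T : comNzRingType) (c : C R) (d : C S) (e : C T) (h : arr c d)
    (l l' : arr d e) : afun l =1 afun l' -> acomp h l = acomp h l' -> l = l'.
Proof.
move=> e0; have ef := functional_extensionality_dep e0.
case: l l' e0 ef => [f l] [f' l'] /= _ ef; subst f'.
by move=> /arr_inj /gerbe_lift_uniq e1; congr Arr; exact: e1.
Qed.

Definition aband (R : comNzRingType) (c : C R) (z : mu2 R) : arr c c := Arr (gband C c z).

Lemma aband_nat (R S : comNzRingType) (c : C R) (d : C S) (a : arr c d) (z : mu2 R) (w : mu2 S) :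
  sval w = afun a (sval z) -> acomp (aband c z) a = acomp a (aband d w).
Proof. by move=> e; rewrite /acomp /=; congr Arr; apply: g_band_nat. Qed.

Lemma mu2_push (R S : comNzRingType) (f : R -> S) (z : mu2 R) : is_rmorph f ->
  exists w : mu2 S, sval w = f (sval z).
Proof.
case=> f1 _ fM; have e : f (sval z) ^+ 2 = 1 by rewrite expr2 -fM -expr2 (svalP z).
by exists (exist (fun w : S => w ^+ 2 = 1) _ e).
Qed.

Lemma garr_band (R : comNzRingType) (S : idomainType) (c : C R) (d : C S) (a a' : arr c d)
    (n1 : rN (gpi C S d)) (nu : S) :
  is_gen n1 -> rn (gpi C S d) = nu *: n1 -> nu != 0 -> afun a =1 afun a' ->
  exists2 z, (sval z = 1 \/ sval z = -1) & a' = acomp a (aband d z).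
Proof.
move=> gn en nz e; have ef := functional_extensionality_dep e.
case: a a' e ef => [f h] [f' h'] /= _ ef; subst f'; have [z hz e] := gerbe_arrows h h' gn en nz.
by exists z => //; rewrite /acomp /= -e.
Qed.
End GerbeArr.

(** * The generic fibre over a ramified power series point *)

Lemma rat_hom_uniq (R : nzRingType) (f g : {rmorphism rat -> R}) : f =1 g.
Proof.
move=> x; have nd : (denq x)%:~R != 0 :> rat by rewrite intr_eq0 denq_neq0.
have e (h : {rmorphism rat -> R}) : h x * (denq x)%:~R = (numq x)%:~R.
  by rewrite -!(rmorph_int h) -rmorphM -{1}(divq_num_den x) divfK.
have u : (denq x)%:~R * f ((denq x)%:~R^-1) = 1 :> R.
  by rewrite -(rmorph_int f) -rmorphM divff // rmorph1.
by rewrite -[LHS]mulr1 -[RHS]mulr1 -u !mulrA !e.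
Qed.

Lemma ratpoly_hom_uniq (R : nzRingType) (f g : {rmorphism {poly rat} -> R}) :
  f 'X = g 'X -> f =1 g.
Proof.
move=> e p; elim/poly_ind: p => [|p c IH]; first by rewrite !rmorph0.
rewrite !rmorphD !rmorphM IH e; congr (_ + _).
exact: (@rat_hom_uniq _ (f \o polyC) (g \o polyC) c).
Qed.

Lemma fraction_hom_uniq (R : idomainType) (F : fieldType) (f g : {rmorphism {fraction R} -> F}) :
  (forall a, f (tofrac a) = g (tofrac a)) -> f =1 g.
Proof.
move=> e x; have [a [b [nb ->]]] := fraction_div x.
by rewrite !fmorph_div !e.
Qed.

Section PolyAt.
Variables (k : fieldType) (qr : {rmorphism rat -> k}).
Definition qpoly_at (tau : pser k) : {rmorphism {poly rat} -> pser k} :=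
  pev_at tau \o map_poly qr.
Lemma qpoly_at_X tau : qpoly_at tau 'X = tau.
Proof. by rewrite /= map_polyX -[LHS]/(pev_at tau 'X) pev_at_X. Qed.
Lemma qpoly_at_C tau c : qpoly_at tau c%:P = pconst (qr c).
Proof. by rewrite /= map_polyC -[LHS]/(pev_at tau (qr c)%:P) pev_atC. Qed.
Lemma qpoly_at_inj a e : (0 < e)%N -> injective (qpoly_at (ramif a e)).
Proof. by move=> e0; apply: inj_comp (pev_ramif_inj e0) (map_poly_inj qr). Qed.
End PolyAt.

Section LocalW.
Variables (D : omod P1) (s : osec D) (C : mu2_gerbe (rootstack s)).
Variables (A : algType Qt) (hC : has_brauer_class C A) (i1 j1 i2 j2 : A).
Hypothesis gens : biquat_gens (17%:R : Qt) tvar (13%:R : Qt) ((tvar - 1) * (tvar - 11%:R)) i1 j1 i2 j2.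
Variables (k : fieldType) (qr : {rmorphism rat -> k}) (t0 : k) (e : nat) (e0 : (0 < e)%N).
Local Notation tau := (ramif t0 e).
Local Notation S := (pser k).
Local Notation F := ({fraction (pser k)}).
Variable c : C S.
Hypothesis atc : P1at false (rpt (gpi C S c)) tau.
Variables (al be : k).
Hypotheses (eal : al ^+ 2 = 17%:R) (ebe : be ^+ 2 = 13%:R).

(** Injectivity extends the ring map to the fraction field, and fixing the coordinate makes the
    extension a map over Q(t); hence [a] acts on the generic fibre. *)
Definition admissible (a : arr c c) := exists f : {rmorphism S -> S},
  [/\ injective f, afun a =1 f & f tau = tau].
Definition sgn_al (a : arr c c) : bool := afun a (pconst al) != pconst al.
Definition sgn_be (a : arr c c) : bool := afun a (pconst be) != pconst be.

Let charQ n : (n.+1%:R : k) != 0.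
Proof. by rewrite -(rmorph_nat qr) fmorph_eq0 pnatr_eq0. Qed.

(* The joint eigenline of i1 and i2, with eigenvalues the square roots of 17 and 13,
   is spanned by some w0, and an arrow [a] maps w0 to [xi a] times the product of
   j1 and j2 to the powers [sgn_al a] and [sgn_be a], applied to w0. *)
Lemma local_W : exists xi : arr c c -> F,
  (forall a, admissible a -> xi a != 0) /\
  forall a a' a'' z (phi : {rmorphism F -> F}), admissible a -> admissible a' -> admissible a'' ->
    acomp a a' = acomp a'' (aband c z) -> (forall f, phi (tofrac f) = tofrac (afun a' f)) ->
    phi (xi a) * xi a' * (tofrac tau ^+ (sgn_al a && sgn_al a') *
      tofrac ((tau - 1) * (tau - 11%:R)) ^+ (sgn_be a && sgn_be a')) =
    tofrac (sval z) * xi a''.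
Proof.
have [r [V [act [r0 bV tw actP [actN [n [bA [hbA act_end]]]]]]]] := hC.
(* As t0 + u^e is transcendental, t |-> t0 + u^e extends to Q(t) -> k((u)), and the generic point of
   c lies over the generic point of the line. *)
pose q := qpoly_at qr tau; have qinj : injective q := @qpoly_at_inj k qr t0 e e0.
have fqinj : injective ((@tofrac S) \o q).
  by move=> x y /= /eqP; rewrite tofrac_eq => /eqP /qinj.
have [qF qFE] := fraction_lift fqinj.
have [ce [he fhe]] := @garr_pull _ _ C _ _ (@tofrac S) c (rmorphP (@tofrac S)).
have tF : qF tvar = tofrac tau by rewrite qFE -[LHS]/(tofrac (q 'X)) qpoly_at_X.
have at_e : P1at false (rpt (gpi C F ce)) (qF tvar).
  rewrite tF -[tofrac tau]/((fun x => tofrac x) tau) -fhe.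
  by apply: P1at_push (@localring_field _) (sval (fmap (gpi C) (ahom he))).1 atc.
have over : over_point (C := C) generic_pt qF ce.
  exact: p1hom_exists (rmorphP qF) P1at_generic at_e.
pose xe : gfibre C generic_pt F := BOb (rmorphP qF) over.
have [act_lin act1 actM actD] := actP F xe.
have [bW hbW] := locfree_basis (@localring_field F) (bV.2 F xe).
have act_end' (phi : V F xe -> V F xe) : is_lin phi -> exists c : 'I_n -> F,
    forall v, phi v = \sum_i c i *: act F xe (bA i) v.
  by move=> /act_end [cc [h _]]; exists cc.
pose cF (x : k) : F := tofrac (pconst x).
have cF_nat m : cF m%:R = m%:R by rewrite /cF !rmorph_nat.
have cF0 x : x != 0 -> cF x != 0.
  by move=> nx; rewrite /cF tofrac_eq0 fmorph_eq0.
have ealF : cF al ^+ 2 = qF 17%:R by rewrite /cF -!rmorphXn eal !rmorph_nat.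
have ebeF : cF be ^+ 2 = qF 13%:R by rewrite /cF -!rmorphXn ebe !rmorph_nat.
have nz_sq (x : k) m : x ^+ 2 = m.+1%:R -> x != 0.
  by move=> ex; have := charQ m; rewrite -ex expf_eq0.
have nal : cF al != 0 by apply/cF0/(nz_sq _ 16).
have nbe : cF be != 0 by apply/cF0/(nz_sq _ 12).
have tvE (m : nat) : tvar - m%:R = tofrac ('X - m%:R%:P) :> Qt.
  by rewrite /tvar rmorphB polyC_natr !rmorph_nat.
have nz_tv (m : nat) : tvar - m%:R != 0 :> Qt.
  by rewrite tvE tofrac_eq0 polyXsubC_eq0.
have nb : qF tvar != 0 by rewrite fmorph_eq0; have := nz_tv 0%N; rewrite subr0.
have nd : qF ((tvar - 1) * (tvar - 11%:R)) != 0.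
  by rewrite fmorph_eq0 mulf_neq0 // (nz_tv 1%N).
have n2 : (2%:R : F) != 0 by rewrite -cF_nat; apply: cF0.
have [w0 [nw0 hw0]] := @joint_eigen_exists _ _ _ _ _ _ (rmorphP qF) act_lin act1 actM actD _ _ r0 hbW
  _ _ _ _ _ _ _ _ gens _ _ ealF ebeF nal nbe nb nd.
have signed := @joint_eigen_signed _ _ _ _ _ _ (rmorphP qF) act_lin act1 actM actD _ _ hbW _ _ act_end'
  _ _ _ _ _ _ _ _ gens _ _ nal nbe nb nd n2 w0.
pose mon := @mono _ A F (V F xe) (act F xe) j1 j2.
have gE : qF ((tvar - 1) * (tvar - 11%:R)) = tofrac ((tau - 1) * (tau - 11%:R)).
  by rewrite rmorphM !rmorphB rmorph1 rmorph_nat tF rmorphM !rmorphB rmorph1 rmorph_nat.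
have lift (a : arr c c) (phi : {rmorphism F -> F}) : admissible a ->
    (forall f, phi (tofrac f) = tofrac (afun a f)) ->
    exists b : arr xe xe, acomp he (Arr (sval (ahom b))) = acomp a he /\ afun b = phi.
  move=> [f [finj fa ft]] ephi.
  have [l [el fl]] : exists l : arr ce ce, acomp he l = acomp a he /\ afun l = phi.
    by apply: garr_lift (rmorphP phi) _ => x; rewrite /= fhe ephi.
  have comp (x : Qt) : afun l (bmap xe x) = bmap xe x.
    rewrite fl; apply: (@fraction_hom_uniq _ _ (phi \o qF) qF _ x) => p.
    rewrite -[LHS]/(phi (qF (tofrac p))) qFE ephi fa; congr tofrac.
    apply: (@ratpoly_hom_uniq _ (f \o q) q _ p).
    by rewrite -[LHS]/(f (q 'X)) qpoly_at_X.
  have [b eb] := bcsub_arr (x := xe) (y := xe) comp.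
  by exists b; rewrite eb el -[afun b]/(afun (Arr (sval (ahom b)))) eb.
have phiE (a : arr c c) : admissible a ->
    {phi : {rmorphism F -> F} | forall f, phi (tofrac f) = tofrac (afun a f)}.
  move=> ha; apply: cid; have [f [finj fa ft]] := ha.
  have [|phi ephi] := @fraction_lift _ _ ((@tofrac S) \o f).
    by move=> x y /= /eqP; rewrite tofrac_eq => /eqP /finj.
  by exists phi => x; rewrite ephi fa.
have sgn_spec (x : k) (m : nat) (a : arr c c) : x ^+ 2 = m%:R -> admissible a ->
    afun a (pconst x) = (-1) ^+ (afun a (pconst x) != pconst x) * pconst x.
  move=> ex [f [_ fa _]]; case: eqP => [->|ne]; first by rewrite mul1r.
  have /eqP : f (pconst x) ^+ 2 = pconst x ^+ 2 by rewrite -!rmorphXn ex !rmorph_nat.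
  rewrite -subr_eq0 subr_sqr mulf_eq0 subr_eq0 addr_eq0 -fa => /orP[/eqP //|/eqP ->].
  by rewrite expr1 mulN1r.
have main (a : arr c c) : admissible a -> {x : F | x != 0 /\ forall (phi : {rmorphism F -> F}) (b : arr xe xe),
    (forall f, phi (tofrac f) = tofrac (afun a f)) ->
    acomp he (Arr (sval (ahom b))) = acomp a he -> afun b = phi ->
    avmap V b w0 = x *: mon (sgn_al a) (sgn_be a) w0}.
  move=> ha; apply: cid; have [phi ephi] := phiE a ha; have [b [eb fb]] := lift a phi ha ephi.
  have sl : semilin phi (avmap V b) by rewrite -fb; apply: avmap_semilin.
  have actb x v : avmap V b (act F xe x v) = act F xe x (avmap V b v) by apply: actN.
  have phis (x : k) m : x ^+ 2 = m%:R ->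
      phi (cF x) = (-1) ^+ (afun a (pconst x) != pconst x) * cF x.
    move=> ex; rewrite ephi (sgn_spec x m a ex ha) rmorphM rmorphXn rmorphN1.
    by congr (_ ^+ _ * _); rewrite -(sgn_spec x m a ex ha).
  have [x ex] : exists x, avmap V b w0 = x *: mon (sgn_al a) (sgn_be a) w0.
    apply: (signed _ _ _ nw0 hw0); rewrite -actb ?hw0.1 ?hw0.2 (semilinZ (rmorphP phi) sl).
      by rewrite (phis al 17%N).
    by rewrite (phis be 13%N).
  exists x; split.
    apply: contraNneq nw0 => x0; move: ex; rewrite x0 scale0r => b0.
    have bc := bV.1 _ _ _ _ _ (ahom b).
    (* V is a vector bundle, so V(b) maps a basis to a basis; this makes xi nonzero. *)
    have gi : injective (avmap V b).
      have hb1 := basechange_basis (arr_rm b) bc hbW.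
      move=> v1 v2; rewrite (coordsE hbW v1) (coordsE hbW v2).
      rewrite !(semilin_sum (rmorphP phi) sl) => ee.
      apply: eq_bigr => l _; congr (_ *: _); apply: (fmorph_inj phi); apply/eqP.
      rewrite -subr_eq0; apply/eqP.
      apply: (is_basis_free (c := fun l => phi (coords hbW v1 l) - phi (coords hbW v2 l)) hb1).
      rewrite (eq_bigr (fun l => phi (coords hbW v1 l) *: avmap V b (bW l) - phi (coords hbW v2 l) *: avmap V b (bW l))); last by move=> ? _; rewrite scalerBl.
      rewrite sumrB; apply/eqP; rewrite subr_eq0; apply/eqP; move: ee.
      by under eq_bigr => ? _ do rewrite (semilinZ (rmorphP phi) sl);
         under [in RHS]eq_bigr => ? _ do rewrite (semilinZ (rmorphP phi) sl).
    by apply/eqP/gi; rewrite b0 (semilin0 (rmorphP phi) sl).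
  move=> phi' b' ephi' eb' fb'.
  suff -> : b' = b by [].
  apply: bcsub_arr_inj; apply: (garr_lift_uniq (h := he)); last by rewrite eb eb'.
  rewrite /= fb fb'; apply: fraction_hom_uniq => x'.
  by rewrite ephi ephi'.
pose xi a := if pselect (admissible a) is left h then sval (main a h) else 0.
have xiE a (h : admissible a) : xi a = sval (main a h).
  by rewrite /xi; case: pselect => // h'; rewrite (Prop_irrelevance h h').
exists xi; split=> [a ha|a a' a'' z phi ha ha' ha'' ec ephi].
  by rewrite (xiE a ha); case: (svalP (main a ha)).
have [phi1 ephi1] := phiE a ha; have [b1 [eb1 fb1]] := lift a phi1 ha ephi1.
have [b2 [eb2 fb2]] := lift a' phi ha' ephi.
have [phi3 ephi3] := phiE a'' ha''; have [b3 [eb3 fb3]] := lift a'' phi3 ha'' ephi3.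
have m1 : avmap V b1 w0 = xi a *: mon (sgn_al a) (sgn_be a) w0.
  by rewrite (xiE a ha); apply: (svalP (main a ha)).2 ephi1 eb1 fb1.
have m2 : avmap V b2 w0 = xi a' *: mon (sgn_al a') (sgn_be a') w0.
  by rewrite (xiE a' ha'); apply: (svalP (main a' ha')).2 ephi eb2 fb2.
have m3 : avmap V b3 w0 = xi a'' *: mon (sgn_al a'') (sgn_be a'') w0.
  by rewrite (xiE a'' ha''); apply: (svalP (main a'' ha'')).2 ephi3 eb3 fb3.
have [zF ezF] := mu2_push z (rmorphP (@tofrac S)).
pose bz : arr xe xe := @Arr (gfibre C generic_pt) _ _ xe xe (fun a => a)
  (exist _ (gband C ce zF) (fun a => erefl)).
have eb : acomp b1 b2 = acomp b3 bz.
  apply: bcsub_arr_inj; apply: (garr_lift_uniq (h := he)).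
    move=> x /=; rewrite fb1 fb2 fb3; apply: (@fraction_hom_uniq _ _ (phi \o phi1) phi3 _ x) => x'.
    rewrite -[LHS]/(phi (phi1 (tofrac x'))) ephi1 ephi ephi3; congr tofrac.
    exact: (congr1 (fun g => afun g x') ec).
  rewrite -[Arr (sval (ahom (acomp b1 b2)))]/(acomp (Arr (sval (ahom b1))) (Arr (sval (ahom b2)))).
  rewrite -[Arr (sval (ahom (acomp b3 bz)))]/(acomp (Arr (sval (ahom b3))) (aband ce zF)).
  rewrite !acompA eb1 eb3 -!acompA eb2 !acompA ec -!acompA.
  by congr acomp; apply: aband_nat; rewrite fhe.
(* Both sides are evaluated at w0. The monomials for a and a' multiply to the one for a'', up to the
   squares of j1 and j2, which are t and (t-1)(t-11); a square appears when both arrows change the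
   corresponding root. *)
have := congr1 (fun b => avmap V b w0) eb; rewrite !avmap_comp m1 m3.
have sl2 : semilin phi (avmap V b2) by rewrite -fb2; apply: avmap_semilin.
have actb2 x v : avmap V b2 (act F xe x v) = act F xe x (avmap V b2 v) by apply: actN.
have monb d1 d2 v : avmap V b2 (mon d1 d2 v) = mon d1 d2 (avmap V b2 v).
  by rewrite /mon /mono; case: d1; case: d2; rewrite ?actb2.
rewrite (semilinZ (rmorphP phi) sl2) monb m2.
rewrite -[avmap V bz _]/(vmap V _ _) (tw F xe zF) ezF.
have mZ := monoZ (W := V F xe) act_lin j1 j2.
rewrite /mon mZ (mono_mono (rmorphP qF) act_lin act1 actM actD gens) !scalerA tF gE.
have sg (x : k) (m : nat) : x ^+ 2 = m.+1%:R ->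
    (afun a (pconst x) != pconst x) (+) (afun a' (pconst x) != pconst x) =
    (afun a'' (pconst x) != pconst x).
  move=> ex; have nx := nz_sq _ _ ex.
  have e1 := sgn_spec x _ a ex ha; have e2 := sgn_spec x _ a' ex ha'.
  have e3 := sgn_spec x _ a'' ex ha''.
  have ef : afun a' (afun a (pconst x)) = afun a'' (pconst x).
    exact: (congr1 (fun g => afun g (pconst x)) ec).
  have [f' [_ fa' _]] := ha'.
  rewrite e1 fa' rmorphM rmorphXn rmorphN1 -fa' e2 e3 mulrA -signr_addb in ef.
  have npx : pconst x != 0 by rewrite fmorph_eq0.
  have {ef} := mulIf npx ef.
  have n11 : (1 : S) != -1.
    rewrite -subr_eq0 opprK -[1 + 1]/(2%:R : S) -(rmorph_nat (@pconst k) 2) fmorph_eq0.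
    exact: (charQ 1).
  by move: (_ != _) (_ (+) _) => [] [] //= /eqP;
    rewrite ?expr0 ?expr1 ?(negPf n11) // eq_sym (negPf n11).
rewrite /sgn_al /sgn_be (sg al 16%N) // (sg be 12%N) // => /eqP.
have nm := mono_neq0 (rmorphP qF) act_lin act1 actM actD gens nb nd (sgn_al a'') (sgn_be a'') nw0.
rewrite -subr_eq0 -scalerBl scaler_eq0 (negPf nm) orbF subr_eq0 => /eqP; exact.
Qed.
End LocalW.


(** * A norm equation from a twisted cocycle *)

Section NormEquation.
Variables (k O : fieldType) (iota : {rmorphism k -> O}) (E : galext iota).
Variables (al : E) (m n : k).
Hypotheses (eal : al ^+ 2 = ge_in E m) (nal : forall a : k, a ^+ 2 != m).
Hypotheses (n0 : n != 0) (two0 : (2%:R : k) != 0).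
Definition flips (x : ge_G E) : bool := ge_act E x al != al.
Variable th : ge_G E -> E.
Hypothesis th0 : forall x, th x != 0.
Hypothesis th_cocycle : forall x y,
  ge_act E x (th y) * th x * ge_in E n ^+ (flips x && flips y) = th (y * x)%g.

Lemma flips_act x : ge_act E x al = (-1) ^+ flips x * al.
Proof.
rewrite /flips; case: eqP => [->|ne]; first by rewrite mul1r.
have /eqP : ge_act E x al ^+ 2 = al ^+ 2 by rewrite -rmorphXn eal ge_act_in.
by rewrite -subr_eq0 subr_sqr mulf_eq0 subr_eq0 addr_eq0 expr1 mulN1r => /orP[/eqP|/eqP].
Qed.

Let al0 : al != 0.
Proof.
apply/eqP => a0; move: (nal 0); rewrite -(inj_eq (fmorph_inj (ge_in E))) -eal a0.
by rewrite rmorphXn rmorph0 eqxx.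
Qed.
Let two0' : (2%:R : E) != 0. Proof. by rewrite -(rmorph_nat (ge_in E)) fmorph_eq0. Qed.
Let n0' : ge_in E n != 0. Proof. by rewrite fmorph_eq0. Qed.
Let N11 : (1 : E) != -1. Proof. by rewrite -subr_eq0 opprK. Qed.

Lemma flipsM x y : flips (x * y)%g = flips x (+) flips y.
Proof.
have := flips_act (x * y)%g; rewrite ge_actM flips_act rmorphM rmorphXn rmorphN1 flips_act.
rewrite mulrA -signr_addb => /(mulIf al0).
by move: (flips _) (_ (+) _) => [] [] //= /eqP;
  rewrite ?expr0 ?expr1 ?(negPf N11) // eq_sym (negPf N11).
Qed.

Lemma flips_exists : exists x, flips x.
Proof.
apply: contrapT => h; have [|a ea] := @ge_fixed _ _ _ E al.
  move=> x; apply/eqP/negPn/negP => hx; by apply: h; exists x.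
by move/eqP: (nal a); apply; apply: (fmorph_inj (ge_in E)); rewrite rmorphXn -ea eal.
Qed.

(* Let x act on E^2 by y |-> th x * x(y) followed, if x flips the square root, by
   (y1, y2) |-> (n y2, y1). This is a semilinear action, and the coordinates of an
   invariant vector have a ratio of norm 1 / n. *)
Lemma norm_equation : exists a b : k, (a ^+ 2 - m * b ^+ 2) * n = 1.
Proof.
have f1 : flips 1%g = false by rewrite /flips ge_act1 eqxx.
(* The invariant vector will be (P false, P true), the sum of the images of (y, 0) under the group;
   independence of characters provides y with P false nonzero. *)
have [|y ny] := @ge_indep _ _ _ E (fun x => if flips x then 0 else th x) 1%g.
  by rewrite f1.
pose P (b : bool) := \sum_(x | flips x == b) th x * ge_act E x y.
have nPf : P false != 0.
  rewrite /P big_mkcond; apply: contraNneq ny => e; apply/eqP; rewrite -[RHS]e.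
  by apply: eq_bigr => x _; case: (flips x); rewrite //= mul0r.
have PE x b : th x * ge_act E x (P b) * ge_in E n ^+ (flips x && b) = P (b (+) flips x).
  rewrite /P rmorph_sum mulr_sumr mulr_suml [RHS](reindex_inj (mulIg x)) /=.
  apply: eq_big => [z|z /eqP <-]; first by rewrite flipsM; case: (flips z) (flips x) b => [] [] [].
  by rewrite ge_actM rmorphM -th_cocycle; ring.
have [x0 hx0] := flips_exists.
have nPt : P true != 0.
  by have := PE x0 false; rewrite hx0 /= mulr1 => <-; rewrite mulf_neq0 // fmorph_eq0.
(* h is fixed by the x that fix al and is sent to h' = 1 / (n h) by the others. So h = a + b al with
   a and b in k, its conjugate is h', and its norm h h' is 1 / n. *)
pose h := P true / P false; have nh : h != 0 by rewrite mulf_neq0 ?invr_eq0.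
pose h' := (ge_in E n * h)^-1.
have nh' : h' != 0 by rewrite invr_eq0 mulf_neq0.
have act0 x : flips x = false -> ge_act E x h = h.
  move=> fx; have := PE x false; have := PE x true; rewrite fx /= !mulr1 => e1 e2.
  by rewrite /h fmorph_div -{2}e1 -{2}e2 -mulf_div divff ?mul1r.
have act1 x : flips x -> ge_act E x h = h'.
  move=> fx; have := PE x false; have := PE x true; rewrite fx /= !mulr1 expr1 => e1 e2.
  have nx : ge_act E x (P false) != 0 by rewrite fmorph_eq0.
  have nx' : ge_act E x (P true) != 0 by rewrite fmorph_eq0.
  rewrite /h' /h fmorph_div; move: (ge_act E x (P true)) (ge_act E x (P false)) nx nx' e1 e2.
  by move=> u v nv nu <- <-; field; rewrite n0' th0 nu nv.
have act' x : ge_act E x h' = if flips x then h else h'.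
  rewrite /h' fmorphV rmorphM ge_act_in; case: (boolP (flips x)) => fx.
    by rewrite act1 // /h' invfM invrK mulKf.
  by rewrite act0 // (negPf fx).
have [|a ea] := @ge_fixed _ _ _ E ((h + h') / 2%:R).
  move=> x; rewrite fmorph_div rmorph_nat rmorphD act'.
  case: (boolP (flips x)) => fx; first by rewrite act1 // addrC.
  by rewrite act0 // (negPf fx).
have [|b eb] := @ge_fixed _ _ _ E ((h - h') / (2%:R * al)).
  move=> x; rewrite fmorph_div rmorphM rmorph_nat rmorphB act' flips_act.
  case: (boolP (flips x)) => fx.
    by rewrite act1 // expr1 mulN1r mulrN invrN mulrN -mulNr opprB.
  by rewrite act0 ?expr0 ?mul1r // (negPf fx).
exists a, b; apply: (fmorph_inj (ge_in E)); rewrite rmorph1 rmorphM rmorphB [ge_in E (m * _)]rmorphM !rmorphXn.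
rewrite -ea -eb -eal /h'; field; by rewrite two0' nh n0' al0.
Qed.
End NormEquation.

(** * The field of 17-adic numbers *)

Section Seventeen.
Variables (K : fieldType) (nrm : K -> rat).
Hypothesis nrm0 : forall x, 0 <= nrm x /\ (nrm x = 0 <-> x = 0).
Hypothesis nrmM : forall x y, nrm (x * y) = nrm x * nrm y.
Hypothesis nrmD : forall x y, nrm (x + y) <= Num.max (nrm x) (nrm y).
Hypothesis nrmQ : forall q : rat, nrm (ratr q) = padic_norm 17 q.
Hypothesis dense : forall (x : K) (e : rat), 0 < e -> exists q : rat, nrm (x - ratr q) < e.
Hypothesis complete : forall u : nat -> K,
  (forall e : rat, 0 < e -> exists n0, forall i j,
     (n0 <= i)%N -> (n0 <= j)%N -> nrm (u i - u j) < e) ->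
  exists x : K, forall e : rat, 0 < e -> exists n0, forall i,
    (n0 <= i)%N -> nrm (u i - x) < e.

Lemma nrm_ge0 x : 0 <= nrm x. Proof. by case: (nrm0 x). Qed.
Lemma nrm_eq0 x : (nrm x == 0) = (x == 0).
Proof. by apply/eqP/eqP => e; apply/(nrm0 x).2. Qed.

Lemma nrm_int (z : int) : nrm z%:~R = padic_norm 17 z%:~R.
Proof. by rewrite -nrmQ ratr_int. Qed.

Lemma padic_norm_int (z : int) : z != 0 ->
  padic_norm 17 z%:~R = (17%:R^-1) ^+ logn 17 `|z|.
Proof.
move=> nz; rewrite /padic_norm intr_eq0 (negPf nz) numq_int denq_int.
by rewrite logn1 sub0r -exprz_inv.
Qed.

Lemma nrm1 : nrm 1 = 1.
Proof. by rewrite -[1 : K]/(1%:~R) nrm_int padic_norm_int. Qed.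

Lemma nrm_sqr_inj x : nrm x ^+ 2 = 1 -> nrm x = 1.
Proof. by move/eqP; rewrite expr2 -expr2 sqrp_eq1 ?nrm_ge0 // => /eqP. Qed.

Lemma nrmN x : nrm (- x) = nrm x.
Proof.
by rewrite -mulN1r nrmM (nrm_sqr_inj (x := -1)) ?mul1r // expr2 -nrmM mulrNN mulr1 nrm1.
Qed.

Lemma nrm_lt x y e : nrm x < e -> nrm y < e -> nrm (x + y) < e.
Proof. by move=> hx hy; apply: le_lt_trans (nrmD _ _) _; rewrite gt_max hx hy. Qed.
Lemma nrm_le x y e : nrm x <= e -> nrm y <= e -> nrm (x + y) <= e.
Proof. by move=> hx hy; apply: le_trans (nrmD _ _) _; rewrite ge_max hx hy. Qed.

Lemma nrm_dom x y : nrm y < nrm x -> nrm (x + y) = nrm x.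
Proof.
move=> h; apply/eqP; rewrite eq_le nrm_le ?lexx ?(ltW h) //= leNgt; apply/negP => h'.
have := nrm_lt h' (_ : nrm (- y) < nrm x); rewrite nrmN h addrK ltxx => hh.
by have := hh isT.
Qed.

Lemma nrm_nat_neq0 n : (n.+1%:R : K) != 0.
Proof.
rewrite -nrm_eq0 -[n.+1%:R : K]/(n.+1%:~R) nrm_int padic_norm_int // expf_neq0 //.
Qed.

Lemma nrm_value x : x != 0 -> exists z : int, nrm x = 17%:R ^ z.
Proof.
move=> nx; have [|q hq] := dense x (_ : 0 < nrm x); first by rewrite lt_def nrm_ge0 nrm_eq0 nx.
have e : nrm (ratr q) = nrm x.
  by rewrite -(nrm_dom (_ : nrm (- (x - ratr q)) < nrm x)) ?nrmN // opprB addrC subrK.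
move: (e); rewrite nrmQ /padic_norm; case: eqP => [_ e0|_ <-]; last by eexists.
by move: nx; rewrite -nrm_eq0 -e0 eqxx.
Qed.

Lemma nrm17 : nrm 17%:R = 17%:R^-1.
Proof. by rewrite -[17%:R : K]/(17%:~R) nrm_int padic_norm_int. Qed.

Lemma exp17_inj : injective (fun z : int => (17%:R : rat) ^ z).
Proof. by apply: ieexprIz. Qed.

(** A nonzero square has even valuation, 17 times one has odd valuation. *)
Lemma nrm_sqr17 x y : x != 0 -> nrm (x ^+ 2) != nrm (17%:R * y ^+ 2).
Proof.
move=> nx; have [->|ny] := eqVneq y 0.
  by rewrite expr0n mulr0 (_ : nrm 0 = 0) ?nrm_eq0 ?expf_neq0 //; apply/eqP; rewrite nrm_eq0.
have [z ez] := nrm_value nx; have [w ew] := nrm_value ny.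
rewrite !expr2 !nrmM ez ew nrm17 -exprN1 -!expfzDr //; apply/eqP => /exp17_inj; lia.
Qed.

Lemma sqrt17_notin (a : K) : a ^+ 2 != 17%:R.
Proof.
have [->|na] := eqVneq a 0; first by rewrite expr0n /= eq_sym nrm_nat_neq0.
apply: contraNneq (nrm_sqr17 1 na) => ->; by rewrite expr1n mulr1.
Qed.

(** By parity of valuations a would be a unit with 11 a^2 = 1 modulo 17, but 11 is not a square
    modulo 17. Density replaces a by a rational number, so that the congruence becomes one between
    integers. *)
Lemma norm11_notin (a b : K) : (a ^+ 2 - 17%:R * b ^+ 2) * 11%:R != 1.
Proof.
apply/eqP => e.
have n11 : nrm 11%:R = 1 by rewrite -[11%:R : K]/(11%:~R) nrm_int padic_norm_int.
have e1 : nrm (a ^+ 2 - 17%:R * b ^+ 2) = 1 by rewrite -[LHS]mulr1 -n11 -nrmM e nrm1.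
have hb : nrm (17%:R * b ^+ 2) < 1 /\ nrm a = 1.
  have [a0|na] := eqVneq a 0.
    have [b0|nb] := eqVneq b 0.
      by move: e; rewrite a0 b0 !expr0n /= mulr0 subrr mul0r => /eqP; rewrite eq_sym oner_eq0.
    move: e1; rewrite a0 expr0n /= sub0r nrmN => e1.
    have /eqP[] : nrm (1 ^+ 2) != nrm (17%:R * b ^+ 2) by apply: nrm_sqr17 (oner_neq0 _).
    by rewrite e1 expr1n nrm1.
  have := nrm_sqr17 b na; rewrite neq_lt => /orP[h|h].
    have e2 : nrm (17%:R * b ^+ 2) = 1.
      by rewrite -e1 addrC nrm_dom ?nrmN.
    have /eqP[] : nrm (1 ^+ 2) != nrm (17%:R * b ^+ 2) by apply: nrm_sqr17 (oner_neq0 _).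
    by rewrite e2 expr1n nrm1.
  have e2 : nrm (a ^+ 2) = 1 by rewrite -e1 nrm_dom ?nrmN.
  by rewrite -{1}e2; split=> //; apply: nrm_sqr_inj; rewrite expr2 -nrmM -expr2.
have {hb} [hb na] := hb.
have [q hq] := dense a ltr01.
have nq : nrm (ratr q) = 1.
  by rewrite -na -(nrm_dom (_ : nrm (- (a - ratr q)) < nrm a)) ?nrmN ?na // opprB addrC subrK.
have d1 : nrm (11%:R * a ^+ 2 - 1) < 1.
  rewrite (_ : _ - _ = 11%:R * (17%:R * b ^+ 2)); last by rewrite -[X in _ - X]e; ring.
  by rewrite nrmM n11 mul1r.
have d2 : nrm (11%:R * ratr q ^+ 2 - 1) < 1.
  rewrite (_ : _ - 1 = (11%:R * a ^+ 2 - 1) + 11%:R * ((ratr q + a) * (- (a - ratr q)))); last by ring.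
  apply: nrm_lt d1 _; rewrite 2!nrmM n11 mul1r nrmN.
  apply: le_lt_trans hq; rewrite ler_piMl ?nrm_ge0 //; apply: nrm_le; by rewrite ?nq ?na.
move: nq; rewrite nrmQ /padic_norm; case: eqP => [_ /eqP|/eqP nzq eq1]; first by rewrite eq_sym oner_eq0.
have l0 : logn 17 `|denq q| = logn 17 `|numq q|.
  by have := @exp17_inj (_ - _) 0 eq1; lia.
have nd : ~~ (17 %| `|denq q|)%N.
  apply/negP => h; have h' : (17 %| `|numq q|)%N.
    rewrite -[17 as X in (X %| _)%N]expn1 pfactor_dvdn ?absz_gt0 ?numq_eq0 // -l0.
    by rewrite -pfactor_dvdn ?absz_gt0 ?denq_neq0.
  have := coprime_num_den q; rewrite /coprime; have : (17 %| gcdn `|numq q| `|denq q|)%N by rewrite dvdn_gcd h h'.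
  by move=> + /eqP e17; rewrite e17.
pose z : int := 11%:Z * numq q ^+ 2 - denq q ^+ 2.
have hz : nrm z%:~R < 1.
  have nz0 (y : int) : y != 0 -> (y%:~R : K) != 0.
    by move=> ny; rewrite -nrm_eq0 nrm_int padic_norm_int // expf_neq0.
  have ndd : ((denq q)%:~R : K) != 0 by apply: nz0; rewrite denq_neq0.
  have -> : (z%:~R : K) = (11%:R * ratr q ^+ 2 - 1) * (denq q)%:~R ^+ 2.
    rewrite /z rmorphB rmorphM !rmorphXn /= /ratr; field; exact: ndd.
  rewrite nrmM expr2 nrmM nrm_int padic_norm_int ?denq_neq0 //.
  by rewrite (eqP (_ : logn 17 `|denq q| == 0%N)) ?expr0 ?mulr1 // -leqn0 -ltnS ltnNge -?pfactor_dvdn ?absz_gt0 ?denq_neq0 // expn1.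
have h17 : (17 %| `|z|)%N.
  have [->|nz] := eqVneq z 0; first by rewrite dvdn0.
  move: hz; rewrite nrm_int padic_norm_int // => hz.
  rewrite -[17 as X in (X %| _)%N]expn1 pfactor_dvdn ?absz_gt0 // lt0n.
  by apply: contraTneq hz => ->; rewrite expr0 ltxx.
have {h17} [w ew] : exists w : int, z = 17%:Z * w.
  have : (17%:Z %| z)%Z by rewrite /dvdz.
  by case/dvdzP => w ->; exists w; rewrite mulrC.
have hmod : (11 * `|numq q| ^ 2 == `|denq q| ^ 2 %[mod 17])%N.
  have -> : (11 * `|numq q| ^ 2 == `|denq q| ^ 2 %[mod 17])%N
          = (((11 * `|numq q| ^ 2)%N : int) == (`|denq q| ^ 2)%N %[mod 17%N])%Z.
    by rewrite !modz_nat.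
  rewrite eqz_mod_dvd; apply/dvdzP; exists w; rewrite mulrC -ew /z PoszM -!abszX !abszE.
  by rewrite !ger0_norm ?sqr_ge0.
have tbl : all (fun r => all (fun t => (11 * r ^ 2 == t ^ 2 %[mod 17]) ==> (t == 0))%N (iota 0 17)) (iota 0 17).
  by vm_compute.
move: hmod; rewrite -modnMmr -modnXm modnMmr -[X in _ == X]modnXm => hmod.
have /allP/(_ (`|denq q| %% 17)%N) := allP tbl (`|numq q| %% 17)%N ltac:(by rewrite mem_iota ltn_mod).
by rewrite mem_iota ltn_mod hmod => /(_ isT) /eqP h0; move: nd; rewrite /dvdn h0.
Qed.

Lemma sqrt13_in : exists x : K, x ^+ 2 = 13%:R.
Proof.
(* Newton's iteration with the constant slope 2 * 8 = -1 mod 17 *)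
pose u := fix u n : K := if n is m.+1 then u m + (u m ^+ 2 - 13%:R) else 8%:R.
pose p : rat := 17%:R^-1.
have p1 : p <= 1 by [].
have p0 : 0 <= p by [].
have pw n : 0 <= p ^+ n by rewrite exprn_ge0.
have pw1 n : p ^+ n.+1 <= p by rewrite exprS ler_piMr // exprn_ile1.
have inv n : nrm (u n ^+ 2 - 13%:R) <= p ^+ n.+1 /\ nrm (u n - 8%:R) <= p.
  elim: n => [|n [IH1 IH2]].
    rewrite subrr (_ : nrm 0 = 0) //; last by apply/eqP; rewrite nrm_eq0.
    split=> //; rewrite (_ : u 0%N ^+ 2 - 13%:R = 17%:R * 3%:R); last by rewrite /=; ring.
    by rewrite -natrM -[_%:R : K]/(51%:~R) nrm_int padic_norm_int.
  split; last first.
    rewrite (_ : u n.+1 - _ = (u n - 8%:R) + (u n ^+ 2 - 13%:R)); last by rewrite /=; ring.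
    by apply: nrm_le IH2 (le_trans IH1 (pw1 n)).
  (* The cofactor is 1 + 2 u n + (u n ^ 2 - 13). Writing u n around 8 gathers 1 + 16 = 17, so each
     of its terms has norm at most 1 / 17. *)
  rewrite (_ : u n.+1 ^+ 2 - _ = (u n ^+ 2 - 13%:R) * (17%:R + (2%:R * (u n - 8%:R) + (u n ^+ 2 - 13%:R)))); last by rewrite /=; ring.
  rewrite nrmM [p ^+ _]exprSr; apply: ler_pM; rewrite ?nrm_ge0 //; apply: nrm_le; first by rewrite nrm17.
  apply: nrm_le (le_trans IH1 (pw1 n)).
  by rewrite nrmM -[2%:R : K]/(2%:~R) nrm_int padic_norm_int // mul1r.
have step n m : nrm (u (n + m)%N - u n) <= p ^+ n.
  elim: m => [|m IH]; first by rewrite addn0 subrr (_ : nrm 0 = 0) //; apply/eqP; rewrite nrm_eq0.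
  rewrite addnS (_ : u (n + m).+1 - _ = (u (n + m)%N - u n) + (u (n + m)%N ^+ 2 - 13%:R)); last by rewrite /=; ring.
  apply: nrm_le IH (le_trans (inv _).1 _); apply: ler_wiXn2l => //; lia.
have small (e : rat) : 0 < e -> exists n, p ^+ n < e.
  move=> e0; have [n hn] : exists n : nat, e^-1 < n%:R.
    exists (Num.truncn e^-1).+1; apply: truncnS_gt.
  exists n; rewrite -[e]invrK exprVn ltf_pV2 ?posrE ?exprn_gt0 ?invr_gt0 //.
  apply: lt_le_trans hn _; rewrite -natrX ler_nat; exact/ltnW/ltn_expl.
have [|x hx] := complete (u := u).
  move=> e e0; have [n hn] := small e e0; exists n => i j ni nj.
  apply: le_lt_trans hn; rewrite -(subnKC ni) -(subnKC nj).
  rewrite (_ : _ - _ = (u (n + (i - n))%N - u n) + - (u (n + (j - n))%N - u n)); last by ring.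
  by apply: nrm_le; rewrite ?nrmN step.
exists x; apply/eqP; rewrite -subr_eq0 -nrm_eq0 eq_le nrm_ge0 andbT leNgt; apply/negP => h.
pose e := Num.min 1 (nrm (x ^+ 2 - 13%:R)); have e0 : 0 < e by rewrite lt_min ltr01.
have [n1 hn1] := hx e e0; have [n2 hn2] := small e e0.
pose n := maxn n1 n2; have hn := hn1 n (leq_maxl _ _); have hn' := hn.
suff : nrm (x ^+ 2 - 13%:R) < e by rewrite lt_min ltxx andbF.
rewrite (_ : x ^+ 2 - _ = (u n - x) * ((u n - x) - 2%:R * (u n - 8%:R) - 16%:R) + (u n ^+ 2 - 13%:R)); last by ring.
apply: nrm_lt; last first.
  apply: le_lt_trans (inv n).1 (le_lt_trans _ hn2); apply: ler_wiXn2l => //; rewrite /n; lia.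
rewrite nrmM; apply: le_lt_trans hn; rewrite ler_piMr ?nrm_ge0 //.
have ni m : nrm m.+1%:R <= 1 by rewrite -[m.+1%:R : K]/(m.+1%:~R) nrm_int padic_norm_int // exprn_ile1.
apply: nrm_le; last by rewrite nrmN.
apply: nrm_le; first by apply: ltW (lt_le_trans hn' _); rewrite ge_min lexx.
rewrite nrmN nrmM mulr_ile1 ?nrm_ge0 //; exact: le_trans (inv n).2 p1.
Qed.

(** Only characteristic zero matters, and it holds because nonzero integers have nonzero norm. *)
Lemma padic_rat : is_rmorph (ratr : rat -> K).
Proof.
have nz (y : int) : y != 0 -> (y%:~R : K) != 0.
  by move=> ny; rewrite -nrm_eq0 nrm_int padic_norm_int // expf_neq0.
have dn (x : rat) : x * (denq x)%:~R = (numq x)%:~R by rewrite -{1}(divq_num_den x) divfK ?intr_eq0 ?denq_neq0.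
have e (x : rat) (a b : int) : b != 0 -> x * b%:~R = a%:~R -> ratr x * b%:~R = a%:~R :> K.
  move=> nb h; rewrite /ratr mulrAC; apply: (canLR (mulfK (nz _ (denq_neq0 x)))).
  rewrite -!intrM; congr _%:~R; apply: (@intr_inj rat); rewrite !intrM -h.
  by rewrite -dn; ring.
have u (x : rat) (a b : int) c : b != 0 -> x * b%:~R = a%:~R -> c * b%:~R = a%:~R :> K -> ratr x = c.
  by move=> nb h1 h2; apply: (mulIf (nz _ nb)); rewrite (e _ a) // h2.
have ed (x : rat) : ratr x * (denq x)%:~R = (numq x)%:~R :> K by apply: e; rewrite ?denq_neq0 ?dn.
split=> [|x y|x y]; first by rewrite -[1 : rat]/(1%:~R) ratr_int.
  apply: (u _ (numq x * denq y + numq y * denq x) (denq x * denq y)); rewrite ?mulf_neq0 ?denq_neq0 //.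
    by rewrite !rmorphD !rmorphM /= -!dn; ring.
  by rewrite !rmorphD !rmorphM /= -!ed; ring.
apply: (u _ (numq x * numq y) (denq x * denq y)); rewrite ?mulf_neq0 ?denq_neq0 //.
  by rewrite !rmorphM /= -!dn; ring.
by rewrite !rmorphM /= -!ed; ring.
Qed.
End Seventeen.

(** * Equivariant power series points of the gerbe *)

Section GalmorComp.
Variables (k O : fieldType) (iota : {rmorphism k -> O}).
Lemma galmor_comp (E E' E'' : galext iota) (j : galmor E E') (j' : galmor E' E'') :
  exists j'' : galmor E E'', forall a, j'' a = j' (j a).
Proof.
have o a : ge_out E'' ((j' \o j) a) = ge_out E a by rewrite /= !gm_out.
have ac x a : ge_act E'' x ((j' \o j) a) = (j' \o j) (ge_act E (gm_res j (gm_res j' x)) a).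
  by rewrite /= !gm_act.
by exists (@GalMor _ _ _ E E'' (j' \o j) o (fun x => gm_res j (gm_res j' x)) ac).
Qed.
Lemma galmor_id (E : galext iota) : exists j : galmor E E, forall a, j a = a.
Proof. by exists (@GalMor _ _ _ E E idfun (fun a => erefl) (fun x => x) (fun x a => erefl)). Qed.
End GalmorComp.

Section EquivariantPoint.
Variables (D : omod P1) (s : osec D).
Hypothesis hD : is_bundle 1 D.
Variables (eD : forall b, D _ (chart b)) (FD : bool -> {poly rat}).
Hypothesis geD : forall b, is_gen (eD b).
Hypothesis sD : forall b, s _ (chart b) = FD b *: eD b.
Variable C : mu2_gerbe (rootstack s).
Variables (k O : fieldType) (iota : {rmorphism k -> O}).
Hypothesis clO : alg_closed O.
Hypothesis algO : forall x, algebraicOver iota x.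
Hypothesis pchark : [pchar k] =i pred0.
Variables (qr : {rmorphism rat -> k}) (t0 : k) (e : nat) (nu g g' : pser k) (sgn : bool).
Hypothesis nug : nu ^+ 2 * g = qpoly_at qr (ramif t0 e) (FD false).
Hypothesis g'g : g' * g = 1.
Hypothesis nu_neg : sgn -> pneg nu = - nu.
Hypothesis g_neg : sgn -> pneg g = g.
Hypothesis t_neg : sgn -> pneg (ramif t0 e) = ramif t0 e.
Implicit Types E : galext iota.

Definition qE E : {rmorphism {poly rat} -> pser E} :=
  pmap (ge_in E) \o qpoly_at qr (ramif t0 e).
(** There are two uses: e = 2, nu = u and [sgn] true at a point of the divisor, and e = 1, nu = 1
    and [sgn] false at a point supposed to lie off it. *)
Definition equivariant_pt E (c : C (pser E)) : Prop :=
  [/\ cdata eD false (gpi C _ c) (qE E) (pmap (ge_in E) nu) (pmap (ge_in E) g),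
      forall x, exists a : arr c c, afun a = pmap (ge_act E x) &
      sgn -> exists a : arr c c, afun a = @pneg E].

Lemma cdata_ext (S : comNzRingType) b (y : rootstack s S) (q q' : {poly rat} -> S) nu1 g1 nu2 g2 :
  q =1 q' -> nu1 = nu2 -> g1 = g2 -> cdata eD b y q nu1 g1 -> cdata eD b y q' nu2 g2.
Proof. by move=> e1 e2 e3; rewrite -(functional_extensionality_dep e1) -e2 -e3. Qed.

Lemma pmap_comp (K1 K2 K3 : comNzRingType) (s1 : {rmorphism K1 -> K2}) (s2 : {rmorphism K2 -> K3}) f :
  pmap s2 (pmap s1 f) = pmap (s2 \o s1) f.
Proof. by []. Qed.

Lemma eq_pmap (K1 K2 : comNzRingType) (s1 s2 : {rmorphism K1 -> K2}) : s1 =1 s2 -> pmap s1 =1 pmap s2.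
Proof. by move=> e12 f; apply: pserP => n /=; rewrite e12. Qed.

Lemma pmap_in E E' (j : galmor E E') f : pmap j (pmap (ge_in E) f) = pmap (ge_in E') f.
Proof. by rewrite pmap_comp; apply: eq_pmap => a /=; rewrite gm_in. Qed.

Lemma pmap_act_in E x f : pmap (ge_act E x) (pmap (ge_in E) f) = pmap (ge_in E) f.
Proof. by rewrite pmap_comp; apply: eq_pmap => a /=; rewrite ge_act_in. Qed.

Lemma pneg_pmap (K1 K2 : comNzRingType) (s1 : {rmorphism K1 -> K2}) f :
  pneg (pmap s1 f) = pmap s1 (pneg f).
Proof. by apply: pserP => n /=; rewrite rmorphM rmorphXn rmorphN1. Qed.

Lemma pmap_inv E : pmap (ge_in E) g' * pmap (ge_in E) g = 1.
Proof. by rewrite -rmorphM g'g rmorph1. Qed.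

Lemma qE_neg E : sgn -> forall p, pneg (qE E p) = qE E p.
Proof.
move=> hs p; rewrite -[qE E p]/(pmap (ge_in E) (qpoly_at qr (ramif t0 e) p)) pneg_pmap; congr (pmap _ _).
apply: (@ratpoly_hom_uniq _ (@pneg k \o qpoly_at qr (ramif t0 e)) (qpoly_at qr (ramif t0 e)) _ p).
by rewrite -[LHS]/(pneg (qpoly_at qr (ramif t0 e) 'X)) qpoly_at_X t_neg.
Qed.

Lemma cdata_galmor E E' (j : galmor E E') (y : rootstack s (pser E)) (y' : rootstack s (pser E')) :
  hom (pmap j) y y' -> cdata eD false y (qE E) (pmap (ge_in E) nu) (pmap (ge_in E) g) ->
  cdata eD false y' (qE E') (pmap (ge_in E') nu) (pmap (ge_in E') g).
Proof.
move=> h hc; have := @cdata_push _ _ hD _ geD _ _ _ _ _ _ _ _ _ _ (@localring_pser E') (pmap_inv E) h hc.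
by apply: cdata_ext => [p||]; rewrite /qE /= pmap_in.
Qed.

Definition endo E (x : option (ge_G E)) : {rmorphism pser E -> pser E} :=
  if x is Some x' then pmap (ge_act E x') else @pneg E.

(** The pullback d has the same data as c, hence the same image in the root stack up to isomorphism,
    though perhaps not in the gerbe. For u -> - u the section nu changes sign, which is made up for
    by the generator - n1. *)
Lemma endo_pull E (c : C (pser E)) (x : option (ge_G E)) : x != None \/ sgn ->
  cdata eD false (gpi C _ c) (qE E) (pmap (ge_in E) nu) (pmap (ge_in E) g) ->
  exists (d : C (pser E)) (a : arr c d), afun a = endo x /\
    inhabited (hom (fun a : pser E => a) (gpi C _ c) (gpi C _ d)).
Proof.
move=> hx hc; have [d [a fa]] := garr_pull c (rmorphP (endo x)); exists d, a; split=> //.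
have := @cdata_push _ _ hD _ geD _ _ _ _ _ _ _ _ _ _ (@localring_pser E) (pmap_inv E) (fmap (gpi C) (ahom a)) hc.
rewrite fa => hc'; apply: (cdata_iso (@localring_pser E) hc).
case: x hx {a fa} hc' => [x|] /= hx hc'.
  by apply: cdata_ext hc' => [p||]; rewrite /qE /= pmap_act_in.
have {hx} hs : sgn by case: hx.
have N11 : (-1) * (-1) = 1 :> pser E by rewrite mulrNN mulr1.
have hc2 := cdata_ext (fun p => qE_neg E hs p) _ _ hc'.
have := hc2 (pmap (ge_in E) nu * -1) (pmap (ge_in E) g).
rewrite !pneg_pmap nu_neg // g_neg // rmorphN mulrN1 => /(_ erefl erefl) hc3.
have := @cdata_scale _ _ _ _ _ _ _ _ _ _ _ N11 (_ : cdata eD false _ _ (pmap (ge_in E) nu * -1) _).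
by rewrite mulrN1 => /(_ _ _ _ _ hc3); rewrite expr2 N11 mulr1.
Qed.

Lemma endo_galmor E E' (j : galmor E E') c (c' : C (pser E')) (h : arr c c') :
  afun h = pmap j -> forall x, (exists h' : arr c c', forall f, afun h' f =
    pmap j (endo (if x is Some x' then Some (gm_res j x') else None) f)) ->
  exists l : arr c' c', afun l = endo x.
Proof.
move=> fh x [h' fh']; have [|l [_ fl]] := garr_lift (h := h) (k := h') (rmorphP (endo x)); last by exists l.
move=> f; rewrite fh' fh; case: x fh' => [x|] _ /=; last by rewrite pneg_pmap.
by rewrite !pmap_comp; apply: eq_pmap => a /=; rewrite gm_act.
Qed.

Lemma equivariant_push E E' (j : galmor E E') (c : C (pser E)) : equivariant_pt c ->
  exists (c' : C (pser E')) (h : arr c c'), afun h = pmap j /\ equivariant_pt c'.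
Proof.
move=> [hc ha hn]; have [c' [h fh]] := garr_pull c (rmorphP (pmap j)); exists c', h; split=> //.
have [h1 eh1] : exists h1 : hom (pmap j) c c', Arr h1 = h by apply: arr_over => a; rewrite fh.
split; first exact: cdata_galmor (fmap (gpi C) h1) hc.
  move=> x; have [a fa] := ha (gm_res j x).
  by apply: (endo_galmor fh (x := Some x)); exists (acomp a h) => f /=; rewrite fa fh.
move=> /hn[a fa].
by apply: (endo_galmor fh (x := None)); exists (acomp a h) => f /=; rewrite fa fh.
Qed.

Lemma equivariant_exists E : exists (E' : galext iota) (j : galmor E E') (c : C (pser E')),
  equivariant_pt c.
Proof.
have nugE : pmap (ge_in E) nu ^+ 2 * pmap (ge_in E) g = qE E (FD false).
  by rewrite -rmorphXn -rmorphM nug.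
have [y hy] := cdata_exists hD geD sD (rmorphP (qE E)) (pmap_inv E) nugE.
have [E1 [j1 [c1 [h1]]]] := gerbe_object_lift C clO algO pchark y (@is_rmorph_id (pser E)).
have hc1 := cdata_galmor h1 hy.
(* For each endomorphism in this list c1 and its pullback become isomorphic in the gerbe after an
   extension of E1. Automorphisms of the larger fields restrict to E1, so the finite list made over
   E1 is enough. *)
pose I := map Some (enum [set: ge_G E1]) ++ (if sgn then [:: None] else [::]).
have [E2 [j2 [c2 [h2 [fh2 hI]]]]] : exists E2 (j2 : galmor E1 E2) (c2 : C (pser E2)) (h2 : arr c1 c2),
    afun h2 = pmap j2 /\ forall x, x \in I -> exists h' : arr c1 c2, forall f, afun h' f = pmap j2 (endo x f).
  have : forall x, x \in I -> x != None \/ sgn.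
    move=> x; rewrite mem_cat => /orP[/mapP[y' _ ->]|]; first by left.
    by case: (sgn) => //; right.
  elim: I => [|x I IH] hI.
    have [j2 ej2] := galmor_id E1.
    by exists E1, j2, c1, (Arr (hid c1)); split=> //; apply: functional_extensionality_dep => f; apply: pserP => n /=; rewrite ej2.
  have [|E2 [j2 [c2 [h2 [fh2 hI2]]]]] := IH; first by move=> x' hx'; apply: hI; rewrite inE hx' orbT.
  have [d [a [fa hi]]] := endo_pull (hI x (mem_head _ _)) hc1.
  have [E3 [j3 [c3 [[p1] [p2]]]]] := gerbe_iso_lift clO algO pchark hi (rmorphP (pmap j2)).
  have [j ej] := galmor_comp j2 j3.
  have pj f : pmap j3 (pmap j2 f) = pmap j f.
    by rewrite pmap_comp; apply: eq_pmap => b /=; rewrite ej.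
  have [|l [el fl]] := garr_lift (h := h2) (k := Arr p1) (rmorphP (pmap j3)).
    by move=> f; rewrite fh2.
  exists E3, j, c3, (acomp h2 l); split; first by apply: functional_extensionality_dep => f; rewrite -[LHS]/(afun l (afun h2 f)) fl fh2; exact: pj.
  move=> x'; rewrite inE => /predU1P[->|/hI2[h' fh']].
    by exists (acomp a (Arr p2)) => f; rewrite -[LHS]/(pmap j3 (pmap j2 (afun a f))) fa; exact: pj.
  by exists (acomp h' l) => f; rewrite -[LHS]/(afun l (afun h' f)) fl fh'; exact: pj.
have [j ej] := galmor_comp j1 j2; exists E2, j, c2.
have [p2 _] : exists p2 : hom (pmap j2) c1 c2, Arr p2 = h2 by apply: arr_over => a; rewrite fh2.
split; first exact: cdata_galmor (fmap (gpi C) p2) hc1.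
  move=> x; apply: (endo_galmor fh2 (x := Some x)); apply: hI.
  by rewrite mem_cat map_f // mem_enum inE.
move=> hs; apply: (endo_galmor fh2 (x := None)); apply: hI.
by rewrite mem_cat hs mem_head orbT.
Qed.
End EquivariantPoint.

(** * Leading terms *)

Section MonomialArrows.
Variable L : fieldType.
Local Notation S := (pser L).

Definition monomial_endo (f : {rmorphism S -> S}) (ep : L) (r : {rmorphism L -> L}) : Prop :=
  [/\ ep != 0, f pX = pconst ep * pX & forall g, pc (f g) 0 = r (pc g 0)].

Lemma monomial_inj f ep r : monomial_endo f ep r -> injective f.
Proof.
move=> [nep fX f0] x y e; apply/eqP; rewrite -subr_eq0; apply/negPn/negP => /eqP/pser_nonzero[n [g [eg ng]]].
have /eqP : f (x - y) = 0 by rewrite rmorphB e subrr.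
rewrite eg rmorphM rmorphXn fX mulf_eq0 expf_eq0 mulf_eq0 fmorph_eq0 (negPf nep) (negPf (pX_neq0 L)) andbF.
by move=> /eqP/(congr1 (fun h => pc h 0)); rewrite f0 pc0 => /eqP; rewrite fmorph_eq0 => /eqP.
Qed.

Lemma monomial_pmap (r : {rmorphism L -> L}) : monomial_endo (pmap r) 1 r.
Proof.
split=> //; first exact: oner_neq0.
by rewrite -[LHS]/(pmap r pX) pmap_X rmorph1 mul1r.
Qed.

Lemma monomial_pneg : monomial_endo (@pneg L) (-1) idfun.
Proof.
split; first by rewrite oppr_eq0 oner_neq0.
  by rewrite -[LHS]/(pneg pX) pneg_X rmorphN1 mulN1r.
by move=> g; rewrite -[LHS]/((-1) ^+ 0 * pc g 0) expr0 mul1r.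
Qed.

Lemma monomial_comp f ep r f' ep' r' : monomial_endo f ep r -> monomial_endo f' ep' r' ->
  f' (pconst ep) = pconst (r' ep) -> monomial_endo (f' \o f) (r' ep * ep') (r' \o r).
Proof.
move=> [n fX f0] [n' fX' f0'] h; split; first by rewrite mulf_neq0 // fmorph_eq0.
  by rewrite -[LHS]/(f' (f pX)) fX rmorphM h // fX' mulrA -rmorphM.
by move=> g; rewrite /= f0' f0.
Qed.

Lemma lterm_bool (x : {fraction S}) n c (b : bool) : lterm x n c ->
  lterm (x ^+ b) (if b then n else 0) (c ^+ b).
Proof.
case: b => // _; rewrite !expr0 -(rmorph1 (@tofrac S)).
by apply: lterm_ps; rewrite pc1 oner_eq0.
Qed.

Variables (D : omod P1) (s : osec D) (C : mu2_gerbe (rootstack s)).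
Variables (A : algType Qt) (hC : has_brauer_class C A) (i1 j1 i2 j2 : A).
Hypothesis gens : biquat_gens (17%:R : Qt) tvar (13%:R : Qt) ((tvar - 1) * (tvar - 11%:R)) i1 j1 i2 j2.
Variables (qr : {rmorphism rat -> L}) (t0 : L) (e : nat) (e0 : (0 < e)%N) (t00 : t0 != 0).
Local Notation tau := (ramif t0 e).
Variable c : C S.
Hypothesis atc : P1at false (rpt (gpi C S c)) tau.
Variables (al be : L).
Hypotheses (eal : al ^+ 2 = 17%:R) (ebe : be ^+ 2 = 13%:R).

Definition monomial_arr (a : arr c c) ep r := exists f : {rmorphism S -> S},
  [/\ afun a = f, f tau = tau & monomial_endo f ep r].

(** The relation of [local_W] is read on valuations and leading coefficients. The substitution u ->
    ep' u contributes the power ep' ^ v a. *)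
Lemma leading_cocycle : exists (v : arr c c -> int) (ld : arr c c -> L),
  (forall a ep r, monomial_arr a ep r -> ld a != 0) /\
  forall a ep r a' ep' r' a'' ep'' r'' z n ga,
    monomial_arr a ep r -> monomial_arr a' ep' r' -> monomial_arr a'' ep'' r'' ->
    acomp a a' = acomp a'' (aband c z) -> lterm (tofrac ((tau - 1) * (tau - 11%:R))) n ga ->
    v a + v a' + (if sgn_be be a && sgn_be be a' then n else 0) = v a'' /\
    ep' ^ v a * r' (ld a) * ld a' *
      (t0 ^+ (sgn_al al a && sgn_al al a') * ga ^+ (sgn_be be a && sgn_be be a')) =
    pc (sval z) 0 * ld a''.
Proof.
have [xi [xi0 xiM]] := local_W hC gens qr e0 atc eal ebe.
have adm (a : arr c c) ep r : monomial_arr a ep r -> admissible t0 e a.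
  by move=> [f [fa ft fm]]; exists f; split=> //; [apply: monomial_inj fm | rewrite fa].
have vl (a : arr c c) : {x : int * L | admissible t0 e a -> lterm (xi a) x.1 x.2}.
  apply: cid; case: (pselect (admissible t0 e a)) => ha; last by exists (0, 0).
  by have [n [d h]] := lterm_exists (xi0 a ha); exists (n, d).
pose v a := (sval (vl a)).1; pose ld a := (sval (vl a)).2.
have vP a : admissible t0 e a -> lterm (xi a) (v a) (ld a) := svalP (vl a).
exists v, ld; split=> [a ep r /adm/vP[]//|].
move=> a ep r a' ep' r' a'' ep'' r'' z n ga ha ha' ha'' ea hn.
have [f' [fa' ft' fm']] := ha'; have [nep fX f0] := fm'.
have [|phi ephi] := @fraction_lift _ _ ((@tofrac S) \o f').
  by move=> x y /= /eqP; rewrite tofrac_eq => /eqP /(monomial_inj fm').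
have M := xiM a a' a'' z phi (adm _ _ _ ha) (adm _ _ _ ha') (adm _ _ _ ha'') ea _.
have {}M := M (fun f => etrans (ephi f) (congr1 (fun g => tofrac (g f)) (esym fa'))).
have l1 := @lterm_map _ _ f' r' ep' phi _ _ _ nep _ fX f0 ephi (vP a (adm _ _ _ ha)).
have {}l1 := l1 (fun x => fun e => fmorph_inj r' (etrans e (esym (rmorph0 r')))).
have lt : lterm (tofrac tau) 0 t0.
  by rewrite -{2}(pc_ramif t0 e0); apply: lterm_ps; rewrite pc_ramif.
have l2 := lterm_bool (sgn_al al a && sgn_al al a') lt.
have l3 := lterm_bool (sgn_be be a && sgn_be be a') hn.
have l4 := ltermM (ltermM l1 (vP a' (adm _ _ _ ha'))) (ltermM l2 l3).
have lz : lterm (tofrac (sval z)) 0 (pc (sval z) 0).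
  apply: lterm_ps; apply/eqP => z0; have := congr1 (fun g => pc g 0) (svalP z).
  by rewrite expr2 pc0M z0 mul0r pc1 => /eqP; rewrite eq_sym oner_eq0.
have l5 := ltermM lz (vP a'' (adm _ _ _ ha'')).
rewrite M in l4; have [ev el] := lterm_uniq l4 l5.
split; last exact: el.
by move: ev; rewrite add0r => <-; congr (_ + _); case: (_ && sgn_al _ _); rewrite add0r.
Qed.
End MonomialArrows.

Lemma fin_hom_zero (G : finGroupType) (h : G -> int) :
  (forall x y, h (x * y)%g = h x + h y) -> forall x, h x = 0.
Proof.
move=> hM x; have h1 : h 1%g = 0 by have := hM 1%g 1%g; rewrite mulg1; lia.
have hX n : h (x ^+ n)%g = h x *+ n.
  by elim: n => [|n IH]; rewrite ?h1 // expgS hM IH mulrS.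
by have /eqP := hX #[x]%g; rewrite expg_order h1 eq_sym mulrn_eq0 eqn0Ngt order_gt0 => /eqP.
Qed.

Section GaloisLeading.
Variables (D : omod P1) (s : osec D).
Variables (eD : forall b, D _ (chart b)) (FD : bool -> {poly rat}).
Variable C : mu2_gerbe (rootstack s).
Variables (A : algType Qt) (hC : has_brauer_class C A) (i1 j1 i2 j2 : A).
Hypothesis gens : biquat_gens (17%:R : Qt) tvar (13%:R : Qt) ((tvar - 1) * (tvar - 11%:R)) i1 j1 i2 j2.
Variables (k O : fieldType) (iota : {rmorphism k -> O}).
Variables (qr : {rmorphism rat -> k}) (t0 : k) (e : nat) (e0 : (0 < e)%N) (t00 : t0 != 0).
Variables (nu g : pser k) (sgn : bool).
Hypothesis nz : nu != 0.
Variables (E : galext iota) (c : C (pser E)).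
Hypothesis hc : equivariant_pt eD qr t0 e nu g sgn c.
Variables (al be : E).
Hypotheses (eal : al ^+ 2 = 17%:R) (ebe : be ^+ 2 = 13%:R).

Local Notation tau := (ramif (ge_in E t0) e).

Lemma pmap_ramif (K1 K2 : fieldType) (f : {rmorphism K1 -> K2}) a :
  pmap f (ramif a e) = ramif (f a) e.
Proof. by rewrite /ramif rmorphD rmorphXn /= pmap_const pmap_X. Qed.

Lemma equivariant_at : P1at false (rpt (gpi C _ c)) tau.
Proof.
have [/(cdata_at (@localring_pser E)) + _ _] := hc.
by rewrite /qE -[X in P1at _ _ X]/(pmap (ge_in E) (qpoly_at qr (ramif t0 e) 'X)) qpoly_at_X pmap_ramif.
Qed.

Lemma equivariant_band (a a' : arr c c) : afun a =1 afun a' ->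
  exists2 z, (sval z = 1 \/ sval z = -1) & a' = acomp a (aband c z).
Proof.
have [[h [n1 [gn en _]]] _ _] := hc; apply: garr_band gn en _.
apply: contra_neq nz => /(congr1 (fun f => pc f)) h0; apply: pserP => n.
by apply: (fmorph_inj (ge_in E)); rewrite rmorph0; apply: (congr1 (fun f => f n) h0).
Qed.

Lemma aband_id (d : C (pser E)) : exists2 z, sval z = 1 & aband d z = Arr (hid d).
Proof.
have [z ez] : exists z, gband C d z = hid d by apply/g_band_im; rewrite fmap_id.
exists z; last by rewrite /aband ez.
pose w : mu2 (pser E) := exist _ 1 (expr1n _ 2).
have ew : sval w = sval z * sval z by rewrite -expr2 (svalP z).
have /g_band_inj <- // : gband C d w = gband C d z.
by rewrite (@g_band_mul _ C _ d z z w ew) ez hcomp1h.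
Qed.

Lemma galois_arrows : exists a : ge_G E -> arr c c,
  forall x, afun (a x) = pmap (ge_act E x) /\ monomial_arr (ge_in E t0) e (a x) 1 (ge_act E x).
Proof.
have [_ ha _] := hc; exists (fun x => sval (cid (ha x))) => x.
case: (cid (ha x)) => a /= fa; split=> //; exists (pmap (ge_act E x)).
by split=> //; [rewrite -[LHS]/(pmap (ge_act E x) tau) pmap_ramif ge_act_in | apply: monomial_pmap].
Qed.

Lemma galois_band (a : ge_G E -> arr c c) : (forall x, afun (a x) = pmap (ge_act E x)) ->
  forall x y, exists z, acomp (a x) (a y) = acomp (a (x * y)%g) (aband c z).
Proof.
move=> fa x y; have [|z _ ez] := @equivariant_band (a (x * y)%g) (acomp (a x) (a y)); last by exists z.
move=> f; rewrite fa -[RHS]/(afun (a y) (afun (a x) f)) !fa pmap_comp.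
by apply: eq_pmap => b /=; rewrite ge_actM.
Qed.

Lemma sgn_flips (b : E) (a : arr c c) x : afun a = pmap (ge_act E x) -> sgn_al b a = flips b x.
Proof. by move=> fa; rewrite /sgn_al fa pmap_const (inj_eq (fmorph_inj _)). Qed.

(* Twice the valuation plus the flip of the square root of 13 is a homomorphism from
   a finite group to the integers. *)
Lemma leading_parity ga : [pchar k] =i pred0 -> (forall b : k, b ^+ 2 != 13%:R) ->
  lterm (tofrac ((tau - 1) * (tau - 11%:R))) 1 ga -> False.
Proof.
move=> pchark n13 hG; have ebe' : be ^+ 2 = ge_in E 13%:R by rewrite rmorph_nat.
have two0 : (2%:R : k) != 0 by rewrite (pcharf0P k).1.
have [a ha] := galois_arrows.
have t0E : ge_in E t0 != 0 by rewrite fmorph_eq0.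
have [v [ld [_ hv]]] := leading_cocycle hC gens (ge_in E \o qr) e0 t0E equivariant_at eal ebe.
have vM x y : v (a x) + v (a y) + (if flips be x && flips be y then 1 else 0) = v (a (x * y)%g).
  have [z ez] := galois_band (fun x => (ha x).1) x y.
  have [+ _] := hv _ _ _ _ _ _ _ _ _ _ _ _ (ha x).2 (ha y).2 (ha _).2 ez hG.
  by rewrite -[sgn_be]/sgn_al !(sgn_flips _ (ha _).1).
pose h x : int := 2 * v (a x) + flips be x.
have hM x y : h (x * y)%g = h x + h y.
  rewrite /h -vM (flipsM ebe' n13 two0).
  by case: (flips be x); case: (flips be y) => /=; lia.
have [x hx] := flips_exists ebe' n13.
by have := fin_hom_zero hM x; rewrite /h hx; lia.
Qed.

Hypothesis e2 : sgn -> pneg (ramif (ge_in E t0) e) = ramif (ge_in E t0) e.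

(** As the root of 13 lies in k, no arrow moves it and the factor (t-1)(t-11) drops out. The
    valuations of the Galois arrows then form a homomorphism from a finite group to the integers,
    which vanishes; that of jj vanishes because jj is an involution up to the band. *)
Lemma leading_data : sgn -> (exists b, be = ge_in E b) ->
  exists (a : ge_G E -> arr c c) (jj : arr c c) (x : ge_G E -> E) (w : E),
  [/\ forall y, afun (a y) = pmap (ge_act E y) /\ x y != 0,
      afun jj = @pneg E /\ w != 0,
      forall y y', exists z, acomp (a y) (a y') = acomp (a (y * y')%g) (aband c z) /\
        ge_act E y' (x y) * x y' * ge_in E t0 ^+ (flips al y && flips al y') =
        pc (sval z) 0 * x (y * y')%g,
      forall y, exists z, acomp (a y) jj = acomp (acomp jj (a y)) (aband c z) /\
        x y * w = pc (sval z) 0 * (ge_act E y w * x y) &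
      exists z, acomp jj jj = aband c z /\ w * w = pc (sval z) 0].
Proof.
move=> hs [b eb]; have [a ha] := galois_arrows.
have [_ _ /(_ hs)[jj fj]] := hc.
have t0E : ge_in E t0 != 0 by rewrite fmorph_eq0.
have [v [ld [ld0 hv]]] := leading_cocycle hC gens (ge_in E \o qr) e0 t0E equivariant_at eal ebe.
have mj : monomial_arr (ge_in E t0) e jj (-1) idfun.
  by exists (@pneg E); split=> //; [apply: e2 | apply: monomial_pneg].
have tau_nz (m : nat) : tau - m%:R != 0.
  have -> : tau - m%:R = qpoly_at (ge_in E \o qr) tau ('X - m%:R%:P).
    by rewrite rmorphB qpoly_at_X polyC_natr rmorph_nat.
  rewrite -(rmorph0 (qpoly_at (ge_in E \o qr) tau)) (inj_eq (@qpoly_at_inj _ _ _ e e0)).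
  by rewrite polyXsubC_eq0.
have [n [ga hG]] : exists n ga, lterm (tofrac ((tau - 1) * (tau - 11%:R))) n ga.
  by apply: lterm_exists; rewrite tofrac_eq0 mulf_neq0 // (tau_nz 1%N).
have sb y : sgn_be be (a y) = false.
  by rewrite -[sgn_be]/sgn_al (sgn_flips _ (ha _).1) /flips eb ge_act_in eqxx.
have sjb b' : sgn_al b' jj = false by rewrite /sgn_al fj pneg_const eqxx.
have vM y y' : exists z, [/\ acomp (a y) (a y') = acomp (a (y * y')%g) (aband c z),
    v (a (y * y')%g) = v (a y) + v (a y') &
    1 ^ v (a y) * ge_act E y' (ld (a y)) * ld (a y') * ge_in E t0 ^+ (flips al y && flips al y') =
        pc (sval z) 0 * ld (a (y * y')%g)].
  have [z ez] := galois_band (fun x => (ha x).1) y y'; exists z.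
  have [hv1 hv2] := hv _ _ _ _ _ _ _ _ _ _ _ _ (ha y).2 (ha y').2 (ha _).2 ez hG.
  move: hv1 hv2; rewrite sb addr0 expr0 mulr1 !(sgn_flips _ (ha _).1) => hv1 hv2.
  by split.
have va y : v (a y) = 0.
  by apply: (fin_hom_zero (h := fun y => v (a y))) => y1 y2; have [z []] := vM y1 y2.
have [z1 ez1 band1] := aband_id c.
have b1 (d : arr c c) : acomp d (aband c z1) = d.
  by rewrite band1 /acomp /= hcomph1; case: d.
pose i := Arr (hid c).
have mi : monomial_arr (ge_in E t0) e i 1 idfun.
  exists idfun; split=> //; split; rewrite ?oner_neq0 //.
  by rewrite rmorph1 mul1r.
have ii : acomp i i = acomp i (aband c z1) by rewrite b1 /acomp /= hcomp1h.
have sib b' : sgn_al b' i = false by rewrite /sgn_al eqxx.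
(* The identity arrow is idempotent, which determines its valuation and leading coefficient. *)
have [vi li] : v i = 0 /\ ld i = 1.
  have [h1 h2] := hv _ _ _ _ _ _ _ _ _ _ _ _ mi mi mi ii hG.
  move: h1 h2; rewrite -[sgn_be]/sgn_al !sib /= addr0 !expr0 !mulr1 ez1 pc1 mul1r => h1.
  have {h1} h1 : v i = 0 by lia.
  by rewrite h1 expr0z mul1r; split=> //; apply: (mulfI (ld0 _ _ _ mi)); rewrite mulr1.
have [zj [ej hj vj]] : exists z, [/\ acomp jj jj = aband c z, ld jj * ld jj = pc (sval z) 0 & v jj = 0].
  have [|z _ ez] := @equivariant_band i (acomp jj jj); first by move=> f; rewrite /= fj pnegK.
  have [h1 h2] := hv _ _ _ _ _ _ _ _ _ _ _ _ mj mj mi ez hG.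
  move: h1 h2; rewrite -[sgn_be]/sgn_al !sjb /= addr0 !expr0 !mulr1 vi li mulr1 => h1.
  have {h1} h1 : v jj = 0 by lia.
  rewrite h1 expr0z mul1r => h2; exists z; split=> //.
  by rewrite ez /acomp /= hcomp1h.
exists a, jj, (fun y => ld (a y)), (ld jj); split.
- by move=> y; split; [apply: (ha y).1 | apply: ld0 (ha y).2].
- by split; [exact: fj | apply: ld0 mj].
- move=> y y'; have [z [h1 _ h2]] := vM y y'; exists z; split=> //.
  by rewrite -h2 va expr0z mul1r.
- move=> y; pose a' := acomp jj (a y).
  have ma' : monomial_arr (ge_in E t0) e a' (ge_act E y (-1) * 1) (ge_act E y \o idfun).
    exists (pmap (ge_act E y) \o @pneg E); split.
    + by rewrite -[LHS]/(fun f => afun (a y) (afun jj f)) fj (ha y).1.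
    + by rewrite -[LHS]/(pmap (ge_act E y) (pneg tau)) e2 // pmap_ramif ge_act_in.
    apply: monomial_comp (monomial_pneg _) (monomial_pmap _) _.
    by rewrite -[LHS]/(pmap _ _) pmap_const.
  have [|z _ ez] := @equivariant_band a' (acomp (a y) jj).
    by move=> f; rewrite /= fj (ha y).1 pneg_pmap.
  exists z; split=> //.
  have [_ h1] := hv _ _ _ _ _ _ _ _ _ _ _ _ mj (ha y).2 ma' (esym (b1 a')) hG.
  have [_ h2] := hv _ _ _ _ _ _ _ _ _ _ _ _ (ha y).2 mj ma' ez hG.
  move: h1 h2; rewrite -[sgn_be]/sgn_al !sjb !andbF /= !expr0 !mulr1 vj va !expr0z !mul1r ez1 pc1 mul1r => ->.
  by [].
by exists zj.
Qed.
End GaloisLeading.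

(** * Base change of moduli objects *)

Lemma omod_eq (X : rcat) (vs : forall R : comNzRingType, X R -> lmodType R)
    (vm : forall (R S : comNzRingType) (f : R -> S) (x : X R) (y : X S), hom f x y -> vs R x -> vs S y)
    p1 p2 p3 q1 q2 q3 : @OMod X vs vm p1 p2 p3 = @OMod X vs vm q1 q2 q3.
Proof. by rewrite (Prop_irrelevance p1 q1) (Prop_irrelevance p2 q2) (Prop_irrelevance p3 q3). Qed.

Section OmodEq.
Variable X : rcat.

(** The two modules differ only in the proofs stored in the objects and arrows of the base change.
    These proofs are made variable, so that proof irrelevance can identify them. *)
Lemma pull_bcrestr (K R S : comNzRingType) (g : K -> R) (h : R -> S) (hg : is_rmorph g)
    (hh : is_rmorph h) (hgh : is_rmorph (fun a => h (g a))) (V : omod (bc X K)) :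
  pull (bcrestr X hh) (pull (bcrestr X hg) V) = pull (bcrestr X hgh) V.
Proof.
pose restr (pf : forall T (x : bc X S T), is_rmorph (fun a => bmap x (h (g a)))) T (x : bc X S T) :=
  @BOb X K (fun _ _ _ => True) T (fun a => bmap x (h (g a))) (bpt x) (pf T x) I.
pose prf := forall (T W : comNzRingType) (f : T -> W) (x : bc X S T) (y : bc X S W) (u : hom f x y) a,
  f (bmap x (h (g a))) = bmap y (h (g a)).
pose rmap pf (pr : prf) (T W : comNzRingType) (f : T -> W) (x : bc X S T) (y : bc X S W) (u : hom f x y) :
  @hom (bc X K) _ _ f (restr pf T x) (restr pf W y) := exist _ (sval u) (pr T W f x y u).
have key pf pf' (pr pr' : prf) p1 p2 p3 q1 q2 q3 :
    @OMod (bc X S) (fun T x => V T (restr pf T x)) (fun T W f x y u => vmap V (rmap pf pr _ _ _ _ _ u)) p1 p2 p3 =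
    @OMod (bc X S) (fun T x => V T (restr pf' T x)) (fun T W f x y u => vmap V (rmap pf' pr' _ _ _ _ _ u)) q1 q2 q3.
  move: q1 q2 q3; rewrite -(Prop_irrelevance pf pf') -(Prop_irrelevance pr pr') => q1 q2 q3.
  exact: (@omod_eq (bc X S) _ _ p1 p2 p3 q1 q2 q3).
exact: key.
Qed.

Lemma vmap_reid (R S : comNzRingType) (V : omod (bc X R)) (x : bc X R S)
    (p : forall a, bmap x a = bmap x a) v :
  vmap V (exist _ (hid (bpt x)) p : hom (fun a : S => a) x x) v = v.
Proof. by rewrite -[RHS](vmap_id v); congr (vmap V _ v); apply: eq_exist. Qed.
End OmodEq.

Section MobjPull.
Variables (D : omod P1) (s : osec D) (C : mu2_gerbe (rootstack s)) (L : omod (rootstack s)) (r : nat).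

Lemma mobj_pull (R S : comNzRingType) (g : R -> S) (hg : is_rmorph g) (m : mobj C L r R) :
  exists m' : mobj C L r S, mV m' = pull (bcrestr C hg) (mV m) /\ is_mpull g m m'.
Proof.
pose V' := pull (bcrestr C hg) (mV m).
pose det' T (x : bc C S T) : {ffun 'I_r -> V' T x} -> detL C L S T x := @mdet _ _ _ _ _ _ m T (bcrestr C hg T x).
have hb : is_bundle r V'.
  have [b1 b2] := mV_bundle m; split=> [T W f x y h|T x]; [exact: b1 | exact: b2].
have ht : is_twisted V'.
  move=> T x z v; rewrite -(@mV_twisted _ _ _ _ _ _ m T (bcrestr C hg T x) z v).
  by congr (vmap (mV m) _ v); exact: eq_exist.
have hd : is_det det'.
  have [d1 d2 d3] := mdetP m; split=> [T x|T W f x y h t|T x t]; 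
    [exact: d1 | exact: (d2 T W f (bcrestr C hg T x) (bcrestr C hg W y) (fmap (bcrestr C hg) h) t) | exact: d3].
have hgeom (K : fieldType) (h : S -> K) (hh : is_rmorph h) : alg_closed K ->
    is_regular (pull (bcrestr C hh) V') /\ is_stable r (pull (bcrestr C hh) V').
  move=> cK; rewrite /V' (pull_bcrestr hg hh (rmorph_comp hg hh)); exact: mV_geom.
exists (MObj hb ht hd hgeom); split=> //.
exists hg, (fun T x v => v); split.
  by split; [move=> T x a v w | move=> T x; exists id | ].
by move=> T x t; congr (mdet _); apply/ffunP => i; rewrite ffunE.
Qed.

(* An isomorphism from the base change of V along f1 to the one along f2. The
   proofs that ring maps are morphisms are quantified, so that no object of the
   base change has to be cast. *)
Definition twist_iso (R S : comNzRingType) (m : mobj C L r R) (f1 f2 : R -> S) : Prop :=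
  exists th : forall (T : comNzRingType) (x : S -> T) (c : C T) (hx : is_rmorph x)
      (h1 : is_rmorph (fun a => x (f1 a))) (h2 : is_rmorph (fun a => x (f2 a))),
      mV m T (@BOb C R (fun _ _ _ => True) T _ c h1 I) -> mV m T (@BOb C R (fun _ _ _ => True) T _ c h2 I),
  [/\ forall (T : comNzRingType) (x : S -> T) (c : C T) hx h1 h2, is_lin (th T x c hx h1 h2),
      forall (T : comNzRingType) (x : S -> T) (c : C T) hx h1 h2, bijective (th T x c hx h1 h2),
      forall (T T' : comNzRingType) (g : T -> T') (x : S -> T) (x' : S -> T') (c : C T) (c' : C T')
        hx hx' h1 h2 h1' h2' (u : hom g c c') (ex : forall a, g (x a) = x' a) v,
        th T' x' c' hx' h1' h2' (@vmap _ (mV m) _ _ g (BOb h1 I) (BOb h1' I) (exist _ u (fun a => ex (f1 a))) v) =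
        @vmap _ (mV m) _ _ g (BOb h2 I) (BOb h2' I) (exist _ u (fun a => ex (f2 a))) (th T x c hx h1 h2 v) &
      forall (T : comNzRingType) (x : S -> T) (c : C T) hx h1 h2
        (t : {ffun 'I_r -> mV m T (@BOb C R (fun _ _ _ => True) T (fun a => x (f1 a)) c h1 I)}),
        mdet [ffun i => th T x c hx h1 h2 (t i)] = mdet t].

Lemma twist_iso_push (R S S' : comNzRingType) (m : mobj C L r R) (f1 f2 : R -> S) (g : S -> S') :
  is_rmorph g -> twist_iso m f1 f2 -> twist_iso m (fun a => g (f1 a)) (fun a => g (f2 a)).
Proof.
move=> hg [th [t1 t2 t3 t4]].
exists (fun T x c hx h1 h2 => th T (fun a => x (g a)) c (rmorph_comp hg hx) h1 h2); split.
- by move=> *; exact: t1.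
- by move=> *; exact: t2.
- move=> T T' g0 x x' c c' hx hx' h1 h2 h1' h2' u ex v.
  exact: (t3 T T' g0 (fun a => x (g a)) (fun a => x' (g a)) c c' _ _ h1 h2 h1' h2' u (fun a => ex (g a))).
- by move=> *; exact: t4.
Qed.

(** The object m and its twist [msg] both become n over S, so the isomorphism is phi3 phi2
    phi1^-1. *)
Lemma twist_iso_mpull (R S S' : comNzRingType) (m : mobj C L r R) (sg : R -> R)
    (msg : mobj C L r R) (n : mobj C L r S) (f : R -> S) (h : S -> S') : is_rmorph h ->
  is_mpull sg m msg -> is_mpull f m n -> is_mpull f msg n ->
  twist_iso m (fun a => h (f a)) (fun a => h (f (sg a))).
Proof.
move=> hh [hsg [phi3 [[l3 b3 n3] d3]]] [hf [phi1 [[l1 b1 n1] d1]]] [hf' [phi2 [[l2 b2 n2] d2]]].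
pose ob0 (T : comNzRingType) (x : S' -> T) (c : C T) (hx : is_rmorph x) : bc C S T :=
  bcrestr C hh T (@BOb C S' (fun _ _ _ => True) T x c hx I).
have ex1 (T : comNzRingType) (x : S' -> T) (c : C T) hx :
    exists k, cancel k (phi1 T (ob0 T x c hx)) /\ cancel (phi1 T (ob0 T x c hx)) k.
  by have [k k1 k2] := b1 T (ob0 T x c hx); exists k.
pose k1 (T : comNzRingType) (x : S' -> T) (c : C T) hx := sval (cid (ex1 T x c hx)).
have k1P (T : comNzRingType) (x : S' -> T) (c : C T) hx :
    cancel (k1 T x c hx) (phi1 T (ob0 T x c hx)) /\ cancel (phi1 T (ob0 T x c hx)) (k1 T x c hx).
  exact: svalP (cid (ex1 T x c hx)).
pose E1 (T : comNzRingType) (x : S' -> T) (c : C T) hx : is_rmorph (fun a => x (h (f a))) :=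
  bmap_rm (bcrestr C hf T (ob0 T x c hx)).
pose E2 (T : comNzRingType) (x : S' -> T) (c : C T) hx : is_rmorph (fun a => x (h (f (sg a)))) :=
  bmap_rm (bcrestr C hsg T (bcrestr C hf' T (ob0 T x c hx))).
(* The identity of c as an arrow between objects that differ only in a proof. *)
pose cast (T : comNzRingType) (x : R -> T) (c : C T) (h1 h2 : is_rmorph x) :
   @hom (bc C R) _ _ (fun a : T => a) (@BOb C R (fun _ _ _ => True) T x c h1 I) (@BOb C R (fun _ _ _ => True) T x c h2 I) :=
  exist _ (hid c) (fun a => erefl).
have castE (T : comNzRingType) (x : R -> T) (c : C T) (h1 : is_rmorph x) v :
  vmap (mV m) (cast T x c h1 h1) v = v by apply: vmap_reid.
pose th0 (T : comNzRingType) (x : S' -> T) (c : C T) (hx : is_rmorph x) v :=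
  phi3 T (bcrestr C hf' T (ob0 T x c hx)) (phi2 T (ob0 T x c hx) (k1 T x c hx v)).
pose th (T : comNzRingType) (x : S' -> T) (c : C T) (hx : is_rmorph x)
   (h1 : is_rmorph (fun a => x (h (f a)))) (h2 : is_rmorph (fun a => x (h (f (sg a))))) v :=
  vmap (mV m) (cast T _ c (E2 T x c hx) h2) (th0 T x c hx (vmap (mV m) (cast T _ c h1 (E1 T x c hx)) v)).
have thE (T : comNzRingType) (x : S' -> T) (c : C T) (hx : is_rmorph x) :
    th T x c hx (E1 T x c hx) (E2 T x c hx) = th0 T x c hx.
  by apply: functional_extensionality_dep => v; rewrite /th !castE.
have kl (T : comNzRingType) (x : S' -> T) (c : C T) hx : is_lin (k1 T x c hx).
  move=> a v w; have [ka kb] := k1P T x c hx; apply: (can_inj kb).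
  by rewrite ka (l1 _ _ a) !ka.
have kn (T T' : comNzRingType) (g : T -> T') (x : S' -> T) (x' : S' -> T') (c : C T) (c' : C T')
    hx hx' (u : hom g c c') (ex : forall a, g (x a) = x' a) v :
    k1 T' x' c' hx' (@vmap _ (mV m) _ _ g (BOb (E1 T x c hx) I) (BOb (E1 T' x' c' hx') I) (exist _ u (fun a => ex (h (f a)))) v) =
    @vmap _ (mV n) _ _ g (ob0 T x c hx) (ob0 T' x' c' hx') (exist _ u (fun a => ex (h a))) (k1 T x c hx v).
  have [ka kb] := k1P T' x' c' hx'; apply: (can_inj kb); rewrite ka n1.
  have [ka' _] := k1P T x c hx; rewrite ka'.
  by congr (vmap (mV m) _ v); exact: eq_exist.
exists th; split.
- move=> T x c hx h1 h2; rewrite (Prop_irrelevance h1 (E1 T x c hx)) (Prop_irrelevance h2 (E2 T x c hx)) thE.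
  by move=> a v w; rewrite /th0 kl l2 l3.
- move=> T x c hx h1 h2; rewrite (Prop_irrelevance h1 (E1 T x c hx)) (Prop_irrelevance h2 (E2 T x c hx)) thE.
  have [ka kb] := k1P T x c hx.
  have [i3 i3a i3b] := b3 T (bcrestr C hf' T (ob0 T x c hx)).
  have [i2 i2a i2b] := b2 T (ob0 T x c hx).
  exists (fun v => phi1 T (ob0 T x c hx) (i2 (i3 v))) => v; first by rewrite /th0 i3a i2a ka.
  by rewrite /th0 kb i2b i3b.
- move=> T T' g x x' c c' hx hx' h1 h2 h1' h2' u ex.
  rewrite (Prop_irrelevance h1 (E1 T x c hx)) (Prop_irrelevance h2 (E2 T x c hx)).
  rewrite (Prop_irrelevance h1' (E1 T' x' c' hx')) (Prop_irrelevance h2' (E2 T' x' c' hx')) !thE => v.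
  rewrite /th0 kn n2 n3; congr (vmap (mV m) _ _); exact: eq_exist.
move=> T x c hx h1 h2; rewrite (Prop_irrelevance h1 (E1 T x c hx)) (Prop_irrelevance h2 (E2 T x c hx)) thE => t.
have [ka kb] := k1P T x c hx.
pose t1 := [ffun i => k1 T x c hx (t i)]; pose t2 := [ffun i => phi2 T (ob0 T x c hx) (t1 i)].
transitivity (mdet t2).
  by rewrite -(d3 T (bcrestr C hf' T (ob0 T x c hx)) t2); congr mdet; apply/ffunP => i; rewrite !ffunE.
transitivity (mdet t1); first exact: (d2 T (ob0 T x c hx) t1).
rewrite -(d1 T (ob0 T x c hx) t1).
have e : [ffun i => phi1 T (ob0 T x c hx) (t1 i)] = t
    :> {ffun 'I_r -> mV m T (bcrestr C hf T (ob0 T x c hx))}.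
  by apply/ffunP => i; rewrite !ffunE; exact: ka.
exact: (congr1 (@mdet _ _ _ _ _ _ m T (bcrestr C hf T (ob0 T x c hx))) e).
Qed.
End MobjPull.

(** * Natural isomorphisms between Galois twists *)

Section Twister.
Variables (D : omod P1) (s : osec D) (C : mu2_gerbe (rootstack s)) (L : omod (rootstack s)) (r : nat).
Variables (R S : comNzRingType) (m : mobj C L r R).

Definition bob_of (T : comNzRingType) (f : R -> T) (c : C T) (h : is_rmorph f) : bc C R T :=
  @BOb C R (fun _ _ _ => True) T f c h I.
Definition barr (T T' : comNzRingType) (g : T -> T') (f : R -> T) (f' : R -> T') (c : C T) (c' : C T')
   (h : is_rmorph f) (h' : is_rmorph f') (u : hom g c c') (e : forall a, g (f a) = f' a) :
  @hom (bc C R) _ _ g (bob_of c h) (bob_of c' h') := exist _ u e.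

Record twister (f1 f2 : R -> S) := Twister {
  tw :> forall (T : comNzRingType) (x : S -> T) (c : C T) (hx : is_rmorph x)
      (h1 : is_rmorph (fun a => x (f1 a))) (h2 : is_rmorph (fun a => x (f2 a))),
      mV m T (bob_of c h1) -> mV m T (bob_of c h2);
  tw_lin : forall (T : comNzRingType) (x : S -> T) (c : C T) (hx : is_rmorph x) h1 h2, is_lin (@tw T x c hx h1 h2);
  tw_bij : forall (T : comNzRingType) (x : S -> T) (c : C T) (hx : is_rmorph x) h1 h2, bijective (@tw T x c hx h1 h2);
  tw_nat : forall (T T' : comNzRingType) (g : T -> T') (x : S -> T) (x' : S -> T') (c : C T) (c' : C T')
        hx hx' h1 h2 h1' h2' (u : hom g c c') (ex : forall a, g (x a) = x' a) v,
        @tw T' x' c' hx' h1' h2' (vmap (mV m) (barr h1 h1' u (fun a => ex (f1 a))) v) =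
        vmap (mV m) (barr h2 h2' u (fun a => ex (f2 a))) (@tw T x c hx h1 h2 v);
  tw_det : forall (T : comNzRingType) (x : S -> T) (c : C T) (hx : is_rmorph x) h1 h2 (t : {ffun 'I_r -> mV m T (bob_of c h1)}),
        mdet [ffun i => @tw T x c hx h1 h2 (t i)] = mdet t }.

Arguments tw {f1 f2} t {T x c} hx h1 h2 v : rename.

Lemma twist_isoP (f1 f2 : R -> S) : twist_iso m f1 f2 -> inhabited (twister f1 f2).
Proof. by case=> th [t1 t2 t3 t4]; apply: inhabits (Twister t1 t2 t3 t4). Qed.

Lemma tw_comp (f1 f2 f3 : R -> S) (t : twister f1 f2) (t' : twister f2 f3) : is_rmorph f2 ->
  exists t'' : twister f1 f3, forall (T : comNzRingType) (x : S -> T) (c : C T) (hx : is_rmorph x) h1 h2 h3 (v : mV m T (bob_of c h1)),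
    tw t'' hx h1 h3 v = tw t' hx h2 h3 (tw t hx h1 h2 v).
Proof.
move=> hf2; pose tt (T : comNzRingType) (x : S -> T) (c : C T) (hx : is_rmorph x) h1 h3 (v : mV m T (bob_of c h1)) :=
  tw t' hx (rmorph_comp hf2 hx) h3 (tw t hx h1 (rmorph_comp hf2 hx) v).
have t1 T x c hx h1 h3 : is_lin (tt T x c hx h1 h3).
  by move=> a v w; rewrite /tt !tw_lin.
have t2 T x c hx h1 h3 : bijective (tt T x c hx h1 h3).
  have [k ka kb] := @tw_bij _ _ t T x c hx h1 (rmorph_comp hf2 hx).
  have [k' ka' kb'] := @tw_bij _ _ t' T x c hx (rmorph_comp hf2 hx) h3.
  by exists (k \o k') => v; rewrite /tt /= ?ka' ?ka ?kb ?kb'.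
have t3 (T T' : comNzRingType) (g : T -> T') (x : S -> T) (x' : S -> T') (c : C T) (c' : C T')
        hx hx' h1 h2 h1' h2' (u : hom g c c') (ex : forall a, g (x a) = x' a) v :
        tt T' x' c' hx' h1' h2' (vmap (mV m) (barr h1 h1' u (fun a => ex (f1 a))) v) =
        vmap (mV m) (barr h2 h2' u (fun a => ex (f3 a))) (tt T x c hx h1 h2 v).
  by rewrite /tt (@tw_nat _ _ t _ _ g x x' c c' hx hx' h1 (rmorph_comp hf2 hx) h1' (rmorph_comp hf2 hx') u ex)
    (@tw_nat _ _ t' _ _ g x x' c c' hx hx' (rmorph_comp hf2 hx) h2 (rmorph_comp hf2 hx') h2' u ex).
have t4 (T : comNzRingType) (x : S -> T) (c : C T) (hx : is_rmorph x) h1 h2 (v : {ffun 'I_r -> mV m T (bob_of c h1)}) :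
        mdet [ffun i => tt T x c hx h1 h2 (v i)] = mdet v.
  rewrite -(@tw_det _ _ t T x c hx h1 (rmorph_comp hf2 hx)) -(@tw_det _ _ t' T x c hx (rmorph_comp hf2 hx) h2).
  by congr mdet; apply/ffunP => i; rewrite !ffunE.
exists (Twister t1 t2 t3 t4) => T x c hx h1 h2 h3 v; rewrite /= /tt.
by rewrite (Prop_irrelevance (rmorph_comp hf2 hx) h2).
Qed.

Lemma tw_inv (f1 f2 : R -> S) (t : twister f1 f2) :
  exists t' : twister f2 f1, forall (T : comNzRingType) (x : S -> T) (c : C T) (hx : is_rmorph x) h1 h2,
   (forall v, tw t' hx h2 h1 (tw t hx h1 h2 v) = v :> mV m T (bob_of c h1)) /\
   (forall v, tw t hx h1 h2 (tw t' hx h2 h1 v) = v :> mV m T (bob_of c h2)).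
Proof.
have ex (T : comNzRingType) (x : S -> T) (c : C T) (hx : is_rmorph x) h1 h2 :
  exists k, cancel (@tw _ _ t T x c hx h1 h2) k /\ cancel k (@tw _ _ t T x c hx h1 h2).
  by have [k ka kb] := @tw_bij _ _ t T x c hx h1 h2; exists k.
pose tt (T : comNzRingType) (x : S -> T) (c : C T) hx h2 h1 := sval (cid (ex T x c hx h1 h2)).
have ttP (T : comNzRingType) (x : S -> T) (c : C T) hx h2 h1 :
   cancel (@tw _ _ t T x c hx h1 h2) (tt T x c hx h2 h1) /\ cancel (tt T x c hx h2 h1) (@tw _ _ t T x c hx h1 h2).
  exact: svalP (cid (ex T x c hx h1 h2)).
have t1 T x c hx h1 h3 : is_lin (tt T x c hx h1 h3).
  move=> a v w; have [ka kb] := ttP T x c hx h1 h3; apply: (can_inj ka).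
  by rewrite kb tw_lin !kb.
have t2 T x c hx h1 h3 : bijective (tt T x c hx h1 h3).
  by have [ka kb] := ttP T x c hx h1 h3; exists (@tw _ _ t T x c hx h3 h1).
have t3 (T T' : comNzRingType) (g : T -> T') (x : S -> T) (x' : S -> T') (c : C T) (c' : C T')
        hx hx' h1 h2 h1' h2' (u : hom g c c') (e : forall a, g (x a) = x' a) v :
        tt T' x' c' hx' h1' h2' (vmap (mV m) (barr h1 h1' u (fun a => e (f2 a))) v) =
        vmap (mV m) (barr h2 h2' u (fun a => e (f1 a))) (tt T x c hx h1 h2 v).
  have [ka kb] := ttP T' x' c' hx' h1' h2'; apply: (can_inj ka); rewrite kb.
  rewrite (@tw_nat _ _ t _ _ g x x' c c' hx hx' h2 h1 h2' h1' u e).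
  by have [_ kb'] := ttP T x c hx h1 h2; rewrite kb'.
have t4 (T : comNzRingType) (x : S -> T) (c : C T) (hx : is_rmorph x) h1 h2 (v : {ffun 'I_r -> mV m T (bob_of c h1)}) :
        mdet [ffun i => tt T x c hx h1 h2 (v i)] = mdet v.
  have [ka kb] := ttP T x c hx h1 h2.
  rewrite -(@tw_det _ _ t T x c hx h2 h1).
  have e : [ffun i => tw t hx h2 h1 ([ffun i0 => tt T x c hx h1 h2 (v i0)] i)] = v.
    by apply/ffunP => i; rewrite !ffunE kb.
  exact: (congr1 (@mdet _ _ _ _ _ _ m T (bob_of c h1)) e).
exists (Twister t1 t2 t3 t4) => T x c hx h1 h2.
by have [ka kb] := ttP T x c hx h2 h1; split.
Qed.

Lemma vmap_barr_id (T : comNzRingType) (f : R -> T) (c : C T) (h : is_rmorph f)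
    (e : forall a, f a = f a) v : vmap (mV m) (barr h h (hid c) e) v = v.
Proof. exact: vmap_reid. Qed.

Lemma tw_re (f1 f2 : R -> S) (e : f1 =1 f2) : exists t : twister f1 f2,
  forall (T : comNzRingType) (x : S -> T) (c : C T) (hx : is_rmorph x) h1 h2 v,
    tw t hx h1 h2 v = vmap (mV m) (barr h1 h2 (hid c) (fun a => congr1 x (e a))) v.
Proof.
have ef := functional_extensionality_dep e; subst f2.
have t4 (T : comNzRingType) (x : S -> T) (c : C T) (hx : is_rmorph x) h1 h2 (v : {ffun 'I_r -> mV m T (bob_of c h1)}) :
   mdet [ffun i => vmap (mV m) (barr h1 h2 (hid c) (fun a => congr1 x (e a))) (v i)] = mdet v.
  move: v; rewrite (Prop_irrelevance h1 h2) => v; congr mdet; apply/ffunP => i.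
  by rewrite ffunE vmap_barr_id.
unshelve eexists (@Twister f1 f1 (fun T x c hx h1 h2 v =>
  vmap (mV m) (barr h1 h2 (hid c) (fun a => congr1 x (e a))) v) _ _ _ t4) => //.
- by move=> T x c hx h1 h2; apply: vmap_semilin.
- move=> T x c hx h1 h2; rewrite (Prop_irrelevance h1 h2).
  by exists id => v; rewrite vmap_barr_id.
move=> T T' g x x' c c' hx hx' h1 h2 h1' h2' u ex.
rewrite (Prop_irrelevance h1 h2) (Prop_irrelevance h1' h2') => v.
by rewrite !vmap_barr_id; congr (vmap (mV m) _ v); exact: eq_exist.
Qed.

End Twister.

Arguments tw {D s C L r R S m f1 f2} t {T x c} hx h1 h2 v : rename.

Lemma tw_push (D : omod P1) (s : osec D) (C : mu2_gerbe (rootstack s)) (L : omod (rootstack s)) (r : nat)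
    (R S S' : comNzRingType) (m : mobj C L r R) (f1 f2 : R -> S) (g : S -> S') (t : twister m f1 f2) :
  is_rmorph g -> exists t' : twister m (fun a => g (f1 a)) (fun a => g (f2 a)),
  forall (T : comNzRingType) (x : S' -> T) (c : C T) (hx : is_rmorph x) (hgx : is_rmorph (fun a => x (g a))) h1 h2 (v : mV m T (bob_of c h1)),
    tw t' hx h1 h2 v = @tw _ _ _ _ _ _ _ _ _ _ t T (fun a => x (g a)) c hgx h1 h2 v.
Proof.
move=> hg.
unshelve eexists (@Twister _ _ _ _ _ _ _ m (fun a => g (f1 a)) (fun a => g (f2 a)) (fun T x c hx h1 h2 v =>
  @tw _ _ _ _ _ _ _ _ _ _ t T (fun a => x (g a)) c (rmorph_comp hg hx) h1 h2 v) _ _ _ _).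
- by move=> *; exact: tw_lin.
- by move=> *; exact: tw_bij.
- move=> T T' g0 x x' c c' hx hx' h1 h2 h1' h2' u ex v.
  exact: (@tw_nat _ _ _ _ _ _ _ _ _ _ t T T' g0 (fun a => x (g a)) (fun a => x' (g a)) c c' _ _ h1 h2 h1' h2' u (fun a => ex (g a))).
- by move=> *; exact: tw_det.
by move=> T x c hx hgx h1 h2 v /=; rewrite (Prop_irrelevance (rmorph_comp hg hx) hgx).
Qed.

Section GaloisTwist.
Variables (D : omod P1) (s : osec D) (C : mu2_gerbe (rootstack s)) (L : omod (rootstack s)) (r : nat).
Variables (k O : fieldType) (iota : {rmorphism k -> O}).
Hypothesis clO : alg_closed O.
Hypothesis algO : forall x, algebraicOver iota x.
Hypothesis pchark : [pchar k] =i pred0.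
Implicit Types E : galext iota.

(** Nothing is asked about the compatibility of the isomorphisms for different x. *)
Definition galois_invariant E0 (m : mobj C L r E0) E (j : galmor E0 E) : Prop :=
  forall x : ge_G E, twist_iso m j (fun a => ge_act E x (j a)).

Lemma galois_invariant_push E0 (m : mobj C L r E0) E (j : galmor E0 E) E' (j' : galmor E E') (j'' : galmor E0 E') :
  (forall a, j'' a = j' (j a)) -> galois_invariant m j -> galois_invariant m j''.
Proof.
move=> e h x; have h' := twist_iso_push (rmorphP j') (h (gm_res j' x)).
have -> : (j'' : E0 -> E') = (fun a => j' (j a)) by apply: functional_extensionality_dep.
have -> // : (fun a => ge_act E' x (j' (j a))) = (fun a => j' (ge_act E (gm_res j' x) (j a))).
by apply: functional_extensionality_dep => a; rewrite gm_act.
Qed.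

(** The section over k is represented by some m over a finite Galois extension. A Galois conjugate
    of m represents the same section, so it becomes isomorphic to m on an etale covering, hence over
    a larger Galois extension. *)
Lemma moduli_exists (M : coarse_moduli C L r k) E : exists E0 (j0 : galmor E E0) (m : mobj C L r E0)
  E1 (j : galmor E0 E1), galois_invariant m j.
Proof.
have [U hU] := cs_exists M.
have [E0 [j0 [i [h [hh eh]]]]] := galext_point clO algO pchark U (rmorphP (ge_in E)).
have [mi csi] := hU i; have [m [_ hm]] := mobj_pull hh mi.
have csm := cs_pull csi hm.
have in0 : (fun a => h (ec_f i a)) = ge_in E0 :> (k -> E0).
  by apply: functional_extensionality_dep => a; rewrite eh gm_in.
rewrite in0 in csm.
exists E0, j0, m.
(* A twist of m depends only on the restriction of the automorphism to E0, so finitely many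
   extensions suffice. *)
suff [E1 [j hj]] : exists E1 (j : galmor E0 E1), forall x, x \in enum [set: ge_G E0] ->
    twist_iso m j (fun a => j (ge_act E0 x a)).
  exists E1, j => x.
  have -> : (fun a => ge_act E1 x (j a)) = (fun a => j (ge_act E0 (gm_res j x) a)).
    by apply: functional_extensionality_dep => a; rewrite gm_act.
  by apply: hj; rewrite mem_enum inE.
elim: (enum _) => [|x xs [E1 [j hj]]].
  by have [j _] := galmor_id E0; exists E0, j.
have [mx [_ hmx]] := mobj_pull (rmorphP (ge_act E0 x)) m.
have csx := cs_pull csm hmx.
have inx : (fun a => ge_act E0 x (ge_in E0 a)) = ge_in E0 :> (k -> E0).
  by apply: functional_extensionality_dep => a; rewrite ge_act_in.
rewrite inx in csx; have [U' hU'] := cs_unique csm csx.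
have [E2 [j2 [i' [h' [hh' eh']]]]] := galext_point clO algO pchark U' (rmorphP j).
have [n [pn pn']] := hU' i'.
have tx := twist_iso_mpull hh' hmx pn pn'.
have [j3 ej3] := galmor_comp j j2; exists E2, j3.
have e1 : (j3 : E0 -> E2) = (fun a => h' (ec_f i' a)).
  by apply: functional_extensionality_dep => a; rewrite ej3 eh'.
move=> y; rewrite inE => /predU1P[->|/hj ty]; first by rewrite e1.
have := twist_iso_push (rmorphP j2) ty.
have -> : (fun a => j2 (j a)) = j3 by apply: functional_extensionality_dep => a; rewrite ej3.
suff -> : (fun a => j2 (j (ge_act E0 y a))) = (fun a => j3 (ge_act E0 y a)) by [].
by apply: functional_extensionality_dep => a; rewrite ej3.
Qed.
End GaloisTwist.

(** * The ramified geometric fibre *)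

Section Special.
Variables (D : omod P1) (s : osec D).
Hypothesis hD : is_bundle 1 D.
Variables (eD : forall b, D _ (chart b)) (FD : bool -> {poly rat}).
Hypothesis geD : forall b, is_gen (eD b).
Variable C : mu2_gerbe (rootstack s).
Variables (k O : fieldType) (iota : {rmorphism k -> O}).
Implicit Types E : galext iota.
Variables (qr : {rmorphism rat -> k}) (t0 : k).

Definition gN : omod C := pull (gpi C) (root_N s).

(** The situation at u = 0: c0 is the reduction of c, [b] and [J] are the reductions of the Galois
    arrows and of the arrow over u -> - u, and [x] and [w] are the leading coefficients of their
    actions on the eigenline. *)
Definition special_pt E (al : E) (c : C (pser E)) (c0 : C E) : Prop :=
  [/\ P1at false (rpt (gpi C _ c)) (ramif (ge_in E t0) 2),
      exists p : arr c c0, afun p = @pev E,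
      s E (rpt (gpi C _ c0)) = 0 &
      exists (b : ge_G E -> arr c0 c0) (J : arr c0 c0) (x : ge_G E -> E) (w : E),
      [/\ forall y, afun (b y) = ge_act E y /\ x y != 0,
          [/\ afun J = (fun a => a), w != 0 & exists (n : rN (gpi C _ c0)) e u v,
            [/\ is_gen n, is_gen e, v * u = 1, rsq n n = u *: e & avmap gN J n = - n]],
          forall y y', exists z, acomp (b y) (b y') = acomp (b (y * y')%g) (aband c0 z) /\
            ge_act E y' (x y) * x y' * ge_in E t0 ^+ (flips al y && flips al y') =
            sval z * x (y * y')%g,
          forall y, exists z, acomp (b y) J = acomp (acomp J (b y)) (aband c0 z) /\
            x y * w = sval z * (ge_act E y w * x y) &
          exists z, acomp J J = aband c0 z /\ w * w = sval z]].

Lemma aband_push (R S : comNzRingType) (d : C R) (d' : C S) (p : arr d d') (z : mu2 R) :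
  exists z', sval z' = afun p (sval z) /\ acomp (aband d z) p = acomp p (aband d' z').
Proof. by have [z' ez'] := mu2_push z (arr_rm p); exists z'; split=> //; apply: aband_nat. Qed.

Lemma avmap_gen (S T : comNzRingType) (d : C S) (d' : C T) (p : arr d d') b q nu g g' :
  localring T -> g' * g = 1 -> cdata eD b (gpi C _ d) q nu g ->
  exists n1 e, [/\ is_gen n1, rn (gpi C _ d) = nu *: n1, is_gen (avmap gN p n1), is_gen e &
    rsq (avmap gN p n1) (avmap gN p n1) = afun p g *: e].
Proof.
move=> lT gg [h [n1 [gn en esq]]].
exists n1, (vmap D (sval (fmap (gpi C) (ahom p))).1 (vmap D h (eD b))); split=> //.
- exact: root_gen_push lT gg esq (eD_gen hD geD h).
- rewrite -vmap_comp; exact: (@eD_gen _ hD _ geD).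
have [_ _ sq] := svalP (fmap (gpi C) (ahom p)).
by rewrite sq esq (semilinZ (arr_rm p) (@vmap_semilin _ D _ _ _ _ _ _)).
Qed.

Variables (g g' : pser k).
Hypothesis g'g : g' * g = 1.

Lemma special_exists (A : algType Qt) (i1 j1 i2 j2 : A) E (c : C (pser E)) (al : E) (be : k) :
  has_brauer_class C A ->
  biquat_gens (17%:R : Qt) tvar (13%:R : Qt) ((tvar - 1) * (tvar - 11%:R)) i1 j1 i2 j2 ->
  t0 != 0 -> al ^+ 2 = 17%:R -> be ^+ 2 = 13%:R ->
  equivariant_pt eD qr t0 2 pX g true c -> exists c0, special_pt al c c0.
Proof.
move=> hC gens t00 eal ebe hc.
have nX : (pX : pser k) != 0 := pX_neq0 k.
have ebe' : ge_in E be ^+ 2 = 13%:R by rewrite -rmorphXn ebe rmorph_nat.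
have tneg : true -> pneg (ramif (ge_in E t0) 2) = ramif (ge_in E t0) 2.
  move=> _; rewrite /ramif rmorphD rmorphXn /= pneg_const pneg_X.
  by rewrite sqrrN.
have [a [jj [x [w [ha [fj nw] h3 h4 h5]]]]] :=
  leading_data hC gens (isT : (0 < 2)%N) t00 nX hc eal ebe' tneg isT (ex_intro _ be erefl).
have [c0 [p fp]] := garr_pull c (rmorphP (@pev E)).
have exb y : {b : arr c0 c0 | acomp p b = acomp (a y) p /\ afun b = ge_act E y}.
  apply: cid; apply: garr_lift (rmorphP _) _ => f.
  by rewrite -[LHS]/(afun p (afun (a y) f)) fp (ha y).1.
pose b y := sval (exb y).
have bE y : acomp p (b y) = acomp (a y) p := (svalP (exb y)).1.
have fb y : afun (b y) = ge_act E y := (svalP (exb y)).2.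
have [J [EJ fJ]] : exists J : arr c0 c0, acomp p J = acomp jj p /\ afun J = (fun a => a).
  apply: garr_lift is_rmorph_id _ => f.
  by rewrite -[LHS]/(afun p (afun jj f)) fp fj -[LHS]/((-1) ^+ 0 * pc f 0) expr0 mul1r.
have [hcd _ _] := hc.
have gE : pmap (ge_in E) g' * pmap (ge_in E) g = 1 by rewrite -rmorphM g'g rmorph1.
have [n1 [eg [gn1 en1 gn0 ge1 esq]]] := avmap_gen p (@localring_field E) gE hcd.
have Xin : pmap (ge_in E) pX = pX by rewrite pmap_X.
exists c0; split.
- exact: equivariant_at hc.
- by exists p.
- rewrite -rsq_n; have -> : rn (gpi C E c0) = 0.
    have <- : avmap gN p (rn (gpi C _ c)) = rn (gpi C E c0).
      by have [_ [] ] := svalP (fmap (gpi C) (ahom p)).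
    have sp := @avmap_semilin _ gN _ _ _ _ p.
    rewrite en1 (semilinZ (arr_rm p) sp) fp.
    by rewrite Xin -[X in X *: _]/(0 : E) scale0r.
  by rewrite -(scale0r (0 : rN _)) rsqZZ mul0r scale0r.
exists b, J, x, w; split.
- by move=> y; split; [exact: fb | exact: (ha y).2].
- split; [exact: fJ | exact: nw | ].
  pose n0 : rN (gpi C E c0) := avmap gN p n1.
  refine (ex_intro _ n0 (ex_intro _ eg (ex_intro _ (afun p (pmap (ge_in E) g))
    (ex_intro _ (afun p (pmap (ge_in E) g')) _)))); split=> //.
    by have [p1 _ pM] := arr_rm p; rewrite -pM gE p1.
  rewrite -avmap_comp EJ avmap_comp.
  (* jj preserves the section u n1 of the square root and sends u to - u, so it must change the sign
     of n1. *)
  have -> : avmap gN jj n1 = - n1.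
    have sj := @avmap_semilin _ gN _ _ _ _ jj; have [la ela] := is_gen_ex (avmap gN jj n1) gn1.
    have : avmap gN jj (rn (gpi C _ c)) = rn (gpi C _ c).
      by have [_ []] := svalP (fmap (gpi C) (ahom jj)).
    rewrite en1 (semilinZ (arr_rm jj) sj) ela fj.
    rewrite -[pneg _]/(pneg (pmap (ge_in E) pX)) Xin pneg_X scalerA => /(is_genZ_inj gn1).
    rewrite mulNr -mulrN -{2}[pX]mulr1 => /(mulfI (pX_neq0 E)) /eqP.
    by rewrite eqr_oppLR => /eqP ->; rewrite scaleN1r.
  exact: semilinN (arr_rm p) (@avmap_semilin _ gN _ _ _ _ p) _.
- move=> y y'; have [z [e1 e2]] := h3 y y'; have [z' [ez' bz]] := aband_push p z.
  exists z'; split; last by rewrite ez' fp.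
  apply: (garr_lift_uniq (h := p)); first by move=> f; rewrite /= !fb ge_actM.
  by rewrite !acompA !bE -!acompA bE -bz !acompA e1.
- move=> y; have [z [e1 e2]] := h4 y; have [z' [ez' bz]] := aband_push p z.
  exists z'; split; last by rewrite ez' fp.
  apply: (garr_lift_uniq (h := p)); first by move=> f; rewrite /= !fb fJ.
  rewrite !acompA bE EJ -!acompA EJ (acompA p) bE -(acompA (a y) p) -bz !acompA e1.
  by [].
have [z [e1 e2]] := h5; have [z' [ez' bz]] := aband_push p z.
exists z'; split; last by rewrite ez' fp.
apply: (garr_lift_uniq (h := p)); first by move=> f; rewrite /= !fJ.
by rewrite acompA EJ -acompA EJ acompA e1 bz.
Qed.

Hypothesis clO : alg_closed O.
Hypothesis pchark : [pchar k] =i pred0.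
Variable L : omod (rootstack s).
Local Notation r := 2%N.

(** Over the closure O regularity gives a basis made of parts of the form E and E (x) N. J acts on N
    by -1, so it acts on the two parts by opposite nonzero numbers. *)
Lemma special_not_scalar E0 (m : mobj C L r E0) E (j : galmor E0 E) (c0 : C E) (J : arr c0 c0)
    (n : rN (gpi C _ c0)) e un vn
    (hj : is_rmorph j) (u : hom (fun a : E => a) c0 c0) (la : E) : Arr u = J ->
  s E (rpt (gpi C _ c0)) = 0 -> is_gen n -> is_gen e -> vn * un = 1 -> rsq n n = un *: e ->
  avmap gN J n = - n ->
  ~ (forall v : mV m E (@bob_of D s C E0 E j c0 hj),
       vmap (mV m) (@barr D s C E0 E E (fun a => a) j j c0 c0 hj hj u (fun a => erefl)) v = la *: v).
Proof.
move=> eu s0 gn ge vu esq Jn hla.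
have [cO [q fq]] := garr_pull c0 (rmorphP (ge_out E)).
have [q' eq'] : exists q' : hom (ge_out E) c0 cO, Arr q' = q by apply: arr_over => a; rewrite fq.
have [JO [EJO fJO]] : exists JO : arr cO cO, acomp q JO = acomp J q /\ afun JO = (fun a => a).
  by apply: garr_lift is_rmorph_id _ => a; rewrite -eu.
have [uO euO] : exists uO : hom (fun a : O => a) cO cO, Arr uO = JO by apply: arr_over => a; rewrite fJO.
pose x : P1 O := rpt (gpi C _ cO).
have sx : s O x = 0.
  have <- := sv_nat s ((sval (fmap (gpi C) q')).1); rewrite s0.
  exact: semilin0 (rmorphP (ge_out E)) (@vmap_semilin _ D _ _ _ _ _ _).
have hgeo := rmorphP (ge_out E0).
have [/(_ x sx) reg _] := mV_geom m hgeo clO.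
have [mm [EE [alpha [beta [mm0 [bE _] [la1 lb1] [na nb] hb]]]]] := reg.
pose y : gfibre C x O := @BOb C O (over_point x) O (fun a => a) cO is_rmorph_id (inhabits (hid x)).
pose JJ : hom (fun a : O => a) y y := exist _ uO (fun a => erefl).
have [e0 ge0] := locfree_gen (@localring_field O) (bE.2 O y).
pose nO : rN (gpi C _ cO) := avmap gN q n.
have gnO : is_gen nO by apply: root_gen_push (@localring_field O) vu esq ge.
have JnO : vmap gN uO nO = - nO.
  rewrite -[LHS]/(avmap gN (Arr uO) nO) euO /nO -avmap_comp EJO avmap_comp Jn.
  exact: semilinN (arr_rm q) (@avmap_semilin _ gN _ _ _ _ q) _.
have [ep eep] := is_gen_ex (vmap EE JJ e0) ge0.
have nep : ep != 0.
  have ge1 := basechange_gen (@is_rmorph_id O) (bE.1 _ _ _ _ _ JJ) ge0.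
  apply/eqP => ep0; move: ge1; rewrite eep ep0 scale0r => ge1.
  have : (1 : O) *: (0 : EE O y) = 0 *: 0 by rewrite !scaler0.
  by move=> /(is_genZ_inj ge1) /eqP; rewrite oner_eq0.
pose W := pull (bcincl (over_point (C := C) x)) (pull (bcrestr C hgeo) (mV m)).
pose la' := ge_out E la.
have [bm hbm] := locfree_basis (@localring_field E) ((mV_bundle m).2 E (@bob_of D s C E0 E j c0 hj)).
pose bq : @hom (bc C E0) _ _ (ge_out E) (@bob_of D s C E0 E j c0 hj)
   (bcrestr C hgeo O (bcincl (over_point (C := C) x) O y)) := exist _ q' (fun a => gm_out j a).
have hbO := basechange_basis (rmorphP (ge_out E)) ((mV_bundle m).1 _ _ _ _ _ bq) hbm.
have scal (v : W O y) : vmap W JJ v = la' *: v.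
  have vq v' : vmap W JJ (vmap (mV m) bq v') = la' *: vmap (mV m) bq v'.
    pose a1 := Arr (@barr D s C E0 E E (fun a => a) j j c0 c0 hj hj u (fun a => erefl)).
    pose a3 := Arr (fmap (bcrestr C hgeo) (fmap (bcincl (over_point (C := C) x)) JJ)).
    have ea : acomp a1 (Arr bq) = acomp (Arr bq) a3.
      apply: bcsub_arr_inj; rewrite -[LHS]/(acomp (Arr u) (Arr q')) -[RHS]/(acomp (Arr q') (Arr uO)).
      by rewrite eu eq' euO EJO.
    have := congr1 (fun a => avmap (mV m) a v') ea; rewrite !avmap_comp.
    rewrite -[avmap (mV m) a1 v']/(vmap (mV m) _ v') hla.
    rewrite (semilinZ (arr_rm (Arr bq)) (@avmap_semilin _ (mV m) _ _ _ _ (Arr bq))) => h.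
    exact: esym h.
  have lW : is_lin (vmap W JJ) := vmap_semilin (o := W) JJ.
  rewrite (coordsE hbO v) (semilin_sum (@is_rmorph_id O) lW) scaler_sumr; apply: eq_bigr => i _.
  by rewrite (semilinZ (@is_rmorph_id O) lW) vq !scalerA mulrC.
have hB := hb O y e0 nO ge0 gnO.
have nz (i : 'I_(mm + mm)) (vv : W O y) : (fun k : 'I_(mm + mm) => match split k with
      | inl i => alpha i O y e0 | inr i => beta i O y e0 nO end) i = vv ->
    forall ka kb : O, ka *: vv = kb *: vv -> ka = kb.
  move=> <- ka kb ek; apply/eqP; rewrite -subr_eq0; apply/eqP.
  rewrite -[RHS](is_basis_free (c := fun i' => if i' == i then ka - kb else 0) hB _ i) ?eqxx //.
  rewrite (bigD1 i) //= eqxx big1 ?addr0 => [|i' /negPf ->]; last by rewrite scale0r.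
  by rewrite scalerBl ek subrr.
pose i0 : 'I_mm := Ordinal mm0.
have h1 : la' = ep.
  apply: (nz (unsplit (inl i0)) (alpha i0 O y e0)); first by rewrite unsplitK.
  rewrite -scal -na eep; exact: (semilinZ (@is_rmorph_id O) (la1 i0 O y)).
have h2 : la' = - ep.
  apply: (nz (unsplit (inr i0)) (beta i0 O y e0 nO)); first by rewrite unsplitK.
  have [l1 l2] := lb1 i0 O y.
  pose N := pull (rfun_comp (bcproj (over_point (C := C) x)) (gpi C)) (root_N s).
  have JN : @vmap _ N _ _ _ y y JJ nO = - nO := JnO.
  rewrite -scal -nb eep JN.
  rewrite (semilinZ (@is_rmorph_id O) (l2 _)) (semilinN (@is_rmorph_id O) (l1 _)).
  by rewrite scalerN scaleNr.
have two0 : (2%:R : O) != 0 by rewrite -(rmorph_nat iota) fmorph_eq0 (pcharf0P k).1.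
have /eqP : ep *+ 2 = 0 by rewrite mulr2n -{1}h1 h2 addNr.
by rewrite -mulr_natr mulf_eq0 (negPf nep) (negPf two0).
Qed.
End Special.

(** * Traces and eigenlines *)

Section HasTrace.
Variable r : nat.

Definition has_trace (R : comNzRingType) (W : lmodType R) (f : W -> W) (ta : R) : Prop :=
  exists (b : 'I_r -> W) (M : 'M[R]_r), [/\ is_basis b, forall i, f (b i) = \sum_j M i j *: b j & ta = \tr M].

Lemma mulmx_comb (R : comNzRingType) (W : lmodType R) p q n (A : 'M[R]_(p, q)) (B : 'M[R]_(q, n)) (b : 'I_n -> W) i :
  \sum_j (A *m B) i j *: b j = \sum_l A i l *: (\sum_j B l j *: b j).
Proof.
under [RHS]eq_bigr => l _ do rewrite scaler_sumr.
rewrite exchange_big; apply: eq_bigr => j _; rewrite mxE scaler_suml; apply: eq_bigr => l _.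
by rewrite scalerA.
Qed.

Lemma coords_mx (R : comNzRingType) (W : lmodType R) n (b : 'I_n -> W) p (v : 'I_p -> W) : is_basis b ->
  exists M : 'M[R]_(p, n), forall i, v i = \sum_j M i j *: b j.
Proof.
move=> hb; exists (\matrix_(i, j) coords hb (v i) j) => i; rewrite [LHS](coordsE hb).
by apply: eq_bigr => j _; rewrite mxE.
Qed.

Lemma basis_mx_inj (R : comNzRingType) (W : lmodType R) n p (b : 'I_n -> W) (M N : 'M[R]_(p, n)) : is_basis b ->
  (forall i, \sum_j M i j *: b j = \sum_j N i j *: b j) -> M = N.
Proof.
move=> hb e; apply/matrixP => i j; apply/eqP; rewrite -subr_eq0; apply/eqP.
apply: (is_basis_free (c := fun j => M i j - N i j) hb).
by under eq_bigr => l _ do rewrite scalerBl; rewrite sumrB e subrr.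
Qed.

Lemma has_trace_ex (R : comNzRingType) (W : lmodType R) (f : W -> W) (b : 'I_r -> W) : is_basis b ->
  exists ta, has_trace f ta.
Proof.
by move=> hb; have [M eM] := coords_mx (fun i => f (b i)) hb; exists (\tr M), b, M.
Qed.

Lemma has_trace_uniq (R : comNzRingType) (W : lmodType R) (f : W -> W) ta ta' : is_lin f ->
  has_trace f ta -> has_trace f ta' -> ta = ta'.
Proof.
move=> lf [b [M [hb eM ->]]] [b' [M' [hb' eM' ->]]].
have [P eP] := coords_mx b' hb; have [Q eQ] := coords_mx b hb'.
have id1 n (c : 'I_n -> W) i : \sum_j (1%:M : 'M[R]_n) i j *: c j = c i.
  rewrite (bigD1 i) //= mxE eqxx scale1r big1 ?addr0 // => j /negPf nj.
  by rewrite mxE eq_sym nj scale0r.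
have PQ : P *m Q = 1%:M.
  apply: (basis_mx_inj hb') => i; rewrite mulmx_comb id1 eP.
  by apply: eq_bigr => j _; rewrite -eQ.
have fsum n (A : 'M[R]_(n, r)) (c : 'I_r -> W) i : f (\sum_j A i j *: c j) = \sum_j A i j *: f (c j).
  rewrite (semilin_sum is_rmorph_id lf); apply: eq_bigr => j _.
  by rewrite (semilinZ is_rmorph_id lf).
have MP : M' *m P = P *m M.
  apply: (basis_mx_inj hb) => i; rewrite !mulmx_comb.
  transitivity (f (b' i)); first by rewrite eM'; apply: eq_bigr => j _; rewrite -eP.
  by rewrite eP fsum; apply: eq_bigr => j _; rewrite eM.
have QP := mulmx1C PQ.
by rewrite -[M']mulmx1 -PQ mulmxA MP -mulmxA mxtrace_mulC -mulmxA QP mulmx1.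
Qed.

Lemma has_trace_push (R S : comNzRingType) (g : R -> S) (W : lmodType R) (W' : lmodType S) (u : W -> W')
    (f : W -> W) (f' : W' -> W') ta : is_rmorph g -> is_basechange g u ->
  (forall v, f' (u v) = u (f v)) -> has_trace f ta -> has_trace f' (g ta).
Proof.
move=> hg hu e [b [M [hb eM ->]]]; exists (fun i => u (b i)), (map_mx g M); split.
- by have := basechange_basis hg hu hb.
- move=> i; rewrite e eM (semilin_sum hg hu.1); apply: eq_bigr => j _.
  by rewrite (semilinZ hg hu.1) mxE.
by rewrite -[g]/(rmor hg : R -> S) -trace_map_mx.
Qed.

Lemma free_basis (F : fieldType) (W : lmodType F) (b c : 'I_r -> W) : is_basis b ->
  (forall k : 'I_r -> F, \sum_i k i *: c i = 0 -> forall i, k i = 0) -> is_basis c.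
Proof.
move=> hb hf; have [P eP] := coords_mx c hb.
have uP : P \in unitmx.
  rewrite -row_free_unit; apply: inj_row_free => v v0; apply/rowP => i; rewrite mxE.
  apply: (hf (fun i => v 0 i)); transitivity (\sum_j (v *m P) 0 j *: b j).
    by rewrite mulmx_comb; apply: eq_bigr => j _; rewrite eP.
  by rewrite v0 big1 // => j _; rewrite mxE scale0r.
apply: is_basisP => // v; have [M eM] := coords_mx (fun _ : 'I_1 => v) hb.
exists (fun j => (M *m invmx P) 0 j); rewrite (eM 0) -[M in LHS]mulmx1 -(mulVmx uP) mulmxA [LHS]mulmx_comb.
by apply: eq_bigr => j _; rewrite eP.
Qed.
End HasTrace.

Section SpecialCocycle.
Variables (D : omod P1) (s : osec D) (hD : is_bundle 1 D) (C : mu2_gerbe (rootstack s)).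
Variables (k O : fieldType) (iota : {rmorphism k -> O}).
Hypothesis clO : alg_closed O.
Hypothesis pchark : [pchar k] =i pred0.
Variable L : omod (rootstack s).
Variables (E0 : galext iota) (m : mobj C L 2 E0) (E : galext iota) (j : galmor E0 E).
Local Notation tws := (twister m j j).
Variable th : forall x : ge_G E, twister m j (fun a => ge_act E x (j a)).
Variable Psi : ge_G E -> ge_G E -> tws.
Hypothesis PsiE : forall x y (T : comNzRingType) (f : E -> T) (c : C T) (hf : is_rmorph f)
    (hfx : is_rmorph (fun a => f (ge_act E x a))) h1 h2 h3 h4 (v : mV m T (bob_of c h1)),
  tw (th (y * x)%g) hf h1 h4 (tw (Psi x y) hf h1 h1 v) =
  vmap (mV m) (barr h3 h4 (hid c) (fun a => congr1 f (esym (ge_actM y x (j a)))))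
    (tw (th y) hfx h2 h3 (tw (th x) hf h1 h2 v)).

Variables (t0 : k) (al : E) (c : C (pser E)) (c0 : C E).
Hypothesis special : special_pt t0 al c c0.

Local Notation hj := (rmorphP j).
Local Notation W := (mV m E (bob_of c0 hj)).
Local Notation hI := (@is_rmorph_id E).
Definition tw0 (t : tws) (v : W) : W := tw t hI hj hj v.

(* The maps th_x^-1 o V(b_x) preserve the eigenlines of V(J), since J and b_x commute
   up to the same sign by which x acts on the eigenvalue w. *)
Lemma special_cocycle : exists (La : tws -> E) (thp thm : ge_G E -> E),
  [/\ forall t, La t != 0 /\ has_trace 2 (tw0 t) (La t + (La t)^-1),
      forall t t' t'', (forall v, tw0 t'' v = tw0 t' (tw0 t v)) -> La t'' = La t' * La t,
      forall x, thp x != 0 /\ thm x != 0 &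
      forall x y, ge_act E x (thp y) * thp x * ge_in E t0 ^+ (flips al y && flips al x) =
          thp (y * x)%g * La (Psi x y) /\
        ge_act E x (thm y) * thm x * ge_in E t0 ^+ (flips al y && flips al x) =
          thm (y * x)%g * (La (Psi x y))^-1].
Proof.
have [_ _ s0 [b [J [xi [w [hb [fJ nw [n [e [u0 [v0 [gn ge vu esq Jn]]]]]] h3 h4 h5]]]]]] := special.
have two0 : (2%:R : E) != 0 by rewrite -(rmorph_nat (ge_in E)) fmorph_eq0 (pcharf0P k).1.
have [uJ euJ] : exists u : hom (fun a : E => a) c0 c0, Arr u = J by apply: arr_over => a; rewrite fJ.
have exu x : {u : hom (ge_act E x) c0 c0 | Arr u = b x} by apply: cid; apply: arr_over => a; rewrite (hb x).1.
pose u x := sval (exu x); have uE x : Arr (u x) = b x := svalP (exu x).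
have hx x : is_rmorph (fun a => ge_act E x (j a)) := rmorph_comp hj (rmorphP (ge_act E x)).
pose JW : W -> W := vmap (mV m) (barr hj hj uJ (fun a => erefl)).
have Jlin : is_lin JW := vmap_semilin (o := mV m) _.
have JZ a v : JW (a *: v) = a *: JW v := semilinZ is_rmorph_id Jlin a v.
have JD v v' : JW (v + v') = JW v + JW v' := semilinD is_rmorph_id Jlin v v'.
have band (f : E0 -> E) (hf : is_rmorph f) (z : mu2 E) (v : mV m E (bob_of c0 hf)) :
   vmap (mV m) (barr hf hf (gband C c0 z) (fun a => erefl)) v = sval z *: v 
  by exact: (@mV_twisted _ _ _ _ _ _ m E (bob_of c0 hf) z v).
have arrE (f f' : E0 -> E) (hf : is_rmorph f) (hf' : is_rmorph f')
   (a a' : @arr (bc C E0) E E (bob_of c0 hf) (bob_of c0 hf')) v :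
   Arr (sval (ahom a)) = Arr (sval (ahom a')) -> avmap (mV m) a v = avmap (mV m) a' v.
  by move=> /(bcsub_arr_inj (X := C)) ->.
have JJ v : JW (JW v) = w ^+ 2 *: v.
  have [z [e1 e2]] := h5; rewrite expr2 e2 -band.
  pose a1 := Arr (@barr D s C E0 E E (fun a => a) j j c0 c0 hj hj uJ (fun a => erefl)).
  rewrite -[LHS]/(avmap (mV m) a1 (avmap (mV m) a1 v)) -avmap_comp.
  apply: (arrE j j hj hj _ (Arr (@barr D s C E0 E E (fun a => a) j j c0 c0 hj hj (gband C c0 z) (fun a => erefl)))).
  by rewrite -[RHS]/(aband c0 z) -e1 -euJ.
have nscal la : ~ forall v, JW v = la *: v.
  exact: (special_not_scalar hD clO pchark euJ s0 gn ge vu esq Jn).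
(* As J^2 = ep^2, every J v + ep v is zero or an eigenvector for ep. If all were zero, J would be
   the scalar - ep. *)
have eigen ep : ep ^+ 2 = w ^+ 2 -> exists v, v != 0 /\ JW v = ep *: v.
  move=> eep; apply: contrapT => h; apply: (nscal (- ep)) => v; apply/eqP; rewrite -subr_eq0.
  apply/negPn/negP => nv; apply: h; exists (JW v - - ep *: v); split=> //.
  rewrite scaleNr opprK JD JJ JZ -eep scalerDr scalerA -expr2 addrC.
  by [].
have [mp [nmp Jp]] := eigen w erefl; have [mm [nmm Jm]] := eigen (- w) (sqrrN w).
have [bW hbW] := locfree_basis (@localring_field E) ((mV_bundle m).2 E (bob_of c0 hj)).
pose mb (i : 'I_2) := if i == 0 then mp else mm.
have sum2 (f : 'I_2 -> W) : \sum_i f i = f 0 + f 1 by rewrite big_ord_recl big_ord1; congr (_ + f _); apply: val_inj.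
have zsc a (v : W) : v != 0 -> a *: v = 0 -> a = 0.
  by move=> nv /eqP; rewrite scaler_eq0 (negPf nv) orbF => /eqP.
have n2w : 2%:R * w != 0 by rewrite mulf_neq0.
have hmb : is_basis mb.
  apply: (free_basis hbW) => kk; rewrite sum2 /mb /= => e0.
  have := congr1 JW e0; rewrite JD !JZ Jp Jm (semilin0 is_rmorph_id Jlin) scaleNr scalerN => e1.
  have k0 : kk 0 = 0.
    apply: (zsc _ mp nmp); apply: (scalerI n2w); rewrite scaler0.
    have := congr2 +%R (congr1 (fun v => w *: v) e0) e1; rewrite scaler0 addr0 scalerDr => <-.
    rewrite !scalerA [kk 0 * w]mulrC [kk 1 * w]mulrC addrACA subrr addr0 -scalerDl; congr (_ *: _); ring.
  have k1 : kk 1 = 0 by move: e0; rewrite k0 scale0r add0r => /(zsc _ mm nmm).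
  by move=> i; case: (unliftP 0 i) => [i'|] -> //; rewrite (ord1 i') (_ : lift _ _ = 1) //; apply: val_inj.
have line ep v : JW v = ep *: v -> (ep = w -> exists a, v = a *: mp) /\ (ep = - w -> exists a, v = a *: mm).
  have [cc ev] := is_basis_gen v hmb; move: ev; rewrite sum2 /mb /= => ->.
  rewrite JD !JZ Jp Jm !scalerDr => e0.
  have e2 : \sum_i (if i == 0 :> 'I_2 then cc 0 * (w - ep) else - (cc 1 * (w + ep))) *: mb i = 0.
    rewrite sum2 /mb /=.
    transitivity (cc 0 *: (w *: mp) + cc 1 *: (- w *: mm) - (ep *: (cc 0 *: mp) + ep *: (cc 1 *: mm))).
      rewrite !scalerA opprD addrACA -!scaleNr -!scalerDl; congr (_ *: _ + _ *: _); ring.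
    by rewrite e0 subrr.
  have f0 := is_basis_free hmb e2 0; have f1 := is_basis_free hmb e2 1.
  split=> eep; [exists (cc 0) | exists (cc 1)].
    suff -> : cc 1 = 0 by rewrite scale0r addr0.
    move: f1; rewrite /= eep => /eqP; rewrite oppr_eq0 mulf_eq0 -mulr2n -mulr_natl (negPf n2w) orbF.
    by move=> /eqP.
  suff -> : cc 0 = 0 by rewrite scale0r add0r.
  move: f0; rewrite /= eep opprK => /eqP; rewrite mulf_eq0 -mulr2n -mulr_natl (negPf n2w) orbF.
  by move=> /eqP.
have b_neq0 (F : fieldType) (U : lmodType F) (bb : 'I_2 -> U) i : is_basis bb -> bb i != 0.
  move=> hbb; apply/eqP => bi0.
  have e0 : \sum_i' (i' == i)%:R *: bb i' = 0.
    by rewrite (bigD1 i) //= bi0 scaler0 big1 ?addr0 // => i' /negPf ->; rewrite scale0r.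
  by have /eqP := is_basis_free hbb e0 i; rewrite eqxx oner_eq0.
have tlin t : is_lin (tw0 t) := @tw_lin _ _ _ _ _ _ _ _ _ _ t E (fun a => a) c0 hI hj hj.
have tZ t a v : tw0 t (a *: v) = a *: tw0 t v := semilinZ is_rmorph_id (tlin t) a v.
have tJ t v : JW (tw0 t v) = tw0 t (JW v).
  exact: esym (@tw_nat _ _ _ _ _ _ _ _ _ _ t E E (fun a => a) (fun a => a) (fun a => a) c0 c0 hI hI hj hj hj hj uJ (fun a => erefl) v).
have tp t : exists a, tw0 t mp = a *: mp.
  by apply: (line w _ _).1 => //; rewrite tJ Jp tZ.
have tm t : exists a, tw0 t mm = a *: mm.
  by apply: (line (- w) _ _).2 => //; rewrite tJ Jm tZ.
pose La t := sval (cid (tp t)); pose Lm t := sval (cid (tm t)).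
have LaE t : tw0 t mp = La t *: mp := svalP (cid (tp t)).
have LmE t : tw0 t mm = Lm t *: mm := svalP (cid (tm t)).
(* t preserves the determinant form of V, whose value on the eigenbasis is a generator. *)
have LaLm t : La t * Lm t = 1.
  pose T0 : {ffun 'I_2 -> W} := [ffun i => mb i].
  have hT0 : is_basis (fun i => T0 i).
    by have -> // : (fun i => T0 i) = mb; apply: functional_extensionality_dep => i; rewrite ffunE.
  have [d1 _ d3] := mdetP m; have gT0 := d3 _ _ _ hT0; have [ml _] := d1 E (bob_of c0 hj).
  have upd_id (U : Type) (v : {ffun 'I_2 -> U}) i : upd v i (v i) = v.
    by apply/ffunP => i'; rewrite ffunE; case: eqP => [->|].
  have e1 : [ffun i => tw0 t (T0 i)] = upd (upd T0 0 (La t *: T0 0)) 1 (Lm t *: upd T0 0 (La t *: T0 0) 1).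
    apply/ffunP => i; rewrite !ffunE; case: (unliftP 0 i) => [i'|] ->.
      rewrite (ord1 i') (_ : lift _ _ = 1); last exact: val_inj.
      by rewrite eqxx /mb /= LmE.
    by rewrite /= /mb eqxx /= LaE.
  have := @tw_det _ _ _ _ _ _ _ _ _ _ t E (fun a => a) c0 hI hj hj T0.
  rewrite -[finfun _]/([ffun i => tw0 t (T0 i)]) e1.
  rewrite (semilinZ is_rmorph_id (ml _ _)) upd_id (semilinZ is_rmorph_id (ml _ _)) upd_id scalerA.
  by rewrite -{2}[mdet T0]scale1r => /(is_genZ_inj gT0) <-; rewrite mulrC.
have LmV t : Lm t = (La t)^-1.
  have nl : La t != 0 by apply: contra_eq_neq (LaLm t) => ->; rewrite mul0r eq_sym oner_eq0.
  by apply: (mulfI nl); rewrite LaLm divff.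
pose Vb x (v : W) : mV m E (bob_of c0 (hx x)) := vmap (mV m) (barr hj (hx x) (u x) (fun a => erefl)) v.
pose T x (v : W) : mV m E (bob_of c0 (hx x)) := tw (th x) hI hj (hx x) v.
have Tinj x : injective (T x) by apply: bij_inj; exact: (@tw_bij _ _ _ _ _ _ _ _ _ _ (th x) E (fun a => a) c0 hI hj (hx x)).
have TZ x a v : T x (a *: v) = a *: T x v.
  exact: semilinZ is_rmorph_id (@tw_lin _ _ _ _ _ _ _ _ _ _ (th x) E (fun a => a) c0 hI hj (hx x)) a v.
have exs x v : exists v', T x v' = Vb x v.
  have [kk ka kb] := @tw_bij _ _ _ _ _ _ _ _ _ _ (th x) E (fun a => a) c0 hI hj (hx x).
  by exists (kk (Vb x v)); apply: kb.
(* The map th_x^-1 o V(b_x), which is semilinear along x. *)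
pose sW x v := sval (cid (exs x v)).
have sE x v : T x (sW x v) = Vb x v := svalP (cid (exs x v)).
have sZ x a v : sW x (a *: v) = ge_act E x a *: sW x v.
  apply: (Tinj x); rewrite TZ (sE x (a *: v)) (sE x v).
  exact: semilinZ (rmorphP (ge_act E x)) (@vmap_semilin _ (mV m) _ _ _ _ _ (barr hj (hx x) (u x) (fun a => erefl))) a v.
pose aj (f : E0 -> E) (hf : is_rmorph f) := Arr (@barr D s C E0 E E (fun a => a) f f c0 c0 hf hf uJ (fun a => erefl)).
pose ab (f : E0 -> E) (hf : is_rmorph f) x (hxf : is_rmorph (fun a => ge_act E x (f a))) :=
  Arr (@barr D s C E0 E E (ge_act E x) f _ c0 c0 hf hxf (u x) (fun a => erefl)).
pose az (f : E0 -> E) (hf : is_rmorph f) z := Arr (@barr D s C E0 E E (fun a => a) f f c0 c0 hf hf (gband C c0 z) (fun a => erefl)).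
have sJ x v : exists z, [/\ JW (sW x v) = z *: sW x (JW v) & xi x * w = z * (ge_act E x w * xi x)].
  have [z [e1 e2]] := h4 x; exists (sval z); split=> //; apply: (Tinj x); rewrite TZ (sE x (JW v)).
  transitivity (avmap (mV m) (aj _ (hx x)) (T x (sW x v))).
    exact: (@tw_nat _ _ _ _ _ _ _ _ _ _ (th x) E E (fun a => a) (fun a => a) (fun a => a) c0 c0 hI hI hj (hx x) hj (hx x) uJ (fun a => erefl) (sW x v)).
  rewrite (sE x v) -band -[RHS]/(avmap (mV m) (az _ (hx x) z) (avmap (mV m) (ab j hj x (hx x)) (avmap (mV m) (aj _ hj) v))).
  rewrite -[Vb x v]/(avmap (mV m) (ab j hj x (hx x)) v) -!avmap_comp; apply: arrE.
  rewrite -[LHS]/(acomp (Arr (u x)) (Arr uJ)) -[RHS]/(acomp (Arr uJ) (acomp (Arr (u x)) (aband c0 z))).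
  by rewrite uE euJ e1 acompA.
have wz x z : xi x * w = z * (ge_act E x w * xi x) -> z * ge_act E x w = w.
  by move=> e1; apply: (mulIf (hb x).2); rewrite -mulrA -e1 mulrC.
have sp x : exists a, sW x mp = a *: mp.
  have [z [e1 /wz e2]] := sJ x mp.
  by apply: (line w _ _).1 => //; rewrite e1 Jp sZ scalerA e2.
have sm x : exists a, sW x mm = a *: mm.
  have [z [e1 /wz e2]] := sJ x mm.
  by apply: (line (- w) _ _).2 => //; rewrite e1 Jm sZ scalerA rmorphN mulrN e2.
pose mup x := sval (cid (sp x)); pose mum x := sval (cid (sm x)).
have mupE x : sW x mp = mup x *: mp := svalP (cid (sp x)).
have mumE x : sW x mm = mum x *: mm := svalP (cid (sm x)).
have s_neq0 x i : sW x (mb i) != 0.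
  have hbx := basechange_basis (rmorphP (ge_act E x)) ((mV_bundle m).1 _ _ _ _ _ (barr hj (hx x) (u x) (fun a => erefl))) hmb.
  have := b_neq0 _ _ _ i hbx; apply: contra_neq => e0.
  rewrite -[LHS]/(Vb x (mb i)) -sE e0.
  exact: semilin0 is_rmorph_id (@tw_lin _ _ _ _ _ _ _ _ _ _ (th x) E (fun a => a) c0 hI hj (hx x)).
have nmup x : mup x != 0.
  by have := s_neq0 x 0; rewrite /mb /= mupE; apply: contra_neq => ->; rewrite scale0r.
have nmum x : mum x != 0.
  by have := s_neq0 x 1; rewrite /mb /= mumE; apply: contra_neq => ->; rewrite scale0r.
(* The band sign z is the same for sW as for xi, so it cancels in the quotients of xi by the
   eigenvalues of sW. *)
have sM x y : exists z, [/\ z != 0, forall v, tw0 (Psi x y) (sW x (sW y v)) = z *: sW (y * x)%g v &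
    ge_act E x (xi y) * xi x * ge_in E t0 ^+ (flips al y && flips al x) = z * xi (y * x)%g].
  have [z [e1 e2]] := h3 y x; exists (sval z); split=> //.
    apply/eqP => z0; have := svalP z; rewrite z0 expr0n => /eqP; by rewrite eq_sym oner_eq0.
  move=> v; apply: (Tinj (y * x)%g); rewrite TZ (sE (y * x)%g v).
  have hxy : is_rmorph (fun a => ge_act E x (ge_act E y (j a))) := rmorph_comp (hx y) (rmorphP (ge_act E x)).
  have e3 := @PsiE x y E (fun a => a) c0 hI (rmorphP (ge_act E x)) hj (hx x) hxy (hx (y * x)%g) (sW x (sW y v)).
  have e4 := sE x (sW y v); rewrite /T in e4; rewrite e4 in e3.
  have e5 := @tw_nat _ _ _ _ _ _ _ _ _ _ (th y) E E (ge_act E x) (fun a => a) (ge_act E x) c0 c0 hI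
    (rmorphP (ge_act E x)) hj (hx y) (hx x) hxy (u x) (fun a => erefl) (sW y v).
  have e6 := sE y v; rewrite /T in e6; rewrite e6 in e5.
  rewrite /Vb in e3; rewrite e5 in e3.
  rewrite /T /tw0 e3 -band.
  pose aR := Arr (barr hxy (hx (y * x)%g) (Defs.hid c0) (fun a => congr1 id (esym (ge_actM y x (j a))))).
  rewrite -[LHS]/(avmap (mV m) aR (avmap (mV m) (ab _ (hx y) x hxy) (avmap (mV m) (ab j hj y (hx y)) v))).
  rewrite -[RHS]/(avmap (mV m) (az _ (hx (y * x)%g) z) (avmap (mV m) (ab j hj (y * x)%g (hx (y * x)%g)) v)).
  rewrite -!avmap_comp.
  have cA : acomp (ab j hj y (hx y)) (acomp (ab _ (hx y) x hxy) aR) =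
      acomp (ab j hj (y * x)%g (hx (y * x)%g)) (az _ (hx (y * x)%g) z).
    apply: bcsub_arr_inj.
    rewrite -[LHS]/(acomp (Arr (u y)) (acomp (Arr (u x)) (Arr (Defs.hid c0)))).
    rewrite -[RHS]/(acomp (Arr (u (y * x)%g)) (aband c0 z)) !uE -e1.
    by rewrite acompA /acomp /= hcomph1.
  by rewrite ?acompA; rewrite acompA in cA; rewrite cA.
exists La, (fun x => xi x / mup x), (fun x => xi x / mum x); split.
- move=> t; have nl : La t != 0 by apply: contra_eq_neq (LaLm t) => ->; rewrite mul0r eq_sym oner_eq0.
  split=> //; exists mb, (\matrix_(i, i') if i == i' then (if i == 0 then La t else Lm t) else 0); split=> //.
    move=> i; rewrite (bigD1 i) //= mxE eqxx big1 ?addr0 => [|i' /negPf ni].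
      by rewrite /mb; case: (i == 0); rewrite ?LaE ?LmE.
    by rewrite mxE eq_sym ni scale0r.
  by rewrite /mxtrace big_ord_recl big_ord1 !mxE !eqxx -LmV.
- move=> t t' t'' e0; have := e0 mp; rewrite !LaE tZ LaE scalerA => e1.
  apply/eqP; rewrite -subr_eq0; apply/eqP; apply: (zsc _ mp nmp).
  by rewrite scalerBl e1 [La t * _]mulrC subrr.
- by move=> x; rewrite !mulf_neq0 ?invr_eq0 // (hb x).2.
move=> x y; have [z [nz e1 e2]] := sM x y.
have scal a b' (v : W) : v != 0 -> a *: v = b' *: v -> a = b'.
  by move=> nv e0; apply/eqP; rewrite -subr_eq0; apply/eqP; apply: (zsc _ v nv); rewrite scalerBl e0 subrr.
have ep : ge_act E x (mup y) * mup x * La (Psi x y) = z * mup (y * x)%g.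
  by have := e1 mp; rewrite mupE sZ mupE !tZ LaE mupE !scalerA; apply: scal.
have em : ge_act E x (mum y) * mum x * Lm (Psi x y) = z * mum (y * x)%g.
  by have := e1 mm; rewrite mumE sZ mumE !tZ LmE mumE !scalerA; apply: scal.
have fin a a' b1 b2 b3 X l : a != 0 -> a' != 0 -> b3 != 0 -> a * a' * l = z * b3 -> b1 * b2 * X = z * (xi (y * x)%g) ->
    b1 / a * (b2 / a') * X = xi (y * x)%g / b3 * l :> E.
  move=> na na' nb e3 e4; rewrite mulf_div.
  apply: (mulIf (mulf_neq0 na na')); apply: (mulIf nb).
  transitivity (b1 * b2 * X * b3); first by field; rewrite na na'.
  transitivity (xi (y * x)%g * (a * a' * l)); last by field; rewrite nb.
  by rewrite e3 e4; ring.
by split; rewrite fmorph_div; apply: fin; rewrite ?fmorph_eq0 // -?LmV.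
Qed.
End SpecialCocycle.

(** * The trace of a natural automorphism is constant on the projective line *)

(** E is finitely generated over k, so [fingen_point] applies to the identity of E as its point. *)
Lemma galext_extend (k O N : fieldType) (iota : {rmorphism k -> O}) (E : galext iota)
    (phi : {rmorphism k -> N}) : alg_closed N ->
  exists h : {rmorphism E -> N}, forall a, h (ge_in E a) = phi a.
Proof.
move=> clN; have [n [b hb]] := ge_fin E.
have gen x : exists p : {mpoly k[n]}, mmap (ge_in E) b p = x.
  have [c ->] := hb x; exists (\sum_i (c i)%:MP * 'X_i); rewrite rmorph_sum; apply: eq_bigr => i _.
  by rewrite rmorphM /= mmapC mmapX mmap1U.
have [h [hh eh]] := @fingen_point k E k E N (ge_in E) id id (ge_in E) phi n b gen (rmorphP (ge_in E))
  is_rmorph_id is_rmorph_id (rmorphP (ge_in E)) (rmorphP phi) clN (fun a => erefl).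
by exists (rmor hh).
Qed.

Section EvalHom.
Variables (K N : fieldType) (x : {rmorphism K -> N}) (ta : N).
Hypothesis trans : forall p : {poly K}, p != 0 -> (map_poly x p).[ta] != 0.
Lemma eval_fraction : exists g : {rmorphism {fraction {poly K}} -> N},
  (forall p, g (tofrac p) = (map_poly x p).[ta]).
Proof.
have [|g eg] := @fraction_lift _ _ (horner_eval ta \o map_poly x); last by exists g.
move=> p q e; apply/eqP; rewrite -subr_eq0; apply/negPn/negP => /trans.
have {}e : (map_poly x p).[ta] = (map_poly x q).[ta] := e.
by rewrite rmorphB hornerD hornerN e subrr eqxx.
Qed.
End EvalHom.

Section TraceConstant.
Variables (D : omod P1) (s : osec D).
Hypothesis hD : is_bundle 1 D.
Variables (eD : forall b, D _ (chart b)) (FD : bool -> {poly rat}).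
Hypothesis geD : forall b, is_gen (eD b).
Hypothesis sD : forall b, s _ (chart b) = FD b *: eD b.
Hypothesis FD0 : forall b, FD b != 0.
Variable C : mu2_gerbe (rootstack s).
Variables (L : omod (rootstack s)) (r : nat) (E0 E : fieldType) (m : mobj C L r E0) (j : E0 -> E).
Hypothesis hj : is_rmorph j.
Variable t : twister m j j.
Variable qr : {rmorphism rat -> E}.

Definition trace_at (T : comNzRingType) (x : E -> T) (c : C T) (ta : T) : Prop :=
  exists (hx : is_rmorph x) (h : is_rmorph (fun a => x (j a))),
    has_trace r (fun v : mV m T (bob_of c h) => tw t hx h h v) ta.

Lemma trace_at_ext (T : comNzRingType) (x x' : E -> T) (c : C T) ta : x =1 x' -> trace_at x c ta -> trace_at x' c ta.
Proof. by move=> e; rewrite (functional_extensionality_dep e). Qed.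

Lemma trace_at_push (T T' : comNzRingType) (g : T -> T') (x : E -> T) (c : C T) (c' : C T') ta :
  hom g c c' -> trace_at x c ta -> trace_at (fun a => g (x a)) c' (g ta).
Proof.
move=> u [hx [h ht]]; have hg := hom_rm u.
exists (rmorph_comp hx hg), (rmorph_comp h hg).
apply: (has_trace_push hg _ _ ht); first exact: ((mV_bundle m).1 _ _ _ _ _ (barr h (rmorph_comp h hg) u (fun a => erefl))).
move=> v.
exact: (@tw_nat _ _ _ _ _ _ _ _ _ _ t T T' g x (fun a => g (x a)) c c' hx _ h h _ _ u (fun a => erefl) v).
Qed.

Lemma trace_at_uniq (T : comNzRingType) (x : E -> T) (c : C T) ta ta' :
  trace_at x c ta -> trace_at x c ta' -> ta = ta'.
Proof.
move=> [hx [h ht]] [hx' [h' ht']]; move: ht'.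
rewrite -(Prop_irrelevance hx hx') -(Prop_irrelevance h h') => ht'.
apply: has_trace_uniq ht ht'; exact: (@tw_lin _ _ _ _ _ _ _ _ _ _ t T x c hx h h).
Qed.

Lemma trace_at_exists (T : comNzRingType) (x : E -> T) (c : C T) : localring T -> is_rmorph x ->
  exists ta, trace_at x c ta.
Proof.
move=> lT hx; have h := rmorph_comp hj hx.
have [b hb] := locfree_basis lT ((mV_bundle m).2 T (bob_of c h)).
by have [ta ht] := has_trace_ex (fun v : mV m T (bob_of c h) => tw t hx h h v) hb; exists ta, hx, h.
Qed.

(** Off the divisor the section of the square root is a generator, since its square generates D. *)
Lemma cdata_generic (N : fieldType) b (y : rootstack s N) (q : {rmorphism {poly rat} -> N}) :
  P1at b (rpt y) (q 'X) -> q (FD b) != 0 -> cdata eD b y q 1 (q (FD b)).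
Proof.
move=> hat nq; have [h] := p1hom_exists (rmorphP q) (P1at_chart b) hat.
have esq : rsq (rn y) (rn y) = q (FD b) *: vmap D h (eD b).
  by rewrite rsq_n (@s_chart _ _ _ _ sD _ _ _ _ h).
exists h, (rn y); split; rewrite ?scale1r //.
have [n0 gn0] := locfree_gen (@localring_field N) (rN_inv y).
have [c ec] := is_gen_ex (rn y) gn0.
have nc : c != 0.
  apply: contra_neq nq => c0; move: esq; rewrite ec c0 rsqZZ mul0r scale0r => /esym h0.
  by apply: (is_genZ_inj (eD_gen hD geD h)); rewrite h0 scale0r.
by rewrite ec; apply: is_gen_unit gn0; apply: mulVf nc.
Qed.

(* Off the divisor, points of C over the same point of the line become isomorphic
   over a larger field. *)
Lemma trace_at_generic (N : fieldType) (x : E -> N) b (c c' : C N) (q : {rmorphism {poly rat} -> N}) ta ta' :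
  P1at b (rpt (gpi C N c)) (q 'X) -> P1at b (rpt (gpi C N c')) (q 'X) -> q (FD b) != 0 ->
  trace_at x c ta -> trace_at x c' ta' -> ta = ta'.
Proof.
move=> h h' nq t1 t2.
have hi := cdata_iso (@localring_field N) (cdata_generic h nq) (cdata_generic h' nq).
have [N' [e [d [[u] [u']]]]] := gerbe_iso_field hi.
apply: (fmorph_inj e); apply: trace_at_uniq (trace_at_push u t1) (trace_at_push u' t2).
Qed.

Local Notation Et := {fraction {poly E}}.
Definition tE : Et := tofrac 'X.
Definition cE : {rmorphism E -> Et} := (@tofrac {poly E}) \o polyC.

Definition qE_at (N : comNzRingType) (x : {rmorphism E -> N}) (th : N) : {rmorphism {poly rat} -> N} :=
  horner_eval th \o map_poly (x \o qr).
Lemma qE_atX (N : comNzRingType) (x : {rmorphism E -> N}) th : qE_at x th 'X = th.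
Proof. by rewrite /qE_at /= map_polyX /horner_eval hornerX. Qed.

Lemma qE_at_neq0 (N : fieldType) (g : {rmorphism Et -> N}) (q : {rmorphism {poly rat} -> N}) p :
  q 'X = g tE -> p != 0 -> q p != 0.
Proof.
move=> eX np; have -> : q p = g (tofrac (map_poly qr p)).
  apply: (@ratpoly_hom_uniq _ q (g \o ((@tofrac {poly E}) \o map_poly qr)) _ p).
  by rewrite eX /= map_polyX.
by rewrite fmorph_eq0 tofrac_eq0 map_poly_eq0.
Qed.

Lemma pchar_rat (N : fieldType) (f : {rmorphism rat -> N}) : [pchar N] =i pred0.
Proof.
move=> p; rewrite !inE; apply/negP => /andP[pp].
by rewrite -(rmorph_nat f) fmorph_eq0 pnatr_eq0 => /eqP p0; rewrite p0 in pp.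
Qed.

(* The trace at a point over a Galois extension of E(t) is Galois invariant. *)
Lemma generic_trace : exists f : Et, forall (N : fieldType) (x : E -> N) (g : {rmorphism Et -> N}) (c : C N) ta,
  (forall a, g (cE a) = x a) -> P1at false (rpt (gpi C N c)) (g tE) -> trace_at x c ta -> ta = g f.
Proof.
have [O [iota [clO algO]]] := algebraic_closure Et.
have pcharE := pchar_rat (cE \o qr).
have [M0 _] := galext_cover clO algO pcharE [::].
pose q0 : {rmorphism {poly rat} -> Et} := qE_at cE tE.
have q0X : q0 'X = tE := qE_atX cE tE.
have nq0 : q0 (FD false) != 0 by apply: (qE_at_neq0 (g := idfun)) (FD0 false).
have nug : 1 ^+ 2 * q0 (FD false) = q0 (FD false) by rewrite expr1n mul1r.
have [y hy] := @cdata_exists _ _ hD _ _ geD sD Et false q0 1 (q0 (FD false)) (q0 (FD false))^-1 (rmorphP q0) (mulVf nq0) nug.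
have [M [jM [c [u]]]] := gerbe_object_galext C clO algO pcharE y (rmorphP (ge_in M0)).
have hat : P1at false (rpt (gpi C M c)) (ge_in M tE).
  have := P1at_push (@localring_field M) (sval u).1 (cdata_at (@localring_field Et) hy).
  by rewrite -[q0 'X]/(q0 'X) q0X gm_in.
pose xM : {rmorphism E -> M} := ge_in M \o cE.
have [ta hta] := trace_at_exists c (@localring_field M) (rmorphP xM).
have [|f ef] := @ge_fixed _ _ _ M ta.
  move=> sg; have [c' [u']] := gerbe_pull c (rmorphP (ge_act M sg)).
  have hat' := P1at_push (@localring_field M) (sval (fmap (gpi C) u')).1 hat.
  have t2 := trace_at_push u' hta.
  apply: esym; apply: (@trace_at_generic M xM false c c' (ge_in M \o q0) ta) hta _.
  - by rewrite -[X in P1at _ _ X]/(ge_in M (q0 'X)) q0X.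
  - by rewrite -[X in P1at _ _ X]/(ge_in M (q0 'X)) q0X -(ge_act_in sg).
  - by rewrite fmorph_eq0.
  by apply: trace_at_ext t2 => a; rewrite /= ge_act_in.
exists f => N x g c2 v gx hat2 tr2.
(* The Galois extension M of E(t) need not map to N, but it maps to an algebraic closure of N. *)
have [N' [iN [clN _]]] := algebraic_closure N.
have [h eh] := galext_extend M (iN \o g) clN.
have [d1 [u1]] := gerbe_pull c (rmorphP h).
have [d2 [u2]] := gerbe_pull c2 (rmorphP iN).
have a1 := P1at_push (@localring_field N') (sval (fmap (gpi C) u1)).1 hat.
have a2 := P1at_push (@localring_field N') (sval (fmap (gpi C) u2)).1 hat2.
have t1 := trace_at_push u1 hta; have t2 := trace_at_push u2 tr2.
have e1 : forall a, h (xM a) = iN (x a) by move=> a; rewrite -gx -[RHS]/((iN \o g) (cE a)) -eh.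
apply: (fmorph_inj iN); rewrite -[RHS]/((iN \o g) f) -eh -ef.
apply: esym; apply: (@trace_at_generic N' (fun a => iN (x a)) false d1 d2 (iN \o g \o q0) _ _ _ _ _ _ t2).
- by rewrite -[X in P1at _ _ X]/(iN (g (q0 'X))) q0X; move: a1; rewrite eh.
- by rewrite -[X in P1at _ _ X]/(iN (g (q0 'X))) q0X.
- by rewrite fmorph_eq0.
exact: trace_at_ext e1 t1.
Qed.

(** For t = a + u^2 the equation of the divisor vanishes to an even order in u, so it is a square
    times a unit, and the series lifts to the root stack whatever a is. *)
Lemma big_point (K : fieldType) (x : {rmorphism E -> K}) b (a : K) :
  exists (k' : fieldType) (e : {rmorphism K -> k'}) (c : C (pser k')), P1at b (rpt (gpi C _ c)) (ramif (e a) 2).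
Proof.
have [mu [q1 nr eF]] := multiplicity_XsubC (map_poly (x \o qr) (FD b)) a.
have nq1 : q1.[a] != 0.
  by move: nr; rewrite map_poly_eq0 FD0 /= rootE.
have [g [eg g0]] := pev_ramif (isT : (0 < 2)%N) eF nq1.
have ug : g \is a GRing.unit by rewrite punitE g0.
have nug : (pX ^+ mu) ^+ 2 * g = qpoly_at (x \o qr) (ramif a 2) (FD b).
  by rewrite -exprM mulnC -eg.
have [y hy] := cdata_exists hD geD sD (rmorphP (qpoly_at (x \o qr) (ramif a 2))) (mulVr ug) nug.
have [k' [e [c [u]]]] := gerbe_object_big C y (@is_rmorph_id (pser K)).
exists k', e, c.
have := P1at_push (@localring_pser k') (sval u).1 (cdata_at (@localring_pser K) hy).
by rewrite qpoly_at_X (pmap_ramif 2).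
Qed.

Lemma local_value f (k' : fieldType) (e : {rmorphism E -> k'}) (a : k') (c : C (pser k')) w :
  (forall (N : fieldType) (x : E -> N) (g : {rmorphism Et -> N}) (c : C N) ta,
  (forall a, g (cE a) = x a) -> P1at false (rpt (gpi C N c)) (g tE) -> trace_at x c ta -> ta = g f) ->
  P1at false (rpt (gpi C _ c)) (ramif a 2) -> trace_at (fun b => pconst (e b)) c w ->
  exists g : {rmorphism Et -> {fraction (pser k')}},
    (forall p, g (tofrac p) = tofrac (pev_at (ramif a 2) (map_poly e p))) /\ tofrac w = g f.
Proof.
move=> hf hat hw; pose x : {rmorphism E -> {fraction (pser k')}} := (@tofrac (pser k')) \o (@pconst k') \o e.
have ev p : (map_poly x p).[tofrac (ramif a 2)] = tofrac (pev_at (ramif a 2) (map_poly e p)).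
  by rewrite pev_atE -horner_map -!map_poly_comp.
have [|g eg] := @eval_fraction _ _ x (tofrac (ramif a 2)).
  move=> p np; rewrite ev tofrac_eq0.
  rewrite -(rmorph0 (pev_at (ramif a 2))) (inj_eq (@pev_ramif_inj _ a 2 isT)) map_poly_eq0.
  by [].
exists g; split=> [p|]; first by rewrite eg ev.
have [d [u]] := gerbe_pull c (rmorphP (@tofrac (pser k'))).
have gt : g tE = tofrac (ramif a 2) by rewrite /tE eg map_polyX hornerX.
apply: (hf _ x g d) (trace_at_push u hw); first by move=> b; rewrite /cE /= eg map_polyC hornerC.
by rewrite gt; apply: P1at_push (@localring_field _) (sval (fmap (gpi C) u)).1 hat.
Qed.

(** The value of p at u^-2, cleared of its pole, is the reversed polynomial at u^2. *)
Lemma rev_poly (k' : fieldType) (p : {poly k'}) : p != 0 -> exists h : pser k', pc h 0 = lead_coef p /\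
  (map_poly ((@tofrac (pser k')) \o (@pconst k')) p).[(tofrac pX ^+ 2)^-1] * tofrac pX ^+ (2 * (size p).-1) = tofrac h.
Proof.
move=> np; have sp : size p = (size p).-1.+1 by rewrite prednK ?size_poly_gt0.
set n := (size p).-1 in sp *.
exists (\sum_(i < n.+1) pconst p`_i * pX ^+ (2 * (n - i))); split.
  rewrite -[LHS]/(pev _) rmorph_sum big_ord_recr big1 => [|i _].
    rewrite -[nat_of_ord ord_max]/n subnn muln0 expr0 mulr1.
    by transitivity (0 + p`_n) => //; rewrite add0r lead_coefE.
  rewrite rmorphM rmorphXn -[X in _ * X ^+ _]/(0 : k') expr0n muln_eq0 subn_eq0 leqNgt.
  by rewrite -[(_ < n)%N]/(i < n)%N ltn_ord mulr0.
rewrite horner_coef size_map_poly sp mulr_suml rmorph_sum; apply: eq_bigr => i _.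
rewrite coef_map rmorphM rmorphXn /= -mulrA; congr (_ * _).
have -> : (2 * n = 2 * i + 2 * (n - i))%N by rewrite -mulnDr subnKC // -ltnS.
rewrite exprVn -exprM exprD mulrA mulVf ?mul1r //.
by rewrite expf_neq0 // fracX_neq0.
Qed.

(* The trace is a rational function, and its values at ramified power series points
   are power series; so it has no poles. *)
Lemma trace_constant : exists ta0, forall a (c : C (pser E)) (d : C E) ta,
  P1at false (rpt (gpi C _ c)) (ramif a 2) -> hom (@pev E) c d -> trace_at id d ta -> ta = ta0.
Proof.
have [f hf] := generic_trace.
suff [ta0 ef] : exists ta0, f = cE ta0.
  exists ta0 => a c d ta hat u hta.
  have [w hw] := trace_at_exists c (@localring_pser E) (rmorphP (@pconst E)).
  have [g [eg ew]] := local_value (e := idfun) hf hat hw.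
  have {}ew : w = pconst ta0.
    by apply/eqP; rewrite -tofrac_eq ew ef -[cE ta0]/(tofrac ta0%:P) eg map_polyC pev_atC.
  have h1 := trace_at_push u hw; rewrite ew -[X in trace_at _ _ X]/ta0 in h1.
  exact: trace_at_uniq hta (trace_at_ext (fun a => erefl) h1).
have [P [Q [nQ [cop ef]]]] : exists P Q : {poly E}, Q != 0 /\ coprimep P Q /\ f = tofrac P / tofrac Q.
  have [p [q [nq ->]]] := fraction_div f; exists (p %/ gcdp p q), (q %/ gcdp p q).
  have nd : gcdp p q != 0 by rewrite gcdp_eq0 negb_and nq orbT.
  split; first by rewrite divp_eq0 (negPf nq) (negPf nd) /= -leqNgt dvdp_leq // dvdp_gcdr.
  split; first by apply: coprimep_div_gcd; rewrite nq orbT.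
  have -> : tofrac p = tofrac (p %/ gcdp p q) * tofrac (gcdp p q) by rewrite -rmorphM divpK ?dvdp_gcdl.
  have -> : tofrac q = tofrac (q %/ gcdp p q) * tofrac (gcdp p q) by rewrite -rmorphM divpK ?dvdp_gcdr.
  by rewrite -mulf_div divff ?mulr1 // tofrac_eq0.
have [K [iE [clK _]]] := algebraic_closure E.
(* Let a be a root of Q over the closure. At t = a + u^2 the trace w is a power series with w Q = P,
   which makes a a root of P as well, against coprimality. *)
have sQ : (size Q <= 1)%N.
  rewrite leqNgt -(size_map_poly iE); apply/negP => /clK[a ra].
  have [k' [e [c hat]]] := big_point iE false a.
  have [w hw] := trace_at_exists c (@localring_pser k') (rmorphP (@pconst k' \o e \o iE)).
  have [g [eg ew]] := local_value (e := e \o iE) hf hat hw.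
  have ngQ : g (tofrac Q) != 0 by rewrite fmorph_eq0 tofrac_eq0.
  have /eqP : tofrac w * g (tofrac Q) = g (tofrac P) by rewrite ew ef fmorph_div divfK.
  rewrite !eg -rmorphM tofrac_eq => /eqP/(congr1 (fun h => pc h 0)).
  rewrite pc0M !pc_pev_at (pc_ramif _ (isT : (0 < 2)%N)) !(map_poly_comp e iE) !horner_map (rootP ra) rmorph0 mulr0.
  move=> /esym/eqP; rewrite fmorph_eq0 => rP.
  have := cop; rewrite -(coprimep_map iE) => /coprimep_root/(_ rP).
  by rewrite (rootP ra) eqxx.
have [c0 nc0 eQ] : exists2 c0, c0 != 0 & Q = c0%:P.
  by exists Q`_0; rewrite -?size1_polyC // -(polyC_eq0) -size1_polyC.
(* At 1 / t = u^2, near infinity, f has a pole of order twice the degree of P, whereas the trace is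
   a power series. *)
have sP : (size P <= 1)%N.
  rewrite leqNgt; apply/negP => sP1.
  have [k' [e [c hat]]] := big_point iE true 0.
  rewrite rmorph0 /ramif rmorph0 add0r in hat.
  have [w hw] := trace_at_exists c (@localring_pser k') (rmorphP (@pconst k' \o e \o iE)).
  have [d [u]] := gerbe_pull c (rmorphP (@tofrac (pser k'))).
  have hat' := P1at_push (@localring_field _) (sval (fmap (gpi C) u)).1 hat.
  pose U : {fraction (pser k')} := tofrac pX.
  have nU : U != 0 := fracX_neq0 k'.
  have UU : (U ^+ 2)^-1 * (fun a => tofrac a) (pX ^+ 2) = 1.
    by rewrite rmorphXn mulVf // expf_neq0.
  have hat2 := P1at_flip UU hat'.
  pose x : {rmorphism E -> {fraction (pser k')}} := (@tofrac (pser k')) \o (@pconst k') \o (e \o iE).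
  have ev (p : {poly E}) : p != 0 -> exists h, pc h 0 = e (iE (lead_coef p)) /\
      (map_poly x p).[(U ^+ 2)^-1] * U ^+ (2 * (size p).-1) = tofrac h.
    move=> np; have [|h [h1 h2]] := @rev_poly k' (map_poly (e \o iE) p); first by rewrite map_poly_eq0.
    exists h; split; first by rewrite h1 lead_coef_map.
    by move: h2; rewrite size_map_poly -map_poly_comp.
  have [|g eg] := @eval_fraction _ _ x (U ^+ 2)^-1.
    move=> p np; have [h [h1 h2]] := ev p np; apply/eqP => e0; move: h2; rewrite e0 mul0r => /esym/eqP.
    rewrite tofrac_eq0 => /eqP h0; move: h1; rewrite h0 pc0 => /esym/eqP.
    by rewrite !fmorph_eq0 lead_coef_eq0 (negPf np).
  have gt : g tE = (U ^+ 2)^-1 by rewrite /tE eg map_polyX hornerX.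
  have gc b : g (cE b) = x b by rewrite /cE /= eg map_polyC hornerC.
  have := hf _ x g d _ gc; rewrite gt => /(_ _ hat2 (trace_at_push u hw)) ew.
  have nP : P != 0 by rewrite -size_poly_gt0 (ltn_trans _ sP1).
  have [h [h1 h2]] := ev P nP.
  have nx : x c0 != 0 by rewrite fmorph_eq0.
  have : tofrac (w * pconst (e (iE c0)) * pX ^+ (2 * (size P).-1)) = tofrac h.
    rewrite -h2 -eg !rmorphM [in LHS]rmorphXn ew ef fmorph_div eQ.
    by rewrite [g (tofrac c0%:P)]eg map_polyC hornerC -[X in _ / _ * X * _]/(x c0) divfK.
  move=> /eqP; rewrite tofrac_eq => /eqP/(congr1 (fun h => pc h 0)).
  rewrite h1 -[LHS]/(pev _) rmorphM rmorphXn -[X in _ * X ^+ _]/(0 : k') expr0n.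
  rewrite muln_eq0 /= -subn1 subn_eq0 leqNgt sP1 mulr0 => /esym/eqP.
  by rewrite !fmorph_eq0 lead_coef_eq0 (negPf nP).
exists (P`_0 / c0); rewrite ef eQ (size1_polyC sP) fmorph_div /cE /= coefC.
by [].
Qed.
End TraceConstant.

(** * The points t = 1 and t = 11 *)

(** The exponent of 13 in a square is even. *)
Lemma rat_sqr13 (b : rat) : b ^+ 2 != 13%:R.
Proof.
apply/eqP => e; pose n := `|numq b|%N; pose d := `|denq b|%N.
have d0 : (0 < d)%N by rewrite absz_gt0 denq_neq0.
have nd : (denq b)%:~R != 0 :> rat by rewrite intr_eq0 denq_neq0.
have e1 : (n ^ 2 = 13 * d ^ 2)%N.
  have ez : numq b ^+ 2 = 13%:Z * denq b ^+ 2.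
    apply: (@intr_inj rat); rewrite rmorphXn rmorphM rmorphXn /= -[13%:Z%:~R]/(13%:R) -e -exprMn.
    by rewrite -{2}(divq_num_den b) divfK.
  have := congr1 absz ez; rewrite abszM !abszX; exact.
have n0 : (0 < n)%N.
  have : (0 < n ^ 2)%N by rewrite e1 muln_gt0 expn_gt0 d0.
  by rewrite expn_gt0 orbF.
have := congr1 (logn 13) e1.
by rewrite lognM ?expn_gt0 ?d0 // !lognX (_ : logn 13 13 = 1%N) //; lia.
Qed.

Lemma closed_sqrt (O : fieldType) (a : O) : alg_closed O -> exists z, z ^+ 2 = a.
Proof.
move=> clO; have [|z rz] := clO ('X^2 - a%:P); first by rewrite size_XnsubC.
by exists z; move: rz; rewrite rootE !hornerE subr_eq0 => /eqP.
Qed.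

Section Assembly.
Variables (H1 H2 A : algType Qt).
Hypothesis hH1 : is_quaternion (17%:R : Qt) tvar H1.
Hypothesis hH2 : is_quaternion (13%:R : Qt) ((tvar - 1) * (tvar - 11%:R)) H2.
Hypothesis hA : is_algtensor H1 H2 A.
Variables (D : omod P1) (s : osec D).
Hypothesis hD : is_bundle 1 D.
Variables (eD : forall b, D _ (chart b)) (FD : bool -> {poly rat}).
Hypothesis geD : forall b, is_gen (eD b).
Hypothesis sD : forall b, s _ (chart b) = FD b *: eD b.
Hypothesis FD0 : forall b, FD b != 0.
Hypothesis FDsq : forall b p, irreducible_poly p -> ~~ (p ^+ 2 %| FD b).
Variable C : mu2_gerbe (rootstack s).
Hypothesis hC : has_brauer_class C A.

(* Off the divisor the classes (17, t) and (13, (t-1)(t-11)) would be unramified at t = m,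
   but the residue of the latter there is the nonsquare 13. *)
Lemma divisor_root (m : nat) : m = 1%N \/ m = 11%N -> (FD false).[m%:R] = 0.
Proof.
move=> hm; apply/eqP/negPn/negP => nF.
have [i1 [j1 [i2 [j2 gens]]]] := biquaternion_gens hH1 hH2 hA.
have [O [iota [clO algO]]] := algebraic_closure rat.
have pch : [pchar rat] =i pred0 := pchar_rat idfun.
have [z17 e17] := closed_sqrt 17%:R clO; have [z13 e13] := closed_sqrt 13%:R clO.
have [E EZ] := galext_cover clO algO pch [:: z17; z13].
have [|al eal] := EZ z17; first by rewrite mem_head.
have [|be ebe] := EZ z13; first by rewrite inE mem_head orbT.
(* If the divisor avoids m, then t - m itself serves as parameter and the square root is generated
   by its section: e = 1 and nu = 1. *)
pose g : pser rat := qpoly_at idfun (ramif m%:R 1) (FD false).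
have ug : g \is a GRing.unit.
  rewrite punitE -[g]/(pev_at (ramif m%:R 1) (map_poly idfun (FD false))) pc_pev_at.
  by rewrite (pc_ramif _ (isT : (0 < 1)%N)) map_poly_id.
have nug : 1 ^+ 2 * g = qpoly_at idfun (ramif m%:R 1) (FD false) by rewrite expr1n mul1r.
have [||| E' [j [c hc]]] := @equivariant_exists D s hD eD FD geD sD C rat O iota clO algO pch idfun m%:R 1 1 g g^-1 false nug (mulVr ug) _ _ _ E => //.
have eal' : j al ^+ 2 = 17%:R.
  by apply: (fmorph_inj (ge_out E')); rewrite rmorphXn gm_out eal e17 rmorph_nat.
have ebe' : j be ^+ 2 = 13%:R.
  by apply: (fmorph_inj (ge_out E')); rewrite rmorphXn gm_out ebe e13 rmorph_nat.
have nat0 (n : nat) : (n.+1%:R : E') != 0 by rewrite -(rmorph_nat (ge_in E')) fmorph_eq0 pnatr_eq0.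
have m0 : (m%:R : rat) != 0 by case: hm => ->.
have lt (h : pser E') : pc h 0 != 0 -> lterm (tofrac (pX * h)) 1 (pc h 0).
  by move=> nh; have := ltermX 1 nh; rewrite expr1z rmorphM.
have tauE n : ramif (ge_in E' m%:R) 1 - n%:R = pX + (pconst (m%:R - n%:R)).
  by rewrite /ramif expr1 (rmorph_nat (ge_in E')) rmorphB !rmorph_nat addrAC addrC.
have X0 : pc (pX : pser E') 0 = 0 by [].
have fin (ga : E') : lterm (tofrac ((ramif (ge_in E' m%:R) 1 - 1) * (ramif (ge_in E' m%:R) 1 - 11%:R))) 1 ga -> False.
  by apply: (leading_parity hC gens _ m0 _ hc eal' ebe' pch rat_sqr13); rewrite ?oner_neq0.
case: hm => em.
  apply: (fin _ _); rewrite (tauE 1%N) (tauE 11%N) em subrr rmorph0 addr0; apply: lt.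
  rewrite pcD X0 add0r -[pc _ 0]/(1 - 11%:R : E') -opprB oppr_eq0 -(natrB _ (isT : (1 <= 11)%N)).
  exact: (nat0 9%N).
apply: (fin _ _); rewrite (tauE 1%N) (tauE 11%N) em subrr rmorph0 addr0 mulrC; apply: lt.
rewrite pcD X0 add0r -[pc _ 0]/(11%:R - 1 : E') -(natrB _ (isT : (1 <= 11)%N)).
exact: (nat0 9%N).
Qed.

(** The equation of the divisor is squarefree, so m is a simple root, and at t = m + u^2 it equals
    u^2 times a unit that is even in u. *)
Lemma ramified_point_data (k : fieldType) (qr : {rmorphism rat -> k}) (m : rat) : (FD false).[m] = 0 ->
  exists g g' : pser k, [/\ g' * g = 1, pX ^+ 2 * g = qpoly_at qr (ramif (qr m) 2) (FD false),
    pneg g = g & pneg (ramif (qr m) 2) = ramif (qr m) 2].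
Proof.
move=> /rootP/factor_theorem[Q eF].
have nQ : Q.[m] != 0.
  apply/negP => /factor_theorem[Q' eQ]; have := FDsq false (irredp_XsubC m).
  by rewrite eF eQ -mulrA -expr2 dvdp_mull.
pose g : pser k := qpoly_at qr (ramif (qr m) 2) Q.
have tneg : pneg (ramif (qr m) 2) = ramif (qr m) 2.
  by rewrite /ramif rmorphD rmorphXn /= pneg_const pneg_X sqrrN.
have ug : g \is a GRing.unit.
  rewrite punitE -[g]/(pev_at _ (map_poly qr Q)) pc_pev_at (pc_ramif _ (isT : (0 < 2)%N)) horner_map.
  by rewrite fmorph_eq0.
exists g, g^-1; split; first exact: mulVr.
- rewrite eF [in RHS]rmorphM mulrC; congr (_ * _).
  by rewrite rmorphB qpoly_at_X qpoly_at_C /ramif addrAC subrr add0r.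
- apply: (@ratpoly_hom_uniq _ (@pneg k \o qpoly_at qr (ramif (qr m) 2)) (qpoly_at qr (ramif (qr m) 2)) _ Q).
  by rewrite -[LHS]/(pneg (qpoly_at qr (ramif (qr m) 2) 'X)) qpoly_at_X.
exact: tneg.
Qed.

Variable L : omod (rootstack s).

(** Psi measures the failure of the cocycle condition: it is the inverse of the isomorphism for y x
    composed with those for x and y in succession. *)
Lemma twister_coboundary (k O : fieldType) (iota : {rmorphism k -> O}) (E0 E : galext iota) (m : mobj C L 2 E0)
    (j : galmor E0 E) (th : forall x : ge_G E, twister m j (fun a => ge_act E x (j a))) (x y : ge_G E) :
  exists Psi : twister m j j, forall (T : comNzRingType) (f : E -> T) (c : C T) (hf : is_rmorph f)
    (hfx : is_rmorph (fun a => f (ge_act E x a))) h1 h2 h3 h4 (v : mV m T (bob_of c h1)),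
  tw (th (y * x)%g) hf h1 h4 (tw Psi hf h1 h1 v) =
  vmap (mV m) (barr h3 h4 (hid c) (fun a => congr1 f (esym (ge_actM y x (j a)))))
    (tw (th y) hfx h2 h3 (tw (th x) hf h1 h2 v)).
Proof.
have hj := rmorphP j; have hx := rmorphP (ge_act E x).
have hxj := rmorph_comp hj hx; have hxyj := rmorph_comp (rmorph_comp hj (rmorphP (ge_act E y))) hx.
have hyx := rmorph_comp hj (rmorphP (ge_act E (y * x)%g)).
have [t1 e1] := tw_push (th y) hx.
have [t2 e2] := tw_comp (th x) t1 hxj.
have [t3 e3] := tw_re m (fun a => esym (ge_actM y x (j a))).
have [t4 e4] := tw_inv (th (y * x)%g).
have [t5 e5] := tw_comp t2 t3 hxyj.
have [t6 e6] := tw_comp t5 t4 hyx.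
exists t6 => T f c hf hfx h1 h2 h3 h4 v.
rewrite (e6 T f c hf h1 h4 h1) (e4 T f c hf h1 h4).2 (e5 T f c hf h1 h3 h4) (e2 T f c hf h1 h2 h3).
by rewrite (e1 T f c hf hfx h2 h3) e3.
Qed.
End Assembly.

Theorem corollary5p2p5
  (H1 H2 A : algType Qt)
  (hH1 : is_quaternion (17%:R : Qt) tvar H1)
  (hH2 : is_quaternion (13%:R : Qt) ((tvar - 1) * (tvar - 11%:R)) H2)
  (hA : is_algtensor H1 H2 A)
  (D : omod P1) (s : osec D) (hs : is_ramification_divisor A s)
  (C : mu2_gerbe (rootstack s)) (hC : has_brauer_class C A)
  (L : omod (rootstack s)) (hL : is_bundle 1 L)
  (Q17 : fieldType) (hQ17 : is_padic_field 17 Q17) :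
  ~ inhabited (coarse_moduli C L 2 Q17).
Proof.
case=> M; have [hD hF] := hs.
have exe b : {e : D _ (chart b) | exists F : {poly rat}, [/\ is_gen e, s _ (chart b) = F *: e, F != 0 &
    forall p : {poly rat}, irreducible_poly p -> ~~ (p ^+ 2 %| F)]}.
  by apply: cid; have [e [F [h1 h2 h3 h4 _]]] := hF b; exists e, F.
pose eD b := sval (exe b).
have exF b := cid (svalP (exe b)); pose FD b := sval (exF b).
have FP b : [/\ is_gen (eD b), s _ (chart b) = FD b *: eD b, FD b != 0 &
    forall p : {poly rat}, irreducible_poly p -> ~~ (p ^+ 2 %| FD b)] := svalP (exF b).
have geD b : is_gen (eD b) by case: (FP b).
have sD b : s _ (chart b) = FD b *: eD b by case: (FP b).
have FD0 b : FD b != 0 by case: (FP b).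
have FDsq b p : irreducible_poly p -> ~~ (p ^+ 2 %| FD b) by case: (FP b) => _ _ _; apply.
have [i1 [j1 [i2 [j2 gens]]]] := biquaternion_gens hH1 hH2 hA.
have [nrm [nrm0 [nrmM nrmD] nrmQ dense complete]] := hQ17.
pose qr : {rmorphism rat -> Q17} := rmor (padic_rat nrm0 nrmQ).
have pch := pchar_rat qr.
have [be ebe] := sqrt13_in nrm0 nrmM nrmD nrmQ complete.
have [O [iota [clO algO]]] := algebraic_closure Q17.
have [z17 e17] := closed_sqrt 17%:R clO.
have [Ea EZ] := galext_cover clO algO pch [:: z17].
have [|ala eala] := EZ z17; first by rewrite mem_head.
have [E0 [j0 [m [Eb [jb gib]]]]] := moduli_exists clO algO pch M Ea.
have r1 := divisor_root hH1 hH2 hA hD geD sD hC (or_introl erefl).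
have r11 := divisor_root hH1 hH2 hA hD geD sD hC (or_intror erefl).
have [g1 [g1' [gg1 nug1 gn1 tn1]]] := ramified_point_data FDsq qr r1.
have [g11 [g11' [gg11 nug11 gn11 tn11]]] := ramified_point_data FDsq qr r11.
have Xn : pneg (pX : pser Q17) = - pX := pneg_X _.
have [Ec [jc [c1c hc1c]]] := @equivariant_exists _ _ hD _ _ geD sD C _ _ _ clO algO pch _ _ _ _ _ _ true nug1 gg1 (fun _ => Xn) (fun _ => gn1) (fun _ => tn1) Eb.
have [E [jd [c11 hc11]]] := @equivariant_exists _ _ hD _ _ geD sD C _ _ _ clO algO pch _ _ _ _ _ _ true nug11 gg11 (fun _ => Xn) (fun _ => gn11) (fun _ => tn11) Ec.
(* The point at t = 11 required a further extension, to which the point at t = 1 is now carried. *)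
have [c1 [_ [_ hc1]]] := equivariant_push hD geD gg1 jd hc1c.
have [je eje] := galmor_comp jc jd.
have [j ej] := galmor_comp jb je.
have gi := galois_invariant_push ej gib.
have [jf ejf] := galmor_comp j0 j; pose al : E := jf ala.
have eal : al ^+ 2 = 17%:R.
  by apply: (fmorph_inj (ge_out E)); rewrite rmorphXn gm_out eala e17 rmorph_nat.
have t10 n : (qr n.+1%:R : Q17) != 0 by rewrite fmorph_eq0 pnatr_eq0.
have [d1 sp1] := special_exists hD geD gg1 hC gens (t10 0%N) eal ebe hc1.
have [d11 sp11] := special_exists hD geD gg11 hC gens (t10 10%N) eal ebe hc11.
have ext x : {t : twister m j (fun a => ge_act E x (j a)) | True}.
  by apply: cid; have [t] := twist_isoP (gi x); exists t.
pose th x := sval (ext x).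
have exP x y := cid (twister_coboundary th x y).
pose Psi x y := sval (exP x y).
have PsiE x y := svalP (exP x y).
have [La1 [p1 [m1 [tr1 mul1 nz1 co1]]]] := special_cocycle hD clO pch PsiE sp1.
have [La11 [p11 [m11 [tr11 mul11 nz11 co11]]]] := special_cocycle hD clO pch PsiE sp11.
have same t : La1 t + (La1 t)^-1 = La11 t + (La11 t)^-1.
  have [ta0 hta] := @trace_constant _ _ hD _ _ geD sD FD0 C L 2 E0 E m j (rmorphP j) t (ge_in E \o qr).
  have at0 (t0 : Q17) c d ta : special_pt t0 al c d -> has_trace 2 (tw0 (c0 := d) t) ta -> ta = ta0.
    move=> [hat [p fp] _ _] ht.
    have [u _] : exists u : hom (@pev E) c d, Arr u = p by apply: arr_over => a; rewrite fp.
    by apply: hta hat u _; exists is_rmorph_id, (rmorphP j).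
  by rewrite (at0 _ _ _ _ sp1 (tr1 t).2) (at0 _ _ _ _ sp11 (tr11 t).2).
(* Both eigenvalues are roots of X^2 - s X + 1, where s is the common trace. *)
have cases t : La11 t = La1 t \/ La11 t = (La1 t)^-1.
  have n1 := (tr1 t).1; have n11 := (tr11 t).1.
  have /eqP : (La11 t - La1 t) * (La11 t - (La1 t)^-1) = 0.
    have e1 : (La1 t + (La1 t)^-1) * La11 t = La11 t ^+ 2 + 1 by rewrite same; field.
    transitivity (La11 t ^+ 2 + 1 - (La1 t + (La1 t)^-1) * La11 t); first by field.
    by rewrite e1 subrr.
  by rewrite mulf_eq0 !subr_eq0 => /orP[/eqP|/eqP]; [left | right].
(* A group is not the union of two proper subgroups. *)
have uniform : (forall t, La11 t = La1 t) \/ (forall t, La11 t = (La1 t)^-1).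
  apply: contrapT => h; have [h1 h2] : (exists t, La11 t <> La1 t) /\ (exists t, La11 t <> (La1 t)^-1).
    split; apply: contrapT => h'; apply: h; [left | right] => t;
      by apply: contrapT => h''; apply: h'; exists t.
  case: h1 => t nt; case: h2 => t' nt'.
  have et : La11 t = (La1 t)^-1 by case: (cases t).
  have et' : La11 t' = La1 t' by case: (cases t').
  have [t'' et''] := tw_comp t t' (rmorphP j).
  have f1 := mul1 t t' t'' (fun v => et'' _ _ _ _ _ _ _ v).
  have f11 := mul11 t t' t'' (fun v => et'' _ _ _ _ _ _ _ v).
  have n1 := (tr1 t).1; have n1' := (tr1 t').1.
  case: (cases t''); rewrite f11 f1 et et'.
    by move=> /(mulfI n1') e0; apply: nt; rewrite et.
  by rewrite invfM => /(mulIf (invr_neq0 n1)) e0; apply: nt'; rewrite et'.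
(* If the eigenvalues at t = 11 are the inverses of those at t = 1, the other eigenline is taken at
   t = 11. *)
have [q [nq coq]] : exists q : ge_G E -> E, (forall x, q x != 0) /\ forall x y,
    ge_act E x (q y) * q x * ge_in E (qr 11%:R) ^+ (flips al y && flips al x) = q (y * x)%g * La1 (Psi x y).
  case: uniform => h; [exists p11 | exists m11]; split=> [x|x y].
  - by case: (nz11 x).
  - by rewrite (co11 x y).1 h.
  - by case: (nz11 x).
  - by rewrite (co11 x y).2 h invrK.
have eal' : al ^+ 2 = ge_in E 17%:R by rewrite rmorph_nat.
have n17 := sqrt17_notin nrm0 nrmM nrmD nrmQ dense.
have nat0 n : (n.+1%:R : Q17) != 0 by rewrite -(rmorph_nat qr) t10.
(* At t = 1 the powers of t0 are 1, and the eigenvalue of Psi x y is the same for [q] and [p1]; the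
   quotient retains only the powers of 11. *)
have [|x y|a [b eab]] := @norm_equation _ _ _ E al 17%:R 11%:R eal' n17 (nat0 10%N) (nat0 1%N) (fun x => q x / p1 x).
- by move=> x; rewrite mulf_neq0 ?invr_eq0 // (nz1 x).1.
- have h1 := (co1 x y).1; have h2 := coq x y.
  rewrite andbC fmorph_div; move: h1 h2; rewrite !rmorph_nat expr1n mulr1.
  move=> h1 h2; have np x' := (nz1 x').1.
  have nA : ge_act E x (p1 y) != 0 by rewrite fmorph_eq0.
  have nL := (tr1 (Psi x y)).1.
  rewrite mulf_div mulrAC h2 h1 -mulf_div divff // mulr1; by [].
by have := norm11_notin nrm0 nrmM nrmD nrmQ dense a b; rewrite eab eqxx.
Qed.
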